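(* Fix $a>1$, let $Y=(Y_t:t>0)$ be the STIT tessellation process on $\mathbb{R}^\ell$ driven by $\Lambda$, and set $\mathcal{Z}_n=a^nY_{a^n}$, $n\in\mathbb{Z}$. Let $W$ be a window and let $\mu^{\mathcal{Z}^d}_W$ be the law of $(\mathcal{Z}_n\wedge W:n\in\mathbb{Z})$ on $\mathbb{T}_W^{\mathbb{Z}}$. Then the shift system $(\mathbb{T}_W^{\mathbb{Z}},\mu^{\mathcal{Z}^d}_W,\sigma_{\mathbb{T}_W})$ is isomorphic to a Bernoulli shift of infinite entropy.
   Context: Fix $\ell\ge 1$. A polytope is the convex hull of a finite point set in $\mathbb{R}^\ell$, always assumed to have nonempty interior. A tessellation of $\mathbb{R}^\ell$ is a countable, locally finite family of polytopes (cells) with pairwise disjoint interiors and union $\mathbb{R}^\ell$; $\mathbb{T}$ is the set of all tessellations. With $\mathbb{F}'$ the space of nonempty closed subsets of $\mathbb{R}^\ell$ with the Fell topology, and $\mathbb{F}(\mathbb{F}')$ the space of closed subsets of $\mathbb{F}'$ with the Fell topology (compact metrizable), $\mathbb{T}$ is a Borel subset of $\mathbb{F}(\mathbb{F}')$ and carries the trace Borel $\sigma$-field $\mathcal{B}(\mathbb{T})$. For $c\ne 0$, $cT=\{cC:C\in T\}$. A window $W$ is a polytope with nonempty interior; $\mathbb{T}_W$ is the set of (finite) tessellations of $W$ into polytopes with disjoint interiors, a Borel subset of $\mathbb{F}(\mathbb{F}'_W)$ (closed subsets, with the Fell topology, of the space $\mathbb{F}'_W$ of nonempty closed subsets of $W$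 with the Fell topology), with its trace Borel $\sigma$-field $\mathcal{B}(\mathbb{T}_W)$. For $T\in\mathbb{T}$, $T\wedge W=\{C\cap W:C\in T,\ \mathrm{int}(C\cap W)\ne\emptyset\}\in\mathbb{T}_W$. STIT process. Let $\Lambda$ be a nonzero $\sigma$-finite translation invariant measure on the space $\mathcal{H}$ of hyperplanes of $\mathbb{R}^\ell$ such that there is no line to which all hyperplanes of the support of $\Lambda$ are parallel. For a set $B\subseteq\mathbb{R}^\ell$ put $[B]=\{H\in\mathcal{H}:H\cap B\ne\emptyset\}$; one has $0<\Lambda([W])<\infty$ for every window $W$, and $\Lambda_W=\Lambda([W])^{-1}\Lambda(\cdot\cap[W])$. For a window $W$, $Y\wedge W=(Y_t\wedge W:t\ge 0)$ is the pure jump càdlàg Markov process in $\mathbb{T}_W$ starting from $Y_0\wedge W=\{W\}$ in which, independently, each present cell $C$ has an exponential lifetime with parameter $\Lambda([C])$, at the end of which $C$ is replaced by the two cells into which it is divided by a random hyperplane of law $\Lambda_C$ (independent of everything else). These laws are consistent: $(Y\wedge W')\wedge W\sim Y\wedge W$ for $W\subseteq W'$, where $\sim$ denotes equality of distributions. The STIT tessellation process $Y=(Y_t:t>0)$ is the $\mathbb{T}$-valued Markov process whose restriction to each window $W$ has this law. Countable product spaces carry product $\sigma$-fields, and probability spaces are understood completed. For a measurable space $\mathcal{S}$, $\sigma_{\mathcal{S}}:\mathcal{S}^{\mathbb{Z}}\to\mathcal{S}^{\mathbb{Z}}$ is the shift $(x_n)_{n}\mapsto(x_{n+1})_n$. The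 law $\mu^{\mathcal{Z}^d}_W$ is $\sigma_{\mathbb{T}_W}$-invariant. A (generalized two-sided) Bernoulli shift is a system $(\mathcal{S}^{\mathbb{Z}},\nu^{\otimes\mathbb{Z}},\sigma_{\mathcal{S}})$ with $\nu$ a probability measure on $\mathcal{S}$. If $(\mathcal{S},\nu)$ is a Lebesgue probability space, its entropy equals $H(\nu)$, where $H(\nu)=\infty$ if $\nu$ has a non-atomic part and $H(\nu)=-\sum_{A}\nu(A)\log\nu(A)$ (sum over the atoms of $\nu$) if $\nu$ is purely atomic. Two dynamical systems $(\Omega,\mu,\psi)$, $(\Omega',\mu',\psi')$ are isomorphic if there is a measurable map $\varphi:\Omega\to\Omega'$ with $\varphi\circ\psi=\psi'\circ\varphi$ $\mu$-a.e. and $\mu\circ\varphi^{-1}=\mu'$, which is one-to-one $\mu$-a.e., onto $\mu'$-a.e., with measurable inverse. *)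

(* Defs.v *)
(* The Euclidean space of dimension l + 1 is ['rV[R]_l.+1]: the space of
   hyperplanes must be nonempty to be a measurable type. *)
From HB Require Import structures.
From mathcomp Require Import all_boot all_order all_algebra.
From mathcomp Require Import all_classical all_reals all_analysis.
From mathcomp Require Import measurable_realfun finmap ring lra zify.

Set Implicit Arguments.
Unset Strict Implicit.
Unset Printing Implicit Defensive.
Import Order.TTheory GRing.Theory Num.Theory.
Import numFieldNormedType.Exports.
Local Open Scope classical_set_scope.
Local Open Scope ring_scope.

Section convex_hull.
Context {R : realType}.

Definition conv_hull (V : lmodType R) (s : seq V) : set V :=
  [set x | exists w : 'I_(size s) -> R,
    [/\ forall i, 0 <= w i, \sum_i w i = 1 & x = \sum_i w i *: s`_i]].

Lemma conv_hullP (V : lmodType R) (I : finType) (p : I -> V) (x : V) :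
  conv_hull [seq p i | i <- enum I] x <->
  exists w : I -> R, [/\ forall i, 0 <= w i, \sum_i w i = 1 &
    x = \sum_i w i *: p i].
Proof.
have sz : size [seq p i | i <- enum I] = #|I| by rewrite size_map cardE.
have bij (W : zmodType) (F : I -> W) : \sum_i F i =
    \sum_(j < size [seq p i | i <- enum I]) F (enum_val (cast_ord sz j)).
  rewrite (reindex (fun j => enum_val (cast_ord sz j))) //=.
  exists (fun i => cast_ord (esym sz) (enum_rank i)) => i _ /=.
    by rewrite enum_valK cast_ordK.
  by rewrite cast_ordKV enum_rankK.
have nthE (j : 'I_(size [seq p i | i <- enum I])) : [seq p i | i <- enum I]`_j = p (enum_val (cast_ord sz j)).
  rewrite (nth_map (enum_val (cast_ord sz j))); last first.
    by rewrite -cardE -sz.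
  by congr p; rewrite [RHS](enum_val_nth (enum_val (cast_ord sz j))).
split=> [[w [w0 w1 ->]]|[w [w0 w1 ->]]].
- exists (fun i => w (cast_ord (esym sz) (enum_rank i))); split=> //.
    by rewrite -w1 bij; apply: eq_bigr => j _; rewrite enum_valK cast_ordK.
  rewrite (bij V); apply: eq_bigr => j _.
  by rewrite enum_valK cast_ordK nthE.
- exists (fun j => w (enum_val (cast_ord sz j))); split=> //.
    by rewrite -w1 bij.
  by rewrite (bij V); apply: eq_bigr => j _; rewrite nthE.
Qed.

Lemma conv_hull_mem (V : lmodType R) (s : seq V) x : x \in s -> conv_hull s x.
Proof.
move=> xs; have ls : (index x s < size s)%N by rewrite index_mem.
exists (fun i => (i == Ordinal ls)%:R); split=> [i| |].
- by rewrite ler0n.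
- by rewrite (bigD1 (Ordinal ls))//= eqxx big1 ?addr0// => i /negbTE ->.
- rewrite (bigD1 (Ordinal ls))//= eqxx scale1r nth_index// big1 ?addr0//.
  by move=> i /negbTE ->; rewrite scale0r.
Qed.

Definition cvx (V : lmodType R) (C : set V) :=
  forall x y t, 0 <= t <= 1 -> C x -> C y -> C (t *: x + (1 - t) *: y).

Lemma conv_hull_cvx (V : lmodType R) (s : seq V) : cvx (conv_hull s).
Proof.
move=> x y t /andP[t0 t1] [u [u0 u1 ->]] [v [v0 v1 ->]].
exists (fun i => t * u i + (1 - t) * v i); split=> [i| |].
- by rewrite /= addr_ge0// mulr_ge0// subr_ge0.
- by rewrite big_split/= -!mulr_sumr u1 v1 !mulr1 addrC subrK.
- rewrite !scaler_sumr -big_split/=; apply: eq_bigr => i _.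
  by rewrite !scalerA -scalerDl.
Qed.

Lemma conv_hull_min (V : lmodType R) (s : seq V) (C : set V) : cvx C ->
  (forall x, x \in s -> C x) -> conv_hull s `<=` C.
Proof.
move=> cC; elim: s => [_ x [w [_]]|a s ih sC x [w [w0]]].
  by rewrite big_ord0 => /esym/eqP; rewrite oner_eq0.
rewrite !big_ord_recl/= => w1 ->.
set t := w ord0; set r := \sum_(i < _) w _ in w1.
have r0 : 0 <= r by exact: sumr_ge0.
have [r00|rn0] := eqVneq r 0.
  have wz i : w (lift ord0 i) = 0.
    move: r00 => /eqP; rewrite psumr_eq0// => /allP/(_ i).
    by rewrite mem_index_enum => /(_ isT)/eqP.
  rewrite big1 ?addr0; last by move=> i _; rewrite wz scale0r.
  move: w1; rewrite r00 addr0 -/t => ->; rewrite scale1r.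
  by apply: sC; rewrite inE eqxx.
have rE : r = 1 - t by rewrite -w1 -/t addrC addKr.
set y := \sum_(i < _) _.
have -> : y = (1 - t) *: (r^-1 *: y) by rewrite scalerA -rE divff// scale1r.
apply: cC.
- by rewrite /t w0/= -subr_ge0 -rE.
- by apply: sC; rewrite inE eqxx.
- apply: ih => [z zs|]; first by apply: sC; rewrite inE zs orbT.
  exists (fun i => r^-1 * w (lift ord0 i)); split=> [i| |].
  + by rewrite mulr_ge0 ?invr_ge0.
  + by rewrite -mulr_sumr -/r mulVf.
  + by rewrite scaler_sumr; apply: eq_bigr => i _; rewrite scalerA.
Qed.

Lemma conv_hull_lin (U V : lmodType R) (f : {linear U -> V}) (s : seq U) :
  f @` conv_hull s = conv_hull (map f s).
Proof.
have nthE i : (i < size s)%N -> (map f s)`_i = f s`_i.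
  by move=> ls; rewrite (nth_map 0).
have szf := size_map f s.
apply/seteqP; split=> [_ [_ [w [w0 w1 ->]] <-]|_ [w [w0 w1 ->]]].
  exists (fun i => w (cast_ord szf i)); split=> //.
    by rewrite -w1 [RHS](reindex (cast_ord szf))//=; apply: onW_bij;
       exists (cast_ord (esym szf)) => i; rewrite ?cast_ordK ?cast_ordKV.
  rewrite linear_sum (reindex (cast_ord szf))/=; last first.
    by apply: onW_bij;
       exists (cast_ord (esym szf)) => i; rewrite ?cast_ordK ?cast_ordKV.
  by apply: eq_bigr => i _; rewrite linearZ/= nthE// -szf.
exists (\sum_(i < size s) w (cast_ord (esym szf) i) *: s`_i).
  exists (fun i => w (cast_ord (esym szf) i)); split=> //.
  by rewrite -w1 [RHS](reindex (cast_ord (esym szf)))//=; apply: onW_bij;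
       exists (cast_ord szf) => i; rewrite ?cast_ordK ?cast_ordKV.
rewrite linear_sum [RHS](reindex (cast_ord (esym szf)))/=; last first.
    by apply: onW_bij;
       exists (cast_ord szf) => i; rewrite ?cast_ordK ?cast_ordKV.
by apply: eq_bigr => i _; rewrite linearZ/= nthE.
Qed.

(* A bounded polyhedron in standard form is the convex hull of its basic
   feasible points. *)
Lemma std_polyhedron (n : nat) (G : set 'rV[R]_n) :
  (forall x y t, G x -> G y -> G (t *: x + (1 - t) *: y)) ->
  (forall x y, G x -> G y -> (forall i, x 0 i <= y 0 i) -> x = y) ->
  exists s, [set x | G x /\ forall i, 0 <= x 0 i] = conv_hull s.
Proof.
move=> affG bndG.
pose F := [set x | G x /\ forall i, 0 <= x 0 i].
pose supp (x : 'rV[R]_n) := [set i | x 0 i != 0]%SET.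
pose basic x := F x /\ forall y, F y -> supp y \subset supp x -> y = x.
pose v (S : {set 'I_n}) := xget 0 [set x | basic x /\ supp x = S].
pose sS := [seq S <- enum {set 'I_n} | `[< exists x, basic x /\ supp x = S >]].
have cF : cvx F.
  move=> x y t /andP[t0 t1] [Gx x0] [Gy y0]; split; first exact: affG.
  by move=> i; rewrite !mxE addr_ge0// mulr_ge0// subr_ge0.
exists (map v sS); apply/seteqP; split; last first.
  apply: conv_hull_min => // _ /mapP[S + ->].
  rewrite mem_filter => /andP[/asboolP ex _].
  by have /= := xgetPex 0 ex; rewrite -/(v S) => -[[]].
have basicv x : basic x -> conv_hull (map v sS) x.
  move=> bx; have ex : exists y, basic y /\ supp y = supp x by exists x.
  have /= := xgetPex 0 ex; rewrite -/(v _) => -[[Fv _] sv].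
  have <- : v (supp x) = x by case: bx => _; apply=> //; rewrite sv.
  apply/conv_hull_mem/map_f; rewrite mem_filter mem_enum andbT.
  exact/asboolP.
move=> x Fx; have [k] := ubnP #|supp x|; elim: k x Fx => // k ih x Fx xk.
have [/basicv//|nb] := pselect (basic x).
have {nb} [y [Fy yx nyx]] :
    exists y, [/\ F y, supp y \subset supp x & y <> x].
  apply: contrapT => h; apply: nb; split=> // y Fy yx.
  by apply: contrapT => nyx; apply: h; exists y.
have step z : G z -> supp z \subset supp x -> z <> x ->
    exists t, 0 < t /\ conv_hull (map v sS) (x + t *: (z - x)).
  move=> Gz zx nzx.
  have [i0 zi0] : exists i, z 0 i < x 0 i.
    apply: contrapT => h; apply: nzx; apply/esym/bndG => //; first by case: Fx.
    by move=> i; rewrite leNgt; apply/negP => ?; apply: h; exists i.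
  pose q i := x 0 i / (x 0 i - z 0 i).
  have [j zj qj] := @arg_minP _ R 'I_n i0 (fun i => z 0 i < x 0 i) q zi0.
  have xj : 0 < x 0 j.
    rewrite lt_neqAle (Fx.2 j) andbT eq_sym; apply/negP => /eqP xj0.
    have : j \in supp z by rewrite inE -xj0 lt_eqF.
    by move=> /(fintype.subsetP zx); rewrite inE xj0 eqxx.
  have qj0 : 0 < q j by rewrite /q divr_gt0// subr_gt0.
  exists (q j); split=> //; apply: ih.
    split.
      have -> : x + q j *: (z - x) = q j *: z + (1 - q j) *: x.
        by rewrite scalerBr scalerBl scale1r addrCA.
      by apply: affG => //; case: Fx.
    move=> i; rewrite !mxE.
    have [zi|zi] := ltP (z 0 i) (x 0 i).
      have := qj i zi; rewrite {2}/q ler_pdivlMr ?subr_gt0// => h.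
      by rewrite -[_ - x 0 i]opprB mulrN subr_ge0.
    apply: addr_ge0; first exact: Fx.2.
    by apply: mulr_ge0; [exact: ltW|rewrite subr_ge0].
  rewrite -ltnS; apply: leq_trans xk; rewrite ltnS.
  apply: proper_card; apply/properP; split.
    apply/fintype.subsetP => i; rewrite !inE; apply: contra => /eqP xi.
    have : z 0 i == 0.
      apply/negPn/negP => zi; have : i \in supp z by rewrite inE.
      by move=> /(fintype.subsetP zx); rewrite inE xi eqxx.
    by move=> /eqP zi; rewrite !mxE xi zi subr0 mulr0 addr0.
  exists j; first by rewrite inE gt_eqF.
  rewrite inE negbK !mxE /q -[_ - x 0 j]opprB mulrN divfK ?subrr//.
  by rewrite subr_eq0 gt_eqF.
have [t [t0 ht]] := step y Fy.1 yx nyx.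
have [|||u [u0 hu]] := step (2 *: x + (1 - 2) *: y).
- by apply: affG => //; [case: Fx|case: Fy].
- apply/fintype.subsetP => i; rewrite !inE; apply: contra => /eqP xi.
  have : y 0 i == 0.
    apply/negPn/negP => yi; have : i \in supp y by rewrite inE.
    by move=> /(fintype.subsetP yx); rewrite inE xi eqxx.
  by move=> /eqP yi; rewrite !mxE xi yi !mulr0 addr0.
- have -> : (1 - 2 : R) = -1 by rewrite -[2]/(1 + 1) opprD addrA subrr add0r.
  rewrite scaleN1r [2]mulr2n scalerDl scale1r -addrA => h.
  apply: nyx; apply/esym/eqP; rewrite -subr_eq0; apply/eqP/(addrI x).
  by rewrite h addr0.
have tu : 0 < t + u by rewrite addr_gt0.
pose c := u / (t + u).
have c1 : 1 - c = t / (t + u).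
  by rewrite -[1](divff (lt0r_neq0 tu)) -mulrBl addrK.
suff -> : x = c *: (x + t *: (y - x)) +
    (1 - c) *: (x + u *: (2 *: x + (1 - 2) *: y - x)).
  apply: conv_hull_cvx => //.
  by apply/andP; split; [|rewrite -subr_ge0 c1]; apply: divr_ge0; exact: ltW.
have -> : 2 *: x + (1 - 2) *: y - x = - (y - x).
  have -> : (1 - 2 : R) = -1 by rewrite -[2]/(1 + 1) opprD addrA subrr add0r.
  by rewrite scaleN1r [2]mulr2n scalerDl scale1r opprB addrAC addrK.
rewrite 2!(scalerDr _ x) addrACA -scalerDl [c + _]addrC subrK scale1r.
rewrite !scalerN !scalerA c1 -scalerBl.
by rewrite /c [t / _ * u]mulrAC [t * u]mulrC mulrAC subrr scale0r addr0.
Qed.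

End convex_hull.

Section polytopes.
Context {R : realType} {n : nat}.
Local Notation E := 'rV[R]_n.
Implicit Types (s : seq E) (C D : set E).

Definition polytope C := (exists s, C = conv_hull s) /\ C° !=set0.

Lemma continuous_bigsum (T : topologicalType) (V : normedModType R) (I : Type)
    (r : seq I) (f : I -> T -> V) :
  (forall i, continuous (f i)) -> continuous (fun x => \sum_(i <- r) f i x).
Proof.
move=> cf; elim: r => [|i r ih].
  by under eq_fun do rewrite big_nil; exact: cst_continuous.
under eq_fun do rewrite big_cons.
by move=> x; apply: cvgD; [exact: cf|exact: ih].
Qed.

Lemma conv_hull_compact s : compact (conv_hull s).
Proof.
pose m := size s.
pose S := [set w : 'rV[R]_m | (forall i, 0 <= w 0 i) /\ \sum_i w 0 i = 1].
pose f (w : 'rV[R]_m) := \sum_i w 0 i *: s`_i.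
have -> : conv_hull s = f @` S.
  apply/seteqP; split=> [_ [w [w0 w1 ->]]|_ [w [w0 w1] <-]].
    exists (\row_i w i).
      by split=> [i|]; [rewrite mxE|rewrite -w1; apply: eq_bigr => i _; rewrite mxE].
    by apply: eq_bigr => i _; rewrite mxE.
  by exists (fun i => w 0 i).
apply: continuous_compact.
  apply: continuous_subspaceT.
  apply: (@continuous_bigsum 'rV[R]_m E _ _ (fun i (w : 'rV[R]_m) => w 0 i *: s`_i)) => i w.
  have c := @coord_continuous R 1 m 0 i w; exact: (cvgZr_tmp (a := s`_i) c).
apply: (subclosed_compact _ (@rV_compact R m (fun=> `[0, 1]%classic) _)).
- have -> : S = (\bigcap_i (fun w : 'rV[R]_m => w 0 i) @^-1` [set x | 0 <= x])
      `&` (fun w : 'rV[R]_m => \sum_i w 0 i) @^-1` [set 1].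
    apply/seteqP; split=> w [w0 w1]; split; try exact: w1.
    - by move=> i _; exact: w0.
    - by move=> i; exact: (w0 i I).
  apply: closedI.
    apply: closed_bigI => i _; apply: closed_comp; last exact: closed_ge.
    by move=> w _; exact: (@coord_continuous R 1 m 0 i).
  apply: closed_comp; last exact: closed_eq.
  move=> w _; apply: (@continuous_bigsum _ R) => i.
  exact: (@coord_continuous R 1 m 0 i).
- by move=> i; exact: segment_compact.
- move=> w [w0 w1] i /=; rewrite in_itv/= w0/= -w1 (bigD1 i)//= lerDl.
  by rewrite sumr_ge0.
Qed.

Lemma polytope_compact C : polytope C -> compact C.
Proof. by case=> -[s ->] _; exact: conv_hull_compact. Qed.

Lemma polytope_closed C : polytope C -> closed C.
Proof. by move=> /polytope_compact; apply: compact_closed; exact: norm_hausdorff. Qed.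

Lemma polytope_cvx C : polytope C -> cvx C.
Proof. by case=> -[s ->] _; exact: conv_hull_cvx. Qed.

Lemma affine_continuous (a : R) (b : E) : continuous (fun x : E => a *: x + b).
Proof.
move=> x; apply: (@cvgD _ E _ (nbhs x) _ (fun x => a *: x) (cst b) (a *: x) b).
  exact: (@cvgZl_tmp _ E _ (nbhs x) _ a id x cvg_id).
exact: cvg_cst.
Qed.

Lemma cvx_closure_interior C : cvx C -> C° !=set0 -> C `<=` closure C°.
Proof.
move=> cC [p Cp] x Cx B nB.
pose g (t : R) := t *: (p - x) + x.
have gx : g t @[t --> (0 : R)] --> x.
  rewrite -[X in _ --> X]add0r -(scale0r (p - x)).
  apply: (@cvgD _ E _ (nbhs (0 : R)) _ (fun t : R => t *: (p - x)) (cst x)).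
    exact: (@cvgZr_tmp _ E _ (nbhs (0 : R)) _ id 0 (p - x) cvg_id).
  exact: cvg_cst.
have : \forall t \near (0 : R)^'+, B (g t).
  by apply: cvg_within; exact: gx.
have : \forall t \near (0 : R)^'+, 0 < t < 1.
  near=> t; apply/andP; split; near: t; [exact: nbhs_right_gt|exact: nbhs_right_lt].
move=> h1 h2; have [t [/andP[t0 t1] Bt]] := filter_ex (filterI h1 h2).
exists (g t); split=> //.
pose k z := t^-1 *: z + (x - t^-1 *: x).
have tn0 : t != 0 by rewrite gt_eqF.
have : nbhs (g t) (k @^-1` C).
  apply: affine_continuous; rewrite -/(k (g t)).
  suff -> : k (g t) = p by exact: Cp.
  by rewrite /k /g (scalerDr t^-1) scalerA mulVf// scale1r addrACA subrK subrr addr0.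
apply: filterS => z Ckz.
suff -> : z = t *: k z + (1 - t) *: x by apply: cC => //; rewrite !ltW.
rewrite /k scalerDr scalerBr !scalerA divff// !scale1r scalerBl scale1r.
by rewrite -addrA [t *: x - x + _]addrA subrK subrr addr0.
Unshelve. all: by end_near. Qed.


Lemma polytopeI C D : polytope C -> polytope D -> (C `&` D)° !=set0 ->
  polytope (C `&` D).
Proof.
move=> [[s ->] _] [[r ->] _] ne; split=> //.
set m := size s; set k := size r.
pose S := \matrix_(i < m) s`_i : 'M[R]_(m, n).
pose Q := \matrix_(i < k) r`_i : 'M[R]_(k, n).
pose f (z : 'rV[R]_(m + k)) := lsubmx z *m S.
pose g (z : 'rV[R]_(m + k)) := rsubmx z *m Q.
pose u (z : 'rV[R]_(m + k)) := \sum_i lsubmx z 0 i.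
pose v (z : 'rV[R]_(m + k)) := \sum_i rsubmx z 0 i.
pose G := [set z | [/\ f z = g z, u z = 1 & v z = 1]].
have fE z : f z = \sum_i lsubmx z 0 i *: s`_i.
  by rewrite /f mulmx_sum_row; apply: eq_bigr => i _; rewrite rowK.
have gE z : g z = \sum_i rsubmx z 0 i *: r`_i.
  by rewrite /g mulmx_sum_row; apply: eq_bigr => i _; rewrite rowK.
have uD x y t : u (t *: x + (1 - t) *: y) = t * u x + (1 - t) * u y.
  rewrite /u !mulr_sumr -big_split/=; apply: eq_bigr => i _.
  by rewrite !mxE.
have vD x y t : v (t *: x + (1 - t) *: y) = t * v x + (1 - t) * v y.
  rewrite /v !mulr_sumr -big_split/=; apply: eq_bigr => i _.
  by rewrite !mxE.
have [||V VE] := @std_polyhedron R (m + k) G.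
- move=> x y t [fx ux vx] [fy uy vy]; split.
  + by rewrite /f /g !linearD/= !linearZ/= !mulmxDl -!scalemxAl -/(f x) -/(f y)
       fx fy.
  + by rewrite uD ux uy !mulr1 addrC subrK.
  + by rewrite vD vx vy !mulr1 addrC subrK.
- move=> x y [_ ux vx] [_ uy vy] xy.
  have sumeq (I : finType) (a b : I -> R) : (forall i, a i <= b i) ->
      \sum_i a i = \sum_i b i -> a =1 b.
    move=> ab /eqP; rewrite eq_sym -subr_eq0 -sumrB psumr_eq0; last first.
      by move=> i _; rewrite subr_ge0.
    move=> /allP h i; apply/esym/eqP; rewrite -subr_eq0.
    by apply: h; rewrite mem_index_enum.
  rewrite -[x]hsubmxK -[y]hsubmxK; congr row_mx; apply/rowP.
    by apply: sumeq; [move=> i; rewrite !mxE|rewrite -/(u x) -/(u y) ux uy].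
  by apply: sumeq; [move=> i; rewrite !mxE|rewrite -/(v x) -/(v y) vx vy].
have -> : conv_hull s `&` conv_hull r =
    f @` [set z | G z /\ forall i, 0 <= z 0 i].
  apply/seteqP; split=> [x [[a [a0 a1 xa]] [b [b0 b1 xb]]]|
                         _ [z [[fg uz vz] z0] <-]].
    pose z := row_mx (\row_i a i) (\row_j b j) : 'rV_(m + k).
    have fz : f z = x.
      rewrite fE row_mxKl xa; apply: eq_bigr => i _; by rewrite mxE.
    exists z => //; split; [split|].
    - rewrite fz gE row_mxKr xb; apply: eq_bigr => i _; by rewrite mxE.
    - by rewrite /u row_mxKl -a1; apply: eq_bigr => i _; rewrite mxE.
    - by rewrite /v row_mxKr -b1; apply: eq_bigr => i _; rewrite mxE.
    - by move=> i; rewrite mxE; case: splitP => j _; rewrite mxE.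
  split; first by exists (lsubmx z 0); split=> // i; rewrite mxE.
  by rewrite fg; exists (rsubmx z 0); split=> // i; rewrite mxE.
by exists (map (mulmxr S \o lsubmx) V); rewrite -conv_hull_lin -VE.
Qed.

End polytopes.

Section tessellations.
Context {R : realType} {n : nat}.
Local Notation E := 'rV[R]_n.
Implicit Types (C D K W : set E) (T : set (set E)).

Definition tessellation D T := [/\ countable T,
  forall K, compact K -> finite_set [set C | T C /\ C `&` K !=set0],
  forall C, T C -> polytope C,
  forall C C', T C -> T C' -> C <> C' -> C° `&` C'° = set0 &
  \bigcup_(C in T) C = D].

Lemma tessellation_finite D T : compact D -> tessellation D T -> finite_set T.
Proof.
move=> cD [_ lf pT _ UT]; apply: sub_finite_set (lf D cD) => C TC; split=> //.
have [_ [x /interior_subset Cx]] := pT C TC.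
by exists x; split=> //; rewrite -UT; exists C.
Qed.

Lemma tessellation_set1 W : polytope W -> tessellation W [set W].
Proof.
move=> pW; split.
- exact/finite_set_countable/finite_set1.
- by move=> K _; apply: sub_finite_set (finite_set1 W) => C [].
- by move=> C ->.
- by move=> C C' -> ->.
- by rewrite bigcup_set1.
Qed.

Definition dilate (c : R) C : set E := [set c *: x | x in C].

Lemma scale_continuous_rV (c : R) : continuous (fun x : E => c *: x).
Proof.
by move=> x; exact: (@cvgZl_tmp _ E _ (nbhs x) _ c id x cvg_id).
Qed.

Lemma tessellation_dilate c T : c != 0 -> tessellation [set: E] T ->
  tessellation [set: E] [set dilate c C | C in T].
Proof.
move=> c0 [cT lf pT dT UT].
have intE C x : (dilate c C)° x -> C° (c^-1 *: x).
  move=> nx; have : nbhs (c^-1 *: x) ((fun y => c *: y) @^-1` dilate c C).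
    apply: scale_continuous_rV; rewrite scalerA divff// scale1r; exact: nx.
  apply: filterS => y [z Cz /= zy].
  by have -> : y = z by apply: (scalerI c0).
split.
- exact: card_le_trans (card_image_le _ _) cT.
- move=> K cK.
  have cK' : compact (dilate c^-1 K).
    apply: continuous_compact => //; apply: continuous_subspaceT.
    exact: scale_continuous_rV.
  apply: sub_finite_set (finite_image (dilate c) (lf _ cK')).
  move=> _ [[C TC <-] [_ [[x Cx <-] Kx]]]; exists C => //; split=> //.
  exists x; split=> //; exists (c *: x) => //.
  by rewrite scalerA mulVf// scale1r.
- move=> _ [C TC <-]; have [[s sE] [p Cp]] := pT C TC; split.
    by exists (map ( *:%R c) s); rewrite -conv_hull_lin sE.
  exists (c *: p).
  have : nbhs (c *: p) ((fun y => c^-1 *: y) @^-1` C).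
    by apply: scale_continuous_rV; rewrite scalerA mulVf// scale1r; exact: Cp.
  apply: filterS => y Cy; exists (c^-1 *: y) => //.
  by rewrite scalerA divff// scale1r.
- move=> _ _ [C TC <-] [C' TC' <-] CC'; apply/eqP/negPn/negP => /set0P.
  move=> [x [/intE Cx /intE C'x]].
  have : (C° `&` C'°) (c^-1 *: x) by [].
  by rewrite dT// => CE; apply: CC'; rewrite CE.
- apply/seteqP; split=> // x _.
  have : [set: E] (c^-1 *: x) by [].
  rewrite -UT => -[C TC Cx]; exists (dilate c C); first by exists C.
  by exists (c^-1 *: x) => //; rewrite scalerA divff// scale1r.
Qed.

Definition trace W T := [set C `&` W | C in [set C | T C /\ (C `&` W)° !=set0]].

Lemma finite_closed_cover (s : seq (set E)) (O : set E) :
  (forall A, A \in s -> closed A) -> open O -> O !=set0 ->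
  O `<=` \bigcup_(A in [set` s]) A -> exists A, A \in s /\ (A° `&` O) !=set0.
Proof.
elim: s O => [|A s ih] O cs oO [x Ox] sO.
  by have [] := sO x Ox.
have [[y [Oy Ay]]|h] := pselect ((O `&` ~` A) !=set0).
  have [||||B [Bs [z [Bz [Oz _]]]]] := ih (O `&` ~` A).
  - by move=> B Bs; apply: cs; rewrite inE Bs orbT.
  - by apply: openI => //; apply: closed_openC; apply: cs; rewrite inE eqxx.
  - by exists y.
  - move=> z [Oz Az]; have [B] := sO z Oz; rewrite /= inE => /orP[/eqP -> //|Bs Bz].
    by exists B.
  by exists B; split; [rewrite inE Bs orbT|exists z].
exists A; split; first by rewrite inE eqxx.
exists x; split=> //; apply: (filterS _ (open_nbhs_nbhs (conj oO Ox))) => z Oz.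
by apply: contrapT => Az; apply: h; exists z.
Qed.

Lemma tessellation_trace W T : polytope W -> tessellation [set: E] T ->
  tessellation W (trace W T).
Proof.
move=> pW [cT lf pT dT UT].
have cW := polytope_compact pW; have clW := polytope_closed pW.
have fW := lf W cW.
have fT : finite_set (trace W T).
  apply: sub_finite_set (finite_image (fun C => C `&` W) fW).
  move=> _ [C [TC [x /interior_subset CWx]] <-].
  by exists C => //; split=> //; exists x.
have cell A : trace W T A -> polytope A.
  by move=> [C [TC ne] <-]; apply: polytopeI => //; exact: pT.
split.
- exact: finite_set_countable.
- by move=> K _; apply: sub_finite_set fT => A [].
- exact: cell.
- move=> _ _ [C [TC _] <-] [C' [TC' _] <-] CC'.
  have ne : C <> C' by move=> CE; apply: CC'; rewrite CE.
  apply/eqP/negPn/negP => /set0P[x [Cx C'x]].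
  have : (C° `&` C'°) x by split; [apply: filterS Cx|apply: filterS C'x] => y [].
  by rewrite dT.
- apply/seteqP; split=> [x [_ [C _ <-]] []//|x Wx].
  apply: contrapT => nx.
  pose U := \bigcup_(A in trace W T) A.
  have cU : closed U.
    by apply: closed_bigcup => // A /cell; exact: polytope_closed.
  have := @cvx_closure_interior R n W (polytope_cvx pW) pW.2 x Wx (~` U).
  case; first by apply: open_nbhs_nbhs; split => //; exact: closed_openC.
  move=> y [Wy Uy].
  have /finite_seqP[s sE] := finite_image (fun C => C `&` W) fW.
  have [||||A [As [z [Az [Wz Uz]]]]] := @finite_closed_cover s (W° `&` ~` U).
  + move=> A; have -> : (A \in s) = ([set` s] A) :> Prop by [].
    rewrite -sE => -[C [TC _] <-].
    by apply: closedI => //; apply: polytope_closed; exact: pT.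
  + by apply: openI; [exact: open_interior|exact: closed_openC].
  + by exists y.
  + move=> z [/interior_subset Wz _]; have : [set: E] z by [].
    rewrite -UT => -[C TC Cz]; exists (C `&` W) => //.
    by rewrite -sE; exists C => //; split=> //; exists z.
  + have : [set` s] A by [].
    rewrite -sE => -[C [TC _] CE]; apply: Uz; exists A; last exact: interior_subset.
    by exists C => //; split=> //; exists z; rewrite CE.
Qed.

Definition unit_cube (z : 'rV[int]_n) : set E :=
  [set x | forall i, (z 0 i)%:~R <= x 0 i <= (z 0 i)%:~R + 1].

Lemma conv_hull_translate (s : seq E) (b : E) :
  [set x + b | x in conv_hull s] = conv_hull [seq x + b | x <- s].
Proof.
have bary (t : R) : t *: b + (1 - t) *: b = b.
  by rewrite -scalerDl addrC subrK scale1r.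
apply/seteqP; split=> [_ [x sx <-]|].
  pose C := [set x | conv_hull [seq x + b | x <- s] (x + b)].
  suff : conv_hull s `<=` C by apply.
  apply: conv_hull_min => [u v t t01 Cu Cv|u us].
    rewrite /C/=; have -> : t *: u + (1 - t) *: v + b =
        t *: (u + b) + (1 - t) *: (v + b).
      by rewrite !(scalerDr _ _ b) addrACA bary.
    exact: conv_hull_cvx.
  by apply: conv_hull_mem; exact: (map_f (fun x => x + b)).
apply: conv_hull_min => [_ _ t t01 [u Cu <-] [v Cv <-]|_ /mapP[u us ->]].
  exists (t *: u + (1 - t) *: v); first exact: conv_hull_cvx.
  by rewrite !(scalerDr _ _ b) addrACA bary.
by exists u => //; exact: conv_hull_mem.
Qed.

Lemma coord_le_norm (x : E) i : `|x 0 i| <= `|x|.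
Proof.
rewrite [leRHS]/Num.norm /= mx_normrE; apply/bigmax_geP; right => /=.
by exists (0, i).
Qed.

Lemma unit_cube_polytope z : polytope (unit_cube z).
Proof.
pose zR : E := \row_i (z 0 i)%:~R.
split.
  pose G := [set w : 'rV[R]_(n + n) |
    forall i, lsubmx w 0 i + rsubmx w 0 i = 1].
  have [||V VE] := @std_polyhedron R (n + n) G.
  - move=> x y t Gx Gy i; rewrite !mxE.
    have := Gx i; have := Gy i; rewrite !mxE => yi xi.
    by rewrite addrACA -!mulrDr xi yi !mulr1 addrC subrK.
  - move=> x y Gx Gy xy.
    have xyi i : lsubmx x 0 i = lsubmx y 0 i /\ rsubmx x 0 i = rsubmx y 0 i.
      have := Gx i; have := Gy i; have := xy (lshift n i); have := xy (rshift n i).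
      rewrite !mxE => h1 h2 h3 h4; split; apply/eqP; rewrite eq_le ?h1 ?h2 /=; lra.
    rewrite -[x]hsubmxK -[y]hsubmxK; congr row_mx; apply/rowP => i.
      by case: (xyi i).
    by case: (xyi i).
  exists [seq x + zR | x <- map (@lsubmx R 1 n n) V].
  rewrite -conv_hull_translate -conv_hull_lin -VE; apply/seteqP; split.
  - move=> x Qx; exists (x - zR); last by rewrite subrK.
    exists (row_mx (x - zR) (const_mx 1 - (x - zR))); last by rewrite /= row_mxKl.
    split=> [i|i].
      by rewrite row_mxKl row_mxKr !mxE; lra.
    rewrite mxE; case: splitP => j _; rewrite !mxE; have /andP[] := Qx j; lra.
  - move=> _ [_ [w [Gw w0] <-] <-] i; rewrite !mxE.
    have := Gw i; have := w0 (lshift n i); have := w0 (rshift n i).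
    by rewrite !mxE => h1 h2 h3; apply/andP; split; lra.
exists (zR + const_mx 2^-1).
apply/nbhs_ballP; exists 2^-1 => /=; first by rewrite invr_gt0.
move=> y; rewrite -ball_normE /= => yz i.
have := le_lt_trans (coord_le_norm _ i) yz.
rewrite !mxE ltr_norml => /andP[h1 h2]; apply/andP; split; lra.
Qed.

Lemma unit_cube_interior z x i : (unit_cube z)° x ->
  (z 0 i)%:~R < x 0 i < (z 0 i)%:~R + 1.
Proof.
move=> /nbhs_ballP[e/= e0 be].
have h (t : R) : `|t| < e -> unit_cube z (x + t *: delta_mx 0 i).
  move=> te; apply: be; rewrite -ball_normE/= opprD addNKr normrN.
  rewrite normrZ (le_lt_trans _ te)// ler_piMr//.
  rewrite [leLHS]/Num.norm/= mx_normrE; apply/bigmax_leP; split=> //= j _.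
  by rewrite mxE; case: (_ && _); rewrite ?normr1 ?normr0.
have /h/(_ i) : `|e / 2| < e by rewrite ger0_norm ?divr_ge0 ?ltW//; lra.
have /h/(_ i) : `|- (e / 2)| < e by rewrite normrN ger0_norm ?divr_ge0 ?ltW//; lra.
rewrite !mxE !eqxx !mulr1 => /andP[h1 h2] /andP[h3 h4]; apply/andP; split; lra.
Qed.

Lemma tessellation_unit_cube :
  tessellation [set: E] [set unit_cube z | z in [set: 'rV[int]_n]].
Proof.
split.
- exact: card_le_trans (card_image_le _ _) (countableP _).
- move=> K /compact_bounded[M [Mr hM]].
  pose N := (Num.trunc (`|M| + 2)).+1.
  pose f (g : {ffun 'I_n -> 'I_(2 * N).+1}) : 'rV[int]_n :=
    \row_i ((g i)%:Z - N%:Z).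
  have fin : finite_set [set unit_cube (f g) | g in [set: {ffun 'I_n -> 'I_(2 * N).+1}]].
    by apply: finite_image; exact: finite_finset.
  apply: sub_finite_set fin => _ [[z _ <-] [x [zx Kx]]].
  have xM : `|x| <= `|M| + 1.
    by apply: hM => //; rewrite (le_lt_trans (ler_norm M))// ltrDl.
  have zN i : `|z 0 i| <= N%:Z.
    have /andP[zi1 zi2] := zx i.
    have := le_trans (coord_le_norm x i) xM; rewrite ler_norml => /andP[xi1 xi2].
    rewrite -(ler_int R) intr_norm; apply: le_trans (ltW (truncnS_gt _)).
    rewrite ler_norml; apply/andP; split; lra.
  exists [ffun i => inord `|(z 0 i + N%:Z)%R|%N] => //.
  congr unit_cube; apply/rowP => i; rewrite mxE ffunE.
  have := zN i; rewrite ler_norml => /andP[h1 h2].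
  rewrite inordK ?gez0_abs ?addrK//; lia.
- by move=> _ [z _ <-]; exact: unit_cube_polytope.
- move=> _ _ [z _ <-] [z' _ <-] zz'; apply/eqP/negPn/negP => /set0P[x [zx z'x]].
  apply: zz'; congr unit_cube; apply/rowP => i.
  have /andP[h1 h2] := unit_cube_interior i zx.
  have /andP[h3 h4] := unit_cube_interior i z'x.
  have : (z 0 i < z' 0 i + 1)%R.
    by rewrite -(ltr_int R) intrD; exact: lt_trans h4.
  have : (z' 0 i < z 0 i + 1)%R.
    by rewrite -(ltr_int R) intrD; exact: lt_trans h2.
  lia.
- apply/seteqP; split=> // x _.
  exists (unit_cube (\row_i Num.floor (x 0 i))); first by eexists.
  move=> i; rewrite mxE floor_le/= ltW//.
  by have := floorD1_gt (x 0 i); rewrite intrD.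
Qed.

End tessellations.

Section fell_topology.

(* The sets of elements [y] hitting an open set, resp. missing a compact set,
   where [f y] is the closed set represented by [y]. *)
Definition hit_or_miss (X : topologicalType) (Y : Type) (f : Y -> set X) :
    set (set Y) :=
  [set [set y | f y `&` G !=set0] | G in [set G | open G]] `|`
  [set [set y | f y `&` K = set0] | K in [set K | compact K]].

Definition fell (X : topologicalType) := {F : set X | closed F}.

HB.instance Definition _ (X : topologicalType) := gen_eqMixin (fell X).
HB.instance Definition _ (X : topologicalType) := gen_choiceMixin (fell X).
HB.instance Definition _ (X : topologicalType) :=
  isPointed.Build (fell X) (exist _ set0 closed0).
HB.instance Definition _ (X : topologicalType) :=
  isSubBaseTopological.Build (fell X) (hit_or_miss (@sval _ _)) id.

(* Nonempty closed subsets of [X] contained in [D]. When [D] is closed, the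
   hit-or-miss sets of the space [X] and of its subspace [D] coincide here. *)
Definition fell_in (X : topologicalType) (D : set X) :=
  {F : set X | [/\ closed F, F !=set0 & F `<=` D]}.

HB.instance Definition _ (X : topologicalType) (D : set X) :=
  gen_eqMixin (fell_in D).
HB.instance Definition _ (X : topologicalType) (D : set X) :=
  gen_choiceMixin (fell_in D).
HB.instance Definition _ (X : topologicalType) (D : set X) :=
  isSubBaseTopological.Build (fell_in D) (hit_or_miss (@sval _ _)) id.

Lemma open_hit_or_miss (X : topologicalType) (D : set X) (A : set (fell_in D)) :
  hit_or_miss (@sval _ _) A -> open A.
Proof.
move=> hA; exists [set A]; last by rewrite bigcup_set1.
move=> _ ->; exists [fset A]%fset.
  by move=> B; rewrite inE => /eqP ->; exact/mem_set.
by rewrite set_fset1 bigcap_set1.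
Qed.

Lemma sval_injective (T : Type) (P : T -> Prop) : injective (@sval T P).
Proof.
move=> [x Px] [y Py] /= xy; case: y / xy Py => Py.
by rewrite (Prop_irrelevance Px Py).
Qed.

Lemma fell_in_closed1 (X : topologicalType) (D : set X) (F : fell_in D) :
  closed [set F].
Proof.
rewrite -[X in closed X]setCK; apply: open_closedC; rewrite openE => G GF.
have nsub : sval G <> sval F.
  by move=> GFE; apply: GF; exact: sval_injective.
have [[x [Gx Fx]]|h] := pselect (sval G `&` ~` sval F !=set0).
  pose A := [set H : fell_in D | sval H `&` ~` sval F !=set0].
  have oA : open A.
    apply: open_hit_or_miss; left; exists (~` sval F) => //=.
    by apply: closed_openC; case: (svalP F).
  apply: (filterS _ (open_nbhs_nbhs (conj oA _))); last by exists x.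
  by move=> H [y [Hy Fy]] HF; apply: Fy; rewrite -HF.
have [[x [Fx Gx]]|h'] := pselect (sval F `&` ~` sval G !=set0).
  pose A := [set H : fell_in D | sval H `&` [set x] = set0].
  have oA : open A.
    by apply: open_hit_or_miss; right; exists [set x] => //; exact: compact_set1.
  apply: (filterS _ (open_nbhs_nbhs (conj oA _))).
    by move=> H HA HF; have : set0 x by rewrite -HA HF.
  by apply/seteqP; split=> // y [Gy yx]; apply: Gx; rewrite -yx.
exfalso; apply: nsub; apply/seteqP; split=> x ?; apply: contrapT => nx.
  by apply: h; exists x.
by apply: h'; exists x.
Qed.

End fell_topology.

Section tessellation_spaces.
Context {R : realType} {n : nat}.
Local Notation E := 'rV[R]_n.

(* The sets carrying a tessellation; the two instances of interest are the
   whole space and the windows. *)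
Record tessellable := Tessellable {
  tset :> set E ;
  tset_tessellation : exists T, tessellation tset T }.

Definition whole_space := Tessellable (ex_intro _ _ (@tessellation_unit_cube R n)).

Definition tess (D : tessellable) := {T : set (set E) | tessellation D T}.

Definition tess_of (D : tessellable) T (h : tessellation D T) : tess D :=
  exist _ T h.

Lemma tess_closed (D : tessellable) (T : tess D) :
  closed [set F : fell_in D | sval T (sval F)].
Proof.
case: T => T /= [_ lf _ _ _].
rewrite -[X in closed X]setCK; apply: open_closedC; rewrite openE => F nTF.
have [_ [x Fx] _] := svalP F.
have cB : compact (closed_ball x 1).
  apply: bounded_closed_compact; last exact: closed_ball_closed.
  exists (`|x| + 1); split=> [|M hM y]; first exact: num_real.
  rewrite closed_ballE//= => xy; apply/ltW/(le_lt_trans _ hM).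
  by rewrite -[y](subKr x) (le_trans (ler_normB _ _))// lerD2l.
pose S := [set G : fell_in D | T (sval G) /\ sval G `&` closed_ball x 1 !=set0].
have fS : finite_set S.
  apply: (finite_preimage (f := @sval _ (fun F : set E => [/\ closed F, F !=set0 & F `<=` D]))) (lf _ cB).
  by move=> G H _ _; exact: sval_injective.
have cS : closed S.
  have -> : S = \bigcup_(G in S) [set G].
    by apply/seteqP; split=> [G SG|G [H SH ->]//]; exists G.
  by apply: closed_bigcup => // G _; exact: fell_in_closed1.
pose A := [set G : fell_in D | sval G `&` ball x 1 !=set0].
have oA : open A.
  apply: open_hit_or_miss; left; exists (ball x 1) => //=.
  exact: ball_open.
have oP : open (A `&` ~` S) by apply: openI => //; exact: closed_openC.
apply: (filterS _ (open_nbhs_nbhs (conj oP _))).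
  move=> G [[y [Gy xy]] SG] TG; apply: SG; split=> //.
  by exists y; split=> //; exact: subset_closed_ball.
split; last by case.
by exists x; split=> //; exact: ballxx.
Qed.

Definition fell_of (D : tessellable) (T : tess D) : fell (fell_in D) :=
  exist _ _ (@tess_closed D T).

HB.instance Definition _ (D : tessellable) := gen_eqMixin (tess D).
HB.instance Definition _ (D : tessellable) := gen_choiceMixin (tess D).
HB.instance Definition _ (D : tessellable) :=
  isPointed.Build (tess D) (tess_of (svalP (cid (tset_tessellation D)))).

(* The trace of the Borel sigma-field of the Fell topology. *)
Definition fell_borel (X : topologicalType) :=
  g_sigma_algebraType [set A : set (fell X) | open A].
HB.instance Definition _ (X : topologicalType) := Measurable.on (fell_borel X).
HB.instance Definition _ (D : tessellable) := Measurable.copy (tess D)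
  (g_sigma_algebra_preimageType (@fell_of D : tess D -> fell_borel (fell_in D))).


End tessellation_spaces.

Section windows.
Context {R : realType} {n : nat}.
Local Notation E := 'rV[R]_n.

Record window := Window { wset :> set E ; wset_polytope : polytope wset }.

Definition tessellable_window (W : window) : tessellable :=
  Tessellable (ex_intro _ [set wset W] (tessellation_set1 (wset_polytope W))).

Definition wedge (W : window) (T : tess (@whole_space R n)) :
    tess (tessellable_window W) :=
  tess_of (D := tessellable_window W)
    (tessellation_trace (wset_polytope W) (svalP T)).

(* [scale c T] is [cT] for [c != 0]; the value at [c = 0] is irrelevant. *)
Definition scale (c : R) (T : tess (@whole_space R n)) : tess (@whole_space R n) :=
  match pselect (c != 0) with
  | left c0 => tess_of (D := whole_space) (tessellation_dilate c0 (svalP T))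
  | right _ => T
  end.

Lemma scaleE (c : R) T : c != 0 ->
  sval (scale c T) = [set dilate c C | C in sval T].
Proof. by move=> c0; rewrite /scale; case: pselect. Qed.

End windows.
Arguments window : clear implicits.

Section hyperplanes.
Context {R : realType} {l : nat}.
Local Notation E := 'rV[R]_l.+1.

Definition dot (u x : E) : R := \sum_i u 0 i * x 0 i.

Definition hyperplane :=
  {h : set E | exists u c, u != 0 /\ h = [set x | dot u x = c]}.

Lemma hyperplane_ex : exists u c, u != 0 /\ 
  [set x : E | dot (const_mx 1) x = 0] = [set x | dot u x = c].
Proof.
exists (const_mx 1), 0; split=> //.
by apply/eqP => /rowP/(_ 0)/eqP; rewrite !mxE oner_eq0.
Qed.

HB.instance Definition _ := gen_eqMixin hyperplane.
HB.instance Definition _ := gen_choiceMixin hyperplane.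
HB.instance Definition _ := isPointed.Build hyperplane (exist _ _ hyperplane_ex).
(* The trace of the Fell topology of the space of closed sets. *)
HB.instance Definition _ :=
  isSubBaseTopological.Build hyperplane (hit_or_miss (@sval _ _)) id.
HB.instance Definition _ := Measurable.copy hyperplane
  (g_sigma_algebraType [set A : set hyperplane | open A]).

Implicit Types (C : set E) (h : hyperplane).

(* [B] in the notation of stochastic geometry *)
Definition hitting (B : set E) : set hyperplane := [set h | sval h `&` B !=set0].

Definition lexi_pos (u : E) :=
  exists i, 0 < u 0 i /\ forall j : 'I_l.+1, (j < i)%N -> u 0 j = 0.

(* The two closed half-spaces bounded by [h]. A hyperplane has no preferred
   side; the labelling by the sign of the first nonzero coordinate of the
   normal is a measurable choice. *)
Definition side (b : bool) h : set E := [set x | exists u c,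
  [/\ lexi_pos u, sval h = [set y | dot u y = c] &
      if b then c <= dot u x else dot u x <= c]].

Variable L : {measure set hyperplane -> \bar R}.

Definition translation_invariant := forall (v : E) (A : set hyperplane),
  measurable A ->
  L [set h | exists2 k, A k & sval h = [set x + v | x in sval k]] = L A.

Definition msupport : set hyperplane :=
  [set h | forall U, open U -> U h -> (0 < L U)%E].

Definition parallel_to (u : E) h :=
  forall x t, sval h x -> sval h (x + t *: u).

(* Finiteness on windows does not follow from sigma-finiteness. *)
Definition driving_measure := [/\
  L [set: hyperplane] <> 0%E,
  sigma_finite [set: hyperplane] L,
  translation_invariant,
  (forall W : window R l.+1, (L (hitting W) < +oo)%E) &
  ~ exists u : E, u != 0 /\ msupport `<=` parallel_to u].

(* The total mass of [hitting C] is positive and finite for a polytope [C]. *)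
Definition normalized_on C (B : set hyperplane) : R :=
  fine (L (B `&` hitting C)) / fine (L (hitting C)).

End hyperplanes.
Arguments hyperplane : clear implicits.

Section stit_window.
Context {R : realType} {l : nat}.
Local Notation E := 'rV[R]_l.+1.
Variables (L : {measure set (hyperplane R l) -> \bar R}) (W : window R l.+1).

(* Cells are indexed by binary words: the cell [w] is divided by the hyperplane
   [k w] into the cells [rcons w true] and [rcons w false], and lives for the
   time [s w] after its birth. *)
Definition cell (k : seq bool -> hyperplane R l) (w : seq bool) : set E :=
  [set x | wset W x /\
     forall i, (i < size w)%N -> side (nth false w i) (k (take i w)) x].

Definition birth (s : seq bool -> R) (w : seq bool) : R :=
  \sum_(i < size w) s (take i w).

Definition present_cells s k (t : R) : set (set E) :=
  [set cell k w | w in [set w | birth s w <= t < birth s w + s w]].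

Context d {Om : measurableType d} (P : probability Om R).
Variables (s : seq bool -> Om -> R) (k : seq bool -> Om -> hyperplane R l).

Definition generations_before (m : nat) : set (set Om) :=
  <<s [set A | exists v, (size v < m)%N /\
    ((exists2 D : set R, measurable D & A = s v @^-1` D) \/
     (exists2 B, measurable B & A = k v @^-1` B))] >>.

(* Conditionally on the generations before the m-th one, the lifetimes and the
   dividing hyperplanes of the cells of generation m are independent, with the
   exponential law of parameter [L (hitting C)] for the lifetime and the law
   [normalized_on L C] for the hyperplane of a cell [C]. *)
Definition cell_division := [/\
  forall w, measurable_fun [set: Om] (s w),
  forall w, measurable_fun [set: Om] (k w) &
  forall (m : nat) (A : set Om) (D : m.-tuple bool -> set R)
      (B : m.-tuple bool -> set (hyperplane R l)),
    generations_before m A ->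
    (forall w, measurable (D w)) -> (forall w, measurable (B w)) ->
    P (A `&` [set o | forall w : m.-tuple bool, D w (s w o) /\ B w (k w o)]) =
    (\int[P]_(o in A) (\prod_(w : m.-tuple bool)
       (fine (exponential_prob (fine (L (hitting (cell (k ^~ o) w)))) (D w)) *
        normalized_on L (cell (k ^~ o) w) (B w)))%:E)%E].

End stit_window.

(* [X] is a version of the process [Y /\ W]. *)
Definition stit_in_window {R : realType} {l : nat}
    (L : {measure set (hyperplane R l) -> \bar R}) (W : window R l.+1)
    d (Om : measurableType d) (P : probability Om R)
    (X : R -> Om -> tess (tessellable_window W)) : Prop :=
  exists s k, [/\ cell_division L W P s k,
    forall t, 0 <= t -> measurable_fun [set: Om] (X t) &
    {ae P, forall o, forall t, 0 <= t ->
       sval (X t o) = present_cells W (s ^~ o) (k ^~ o) t}].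

Section stit.
Context {R : realType} {l : nat} d {Om : measurableType d}.
Local Notation TT := (tess (@whole_space R l.+1)).
Variables (L : {measure set (hyperplane R l) -> \bar R}) (P : probability Om R)
  (Y : R -> Om -> TT).

Definition past (u : R) : set (set Om) :=
  <<s [set A | exists r, 0 < r <= u /\
    exists2 B, measurable B & A = Y r @^-1` B] >>.

Definition markov_process := forall u t, 0 < u <= t ->
  forall B : set TT, measurable B ->
  exists g : TT -> R, [/\ measurable_fun [set: TT] g,
    (forall T, 0 <= g T <= 1) &
    forall A, past u A ->
      P (A `&` Y t @^-1` B) = (\int[P]_(o in A) (g (Y u o))%:E)%E].

(* The index set is ]0, +oo[; the values of [Y] outside of it are irrelevant. *)
Definition stit_process := [/\
  forall t, 0 < t -> measurable_fun [set: Om] (Y t),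
  markov_process &
  forall W : window R l.+1, exists (d' : measure_display)
      (Om' : measurableType d') (P' : probability Om' R)
      (X : R -> Om' -> tess (tessellable_window W)),
    stit_in_window L P' X /\
    forall (ts : seq R) (B : R -> set (tess (tessellable_window W))),
      (forall t, t \in ts -> 0 < t) ->
      (forall t, measurable (B t)) ->
      P [set o | forall t, t \in ts -> B t (wedge W (Y t o))] =
      P' [set o | forall t, t \in ts -> B t (X t o)]].

End stit.

Section dynamical_systems.

Definition zseq (S : Type) := int -> S.

Definition zcylinder d (S : measurableType d) : set (set (zseq S)) :=
  [set A | exists m (B : set S), measurable B /\ A = [set x | B (x m)]].

HB.instance Definition _ (S : pointedType) := Pointed.copy (zseq S) (int -> S).
HB.instance Definition _ d (S : measurableType d) := Measurable.copy (zseq S)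
  (g_sigma_algebraType (@zcylinder d S)).

Definition zshift (S : Type) (x : zseq S) : zseq S := fun m => x (m + 1).

(* [m] is the product measure of countably many copies of [nu]. *)
Definition is_product_measure (R : realType) d (S : measurableType d)
    (nu : probability S R) (m : probability (zseq S) R) :=
  forall (J : seq int) (B : int -> set S), uniq J ->
    (forall i, measurable (B i)) ->
    m [set x | forall i, i \in J -> B i (x i)] = (\prod_(i <- J) fine (nu (B i)))%:E.

Definition completed_measure (R : realType) d (T : measurableType d)
    (mu : set T -> \bar R) (A : set T) : \bar R :=
  ereal_inf [set mu B | B in [set B | measurable B /\ A `<=` B]].

(* [phi] is an isomorphism mod 0 between the completed probability spaces. *)
Definition iso_mod0 (R : realType) d (T : measurableType d) d'
    (T' : measurableType d') (mu : probability T R) (mu' : probability T' R)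
    (phi : T -> T') :=
  (forall B, completed_algebra_gen mu' B ->
     completed_algebra_gen mu (phi @^-1` B) /\
     completed_measure mu (phi @^-1` B) = completed_measure mu' B) /\
  exists (A : set T) (A' : set T'), [/\ mu.-negligible (~` A),
    mu'.-negligible (~` A'), set_bij A A' phi &
    forall B, completed_algebra_gen mu B -> B `<=` A ->
      completed_algebra_gen mu' (phi @` B)].

Definition isomorphic (R : realType) d (T : measurableType d) d'
    (T' : measurableType d') (mu : probability T R) (psi : T -> T)
    (mu' : probability T' R) (psi' : T' -> T') :=
  exists phi, iso_mod0 mu mu' phi /\ {ae mu, forall x, phi (psi x) = psi' (phi x)}.

Section entropy.
Context {R : realType} d {S : measurableType d} (nu : probability S R).

(* Isomorphic mod 0 to an interval with Lebesgue measure together with countably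
   many atoms, here placed at the negative integers. *)
Definition lebesgue_probability_space :=
  exists (c : R) (p : nat -> R) (m : probability (measurableTypeR R) R) phi,
    [/\ 0 <= c, (forall j, 0 <= p j),
      (forall A, measurable A ->
         m A = lebesgue_measure (A `&` `[0%R, c]) +
               \sum_(0 <= j <oo) ((p j)%:E * \d_((- j.+1%:R)%R : R) A))%E &
      iso_mod0 nu m phi].

Definition atom (A : set S) := [/\ measurable A, (0 < nu A)%E &
  forall B, measurable B -> B `<=` A -> nu B = 0%E \/ nu B = nu A].

(* [nu] is purely atomic, with atoms the nonempty sets [A j]. *)
Definition atomic_partition (A : nat -> set S) := [/\
  (forall j, A j = set0 \/ atom (A j)), trivIset [set: nat] A &
  nu (\bigcup_j A j) = 1%E].

Definition entropy : \bar R :=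
  match pselect (exists A, atomic_partition A) with
  | left ex => (\sum_(0 <= j <oo) (- (fine (nu (sval (cid ex) j)) *
                  ln (fine (nu (sval (cid ex) j)))))%:E)%E
  | right _ => +oo%E
  end.

End entropy.

Definition isomorphic_to_bernoulli_of_infinite_entropy (R : realType) d
    (T : measurableType d) (mu : probability T R) (psi : T -> T) : Prop :=
  exists (d' : measure_display) (S : measurableType d') (nu : probability S R)
      (m : probability (zseq S) R),
    [/\ lebesgue_probability_space nu, is_product_measure nu m,
      entropy nu = +oo%E & isomorphic mu psi m (@zshift S)].

End dynamical_systems.

(* Main.v *)
(* Call [star] the tessellation [{W}]. A hyperplane that misses a window [M] misses one of the two
   windows through which the past and the future of the sequence are seen, so these are independent
   given that [M] is undivided. With [M] the window seen at time 0, [star] is a renewal state; with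
   [M] a window seen later, hence undivided with probability near 1, one gets enough mixing for
   [star] to be recurrent. The sequence is thus made of i.i.d. blocks. Since the first dividing
   hyperplane almost surely touches no given convex body at its boundary only, the law of a block is
   non-atomic, and a block of length [L] can be coded by [L] uniform variables conditioned on the
   first one lying in an interval [Ilen L] whose length is the probability of that block length. The
   coded sequence is i.i.d. uniform, and the blocks are recovered from it through synchronizing
   configurations. The law of STIT enters through one functional only, the probability that the cells
   born from [C] at time [s] pass given tests at given times. It is the limit of the iterates from 1
   of a renewal equation in [(C, s)], whose solutions are compared by an Euler scheme; this gives
   consistency, scaling and the factorization behind the independence. *)
From HB Require Import structures.
Require Import Defs.
From mathcomp Require Import all_boot all_order all_algebra.
From mathcomp Require Import all_classical all_reals all_analysis.
From mathcomp Require Import measurable_realfun finmap ring lra zify.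
Import Order.TTheory GRing.Theory Num.Theory.
Import numFieldNormedType.Exports.
Set Implicit Arguments.
Unset Strict Implicit.
Unset Printing Implicit Defensive.
Local Open Scope classical_set_scope.
Local Open Scope ring_scope.

(** The law of the process is given window by window, each window with its own probability space, so
    division trees seen in different windows cannot be coupled; they are compared only through
    functions of a cell and a time. The value at index $n$ depends on the trace in $a^{-n}W$ of the
    tessellation at time $a^n$: the past is seen in large windows at early times, the future in
    small windows at late times. The origin may lie outside $W$. A hyperplane missing $cW$ leaves it
    in an open half-space where a linear form is less than some $e$; if $e\le 0$ this half-space
    contains all larger dilates, otherwise all smaller ones, whence the missed window. On the coding
    side, a block of length L must use exactly L symbols for the code to commute with the shift. No
    symbol is left to announce the length, which is why the first uniform variable carries it. Such
    a code is read forwards from a known start, and starts must be found in the coded sequence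
    itself: all large lengths have positive probability and the mean length is finite, so a
    configuration that forces a start occurs again and again. *)

Notation mfunT f := (measurable_fun [set: _] f).

Ltac seteq := apply/seteqP; split.

(** * Measurability of sets and functions given by formulas *)

Section measurable_tools.
Context {d} {S : measurableType d}.
Implicit Types K L M : S -> Prop.

Lemma meas_preim d' (S' : measurableType d') (f : S -> S') (A : set S') :
  mfunT f -> measurable A -> measurable (f @^-1` A).
Proof. by move=> mf mA; rewrite -[X in measurable X]setTI; exact: mf. Qed.

Lemma meas_bigcup (I : countType) (F : I -> set S) :
  (forall i, measurable (F i)) -> measurable (\bigcup_i F i).
Proof. exact/countable_bigcupT_measurable. Qed.

Lemma meas_ex (I : countType) (K : I -> S -> Prop) :
  (forall i, measurable [set x | K i x]) -> measurable [set x | exists i, K i x].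
Proof. by move=> /meas_bigcup; congr measurable; seteq=> x [i]; exists i. Qed.

Lemma meas_not K : measurable [set x | K x] -> measurable [set x | ~ K x].
Proof. exact: measurableC. Qed.

Lemma meas_and K L :
  measurable [set x | K x] -> measurable [set x | L x] -> measurable [set x | K x /\ L x].
Proof. exact: measurableI. Qed.

Lemma meas_and3 K L M : measurable [set x | K x] -> measurable [set x | L x] ->
  measurable [set x | M x] -> measurable [set x | [/\ K x, L x & M x]].
Proof.
by move=> mK mL mM; have := meas_and mK (meas_and mL mM); congr measurable; seteq=> x; [case=> ? []|case].
Qed.

Lemma meas_all (I : countType) (K : I -> S -> Prop) :
  (forall i, measurable [set x | K i x]) -> measurable [set x | forall i, K i x].
Proof.
move=> mK; have := meas_not (meas_ex (fun i => meas_not (mK i))).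
congr measurable; seteq=> x h; last by case=> i; exact.
by move=> i; apply: contrapT => nK; apply: h; exists i.
Qed.

Lemma meas_Prop (K : Prop) : measurable [set _ : S | K].
Proof. by have [/propT->|/propF->] := pselect K; [exact: measurableT|exact: measurable0]. Qed.

Lemma meas_impl K L :
  measurable [set x | K x] -> measurable [set x | L x] -> measurable [set x | K x -> L x].
Proof.
move=> mK mL; rewrite (_ : [set x | _] = ~` [set x | K x] `|` [set x | L x]).
  by apply: measurableU => //; exact: measurableC.
seteq=> x /=; last by case.
by have [k /(_ k)|nK] := pselect (K x); [right|left].
Qed.

Lemma meas_imp (K : Prop) L :
  (K -> measurable [set x | L x]) -> measurable [set x | K -> L x].
Proof.
have [k /(_ k)|nK _] := pselect K; first by apply: meas_impl; exact: meas_Prop.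
by rewrite (_ : [set x | _] = setT)//; seteq=> x // _ /nK.
Qed.

Lemma meas_le (R : realType) (f g : S -> R) :
  mfunT f -> mfunT g -> measurable [set x | f x <= g x].
Proof. by move=> mf mg; rewrite -[X in measurable X]setTI; exact: measurable_fun_le. Qed.

Lemma meas_lt (R : realType) (f g : S -> R) :
  mfunT f -> mfunT g -> measurable [set x | f x < g x].
Proof.
move=> mf mg; have := meas_not (meas_le mg mf); congr measurable.
by apply: eq_set => x; rewrite ltNge; apply/propext; split=> /negP.
Qed.

(* [f] agrees with [g i] on [E i] and is constant off the pieces. *)
Lemma meas_pieces (I : countType) d' (S' : measurableType d')
    (E : I -> set S) (g : I -> S -> S') (c : S') (f : S -> S') :
  (forall i, measurable (E i)) -> (forall i, mfunT (g i)) ->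
  (forall i x, E i x -> f x = g i x) -> (forall x, (forall i, ~ E i x) -> f x = c) ->
  mfunT f.
Proof.
move=> mE mg fg fc _ B mB; rewrite setTI (_ : _ @^-1` B =
  [set x | (exists i, E i x /\ B (g i x)) \/ (forall i, ~ E i x) /\ B c]).
  apply: measurableU; last by apply: meas_and (meas_Prop _); apply: meas_all => i; exact: meas_not (mE i).
  by apply: meas_ex => i; apply: meas_and; [exact: mE|exact: meas_preim].
seteq=> x; rewrite /preimage /=; last by case=> [[i [/fg->]]|[/fc->]].
have [[i Ei]|nE] := pselect (exists i, E i x); first by left; exists i; rewrite -(fg _ _ Ei).
have {}nE i : ~ E i x by move=> Ei; apply: nE; exists i.
by right; rewrite -(fc _ nE).
Qed.
End measurable_tools.

Section zseq_measurable.
Context {d} {S : measurableType d}.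

Lemma meas_at (m : int) : mfunT (fun x : zseq S => x m).
Proof.
move=> _ B mB; rewrite setTI; apply: sub_sigma_algebra.
by exists m, B.
Qed.

Lemma meas_zseq d' (T : measurableType d') (f : T -> zseq S) :
  (forall m, mfunT (fun x => f x m)) -> mfunT f.
Proof.
move=> mf; apply: (measurability (@zcylinder _ S)) => //.
move=> _ [_ [m [B [mB ->]]] <-]; exact: mf.
Qed.

Lemma meas_zshift : mfunT (@zshift S).
Proof. by apply: meas_zseq => m; exact: meas_at. Qed.
End zseq_measurable.

Create HintDb meas.
#[export] Hint Resolve meas_at meas_zshift measurableT measurable0 measurable_itv
  measurable_cst measurable_id measurable_fst measurable_snd fine_measurable measurable_expR : meas.

Ltac meas_step := first
  [ apply: meas_and | apply: meas_and3 | apply: meas_not | apply: meas_all => ?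
  | apply: meas_ex => ? | apply: meas_imp => ? | apply: meas_impl
  | apply: measurableI | apply: measurableU | apply: measurableC | apply: measurableD
  | apply: meas_preim | apply: meas_le | apply: meas_lt
  | apply: meas_zseq => ?
  | apply: measurable_funD | apply: measurable_funB | apply: measurable_funM
  | match goal with
    | |- measurable_fun _ (fun x => (_, _)) => apply: measurable_fun_pair
    | |- measurable_fun _ (fun x => EFin _) => apply/measurable_EFinP
    | |- measurable_fun _ (EFin \o _) => apply/measurable_EFinP
    | |- measurable_fun _ (fun x => - _)%R => apply: (measurableT_comp (@oppr_measurable _ _))
    end
  | apply: (measurableT_comp (f := expR))
  | match goal with
    | mf : measurable_fun _ ?f |- measurable_fun _ (fun x => ?f _) => apply: (measurableT_comp mf)
    | |- measurable_fun setT _ => fail 1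
    | |- measurable_fun _ _ => apply: measurable_funTS
    end ].

Ltac meas_upto n := match n with S ?m =>
  intros; first [ solve [auto 3 with meas] | exact: meas_Prop | meas_step; meas_upto m ] end.

Ltac meas := meas_upto (S (S (S (S (S (S (S (S O)))))))).

Ltac set_eq := apply/seteqP; split=> ?; rewrite /preimage /=; first [tauto | by firstorder].

(** * Measurable retracts among the line, binary sequences and double sequences *)

Section retract.
Context {R : realType}.

Definition meas_retract d d' (S : measurableType d) (S' : measurableType d') :=
  exists (i : S -> S') (j : S' -> S),
    [/\ mfunT i, mfunT j & cancel i j].

Lemma meas_retract_trans d1 d2 d3 (S1 : measurableType d1)
    (S2 : measurableType d2) (S3 : measurableType d3) :
  meas_retract S1 S2 -> meas_retract S2 S3 -> meas_retract S1 S3.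
Proof.
move=> [i [j [mi mj ij]]] [i' [j' [mi' mj' ij']]].
exists (i' \o i), (j \o j'); split; [exact: measurableT_comp..|].
exact: can_comp.
Qed.

Lemma meas_retract_zseq d d' (S : measurableType d) (S' : measurableType d') :
  meas_retract S S' -> meas_retract (zseq S) (zseq S').
Proof.
move=> [i [j [mi mj ij]]].
exists (fun x m => i (x m)), (fun y m => j (y m)); split.
- by meas.
- by meas.
- by move=> x; apply/funext => m; rewrite ij.
Qed.

Definition int_code (c : countType) (x : Countable.sort c) : int := (choice.pickle x)%:Z.
Definition int_decode (c : countType) (m : int) : option c := choice.unpickle `|m|%N.

Lemma int_codeK (c : countType) : pcancel (@int_code c) (@int_decode c).
Proof. by move=> x; rewrite /int_code /int_decode absz_nat choice.pickleK. Qed.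

Lemma meas_retract_zseq2 d (S : measurableType d) :
  meas_retract (zseq (zseq S)) (zseq S).
Proof.
exists (fun x m => if @int_decode (int * int)%type m is Some p then x p.1 p.2 else point),
  (fun y m k => y (int_code (m, k))); split.
- apply: meas_zseq => m; case: int_decode => [p|]; last meas.
  exact: (measurableT_comp (meas_at _) (meas_at _)).
- by meas.
- by move=> x; apply/funext => m; apply/funext => k; rewrite int_codeK.
Qed.

(** A real number is recorded by its Dedekind cut, the rationals [q n] at most [x], and recovered as
    the supremum of these. The value [-oo] at the other indices keeps them out of the supremum. *)
Lemma meas_retract_bits : meas_retract (measurableTypeR R) (zseq bool).
Proof.
pose q (n : nat) : R := if choice.unpickle n is Some r then ratr (r : rat) else 0.
pose i (x : R) : zseq bool := fun m => (q `|m|%N <= x).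
pose h (n : nat) (b : zseq bool) : \bar R := if b n then (q n)%:E else -oo%E.
have mh n : mfunT (h n).
  apply: (measurable_fun_ifT (f := fun b : zseq bool => b n)) => //.
  by meas.
exists i, (fun b => fine (esups (h ^~ b) 0%N)); split.
- apply: meas_zseq => m; rewrite /i.
  exact: (measurable_fun_ler (measurable_cst _) (@measurable_id _ _ _)).
- apply: measurableT_comp => //; exact: measurable_fun_esups.
- suff key (x : R) : esups (h ^~ (i x)) 0%N = x%:E by move=> x; rewrite key.
  apply/eqP; rewrite eq_le; apply/andP; split.
    apply: ub_ereal_sup => _ [n _ <-]; rewrite /h /i /=.
    by case: ifP => // _; exact: leNye.
  rewrite leNgt; apply/negP => lx.
  have [r [r0 rx]] : exists r : rat, (esups (h ^~ (i x)) 0%N < (ratr r)%:E)%E /\ ratr r <= x.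
    move: lx; case: (esups _ _) => [y|//|_].
      rewrite lte_fin => /rat_in_itvoo[r]; rewrite in_itv/= => /andP[yr rx].
      by exists r; rewrite lte_fin yr ltW.
    have /rat_in_itvoo[r] : x - 1 < x by lra.
    rewrite in_itv/= => /andP[yr rx].
    by exists r; rewrite ltNyr ltW.
  move: r0; apply/negP; rewrite -leNgt.
  apply: ereal_sup_ubound; exists (choice.pickle r) => //.
  by rewrite /h /i /= /q choice.pickleK rx.
Qed.

(** Digits 0 and 1 are summed in base 3: the tail after the first digit is at most 1/2, so
    comparison with 1 reads the first digit without the ambiguity of binary expansions. *)
Lemma meas_bits_retract : meas_retract (zseq bool) (measurableTypeR R).
Proof.
pose sh (b : zseq bool) : zseq bool := fun m => b (m + 1).
pose S (n : nat) (b : zseq bool) : R := \sum_(k < n) (b k%:Z)%:R / 3 ^+ k.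
have SS n b : S n.+1 b = (b 0)%:R + S n (sh b) / 3.
  rewrite /S big_ord_recl expr0 divr1 mulr_suml; congr +%R.
  apply: eq_bigr => k _; rewrite lift0 /sh exprSr invfM mulrA.
  by rewrite -[X in b (Posz X)]addn1 PoszD.
have S0 n b : 0 <= S n b <= 3 / 2.
  elim: n b => [|n ih] b; first by rewrite /S big_ord0 lexx /=; lra.
  by rewrite SS; have /andP[h1 h2] := ih (sh b); case: (b 0) => /=; apply/andP; split; lra.
have ndS b : nondecreasing_seq (S ^~ b).
  apply/nondecreasing_seqP => n; rewrite /S big_ord_recr/= lerDl.
  by rewrite divr_ge0.
have cS b : cvgn (S ^~ b).
  apply: nondecreasing_is_cvgn => //; exists (3 / 2) => _ [n _ <-].
  by have /andP[] := S0 n b.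
pose c b := limn (S ^~ b).
have mc : mfunT c.
  apply: (measurable_fun_cvg (h := S)) => // n.
  apply: measurable_sum => k; apply: measurable_funM => //.
  apply: (measurableT_comp (f := fun a : bool => a%:R : R)) => //.
  by meas.
have c0 b : 0 <= c b <= 3 / 2.
  apply/andP; split.
    by apply: limr_ge => //; near=> n; have /andP[] := S0 n b.
  by apply: limr_le => //; near=> n; have /andP[] := S0 n b.
have cE b : c b = (b 0)%:R + c (sh b) / 3.
  apply/cvg_lim => //; rewrite -(cvg_shiftS _) /=.
  under eq_fun do rewrite SS.
  by apply: cvgD; [exact: cvg_cst|apply: cvgM; [exact: cS|exact: cvg_cst]].
(* Subtracting the digit just read and multiplying by 3 shifts the expansion; [D n] exposes the
   digit of index [n]. *)
pose D (n : nat) (x : R) : R := iter n (fun y : R => 3 * (y - (1 <= y :> R)%:R)) x.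
have mD n : measurable_fun [set: R] (D n).
  elim: n => [|n ih]; first meas.
  apply: measurable_funM => //; apply: measurable_funB => //.
  apply: (measurableT_comp (f := fun a : bool => a%:R : R)) => //.
  exact: (measurable_fun_ler (measurable_cst _) ih).
have b0E b : (1 <= c b) = b 0.
  by rewrite cE; have /andP[h1 h2] := c0 (sh b); case: (b 0) => /=;
    [lra|apply/negbTE; rewrite -ltNge; lra].
have DE n b : D n (c b) = c (fun m => b (m + n%:Z)).
  elim: n b => [|n ih] b; first by rewrite /D/=; congr c; apply/funext => m; rewrite addr0.
  rewrite /D iterSr -/(D n _) b0E; have -> : 3 * (c b - (b 0)%:R) = c (sh b).
    by rewrite cE; lra.
  by rewrite ih; congr c; apply/funext => m; rewrite /sh; congr b; lia.
(* The series sees only nonnegative indices, so a two-sided sequence is first enumerated along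
   [int_code]. *)
pose e : zseq bool -> zseq bool := fun b m => if @int_decode int m is Some k then b k else false.
exists (fun b => c (e b)), (fun x m => 1 <= D `|int_code m|%N x); split.
- apply: measurableT_comp => //; apply: meas_zseq => m; rewrite /e.
  by case: int_decode => [k|]; meas.
- apply: meas_zseq => m.
  exact: (measurable_fun_ler (measurable_cst _) (mD _)).
- move=> b; apply/funext => m; rewrite DE b0E add0r /e.
  have -> : `|int_code m|%N%:Z = int_code m by rewrite /int_code absz_nat.
  by rewrite int_codeK.
Unshelve. all: by end_near. Qed.
End retract.

(** * Image measures and almost sure statements *)

Section pushforward_probability.
Context {R : realType} d d' (T : measurableType d) (T' : measurableType d').

Lemma ex_pushforward (P : probability T R) (f : T -> T') :
  mfunT f ->
  exists Q : probability T' R, forall A, Q A = P (f @^-1` A).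
Proof.
move=> mf.
pose X : {mfun T >-> T'} := HB.pack f (@isMeasurableFun.Build _ _ _ _ f mf).
by exists (distribution P (X : {RV P >-> T'})).
Qed.
End pushforward_probability.

Section almost_everywhere.
Context {R : realType} d d' (T : measurableType d) (T' : measurableType d').

Lemma ae_preimage (P : {measure set T -> \bar R}) (Q : {measure set T' -> \bar R}) (f : T -> T')
    (K : T' -> Prop) : mfunT f ->
  (forall A, measurable A -> P (f @^-1` A) = Q A) ->
  {ae Q, forall y, K y} -> {ae P, forall x, K (f x)}.
Proof.
move=> mf PQ [N [mN QN sN]]; exists (f @^-1` N); split.
- by meas.
- by rewrite PQ.
- by move=> x nK; apply: sN.
Qed.

Lemma measure_le (P : {measure set T -> \bar R}) (A B : set T) :
  measurable A -> measurable B -> A `<=` B -> (P A <= P B)%E.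
Proof. by move=> mA mB; apply: le_measure; apply: mem_set. Qed.

Lemma aeS (P : {measure set T -> \bar R}) (K L : T -> Prop) :
  (forall x, K x -> L x) -> {ae P, forall x, K x} -> {ae P, forall x, L x}.
Proof. exact: filterS. Qed.

Lemma aeI (P : {measure set T -> \bar R}) (K L : T -> Prop) :
  {ae P, forall x, K x} -> {ae P, forall x, L x} -> {ae P, forall x, K x /\ L x}.
Proof. by apply: filterS2. Qed.

Lemma null_negligible (P : probability T R) A : measurable A -> P A = 0%E -> P.-negligible A.
Proof. by move=> mA PA; exists A; split => //; exact: PA. Qed.

Lemma negligible_null (P : probability T R) A : measurable A -> P.-negligible A -> P A = 0%E.
Proof. by move=> mA /(negligibleP P mA). Qed.

Lemma negligible_countable (I : countType) (P : {measure set T -> \bar R}) (N : I -> set T) :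
  (forall i, P.-negligible (N i)) -> P.-negligible (\bigcup_i N i).
Proof.
move=> nN; pose M n := if choice.unpickle n is Some i then N i else set0.
apply: (@negligibleS _ _ _ _ (\bigcup_n M n)).
  by move=> x [i _ Nx]; exists (choice.pickle i) => //; rewrite /M choice.pickleK.
apply: negligible_bigcup => n; rewrite /M.
by case: choice.unpickle => [i|]; [exact: nN|exact: negligible_set0].
Qed.

Lemma ae_countable (I : countType) (P : {measure set T -> \bar R}) (K : I -> T -> Prop) :
  (forall i, {ae P, forall x, K i x}) -> {ae P, forall x, forall i, K i x}.
Proof.
move=> aeK; have := negligible_countable aeK; apply: negligibleS => x /= /existsNP[i nK].
by exists i.
Qed.

Lemma ae_measure_eq (P : {measure set T -> \bar R}) (A B : set T) :
  measurable A -> measurable B -> {ae P, forall x, A x <-> B x} -> P A = P B.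
Proof.
have le (C D : set T) : measurable C -> measurable D ->
    {ae P, forall x, C x <-> D x} -> (P C <= P D)%E.
  move=> mC mD [N [mN PN sN]].
  rewrite -[leRHS]adde0 -PN; apply: le_trans (measureU2 _ _ _) => //.
  apply: measure_le => //; first meas.
  move=> x Cx; have [CD|/sN] := pselect (C x <-> D x); last by right.
  by left; apply/CD.
move=> mA mB AB; apply/eqP; rewrite eq_le !le//.
by apply: filterS AB => x [].
Qed.

Lemma ae_probability1 (P : probability T R) (A : set T) : measurable A ->
  P A = 1%E -> {ae P, forall x, A x}.
Proof.
move=> mA PA; exists (~` A); split=> //; first meas.
by rewrite probability_setC// PA subee.
Qed.
End almost_everywhere.

Lemma meas_set1R (R : realType) (x : R) : measurable ([set x] : set (measurableTypeR R)).
Proof. by meas. Qed.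

Lemma meas_eq_real (R : realType) d0 (S0 : measurableType d0) (f g : S0 -> R) :
  mfunT f -> mfunT g ->
  measurable [set x | f x = g x].
Proof.
move=> mf mg; have := measurable_fun_eqr mf mg.
move=> /(_ measurableT [set true] I); rewrite setTI.
by congr measurable; seteq=> x /= /eqP.
Qed.

(** * Distribution functions and quantiles *)

Section real_line.
Context {R : realType}.
Local Notation RR := (measurableTypeR R).
Implicit Types (P Q : probability RR R).

Lemma probability_eq_itvNyc P Q :
  (forall x : R, P `]-oo, x]%classic = Q `]-oo, x]%classic) ->
  forall A, measurable A -> P A = Q A.
Proof.
move=> PQ; apply: (@measure_unique _ R RR (@RGenOInfty.G R) (fun n : nat => `](- n%:R : R), +oo[%classic)) => //.
- exact: RGenOInfty.measurableE.
- move=> _ _ [x ->] [y ->]; exists (Num.max x y).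
  by seteq=> z /=; rewrite !in_itv/= !andbT gt_max => /andP.
- by move=> n; exists (- n%:R).
- seteq=> // x _; exists (Num.trunc `|x|).+1 => //=.
  by rewrite in_itv/= andbT ltrNl (le_lt_trans (ler_norm (- x)))// normrN truncnS_gt.
- move=> _ [x ->]; rewrite -setCitvl; apply: etrans (probability_setC P (measurable_itv _)) _.
  by rewrite PQ -probability_setC.
- by move=> k; rewrite (le_lt_trans (probability_le1 _ _))// ?ltry//; meas.
Qed.

Definition nu01 : probability RR R := uniform_prob (@ltr01 R).

Lemma uniform01E (A : set RR) : measurable A ->
  nu01 A = lebesgue_measure (A `&` `[0%R, 1%R]%classic).
Proof.
move=> mA; rewrite /nu01/= /uniform_prob integral_uniform_pdf.
rewrite (eq_integral (fun=> 1%E)); last first.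
  move=> x /set_mem[_]; rewrite /= in_itv/= /uniform_pdf => ->.
  by rewrite subr0 invr1.
by rewrite integral_cst ?mul1e//; meas.
Qed.

(** Generalized inverse of [F]. For a distribution function the set is sure to be nonempty and
    bounded below only when [u] lies in ]0, 1[, hence the default value elsewhere. *)
Definition quantile (F : R -> R) (u : R) : R :=
  if (0 < u < 1) then inf [set x | u <= F x] else 0.

Section cdf.
Variable P : probability RR R.

Definition rcdf (x : R) : R := fine (P `]-oo, x]%classic).

Lemma rcdfE x : (rcdf x)%:E = P `]-oo, x]%classic.
Proof. by rewrite /rcdf fineK// fin_num_measure. Qed.

Let idR : RR -> R := idfun.
#[local] HB.instance Definition _ := @isMeasurableFun.Build _ _ _ _ idR (@measurable_id _ _ setT).
Let idRV : {RV P >-> R} := idR.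
Let cdfE x : cdf idRV x = (rcdf x)%:E.
Proof. by rewrite rcdfE. Qed.

Lemma rcdf_nd : {homo rcdf : x y / x <= y}.
Proof. by move=> x y xy; rewrite -lee_fin -!cdfE; exact: cdf_nondecreasing. Qed.

Lemma meas_rcdf : measurable_fun [set: R] rcdf.
Proof. by apply: nondecreasing_measurable => // x y; exact: rcdf_nd. Qed.

Lemma rcdf_lt u : 0 < u -> exists x, rcdf x < u.
Proof.
move=> u0.
have := cvg_cdfNy0 idRV.
move=> /fine_cvgP[_ /cvgrPdist_lt/(_ u u0)] [M [_ hM]].
exists (M - 1); have /hM : M - 1 < M by lra.
rewrite /= cdfE/= sub0r normrN ger0_norm// /rcdf.
by rewrite fine_ge0.
Qed.

Lemma rcdf_gt u : u < 1 -> exists x, u < rcdf x.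
Proof.
move=> u1; have h : 0 < 1 - u by lra.
have := cvg_cdfy1 idRV.
move=> /fine_cvgP[_ /cvgrPdist_lt/(_ (1 - u) h)] [M [_ hM]].
exists (M + 1); have /hM : M < M + 1 by lra.
rewrite /= cdfE/= => hu; have := le_lt_trans (ler_norm _) hu.
by lra.
Qed.

Lemma rcdf_right x e : 0 < e -> exists2 d, 0 < d & rcdf (x + d) < rcdf x + e.
Proof.
move=> e0; have := @cdf_right_continuous _ _ _ P idRV x.
rewrite cdfE.
move=> /fine_cvgP[_ /cvgrPdist_lt/(_ e e0)] [d /= d0 hd].
exists (d / 2); first by rewrite divr_gt0.
have /hd : ball_ (fun z => `|z|) x d (x + d / 2).
  by rewrite /= opprD addNKr normrN ger0_norm ?divr_ge0 ?ltW// ltr_pdivrMr// ltr_pMr// ltr1n.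
rewrite ltrDl divr_gt0// => /(_ isT); rewrite /= cdfE/= => h.
by rewrite -ltrBlDl; apply: le_lt_trans h; rewrite distrC ler_norm.
Qed.

Lemma quantile_le u x : 0 < u < 1 -> (quantile rcdf u <= x) = (u <= rcdf x).
Proof.
move=> u01; rewrite /quantile u01; set A := [set x | _].
have [u0 u1] := andP u01.
have hA : has_inf A.
  split.
    by have [y uy] := rcdf_gt u1; exists y; exact: ltW.
  have [y yu] := rcdf_lt u0; exists y => z uz; rewrite leNgt; apply/negP => zy.
  by have := lt_le_trans yu uz; rewrite ltNge rcdf_nd// ltW.
apply/idP/idP => [ix|]; last first.
  by move=> ux; apply: ge_inf => //; exact: hA.2.
rewrite leNgt; apply/negP => Fx.
have [e e0 he] : exists2 e, 0 < e & rcdf (x + e) < u.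
  have [|d d0 hd] := @rcdf_right x (u - rcdf x); first lra.
  by exists d => //; lra.
have [y Ay yx] : exists2 y, A y & y < x + e.
  apply: inf_lt; first exact: hA.1.
  by lra.
by have := lt_le_trans he Ay; rewrite ltNge rcdf_nd// ltW.
Qed.

Lemma meas_quantile : measurable_fun [set: R] (quantile rcdf).
Proof.
apply: (measurability _ (RGenOInfty.measurableE R)) => //.
move=> _ [_ [x ->] <-]; rewrite setTI -setCitvl preimage_setC; apply: measurableC.
rewrite [X in measurable X](_ : _ =
    (`]0, 1[%classic `&` `]-oo, rcdf x]%classic) `|`
    (~` `]0, 1[%classic `&` [set u | 0 <= x])); last first.
  seteq=> u /=; rewrite !in_itv/=.
    have [u01|u01] := boolP (0 < u < 1).
      by rewrite quantile_le// => h; left.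
    by rewrite /quantile (negbTE u01) => h; right; split=> //; exact/negP.
  move=> [[u01 ux]|[/negP/negbTE u01 x0]]; first by rewrite quantile_le.
  by rewrite /quantile u01.
by meas.
Qed.

Lemma uniform01_open : nu01 `]0, 1[%classic = 1%E.
Proof.
rewrite uniform01E// (_ : _ `&` _ = `]0, 1[%classic).
  by rewrite lebesgue_measure_itv/= lte01 sube0.
by apply: setIidl => x; apply: subset_itv; rewrite bnd_simp.
Qed.

Lemma uniform01_le (u : R) : 0 <= u <= 1 -> nu01 `]-oo, u]%classic = u%:E.
Proof.
move=> /andP[u0 u1]; rewrite uniform01E// (_ : _ `&` _ = `[0, u]%classic).
  by rewrite lebesgue_measure_itv/= lte_fin; case: ltgtP u0 => //; [rewrite sube0|move=> <-].
seteq=> x /=; rewrite !in_itv/=; first by move=> [-> /andP[->]].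
by lra.
Qed.

Lemma uniform01_quantile (A : set RR) : measurable A ->
  nu01 (quantile rcdf @^-1` A) = P A.
Proof.
have [Q QE] := @ex_pushforward R _ _ RR RR nu01 _ meas_quantile.
move=> mA; rewrite -QE; apply: probability_eq_itvNyc mA => x; rewrite QE.
have F01 : 0 <= rcdf x <= 1 by rewrite -!lee_fin rcdfE measure_ge0 probability_le1.
rewrite -rcdfE -(uniform01_le F01).
have m1 : measurable (quantile rcdf @^-1` `]-oo, x]%classic) by exact: (meas_preim meas_quantile).
apply: ae_measure_eq => //; have ae0 := @ae_probability1 R _ RR nu01 _ (measurable_itv _) uniform01_open.
by apply: aeS ae0 => u; rewrite /= !in_itv/= => u01; rewrite quantile_le.
Qed.
End cdf.
End real_line.
Section nonatomic.
Context {R : realType}.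
Local Notation RR := (measurableTypeR R).
Variable P : probability RR R.
Hypothesis P_na : forall x : R, P [set x] = 0%E.
Local Notation F := (rcdf P).
Local Notation g := (quantile F).

(** If [F (g u)] exceeded [u], then [g] would be constant on the interval from [u] to [F (g u)], and
    [g u] would be an atom of [P]. *)
Lemma rcdf_quantile u : 0 < u < 1 -> F (g u) = u.
Proof.
move=> u01; apply/eqP; rewrite eq_le -[X in _ && X]quantile_le// lexx andbT leNgt; apply/negP => uF.
have F1 : F (g u) <= 1 by rewrite -lee_fin rcdfE probability_le1.
have sub : `]u, F (g u)[%classic `<=` g @^-1` [set g u].
  move=> v /=; rewrite in_itv/= => /andP[uv vF]; have v01 : 0 < v < 1 by lra.
  apply/eqP; rewrite eq_le quantile_le// (ltW vF) quantile_le//=.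
  by rewrite (le_trans (ltW uv))// -quantile_le.
have mg := meas_preim (meas_quantile P) (meas_set1R (g u)).
have e0 : nu01 (g @^-1` [set g u]) = 0%E by rewrite (uniform01_quantile P (meas_set1R _)); exact: P_na.
have e1 : nu01 `]u, F (g u)[%classic = (F (g u) - u)%:E.
  rewrite uniform01E// (_ : _ `&` _ = `]u, F (g u)[%classic); first by rewrite lebesgue_measure_itv/= lte_fin uF.
  by apply: setIidl => v; rewrite /= !in_itv/=; lra.
have := measure_le nu01 (measurable_itv _) mg sub.
by rewrite [X in (X <= _)%E]e1 [X in (_ <= X)%E]e0 lee_fin subr_le0 leNgt uF.
Qed.

Let ae01 : {ae nu01, forall u : RR, F (g u) = u}.
Proof.
have ae0 := @ae_probability1 R _ RR nu01 _ (measurable_itv _) uniform01_open.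
by apply: aeS ae0 => u; rewrite /= in_itv/=; exact: rcdf_quantile.
Qed.

Lemma rcdf_uniform01 (A : set RR) : measurable A -> P (F @^-1` A) = nu01 A.
Proof.
move=> mA; have mF := meas_preim (meas_rcdf P) mA.
rewrite -(uniform01_quantile P mF); apply: ae_measure_eq => //.
  exact: (meas_preim (meas_quantile P)).
by move: ae01; apply: aeS => u; rewrite /preimage /= => ->.
Qed.

Lemma quantile_rcdf : {ae P, forall x, g (F x) = x}.
Proof.
have mE : measurable [set x : RR | g (F x) = x].
  exact: (meas_eq_real (measurableT_comp (meas_quantile P) (meas_rcdf P)) (@measurable_id _ RR setT)).
apply: (ae_probability1 mE); rewrite -(uniform01_quantile P mE) -[RHS](probability_setT nu01).
apply: ae_measure_eq => //; first exact: (meas_preim (meas_quantile P)).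
by move: ae01; apply: aeS => u; rewrite /preimage /= => ->.
Qed.
End nonatomic.

Definition ae_retract (R : realType) d d' (S : measurableType d) (S' : measurableType d')
    (P : {measure set S -> \bar R}) :=
  exists (i : S -> S') (j : S' -> S), [/\ mfunT i,
    mfunT j & {ae P, forall x, j (i x) = x}].

Section nonatomic_isomorphism.
Context {R : realType} d d' (S : measurableType d) (S' : measurableType d').
Local Notation RR := (measurableTypeR R).

(** The law of the real code [i x] has no atom, its fibres being null sets. Its distribution
    function therefore makes it uniform, and the quantile function undoes this almost surely. *)
Lemma nonatomic_uniform d0 (S0 : measurableType d0) (P : probability S0 R) :
    ae_retract RR P -> (forall x, P.-negligible [set x]) ->
  exists (f : S0 -> RR) (g : RR -> S0), [/\ mfunT f, measurable_fun [set: RR] g,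
    forall A, measurable A -> P (f @^-1` A) = nu01 A & {ae P, forall x, g (f x) = x}].
Proof.
move=> [i [j [mi mj ij]]] na; have [Q QE] := @ex_pushforward R _ _ S0 RR P i mi.
have Qna (y : R) : Q [set y] = 0%E.
  rewrite QE; apply/negligibleP; first meas.
  apply: (negligibleS _ (negligibleU (na (j y)) ij)) => x /= ixy.
  by have [jx|jx] := pselect (j (i x) = x); [left; rewrite -jx ixy|right].
have mF := meas_rcdf Q; have mg := meas_quantile Q.
exists (rcdf Q \o i), (j \o quantile (rcdf Q)); split; try exact: measurableT_comp.
  by move=> A mA; rewrite -(rcdf_uniform01 Qna mA) QE.
have h := ae_preimage (K := fun y : RR => quantile (rcdf Q) (rcdf Q y) = y) mi (fun A _ => esym (QE A)) (quantile_rcdf Qna).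
by apply: filterS (aeI h ij) => x [/= -> ->].
Qed.

(* The distribution functions carry both measures to the uniform one. *)
Lemma nonatomic_iso (P : probability S R) (P' : probability S' R) :
    ae_retract RR P -> ae_retract RR P' ->
    (forall x, P.-negligible [set x]) -> (forall x, P'.-negligible [set x]) ->
  exists (th : S -> S') (th' : S' -> S),
    [/\ mfunT th, mfunT th',
        forall A, measurable A -> P (th @^-1` A) = P' A &
        {ae P, forall x, th' (th x) = x}].
Proof.
move=> rP rP' na na'; have [f [g [mf mg Pf gf]]] := nonatomic_uniform rP na.
have [f' [g' [mf' mg' Pf' gf']]] := nonatomic_uniform rP' na'.
exists (g' \o f), (g \o f'); split; try exact: measurableT_comp.
  move=> A mA; have mA' := meas_preim mg' mA.
  rewrite (Pf (g' @^-1` A) mA') -(Pf' _ mA'); apply: ae_measure_eq => //; first meas.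
  by apply: filterS gf' => y; rewrite /preimage /= => ->.
have mE : measurable [set u : RR | f' (g' u) = u].
  exact: (meas_eq_real (measurableT_comp mf' mg') (@measurable_id _ RR setT)).
have h : {ae nu01, forall u : RR, f' (g' u) = u}.
  apply: (ae_probability1 mE); rewrite -Pf'// -[RHS](probability_setT P').
  apply: ae_measure_eq => //; first meas.
  by apply: filterS gf' => y; rewrite /preimage /= => ->.
have h' := ae_preimage (K := fun u : RR => f' (g' u) = u) mf Pf h.
by apply: filterS (aeI h' gf) => x [/= -> ->].
Qed.
End nonatomic_isomorphism.

(** * Isomorphisms mod 0 and the uniform law as a base of infinite entropy *)

Section isomorphism_from_code.
Context {R : realType} d d' (T : measurableType d) (T' : measurableType d').

Lemma completed_measureE d0 (S : measurableType d0) (mu : probability S R) (A N : set S) :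
  measurable A -> mu.-negligible N -> completed_measure mu (A `|` N) = mu A.
Proof.
move=> mA [N0 [mN N00 sN]]; apply/eqP; rewrite eq_le; apply/andP; split.
  apply: (@le_trans _ _ (mu (A `|` N0))).
    apply: ereal_inf_lbound; exists (A `|` N0) => //; split; first meas.
    exact: setUS.
  by rewrite (le_trans (measureU2 _ mA mN))// [X in (_ + X)%E]N00 adde0.
apply: le_ereal_inf_tmp => _ [B [mB sB] <-]; apply: measure_le => // x Ax.
by apply: sB; left.
Qed.

(** On the set cut out of the target by the equation [phi (psi v) = v], the image of a set under
    [phi] is its preimage under [psi]. Images are thus measurable by a direct computation. *)
Lemma iso_mod0_code (mu : probability T R) (m : probability T' R) (phi : T -> T') (psi : T' -> T) :
  mfunT phi -> mfunT psi ->
  measurable [set v | phi (psi v) = v] ->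
  (forall A, measurable A -> m A = mu (phi @^-1` A)) ->
  {ae mu, forall x, psi (phi x) = x} -> iso_mod0 mu m phi.
Proof.
move=> mphi mpsi meq mE psiphi.
have mpre A : measurable A -> measurable (phi @^-1` A) by meas.
have mpre' A : measurable A -> measurable (psi @^-1` A) by meas.
have npre N : m.-negligible N -> mu.-negligible (phi @^-1` N).
  by move=> [N0 [mN N00 sN]]; exists (phi @^-1` N0); split; [exact: mpre|rewrite -mE|move=> x; exact: sN].
have null N : measurable N -> mu.-negligible (phi @^-1` N) -> m.-negligible N.
  by move=> mN nN; apply: null_negligible => //; apply: (etrans (mE _ mN)); apply: negligible_null nN; exact: mpre.
split.
  move=> _ [A mA [N nN <-]]; rewrite preimage_setU; split.
    by exists (phi @^-1` A); [exact: mpre|exists (phi @^-1` N) => //; exact: npre].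
  by rewrite !completed_measureE//; [rewrite mE|exact: mpre|exact: npre].
have [N0 [mN N00 sN]] := psiphi.
pose A0 := ~` N0.
have mA0 : measurable A0 by meas.
have A0P x : A0 x -> psi (phi x) = x by move=> Ax; apply: contrapT => h; apply: Ax; exact: sN.
pose A' := [set v | phi (psi v) = v] `&` psi @^-1` A0.
have mA' : measurable A' by meas.
have phiA x : A0 x -> A' (phi x) by move=> Ax; split; rewrite /= A0P.
have nA' : m.-negligible (~` A').
  apply: null; first meas.
  by exists N0; split=> // x h; apply: contrapT => Nx; apply: h; exact: phiA.
have imE B : B `<=` A0 -> phi @` B = A' `&` psi @^-1` B.
  move=> BA; seteq=> [_ [x Bx <-]|v [[vE _] Bv]].
    by split; [exact/phiA/BA|rewrite /= A0P//; exact: BA].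
  by exists (psi v).
exists A0, A'; split=> //.
- by rewrite setCK; exists N0; split.
- split=> [x Ax|x y /set_mem Ax /set_mem Ay xy|v [vE Av]]; first exact: phiA.
    by rewrite -(A0P x)// xy A0P.
  by exists (psi v).
- move=> _ [A mA [N nN <-]] BA; rewrite image_setU.
  have AA : A `<=` A0 by move=> x Ax; apply: BA; left.
  have NA : N `<=` A0 by move=> x Nx; apply: BA; right.
  exists (phi @` A); first by rewrite imE//; meas.
  exists (phi @` N) => //; rewrite imE//.
  have [N1 [mN1 N10 sN1]] := nN.
  apply: (@negligibleS _ _ _ _ (A' `&` psi @^-1` N1)); first by move=> v [A'v Nv]; split=> //; exact: sN1.
  apply: null; first meas.
  apply: negligibleS (negligibleU (null_negligible mN1 N10) (null_negligible mN N00)) => x [_ /= N1x].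
  by have [Nx|Ax] := pselect (N0 x); [right|left; move: N1x; rewrite A0P].
Qed.
End isomorphism_from_code.

Section uniform_base.
Context {R : realType}.
Local Notation RR := (measurableTypeR R).

Lemma nu01_set1 (x : R) : nu01 (R := R) [set x] = 0%E.
Proof.
rewrite uniform01E; last meas.
apply/eqP; rewrite eq_le measure_ge0 andbT -(lebesgue_measure_set1 x).
by apply: measureIl => //; meas.
Qed.

Lemma lebesgue_nu01 : lebesgue_probability_space (nu01 (R := R)).
Proof.
exists 1, (fun=> 0), nu01, idfun; split=> //.
- move=> A mA; rewrite uniform01E// eseries0 ?adde0//.
  by move=> j _ _; rewrite mul0e.
- apply: (@iso_mod0_code R _ _ RR RR nu01 nu01 idfun idfun) => //.
  + by meas.
  + by meas.
  + by rewrite (_ : [set _ | _] = setT)//; seteq.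
  + exact: aeW.
Qed.

(** Intervals shorter than the mass of a supposed atom cut it into pieces that are too small to
    carry the whole mass, hence are null; countably many of them exhaust it. *)
Lemma nu01_not_atom (A : set RR) : ~ atom nu01 A.
Proof.
move=> [mA A0 hA].
have [n nA] : exists n : nat, (n.+1%:R^-1%:E < nu01 A)%E.
  have : 0 < fine (nu01 A) by rewrite fine_gt0// A0 (le_lt_trans (probability_le1 _ mA))// ltry.
  move=> /ltr_add_invr[n]; rewrite add0r => h; exists n.
  by rewrite -[ltRHS]fineK ?fin_num_measure// lte_fin.
pose I (k : int) : set RR := `[k%:~R / n.+1%:R, (k + 1)%:~R / n.+1%:R]%classic.
have small k : nu01 (A `&` I k) = 0%E.
  have mAI : measurable (A `&` I k) by apply: measurableI => //; exact: measurable_itv.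
  have [|//|h] := hA (A `&` I k) mAI; first by move=> x [].
  exfalso; move: nA; rewrite -h ltNge => /negP; apply.
  apply: (@le_trans _ _ (lebesgue_measure (I k))).
    rewrite uniform01E//; apply: measure_le => //; last by move=> x [[_]].
      by meas.
    exact: measurable_itv.
  rewrite lebesgue_measure_itv/= lte_fin ltr_pM2r ?invr_gt0// ltr_int ltrDl ltr01.
  rewrite -EFinB lee_fin -mulrBl intrD addrAC subrr add0r mul1r.
  by [].
have : nu01.-negligible A.
  have : nu01.-negligible (\bigcup_k (A `&` I k)).
    apply: negligible_countable => k; exists (A `&` I k); split=> //.
      by apply: measurableI => //; exact: measurable_itv.
    exact: small.
  apply: negligibleS => x Ax; exists (Num.floor (x * n.+1%:R)) => //; split=> //.
  rewrite /I/= in_itv/= ler_pdivrMr// ler_pdivlMr// floor_le/=.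
  by rewrite ltW// floorD1_gt.
move=> /(negligibleP nu01 mA) A00; move: A0.
by rewrite [X in (_ < X)%E]A00 ltxx.
Qed.

Lemma entropy_nu01 : entropy (nu01 (R := R)) = +oo%E.
Proof.
rewrite /entropy; case: pselect => // p; exfalso; case: p => A [hA _ A1].
have A0 j : A j = set0 by have [//|/nu01_not_atom] := hA j.
by move: A1; rewrite bigcup0// measure0 => /eqP; rewrite eqe eq_sym oner_eq0.
Qed.
End uniform_base.

(** * Conditional laws and finite products of the uniform law *)

Section conditional_law.
Context {R : realType} d d' (S : measurableType d) (S' : measurableType d').

Lemma ex_conditional_law (mu : probability S R) (E : set S) (f : S -> S') :
  measurable E -> mfunT f -> (0 < mu E)%E ->
  exists Q : probability S' R, forall A, measurable A ->
    Q A = (mu (E `&` f @^-1` A) * ((fine (mu E))^-1)%:E)%E.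
Proof.
move=> mE mf E0.
pose nu : {measure set S -> \bar R} := mrestr mu mE.
have [Q QE] := ex_pushforward (mnormalize nu mu) mf.
have nuT : nu setT = mu E by rewrite /nu/= /mrestr setTI.
have F : (nu setT == 0%E) || (nu setT == +oo%E) = false.
  by rewrite nuT gt_eqF// lt_eqF// (le_lt_trans (probability_le1 mu mE))// ltry.
exists Q => A mA.
have nuA : nu (f @^-1` A) = mu (E `&` f @^-1` A) by rewrite setIC.
have key : mnormalize nu mu (f @^-1` A) =
    (mu (E `&` f @^-1` A) * ((fine (mu E))^-1)%:E)%E.
  by rewrite /mnormalize F nuT -nuA.
by rewrite QE; exact: key.
Qed.
End conditional_law.

Section finite_product.
Context {R : realType}.
Local Notation RR := (measurableTypeR R).

Definition zmask (S : Type) (c : S) (n : nat) (x : zseq S) : zseq S :=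
  fun m => if (1 <= m <= n%:Z) then x m else c.

Lemma meas_zmask d (S : measurableType d) (c : S) n :
  mfunT (@zmask S c n).
Proof.
apply: meas_zseq => m; rewrite /zmask; case: (_ <= _ <= _); first meas.
by meas.
Qed.

(** Built by adding one independent coordinate at a time. The coordinates outside 1, ..., n are
    frozen at 0, so that a sequence is determined by the symbols of one block; decoding a block
    relies on this. *)
Lemma ex_finite_product n : exists M : probability (zseq RR) R,
  (forall B : int -> set RR, (forall m, measurable (B m)) ->
     M [set y | forall m, 1 <= m <= n%:Z -> B m (y m)] =
     (\prod_(1 <= k < n.+1) fine (nu01 (B k%:Z)))%:E) /\
  M [set y | zmask 0 n y = y] = 1%E.
Proof.
have mB (k : nat) (B : int -> set RR) : (forall m, measurable (B m)) ->
    measurable [set y : zseq RR | forall m, 1 <= m <= k%:Z -> B m (y m)].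
  by meas.
have mK (k : nat) : measurable [set y : zseq RR | zmask 0 k y = y].
  rewrite (_ : [set _ | _] = [set y | forall m, ~ (1 <= m <= k%:Z) -> [set 0 : R] (y m)]).
    by meas.
  seteq=> y /=.
    by move=> <- m /negP/negbTE h; rewrite /zmask h.
  by move=> h; apply/funext => m; rewrite /zmask; case: ifPn => // /negP /h ->.
elim: n => [|n [M [MB M1]]].
  exists (dirac ((fun=> 0) : zseq RR)); split=> [B mB'|].
    rewrite big_geq// [LHS]diracE mem_set// => m; lia.
  by rewrite [LHS]diracE mem_set//=; apply/funext => m; rewrite /zmask; case: (_ <= _ <= _).
pose f (p : RR * zseq RR) : zseq RR := fun m => if m == n.+1 then p.1 else p.2 m.
have mf : mfunT f.
  apply: meas_zseq => m; rewrite /f; case: (_ == _); first exact: measurable_fst.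
  exact: (measurableT_comp (meas_at m) measurable_snd).
pose N : probability (RR * zseq RR)%type R := (nu01 \x M)%E.
have [M' M'E] := ex_pushforward N mf.
exists M'; split=> [B mB'|]; rewrite M'E.
- have -> : f @^-1` [set y | forall m, 1 <= m <= n.+1%:Z -> B m (y m)] =
      B n.+1%:Z `*` [set y | forall m, 1 <= m <= n%:Z -> B m (y m)].
    seteq=> [[u y] /= h|[u y] /= [Bu h] m mn].
      split=> [|m mn]; first by have := h n.+1%:Z; rewrite /f eqxx; apply; lia.
      have := h m; rewrite /f; case: eqP => [mE|_] hm; last by apply: hm; lia.
      by exfalso; move: mn mE; lia.
    rewrite /f; case: eqP => [->//|nm]; apply: h; move: mn nm; lia.
  rewrite [LHS](product_measure1E _ _ (mB' _) (mB n B mB')).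
  by rewrite big_nat_recr//= MB// muleC EFinM fineK// fin_num_measure.
- apply/eqP; rewrite eq_le probability_le1/=; last first.
    by meas.
  have <- : N (setT `*` [set y | zmask 0 n y = y]) = 1%E.
    rewrite [LHS](product_measure1E _ _ measurableT (mK n)).
    by rewrite [X in (X * _)%E]probability_setT [X in (_ * X)%E]M1 mule1.
  apply: measure_le; [exact: measurableX|by apply: meas_preim => //; exact: mK|].
  move=> [u y] [_ /= yE]; apply/funext => m; rewrite /f /zmask /=.
  case: (m =P n.+1) => [->|mn1]; first by rewrite lexx.
  have /(congr1 (fun g => g m)) := yE; rewrite /zmask; case: ifP => h; case: ifP => // h'.
  by exfalso; move: h h' mn1; lia.
Qed.
End finite_product.

Lemma meas_eq_zseq (R : realType) d' (T : measurableType d') (f g : T -> zseq (measurableTypeR R)) :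
  mfunT f -> mfunT g -> measurable [set x | f x = g x].
Proof.
move=> mf mg; rewrite (_ : [set x | _] = [set x | forall m, f x m = g x m]).
  by apply: meas_all => m; apply: meas_eq_real; exact: measurableT_comp (meas_at m) _.
by seteq=> x /= h; [move=> m; rewrite h|exact/funext].
Qed.

(** * Stationary two-sided sequences *)

Section stationary_starts.
Context {R : realType} d {T : measurableType d}.
Local Notation RR := (measurableTypeR R).
Local Notation ZT := (zseq T).

Definition zshiftk (S : Type) (k : int) (x : zseq S) : zseq S := fun m => x (m + k).

Lemma meas_zshiftk d' (S : measurableType d') k :
  mfunT (@zshiftk S k).
Proof. by apply: meas_zseq => m; exact: meas_at. Qed.

Lemma zshiftkD (S : Type) j k (x : zseq S) : zshiftk j (zshiftk k x) = zshiftk (j + k) x.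
Proof. by apply/funext => m; rewrite /zshiftk addrA. Qed.

Lemma zshiftk0 (S : Type) (x : zseq S) : zshiftk 0 x = x.
Proof. by apply/funext => m; rewrite /zshiftk addr0. Qed.

Lemma preimage_zshiftkD (S : Type) j k (A : set (zseq S)) :
  zshiftk j @^-1` (zshiftk k @^-1` A) = zshiftk (k + j) @^-1` A.
Proof. by seteq=> x /=; rewrite /preimage /= zshiftkD. Qed.

Lemma preimage_zshiftk0 (S : Type) (A : set (zseq S)) : zshiftk 0 @^-1` A = A.
Proof. by seteq=> x /=; rewrite /preimage /= zshiftk0. Qed.

Lemma stationary_shiftk d' (S : measurableType d') (mu : probability (zseq S) R) :
  (forall A, measurable A -> mu (@zshift S @^-1` A) = mu A) ->
  forall k A, measurable A -> mu (zshiftk k @^-1` A) = mu A.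
Proof.
move=> stat.
have pos (n : nat) A : measurable A -> mu (zshiftk n%:Z @^-1` A) = mu A.
  elim: n A => [|n ih] A mA; first by rewrite preimage_zshiftk0.
  rewrite -[RHS]ih// -[RHS]stat; last by apply: meas_preim => //; exact: meas_zshiftk.
  by rewrite (_ : @zshift S = zshiftk 1)// preimage_zshiftkD addrC -intS.
move=> [n|n] A mA; first exact: pos.
rewrite -[LHS](pos n.+1); last by apply: meas_preim => //; exact: meas_zshiftk.
by rewrite preimage_zshiftkD NegzE addNr preimage_zshiftk0.
Qed.

(** Continuity from below: the constant probability is that of the union, which is almost sure. *)
Lemma ae_monotone_const d' (S : measurableType d') (mu : probability S R) (K : nat -> S -> Prop) :
  (forall n, measurable [set x | K n x]) ->
  (forall m n x, (m <= n)%N -> K m x -> K n x) ->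
  (forall n, mu [set x | K n x] = mu [set x | K 0%N x]) ->
  {ae mu, forall x, exists n, K n x} -> mu [set x | K 0%N x] = 1%E.
Proof.
move=> mK ndK cK aeK.
have cv : mu [set x | K n x] @[n --> \oo] --> mu (\bigcup_n [set x | K n x]).
  apply: nondecreasing_cvg_mu => //; first exact: bigcup_measurable.
  by move=> m n mn; apply/subsetPset => x; exact: ndK.
have <- : mu (\bigcup_n [set x | K n x]) = 1%E.
  rewrite -(@probability_setT _ _ _ mu); apply: ae_measure_eq => //.
    exact: bigcup_measurable.
  by apply: filterS aeK => x [n Kn]; split=> // _; exists n.
apply/esym; rewrite -(cvg_lim (@ereal_hausdorff R) cv).
by under eq_fun do rewrite cK; exact: lim_cst.
Qed.
End stationary_starts.

Section zseq_unique.
Context {R : realType} d {S : measurableType d}.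

Definition zcyl (N : nat) (B : int -> set S) : set (zseq S) :=
  [set x | forall m : int, (absz m <= N)%N -> B m (x m)].

Lemma meas_zcyl N B : (forall m, measurable (B m)) -> measurable (zcyl N B).
Proof. by meas. Qed.

Lemma zseq_measure_unique (G : set (set S)) (m1 m2 : {measure set (zseq S) -> \bar R}) :
  @measurable _ S = <<s G >> -> setI_closed G -> G setT -> (m1 setT < +oo)%E ->
  (forall N B, (forall m, G (B m)) -> m1 (zcyl N B) = m2 (zcyl N B)) ->
  forall A, measurable A -> m1 A = m2 A.
Proof.
move=> mG GI GT fin eqG.
pose H := [set A | exists N B, (forall m, G (B m)) /\ A = zcyl N B].
have Gm B : G B -> measurable B by rewrite mG => GB; exact: sub_sigma_algebra.
have HT : H setT.
  by exists 0%N, (fun=> setT); split=> //; seteq.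
apply: (@measure_unique _ R _ H (fun=> setT)) => //.
- seteq.
    apply: smallest_sub; first exact: smallest_sigma_algebra.
    move=> _ [m [B [mB ->]]].
    suff : @measurable _ S `<=` [set B | <<s H >> [set x : zseq S | B (x m)]] by apply.
    rewrite mG; apply: smallest_sub.
      split=> [|C hC|F hF] /=.
      - rewrite (_ : [set _ | _] = set0); last set_eq.
        exact: sigma_algebra0.
      - have -> : [set x : zseq S | (setT `\` C) (x m)] = setT `\` [set x : zseq S | C (x m)] by set_eq.
        exact: sigma_algebraCD.
      - have -> : [set x : zseq S | (\bigcup_k F k) (x m)] = \bigcup_k [set x : zseq S | F k (x m)] by set_eq.
        exact: sigma_algebra_bigcup.
    move=> C GC /=; apply: sub_sigma_algebra.
    exists (absz m), (fun k => if k == m then C else setT); split.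
      by move=> k; case: ifP.
    seteq=> x /=.
      by move=> Cx k _; case: eqP => // ->.
    by move=> /(_ m); rewrite eqxx; apply.
  apply: smallest_sub; first exact: sigma_algebra_measurable.
  by move=> _ [N [B [GB ->]]]; meas.
- move=> _ _ [N [B [GB ->]]] [N' [B' [GB' ->]]].
  exists (maxn N N'), (fun m => (if (absz m <= N)%N then B m else setT) `&`
    (if (absz m <= N')%N then B' m else setT)); split.
    by move=> m; apply: GI; case: ifP.
  seteq=> x /=.
    by move=> [h h'] m _; split; case: ifP => // hm; [exact: h|exact: h'].
  move=> h; split=> m hm.
    by have [|] := h m; [rewrite leq_max hm|rewrite hm].
  by have [|_] := h m; [rewrite leq_max hm orbT|rewrite hm].
- by seteq=> // x _; exists 0%N.
- by move=> _ [N [B [GB ->]]]; exact: eqG.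
Qed.
End zseq_unique.

Lemma ae_sum_measure (R : realType) d (T : measurableType d) (mu : {measure set T -> \bar R})
    (E : set T) (F : nat -> set T) : measurable E -> (forall j, measurable (F j)) ->
  trivIset setT F -> {ae mu, forall x, E x <-> exists j, F j x} ->
  mu E = (\sum_(0 <= j <oo) mu (F j))%E.
Proof.
move=> mE mF tF h.
rewrite -(@measure_semi_bigcup _ _ _ mu F) //; last exact: bigcupT_measurable.
apply: ae_measure_eq => //; first exact: bigcupT_measurable.
by apply: filterS h => x [h1 h2]; split=> [/h1[j]|[j _ Fj]]; [exists j|apply: h2; exists j].
Qed.

(** Weierstrass's product inequality. It bounds below the probability of many independent conditions
    whose failure probabilities have a small sum. *)
Lemma prod_ge_1sub (R : realDomainType) (a : nat -> R) m n :
  (forall i, 0 <= a i <= 1) -> 1 - \sum_(m <= i < n) a i <= \prod_(m <= i < n) (1 - a i).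
Proof.
move=> a01; have [nm|mn] := leqP n m; first by rewrite !big_geq// subr0.
elim: n mn => // n ih; rewrite ltnS leq_eqVlt => /orP[/eqP <-|mn].
  by rewrite !big_nat1.
rewrite !big_nat_recr ?(ltnW mn)//=; have := ih mn.
set p := \prod_(_ <= _ < _) _; set s := \sum_(_ <= _ < _) _ => h.
have p1 : 0 <= p <= 1.
  apply: (big_ind (fun z => 0 <= z <= 1)) => [|x y /andP[? ?] /andP[? ?]|i _].
  - by lra.
  - by nra.
  - by have /andP[? ?] := a01 i; lra.
have /andP[? ?] := a01 n; move/andP: p1 => [? ?]; nra.
Qed.

Lemma bounded_tail_small (R : realType) (S : nat -> R) (C e : R) : {homo S : i j / (i <= j)%N >-> i <= j} ->
  (forall i, S i <= C) -> 0 < e -> exists K, forall J, S J - S K <= e.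
Proof.
move=> nd SC e0.
have hs : has_sup (range S).
  by split; [exists (S 0%N), 0%N|exists C => _ [i _ <-]].
have [_ [K _ <-] hK] := sup_adherent e0 hs.
exists K => J; rewrite lerBlDr; apply: (@le_trans _ _ (sup (range S))).
  by apply: sup_upper_bound => //; exists J.
by lra.
Qed.

Lemma nu01_lt (R : realType) (c : R) : 0 <= c <= 1 ->
  nu01 ([set u | u < c] : set (measurableTypeR R)) = c%:E.
Proof.
move=> /andP[c0 c1].
have -> : [set u : R | u < c] = `]-oo, c[%classic by set_eq.
rewrite uniform01E; last meas.
have -> : `]-oo, c[%classic `&` `[0, 1]%classic = `[0, c[%classic :> set R.
  seteq=> u; rewrite /= !in_itv/=; first by move=> [uc /andP[-> _]].
  by lra.
rewrite lebesgue_measure_itv/= lte_fin; case: ltP => // h; first by rewrite sube0.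
by congr EFin; apply/eqP; rewrite eq_le c0 h.
Qed.

(** * Blocks of a renewal sequence *)

Section renewal.
Context {R : realType} d {T : measurableType d}.
Local Notation RR := (measurableTypeR R).
Local Notation ZT := (zseq T).
Variable star : T.
Hypothesis mset1 : forall t : T, measurable [set t].
Implicit Types x y : ZT.

(* A block starts right after each visit to [star] followed by a non-visit. *)
Definition isst x (n : int) := x n = star /\ x (n + 1) <> star.

Definition blk (L : nat) x := [/\ (0 < L)%N, isst x 0, isst x L%:Z &
  forall m : int, 0 < m < L%:Z -> ~ isst x m].

Lemma isst_shiftk k x n : isst (zshiftk k x) n = isst x (n + k).
Proof. by rewrite /isst /zshiftk addrAC. Qed.

Lemma meas_isst n : measurable [set x | isst x n].
Proof.
apply: meas_and; first exact: (meas_preim (meas_at n) (mset1 star)).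
apply: meas_not; exact: (meas_preim (meas_at (n + 1)) (mset1 star)).
Qed.

Lemma meas_blk L : measurable [set x | blk L x].
Proof.
have -> : [set x | blk L x] = [set x | (0 < L)%N /\ (isst x 0 /\ (isst x L%:Z /\
    forall m : int, 0 < m < L%:Z -> ~ isst x m))].
  by seteq=> x; [case|move=> [? [? []]]].
apply: meas_and; first meas.
apply: meas_and; first exact: meas_isst.
apply: meas_and; first exact: meas_isst.
apply: meas_all => m; apply: meas_imp => _.
by apply: meas_not; exact: meas_isst.
Qed.

(** The block started at [s] owns the times [s + 1] to [s + L]: the visit at [s] itself still
    belongs to the preceding block. *)
Definition inblk x (n s : int) (L : nat) := blk L (zshiftk s x) /\ s < n <= s + L%:Z.

Lemma inblkP x n s L : inblk x n s L <-> [/\ isst x s, isst x (s + L%:Z), s < n <= s + L%:Z &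
  forall m, s < m < s + L%:Z -> ~ isst x m].
Proof.
split=> [[[L0 s0 sL sm] sn]|[s0 sL sn sm]].
  split=> //.
  - by move: s0; rewrite isst_shiftk add0r.
  - by move: sL; rewrite isst_shiftk addrC.
  - move=> m hm; have := sm (m - s); rewrite isst_shiftk subrK; apply; lia.
split=> //; split; rewrite ?isst_shiftk ?add0r//; first lia.
  by rewrite addrC.
by move=> m hm; rewrite isst_shiftk; apply: sm; lia.
Qed.

Lemma inblk_inj x n s L s' L' : inblk x n s L -> inblk x n s' L' -> s = s' /\ L = L'.
Proof.
move=> /inblkP[s0 sL sn sm] /inblkP[s0' sL' sn' sm'].
have ss : s = s'.
  have [lt|lt|//] := ltgtP s s'.
    by exfalso; apply: (sm s') => //; lia.
  by exfalso; apply: (sm' s) => //; lia.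
split=> //; move: sL sL' sn sn' sm sm'; rewrite -{}ss => sL sL' sn sn' sm sm'.
have [lt|lt|//] := ltngtP L L'.
  by exfalso; apply: (sm' (s + L%:Z)) => //; lia.
by exfalso; apply: (sm (s + L'%:Z)) => //; lia.
Qed.

Definition io_starts x := forall n : int, (exists2 m, m < n & isst x m) /\ (exists2 m, n <= m & isst x m).

Lemma inblk_ex x n : io_starts x -> exists s L, inblk x n s L.
Proof.
move=> /(_ n)[[m mn stm] [k nk stk]].
have ex1 : exists j : nat, `[< isst x (n - 1 - j%:Z) >].
  by exists (absz (n - 1 - m)%R); apply/asboolP; rewrite (_ : _ - _ = m)//; lia.
have ex2 : exists j : nat, `[< isst x (n + j%:Z) >].
  by exists (absz (k - n)%R); apply/asboolP; rewrite (_ : _ + _ = k)//; lia.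
have [j1 /asboolP h1 min1] := ex_minnP ex1.
have [j2 /asboolP h2 min2] := ex_minnP ex2.
exists (n - 1 - j1%:Z), (j1 + j2).+1; apply/inblkP; split=> //.
- by rewrite (_ : _ + _ = n + j2%:Z)//; lia.
- lia.
- move=> i hi sti; have [lt|ge] := ltP i n.
    have /min1 : `[< isst x (n - 1 - ((absz (n - 1 - i)%R))%:Z) >].
      by apply/asboolP; rewrite (_ : _ - _ = i)//; lia.
    lia.
  have /min2 : `[< isst x (n + ((absz (i - n)%R))%:Z) >].
    by apply/asboolP; rewrite (_ : _ + _ = i)//; lia.
  lia.
Qed.

Variable mu : probability ZT R.
Hypothesis stat : forall A, measurable A -> mu (@zshift T @^-1` A) = mu A.
Hypothesis rec : {ae mu, forall x, exists n, isst x n}.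
Local Notation pr A := (fine (mu A)).

Let statk := stationary_shiftk stat.

#[local] Hint Resolve meas_isst meas_blk meas_zshiftk meas_zmask : meas.

Let ae_shiftk k (K : ZT -> Prop) : {ae mu, forall x, K x} -> {ae mu, forall x, K (zshiftk k x)}.
Proof. exact: (ae_preimage (meas_zshiftk k) (@statk k)). Qed.

(** The events that a start occurs beyond [N - n] grow with [n] and by stationarity share one
    probability, while their union is almost sure. The flag [fwd] treats the two directions of time
    together. *)
Lemma ae_io_starts : {ae mu, forall x, io_starts x}.
Proof.
have hit (fwd : bool) (N : int) : {ae mu, forall x, exists m, N <= (if fwd then m else - m) /\ isst x m}.
  pose g (m : int) := if fwd then m else - m; pose K (n : nat) x := exists m, N - n%:Z <= g m /\ isst x m.
  have mK n : measurable [set x | K n x] by apply: meas_ex => m; meas.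
  apply: filterS (ae_probability1 (mK 0%N) _) => [x|]; first by rewrite /K subr0.
  apply: ae_monotone_const (mK) _ _ _ => [m n x mn [i [h st]]|n|].
  - by exists i; split=> //; lia.
  - rewrite -(statk (- g n%:Z) (mK 0%N)); congr (mu _); seteq=> x /= [m [h st]].
      by exists (m + g n%:Z); rewrite isst_shiftk addrK; split=> //; move: h; rewrite /g; case: (fwd); lia.
    by exists (m - g n%:Z); rewrite isst_shiftk in st; split=> //; move: h; rewrite /g; case: (fwd); lia.
  - apply: filterS rec => x [m st]; exists (absz (N - g m)%R), m; split=> //; lia.
apply: ae_countable => n; apply: aeI.
  by apply: filterS (hit false (1 - n)) => x [m [h st]]; exists m => //; lia.
by apply: filterS (hit true n) => x [m [h st]]; exists m.
Qed.

(** Both halves are completed by [star] so as to remain sequences. For [futz] this puts a visit at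
    time 0, so that a start at 0 is visible in the future half alone. *)
Definition pastz x : ZT := fun m => if m <= 0 then x m else star.
Definition futz x : ZT := fun m => if 1 <= m then x m else star.

Lemma meas_pastz : mfunT pastz.
Proof.
apply: meas_zseq => m; rewrite /pastz; case: (_ <= _).
  by meas.
by meas.
Qed.

Lemma meas_futz : mfunT futz.
Proof.
apply: meas_zseq => m; rewrite /futz; case: (_ <= _).
  by meas.
by meas.
Qed.

Let mz n : measurable [set x : ZT | x n = star].
Proof. exact: (meas_preim (meas_at n) (mset1 star)). Qed.

#[local] Hint Resolve meas_pastz meas_futz : meas.

(** Conditional independence of past and future given a visit at 0, cleared of denominators. *)
Hypothesis ren : forall A B, measurable A -> measurable B ->
  (mu [set x | [/\ A (pastz x), x 0%R = star & B (futz x)]] * mu [set x | x 0%R = star] =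
   mu [set x | A (pastz x) /\ x 0%R = star] * mu [set x | x 0%R = star /\ B (futz x)])%E.

Let mpast A : measurable A -> measurable [set x | A (pastz x)].
Proof. exact: meas_preim meas_pastz. Qed.
Let mfut A : measurable A -> measurable [set x | A (futz x)].
Proof. exact: meas_preim meas_futz. Qed.
Let mst n : measurable [set x | isst x n].
Proof. by meas. Qed.

Let prE A : measurable A -> mu A = (pr A)%:E.
Proof. by move=> mA; rewrite fineK// fin_num_measure. Qed.

Definition pst := pr [set x | isst x 0].

Lemma pst_gt0 : 0 < pst.
Proof.
rewrite lt_neqAle fine_ge0// andbT; apply/negP => /eqP p0.
have mu0 n : mu.-negligible [set x : ZT | isst x n].
  apply: null_negligible => //; rewrite -(statk (- n) (mst n)) prE.
    congr EFin; rewrite [RHS]p0; congr (pr _); seteq=> x /=;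
    by rewrite /preimage /= isst_shiftk subrr.
  by apply: meas_preim => //; meas.
have : mu.-negligible [set: ZT].
  have := negligible_countable mu0.
  move=> /negligibleU/(_ rec); apply: negligibleS => x _.
  by have [[n st]|h] := pselect (exists n, isst x n); [left; exists n|right].
move=> /(negligible_null measurableT); rewrite probability_setT.
by move=> /eqP; rewrite eqe oner_eq0.
Qed.
Let p0 := pst_gt0.

(** A start is a visit followed by the future event [S]. The renewal identity is applied to the
    future [S] and to its intersection with [B]; the probability of a visit then cancels. *)
Lemma start_renewal A B : measurable A -> measurable B ->
  pr [set x | [/\ A (pastz x), isst x 0 & B (futz x)]] * pst =
  pr [set x | A (pastz x) /\ isst x 0] * pr [set x | isst x 0 /\ B (futz x)].
Proof.
move=> mA mB.
pose S := [set y : ZT | y 1 <> star].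
have mS : measurable S.
  by apply: meas_not; exact: mz.
have stE x : isst x 0 <-> x 0 = star /\ S (futz x) by rewrite /isst /S /futz /= add0r.
have pr0 : 0 < pr [set x | x 0 = star].
  apply: lt_le_trans pst_gt0 _; apply: fine_le; rewrite ?fin_num_measure//.
  by apply: measure_le => // x [].
have renR A' B' (mA' : measurable A') (mB' : measurable B') :
    pr [set x | [/\ A' (pastz x), x 0 = star & B' (futz x)]] * pr [set x | x 0 = star] =
    pr [set x | A' (pastz x) /\ x 0 = star] * pr [set x | x 0 = star /\ B' (futz x)].
  have n1 : measurable [set x : ZT | x 0 = star /\ B' (futz x)] by meas.
  have n2 : measurable [set x | A' (pastz x) /\ x 0 = star] by meas.
  have n3 : measurable [set x | [/\ A' (pastz x), x 0 = star & B' (futz x)]] by meas.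
  have := ren mA' mB'; rewrite (prE n1) (prE n2) (prE n3) (prE (mz 0)).
  by rewrite -!EFinM => -[].
have mSB : measurable (S `&` B) by meas.
have e1 := renR A (S `&` B) mA mSB.
have e2 := renR A S mA mS.
have s1 : [set x : ZT | [/\ A (pastz x), isst x 0 & B (futz x)]] =
    [set x : ZT | [/\ A (pastz x), x 0 = star & (S `&` B) (futz x)]].
  by seteq=> x /= => [[a /stE[b c] e]|[a b [c e]]]; split=> //; exact/stE.
have s2 : [set x : ZT | A (pastz x) /\ isst x 0] = [set x : ZT | [/\ A (pastz x), x 0 = star & S (futz x)]].
  by seteq=> x /= => [[a /stE[b c]]|[a b c]]; split=> //; exact/stE.
have s3 : [set x : ZT | isst x 0 /\ B (futz x)] = [set x : ZT | x 0 = star /\ (S `&` B) (futz x)].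
  by seteq=> x /= => [[/stE[b c] e]|[b [c e]]]; split=> //; exact/stE.
have s4 : [set x : ZT | isst x 0] = [set x : ZT | x 0 = star /\ S (futz x)] by seteq=> x /= /stE.
rewrite /pst s1 s2 s3 s4; apply: (mulIf (lt0r_neq0 pr0)).
by rewrite mulrAC e1 mulrAC -mulrA mulrC [RHS]mulrAC e2 mulrC mulrA.
Qed.

Lemma isst_pastz x m : m < 0 -> isst (pastz x) m <-> isst x m.
Proof. by move=> m0; rewrite /isst /pastz !ifT//; lia. Qed.

Let mblk L : measurable [set x | blk L x].
Proof. by meas. Qed.

Let io : {ae mu, forall x, io_starts x}.
Proof. exact: (ae_io_starts). Qed.

Lemma blk_inj x L L' : blk L x -> blk L' x -> L = L'.
Proof.
move=> b b'; have h (M : nat) : blk M x -> inblk x 1 0 M.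
  by move=> bM; split; [rewrite zshiftk0|case: bM => M0 _ _ _; lia].
by have [] := inblk_inj (h _ b) (h _ b').
Qed.

Lemma blk_ex x : io_starts x -> isst x 0 -> exists L, blk L x.
Proof.
move=> ios st0; have [s [L ib]] := inblk_ex 1 ios.
have [b s1] := ib; have /inblkP[_ _ _ h] := ib.
suff s0 : s = 0 by exists L; move: b; rewrite s0 zshiftk0.
have [s0|s0|//] := ltgtP s 0.
  by exfalso; apply: (h 0) => //; lia.
by exfalso; lia.
Qed.

(** Law of the block length given a start at 0 (the Palm law). Its distribution function [clen]
    counts the lengths strictly below the argument. *)
Definition qlen (L : nat) : R := pr [set x | blk L x] / pst.

Lemma qlen_ge0 L : 0 <= qlen L.
Proof. by rewrite divr_ge0// fine_ge0. Qed.

Lemma qlenE L : pr [set x | blk L x] = pst * qlen L.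
Proof. by rewrite mulrC divfK// lt0r_neq0// pst_gt0. Qed.

Definition clen (L : nat) : R := \sum_(l < L) qlen l.

Definition longer (j : nat) x := isst x 0 /\ forall m : int, 0 < m <= j%:Z -> ~ isst x m.

Let mlonger j : measurable [set x | longer j x].
Proof. by meas. Qed.

Lemma clenS L : clen L.+1 = clen L + qlen L.
Proof. by rewrite /clen big_ord_recr. Qed.

Lemma pr_longer j : pr [set x | longer j x] = pst * (1 - clen j.+1).
Proof.
elim: j => [|j ih].
  rewrite /clen big_ord_recl big_ord0 addr0.
  have -> : qlen 0 = 0.
    rewrite /qlen (_ : [set _ | _] = set0) ?measure0 ?mul0r//.
    by seteq=> x // [].
  rewrite subr0 mulr1; congr (pr _); seteq=> x; first by case.
  by move=> st0; split=> // m; lia.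
have e : [set x : ZT | longer j x] = [set x : ZT | longer j.+1 x] `|` [set x : ZT | blk j.+1 x].
  seteq=> x /=.
    move=> [st0 h]; have [stj|nst] := pselect (isst x j.+1).
      by right; split=> // m hm; apply: h; lia.
    left; split=> // m hm; have [->//|mj] := eqVneq m j.+1.
    by apply: h; lia.
  move=> [[st0 h]|[_ st0 _ h]]; split=> // m hm; apply: h; lia.
have := ih; rewrite e measureU//; last first.
  by seteq=> x // -[[_ h] [_ _ st _]]; apply: (h j.+1) => //; lia.
rewrite fineD ?fin_num_measure// qlenE => /eqP.
rewrite -subr_eq0 => /eqP E; apply/eqP; rewrite -subr_eq0; apply/eqP.
by rewrite -[RHS]E (clenS j.+1); ring.
Qed.

(** Kac's argument: the events that the last start up to time 0 is at [-j] are disjoint, and each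
    has the probability of [longer j]. The mean block length is therefore at most the inverse of
    [pst]. *)
Lemma clen_tail_sum J : \sum_(j < J) (1 - clen j.+1) <= pst^-1.
Proof.
pose E (j : nat) := zshiftk (- j%:Z) @^-1` [set x : ZT | longer j x].
have mE j : measurable (E j) by apply: meas_preim => //; meas.
have EE j : pr (E j) = pst * (1 - clen j.+1) by rewrite -pr_longer /E (statk (- j%:Z) (mlonger j)).
have tE : trivIset `I_J E.
  move=> i j _ _ [x [[/= sti hi] [stj hj]]].
  have [lt|lt|//] := ltngtP i j.
    exfalso; apply: (hj (j%:Z - i%:Z)); first lia.
    by move: sti; rewrite !isst_shiftk add0r addrAC subrr add0r.
  exfalso; apply: (hi (i%:Z - j%:Z)); first lia.
  by move: stj; rewrite !isst_shiftk add0r addrAC subrr add0r.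
have mU : measurable (\big[setU/set0]_(j < J) E j) by apply: bigsetU_measurable.
have : (\sum_(j < J) mu (E j) <= 1)%E.
  rewrite (_ : (\sum_(j < J) mu (E j))%E = mu (\big[setU/set0]_(j < J) E j)).
    exact: probability_le1.
  exact: esym (@measure_semi_additive_ord_I _ _ _ mu E J (fun k _ => mE k) tE mU).
under eq_bigr => j _ do rewrite (prE (mE j)) EE.
by rewrite sumEFin lee_fin -mulr_sumr mulrC -ler_pdivlMr// div1r.
Qed.

Lemma clen_le1 j : clen j <= 1.
Proof.
case: j => [|j]; first by rewrite /clen big_ord0 ler01.
have : 0 <= pr [set x | longer j x] by rewrite fine_ge0.
by rewrite pr_longer pmulr_rge0 ?pst_gt0// subr_ge0.
Qed.

Lemma clen_nd : {homo clen : i j / (i <= j)%N >-> i <= j}.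
Proof.
apply: homo_leq => //; first exact: le_trans.
by move=> j; rewrite clenS lerDl qlen_ge0.
Qed.

Lemma clen_ge0 j : 0 <= clen j.
Proof. by apply: sumr_ge0 => l _; exact: qlen_ge0. Qed.

(** If [clen] never exceeded [u], the tail sums would grow linearly, against the bound on the mean
    length. *)
Lemma clen_gt u : u < 1 -> exists L, u < clen L.
Proof.
move=> u1; apply: contrapT => h.
have le L : clen L <= u by rewrite leNgt; apply/negP => lt; apply: h; exists L.
pose J := (Num.trunc ((1 - u)^-1 * pst^-1)).+1.
have := clen_tail_sum J; rewrite leNgt => /negP; apply.
apply: (@lt_le_trans _ _ (\sum_(j < J) (1 - u))); last first.
  by apply: ler_sum => j _; rewrite lerD2l lerN2.
rewrite sumr_const card_ord -mulr_natr -ltr_pdivrMl ?subr_gt0//.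
exact: truncnS_gt.
Qed.

Definition Ilen (L : nat) : set RR := `[clen L, clen L.+1[%classic.

Lemma meas_Ilen L : measurable (Ilen L).
Proof. exact: measurable_itv. Qed.
#[local] Hint Resolve meas_Ilen : meas.

Lemma nu01_Ilen L : nu01 (Ilen L) = (qlen L)%:E.
Proof.
rewrite uniform01E; last exact: meas_Ilen.
rewrite (_ : _ `&` _ = Ilen L).
  rewrite lebesgue_measure_itv/= lte_fin clenS; rewrite ltrDl.
  have := qlen_ge0 L; rewrite le_eqVlt => /orP[/eqP <-|q0]; first by rewrite ltxx.
  by rewrite q0 -EFinB addrAC subrr add0r.
apply: setIidl => u; rewrite /Ilen /= !in_itv/= => /andP[h1 h2].
by rewrite (le_trans (clen_ge0 _) h1) ltW// (lt_le_trans h2 (clen_le1 _)).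
Qed.

Lemma Ilen_ex (u : R) : 0 <= u < 1 -> exists L, Ilen L u.
Proof.
move=> /andP[u0 u1]; have exL : exists L, u < clen L by exact: clen_gt.
have [[|L] hL minL] := ex_minnP exL.
  by move: hL; rewrite /clen big_ord0 ltNge u0.
exists L; rewrite /Ilen /= in_itv/= hL andbT leNgt; apply/negP => /minL.
by rewrite ltnn.
Qed.

Lemma Ilen_inj (u : R) L L' : Ilen L u -> Ilen L' u -> L = L'.
Proof.
rewrite /Ilen /= !in_itv/= => /andP[h1 h2] /andP[h3 h4].
have [lt|lt|//] := ltngtP L L'.
  by have := le_lt_trans h3 h2; rewrite ltNge clen_nd.
by have := le_lt_trans h1 h4; rewrite ltNge clen_nd.
Qed.

Variables (i0 : T -> zseq bool) (j0 : zseq bool -> T).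
Hypotheses (mi0 : mfunT i0) (mj0 : mfunT j0) (ij0 : cancel i0 j0).
Hypothesis na : forall t, t <> star -> mu.-negligible [set x : ZT | x 0 = t].

(** Given the length, the law of the block and that of the conditioned uniform vector are both
    non-atomic and live on retracts of the line, hence they are isomorphic. The total masses agree
    because [Ilen L] has length [qlen L]. *)
Lemma block_code_ex L : exists (th : ZT -> zseq RR) (th' : zseq RR -> ZT)
    (M : probability (zseq RR) R), [/\ mfunT th,
    mfunT th',
    (forall B : int -> set RR, (forall m, measurable (B m)) ->
     M [set y | forall m, 1 <= m <= L%:Z -> B m (y m)] =
       (\prod_(1 <= k < L.+1) fine (nu01 (B k%:Z)))%:E) /\ M [set y | zmask 0 L y = y] = 1%E,
    (forall C, measurable C -> (0 < L)%N ->
      pr [set x | blk L x /\ C (th (zmask star L x))] =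
      pst * fine (M [set y | Ilen L (y 1) /\ C y])) &
    {ae mu, forall x, blk L x -> th' (th (zmask star L x)) = zmask star L x}].
Proof.
have [M [MB M1]] := ex_finite_product (R := R) L.
(* A length of probability zero: almost surely no block has to be coded, and [Ilen L] is empty, so
   any maps will do. *)
have [q0|q0] := leP (qlen L) 0.
  have b0 : pr [set x | blk L x] = 0 by rewrite qlenE (le_anti (introT andP (conj q0 (qlen_ge0 L)))) mulr0.
  have mub : mu [set x | blk L x] = 0%E by rewrite prE// b0.
  exists (cst point), (cst point), M; split=> //.
  - move=> C mC L0.
    have -> : fine (M [set y | Ilen L (y 1) /\ C y]) = 0.
      suff -> : [set y : zseq RR | Ilen L (y 1) /\ C y] = set0 by rewrite measure0.
      seteq=> // y [] /=; rewrite /Ilen/= in_itv/= clenS => /andP[h1 h2] _.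
      by have := le_lt_trans h1 h2; rewrite ltNge gerDl q0.
    rewrite mulr0 (_ : mu _ = 0%E)//; apply: subset_measure0 mub => //.
      by meas.
    by move=> x [].
  - exists [set x | blk L x]; split=> // x /= h; apply: contrapT => nb; apply: h => b; exfalso; exact: nb.
have b0 : (0 < mu [set x | blk L x])%E by rewrite prE// lte_fin qlenE mulr_gt0// pst_gt0.
have [be beE] := ex_conditional_law (mblk L) (meas_zmask star L) b0.
have mI : measurable [set y : zseq RR | Ilen L (y 1)].
  exact: (meas_preim (meas_at 1) (meas_Ilen L)).
have L0 : (0 < L)%N.
  by case: L q0 {M MB M1 b0 be beE mI} => // ; rewrite /qlen (_ : [set _ | _] = set0) ?measure0 ?mul0r ?ltxx//;
    seteq=> x // [].
have MU U : measurable U -> M [set y | U (y 1)] = nu01 U.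
  move=> mU; pose B (m : int) : set RR := if m == 1 then U else setT.
  have mB m : measurable (B m) by rewrite /B; case: ifP.
  have := MB B mB; rewrite (_ : [set y | _] = [set y : zseq RR | U (y 1)]).
    rewrite big_ltn// big_nat_cond big1 ?mulr1; first by rewrite /B eqxx fineK ?fin_num_measure.
    by move=> k; rewrite andbT => /andP[k1 _]; rewrite /B gt_eqF ?probability_setT//; lia.
  seteq=> y /=; first by move=> /(_ 1); rewrite /B eqxx; apply; lia.
  by move=> y1 m hm; rewrite /B; case: eqP => // ->.
have MI : M [set y | Ilen L (y 1)] = (qlen L)%:E.
  by rewrite (MU (Ilen L)) ?nu01_Ilen//; exact: meas_Ilen.
have MI0 : (0 < M [set y : zseq RR | Ilen L (y 1%R)])%E by rewrite MI lte_fin.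
have [nuL nuLE] := ex_conditional_law mI (@measurable_id _ _ setT) MI0.
have r1 : ae_retract RR be.
  have [f [g [mf mg fg]]] := meas_retract_trans (@meas_retract_zseq2 _ bool) (@meas_bits_retract R).
  exists (fun x => f (fun m => i0 (x m))), (fun u m => j0 (g u m)); split.
  - have h : mfunT (fun x => (fun m => i0 (x m)) : zseq (zseq bool)).
      by apply: meas_zseq => m; exact: (measurableT_comp mi0 (meas_at m)).
    exact: (measurableT_comp mf h).
  - by apply: meas_zseq => m; exact: (measurableT_comp mj0 (measurableT_comp (meas_at m) mg)).
  - by apply: aeW => x; apply/funext => m; rewrite fg ij0.
have r2 : ae_retract RR nuL.
  have [f [g [mf mg fg]]] := meas_retract_trans (meas_retract_zseq (@meas_retract_bits R))
    (meas_retract_trans (@meas_retract_zseq2 _ bool) (@meas_bits_retract R)).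
  by exists f, g; split=> //; apply: aeW => y; exact: fg.
(* The coordinate 1 settles it: in a block it is never [star], and its other values are not
   atoms. *)
have na1 y : be.-negligible [set y].
  have my := meas_preim (meas_at 1) (mset1 (y 1)).
  exists [set z | z 1 = y 1]; split=> //; last by move=> z ->.
  rewrite beE// (_ : mu _ = 0%E) ?mul0e//; have [y1|y1] := pselect (y 1 = star).
    rewrite (_ : _ `&` _ = set0) ?measure0//; seteq=> // x [/= [_ [_]]].
    by rewrite add0r /zmask y1; case: ifP => //; lia.
  have n1 : mu [set x | x 1 = y 1] = 0%E.
    have m0 := meas_preim (meas_at 0) (mset1 (y 1)).
    rewrite -(negligible_null m0 (na y1)) -[RHS](statk 1 m0); by congr (mu _); set_eq.
  apply: subset_measure0 n1 => //; first by meas.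
  by move=> x [_] /=; rewrite /zmask; case: ifP => //; lia.
have na2 (y : zseq RR) : nuL.-negligible [set y].
  have my : measurable [set z : zseq RR | z 1 = y 1].
    exact: (meas_preim (meas_at 1) (meas_set1R _)).
  exists [set z | z 1 = y 1]; split=> //; last by move=> z ->.
  rewrite nuLE// (_ : M _ = 0%E) ?mul0e//.
  have M0 : M [set z | z 1 = y 1] = 0%E.
    rewrite (MU [set y 1]); last exact: meas_set1R.
    by apply/eqP; rewrite -[nu01 _]fineK ?fin_num_measure// nu01_set1.
  by apply: subset_measure0 M0 => //; meas.
have [th [th' [mth mth' thE thK]]] := nonatomic_iso r1 r2 na1 na2.
exists th, th', M; split=> //.
- move=> C mC _.
  have mthC := meas_preim mth mC.
  have mzC := meas_preim (meas_zmask star L) mthC.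
  have := thE C mC; rewrite beE// nuLE// MI qlenE.
  rewrite (_ : [set x | blk L x] `&` _ = [set x : ZT | blk L x /\ C (th (zmask star L x))])//.
  rewrite (_ : [set y | Ilen L (y 1)] `&` _ = [set y : zseq RR | Ilen L (y 1) /\ C y])//.
  have m1 : measurable [set x | blk L x /\ C (th (zmask star L x))] by meas.
  have m2 : measurable [set y : zseq RR | Ilen L (y 1) /\ C y] by meas.
  rewrite (prE m1) -[M _]fineK ?fin_num_measure// -!EFinM => -[] /=.
  move=> /(congr1 (fun z => z * (pst * qlen L))).
  have q1 : qlen L != 0 by rewrite lt0r_neq0.
  have pq : pst * qlen L != 0 by rewrite mulf_neq0// lt0r_neq0.
  by rewrite (divfK pq) => ->; rewrite mulrCA (divfK q1).
- have [N [mN N0 sN]] := thK.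
  have mNb : measurable ([set x : ZT | blk L x] `&` zmask star L @^-1` N) by meas.
  exists ([set x : ZT | blk L x] `&` zmask star L @^-1` N); split=> //.
    move: N0; rewrite beE// => /eqP; rewrite mule_eq0 => /orP[/eqP //|].
    rewrite eqe invr_eq0 qlenE mulf_eq0 !gt_eqF//; exact: pst_gt0.
  move=> x /= h; have bx : blk L x by apply: contrapT => nb; apply: h => b; exfalso; exact: nb.
  by split=> //; apply: sN => /= e; apply: h.
Qed.

Hypothesis pos2 : (0 < mu [set x | x 0%R = star /\ x 1%R = star])%E.
Let nd i j : (i <= j)%N -> clen i <= clen j.
Proof. exact: clen_nd. Qed.
Let ren_pos A B : measurable A -> measurable B ->
  (0 < mu [set x | A (pastz x) /\ x 0%R = star])%E ->
  (0 < mu [set x | x 0%R = star /\ B (futz x)])%E ->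
  (0 < mu [set x | [/\ A (pastz x), x 0%R = star & B (futz x)]])%E.
Proof.
move=> mA mB pA pB; rewrite lt0e measure_ge0 andbT; apply/eqP => e.
have := ren mA mB; rewrite e mul0e => /esym/eqP; rewrite mule_eq0.
by rewrite !gt_eqF.
Qed.

(** A block of length [L] ending at 0 is prolonged by one more visit: if [x 0] and [x 1] equal
    [star] and [x 2] does not, the start at 0 is moved to 1. Renewal at 0 glues such a past to such
    a future with positive probability, and [pos2] makes that future possible. *)
Lemma qlen_gt0S L : 0 < qlen L -> 0 < qlen L.+1.
Proof.
move=> qL.
have L0 : (0 < L)%N.
  case: L qL => //; rewrite /qlen (_ : [set _ | _] = set0) ?measure0 ?mul0r ?ltxx//.
  by seteq=> x // [].
have mns n : measurable [set x : ZT | x n <> star] by meas.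
pose B1 := [set y : ZT | y 1 <> star].
pose A1 := [set y : ZT | y (-1) = star].
have h1 : (0 < mu [set x | [/\ A1 (pastz x), x 0%R = star & B1 (futz x)]])%E.
  apply: ren_pos; [exact: mz|exact: mns| |].
  - rewrite (_ : [set x : ZT | _] = zshiftk (-1) @^-1` [set x : ZT | x 0%R = star /\ x 1%R = star]).
      rewrite statk//; meas.
    by set_eq.
  - apply: lt_le_trans (_ : mu [set x | isst x 0] <= _)%E.
      by rewrite prE// lte_fin.
    by meas.
have m1 : measurable [set x | [/\ A1 (pastz x), x 0%R = star & B1 (futz x)]].
  exact: (meas_and3 (mpast (mz _)) (mz 0) (mfut (mns _))).
pose A2 := [set y : ZT | isst y (- L%:Z) /\ forall m, - L%:Z < m < 0 -> ~ isst y m].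
pose B2 := [set y : ZT | y 1 = star /\ y 2 <> star].
have mA2 : measurable A2 by meas.
have mB2 : measurable B2 by meas.
have h2 : (0 < mu [set x | [/\ A2 (pastz x), x 0%R = star & B2 (futz x)]])%E.
  apply: ren_pos => //.
  - apply: lt_le_trans (_ : mu (zshiftk (- L%:Z) @^-1` [set x : ZT | blk L x]) <= _)%E.
      by rewrite statk// prE// lte_fin qlenE mulr_gt0.
    apply: measure_le.
    + by meas.
    + by meas.
    + move=> x [_]; rewrite !isst_shiftk add0r subrr => st1 st0 h.
      split; last by case: st0.
      split; first by apply/isst_pastz => //; lia.
      move=> m hm /isst_pastz H; apply: (h (m + L%:Z)); first lia.
      by rewrite isst_shiftk addrK; apply: H; lia.
  - rewrite (_ : [set x : ZT | x 0 = star /\ _] = zshiftk 1 @^-1` [set x : ZT | [/\ A1 (pastz x), x 0%R = star & B1 (futz x)]]).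
      by rewrite (statk 1 m1).
    by seteq=> x; rewrite /A1 /B1 /B2 /pastz /futz /zshiftk /=; [move=> [? []]|case].
have : (0 < mu (zshiftk (- L%:Z) @^-1` [set x : ZT | blk L.+1 x]))%E.
  apply: lt_le_trans h2 _; apply: measure_le.
  - by meas.
  - by meas.
  - move=> x [[st1 h] x0 [x1 x2]].
    rewrite /futz /= in x1 x2.
    split=> //.
    + by rewrite isst_shiftk add0r; apply/isst_pastz => //; lia.
    + by rewrite isst_shiftk (_ : L.+1%:Z + - L%:Z = 1)//; lia.
    + move=> m hm; rewrite isst_shiftk => st.
      have [m0|m0] := ltP (m - L%:Z) 0; first by apply: (h (m - L%:Z)); [lia|apply/isst_pastz].
      move: st; rewrite (_ : m - L%:Z = 0); last lia.
      by case; rewrite add0r.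
rewrite statk// prE// lte_fin qlenE.
by rewrite pmulr_rgt0.
Qed.

Lemma qlen_eventually_gt0 : exists2 j, (0 < j)%N & forall L, (j <= L)%N -> 0 < qlen L.
Proof.
have [L hL] : exists L, 0 < clen L by exact: (clen_gt ltr01).
have [l ql] : exists l, 0 < qlen l.
  apply: contrapT => h; move: hL; rewrite /clen big1 ?ltxx// => l _.
  apply/eqP; rewrite eq_le qlen_ge0 andbT leNgt; apply/negP => ql.
  by apply: h; exists l.
exists l.+1 => // k; elim: k => // k ih; rewrite leq_eqVlt => /orP[/eqP <-|]; first exact: qlen_gt0S.
by rewrite ltnS => /ih; exact: qlen_gt0S.
Qed.

(** * The coded sequence and its law *)

Section codes.
Variables (th : nat -> ZT -> zseq RR) (M : nat -> probability (zseq RR) R).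
Hypothesis mth : forall L, mfunT (th L).
Hypothesis MB : forall L (B : int -> set RR), (forall m, measurable (B m)) ->
     M L [set y | forall m, 1 <= m <= L%:Z -> B m (y m)] =
       (\prod_(1 <= k < L.+1) fine (nu01 (B k%:Z)))%:E.
Hypothesis thE : forall L C, measurable C -> (0 < L)%N ->
      pr [set x | blk L x /\ C (th L (zmask star L x))] =
      pst * fine (M L [set y | Ilen L (y 1) /\ C y]).

Definition vcode x : zseq RR := fun n =>
  match pselect (exists p : int * nat, inblk x n p.1 p.2) with
  | left ex => th (projT1 (cid ex)).2 (zmask star (projT1 (cid ex)).2 (zshiftk (projT1 (cid ex)).1 x))
      (n - (projT1 (cid ex)).1)
  | right _ => 0
  end.

Lemma vcodeE x n s L : inblk x n s L ->
  vcode x n = th L (zmask star L (zshiftk s x)) (n - s).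
Proof.
move=> h; rewrite /vcode; case: pselect => [ex|[]]; last by exists (s, L).
by case: cid => -[s' L'] /= h'; have [-> ->] := inblk_inj h h'.
Qed.

Lemma vcode_out x n : (forall s L, ~ inblk x n s L) -> vcode x n = 0.
Proof.
by move=> h; rewrite /vcode; case: pselect => // ex; exfalso; case: (ex) => -[s L]; exact: h.
Qed.

Lemma inblk_shiftk k x n s L : inblk (zshiftk k x) n s L <-> inblk x (n + k) (s + k) L.
Proof. by rewrite /inblk zshiftkD; split=> -[? ?]; split=> //; lia. Qed.

Lemma vcode_shiftk k x n : vcode (zshiftk k x) n = vcode x (n + k).
Proof.
have [[[s L] h]|h] := pselect (exists p : int * nat, inblk (zshiftk k x) n p.1 p.2).
  rewrite (vcodeE h); move/inblk_shiftk in h; rewrite (vcodeE h) zshiftkD.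
  by congr (th _ _ _); lia.
rewrite !vcode_out// => s L hs; apply: h.
  by exists (s - k, L); apply/inblk_shiftk; rewrite subrK.
by exists (s, L).
Qed.

Lemma meas_inblk n s L : measurable [set x | inblk x n s L].
Proof.
apply: meas_and; last meas.
exact: (meas_preim (meas_zshiftk s) (mblk L)).
Qed.
#[local] Hint Resolve meas_inblk : meas.

Lemma meas_vcode n : mfunT (fun x => vcode x n).
Proof.
apply: (@meas_pieces _ _ (int * nat)%type _ _ (fun p => [set x : ZT | inblk x n p.1 p.2])
  (fun p x => th p.2 (zmask star p.2 (zshiftk p.1 x)) (n - p.1)) 0).
- by move=> p; exact: meas_inblk.
- move=> [s L] /=.
  have h := measurableT_comp (mth L) (measurableT_comp (meas_zmask star L) (meas_zshiftk s)).
  exact: (measurableT_comp (meas_at (n - s)) h).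
- by move=> [s L] x /= /vcodeE.
- by move=> x h; apply: vcode_out => s L; exact: (h (s, L)).
Qed.
#[local] Hint Resolve meas_vcode : meas.

Lemma vcode_blk L x m : blk L x -> 1 <= m <= L%:Z -> vcode x m = th L (zmask star L x) m.
Proof.
move=> b hm; have h : inblk x m 0 L by split; [rewrite zshiftk0|lia].
by rewrite (vcodeE h) zshiftk0 subr0.
Qed.

Lemma isst_futz x n : isst x 0 -> 0 <= n -> isst (futz x) n <-> isst x n.
Proof.
move=> [x0 x1] n0; rewrite /isst /futz.
have -> : (1 <= n + 1) by lia.
case: ifP => // n1; have -> : n = 0 by lia.
by split=> -[_ ?].
Qed.

Lemma inblk_ge0 x n s L : isst x 0 -> 1 <= n -> inblk x n s L -> 0 <= s.
Proof.
move=> st0 n1 /inblkP[_ _ sn h]; rewrite leNgt; apply/negP => s0.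
by apply: (h 0) => //; lia.
Qed.

Lemma inblk_futz x n s L : isst x 0 -> 1 <= n -> inblk (futz x) n s L <-> inblk x n s L.
Proof.
move=> st0 n1; have st0' : isst (futz x) 0 by apply/isst_futz.
split=> h; have s0 := inblk_ge0 _ n1 h.
  move/inblkP: h => [sts stL sn h]; apply/inblkP; split=> //.
  - by apply/isst_futz => //; exact: s0.
  - by apply/isst_futz => //; have := s0 st0'; lia.
  - by move=> m hm /(isst_futz st0) H; apply: (h m hm); apply: H; have := s0 st0'; lia.
move/inblkP: h => [sts stL sn h]; apply/inblkP; split=> //.
  - by apply/isst_futz => //; exact: s0.
  - by apply/isst_futz => //; have := s0 st0; lia.
  - by move=> m hm /(isst_futz st0) H; apply: (h m hm); apply: H; have := s0 st0; lia.
Qed.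

Lemma vcode_futz x m : isst x 0 -> 1 <= m -> vcode (futz x) m = vcode x m.
Proof.
move=> st0 m1.
have [[[s L] h]|h] := pselect (exists p : int * nat, inblk x m p.1 p.2); last first.
  rewrite !vcode_out// => s L.
    by move=> hs; apply: h; exists (s, L).
  by move=> /(inblk_futz _ _ st0 m1) hs; apply: h; exists (s, L).
have s0 := inblk_ge0 st0 m1 h.
rewrite (vcodeE h) (vcodeE (proj2 (inblk_futz _ _ st0 m1) h)).
congr (th _ _ _); apply/funext => k; rewrite /zmask /zshiftk /futz.
case: ifP => // hk; case: ifP => //; lia.
Qed.

Lemma prod_cyl L N (B : int -> set RR) : (0 < L)%N -> (0 < N)%N -> (forall m, measurable (B m)) ->
  fine (M L [set y | Ilen L (y 1) /\ forall m, 1 <= m <= (minn L N)%:Z -> B m (y m)]) =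
  fine (nu01 (Ilen L `&` B 1)) * \prod_(2 <= k < (minn L N).+1) fine (nu01 (B k%:Z)).
Proof.
move=> L0 N0 mB.
pose B' m := if m == 1 then Ilen L `&` B 1 else if m <= N%:Z then B m else setT.
have mB' m : measurable (B' m).
  rewrite /B'; case: ifP => _; last by case: ifP.
  by meas.
have := MB L mB'; rewrite (_ : [set y | _] =
    [set y : zseq RR | Ilen L (y 1) /\ forall m, 1 <= m <= (minn L N)%:Z -> B m (y m)]); last first.
  seteq=> y /=.
    move=> h; split.
      by have := h 1; rewrite /B' eqxx => h1; have [] : (Ilen L `&` B 1) (y 1) by apply: h1; lia.
    move=> m hm; have := h m; rewrite /B'; case: eqP => [->|_].
      by move=> h1; have [] : (Ilen L `&` B 1) (y 1) by apply: h1; lia.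
    by case: ifP => [_|]; [apply; lia|lia].
  move=> [yI h] m hm; rewrite /B'; case: eqP => [->|_]; first by split=> //; apply: h; lia.
  by case: ifP => // mN; apply: h; lia.
move=> ->; rewrite [LHS]/= big_ltn// {1}/B' eqxx; congr (_ * _).
have lN : (minn L N < L.+1)%N by lia.
rewrite (big_cat_nat (n := (minn L N).+1))//=; last by lia.
rewrite [X in _ * X]big_nat_cond [X in _ * X]big1 ?mulr1.
  apply: eq_big_nat => k hk; rewrite /B'; case: eqP; first lia.
  by case: ifP => //; lia.
move=> k; rewrite andbT => hk; rewrite /B'; case: eqP; first lia.
by case: ifP; [lia|rewrite probability_setT].
Qed.

(** Induction on the number of symbols, according to the length [L] of the first block. If [L] is at
    least the number of symbols, the block code gives everything; otherwise renewal at time [L]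
    splits off the first [L] symbols. Summing over [L] reassembles the constraint on the first
    symbol, since the intervals [Ilen L] partition [0, 1[. *)
Lemma vcode_future N (B : int -> set RR) : (forall m, measurable (B m)) ->
  pr [set x | isst x 0 /\ forall m, 1 <= m <= N%:Z -> B m (vcode x m)] =
  pst * \prod_(1 <= k < N.+1) fine (nu01 (B k%:Z)).
Proof.
have [n] := ubnP N; elim: n N B => // n ih N B Nn mB.
case: N Nn => [_|N Nn].
  rewrite big_geq// mulr1; congr (pr _); seteq=> x; first by case.
  by move=> st0; split=> // m; lia.
set N1 := N.+1 in Nn *.
have mE b (B' : int -> set RR) N' : (forall m, measurable (B' m)) ->
    measurable [set x | forall m, b + 1 <= m <= N' -> B' m (vcode x m)].
  move=> mB'; apply: meas_all => m; apply: meas_imp => _.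
  exact: (meas_preim (meas_vcode m) (mB' m)).
pose F L := [set x : ZT | blk L x /\ forall m, 1 <= m <= N1%:Z -> B m (vcode x m)].
have mF L : measurable (F L) by apply: meas_and => //; exact: (mE 0).
rewrite (@ae_sum_measure _ _ _ mu _ F) //; last first.
- apply: filterS io => x ios; split=> [[st0 h]|[L [bL h]]].
    by have [L bL] := blk_ex ios st0; exists L; split.
  by split=> //; case: bL.
- by move=> i j _ _ [x [[/= bi _] [bj _]]]; exact: blk_inj bi bj.
- by apply: meas_and => //; exact: (mE 0).
(* The first symbol is kept apart, because it also has to lie in the interval that announces the
   length. *)
pose c := \prod_(2 <= k < N1.+1) fine (nu01 (B k%:Z)).
have c0 : 0 <= c by apply: prodr_ge0 => k _; rewrite fine_ge0.
have key L : mu (F L) = ((pst * c)%:E * nu01 (Ilen L `&` B 1%R))%E.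
  have mI : measurable (Ilen L `&` B 1) by meas.
  rewrite -[nu01 _]fineK ?fin_num_measure// -EFinM prE//; congr EFin.
  have [L0|L0] := posnP L.
    rewrite L0 (_ : F 0%N = set0); last by seteq=> // x [[]].
    rewrite measure0 (_ : Ilen 0 `&` B 1 = set0) ?measure0 ?mulr0//.
    seteq=> // u [] /=; rewrite /Ilen /= in_itv/= /clen big_ord0 big_ord1.
    rewrite /qlen (_ : [set x | _] = set0); last by seteq=> // x [].
    by rewrite measure0 mul0r => /andP[h1 h2]; lra.
  pose C := [set y : zseq RR | forall m, 1 <= m <= (minn L N1)%:Z -> B m (y m)].
  have mC : measurable C by meas.
  have e1 := thE mC L0.
  rewrite prod_cyl// in e1.
  have CE x : blk L x -> C (th L (zmask star L x)) <-> forall m, 1 <= m <= (minn L N1)%:Z -> B m (vcode x m).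
    by move=> b; split=> h m hm; have := h m hm; rewrite (vcode_blk b)//; lia.
  have [NL|LN] := leqP N1 L.
    rewrite (minn_idPr NL) in e1 CE; rewrite /c mulrAC -mulrA -e1; congr (pr _).
    by seteq=> x [b /(CE _ b)].
  rewrite (minn_idPl (ltnW LN)) in e1 CE.
  (* Seen from time [L], the first block is an event of the past and the remaining symbols are an
     event of the future. *)
  pose A := [set y : ZT | (isst y (- L%:Z) /\ forall m, - L%:Z < m < 0 -> ~ isst y m) /\
     C (th L (zmask star L (zshiftk (- L%:Z) y)))].
  have mA : measurable A.
    apply: meas_and; first apply: meas_and => //.
      by meas.
    have h := measurableT_comp (mth L) (measurableT_comp (meas_zmask star L) (meas_zshiftk (- L%:Z))).
    exact: (meas_preim h mC).
  pose B2 m := B (m + L%:Z).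
  have mB2 m : measurable (B2 m) by exact: mB.
  pose D := [set y : ZT | forall m, 1 <= m <= (N1 - L)%:Z -> B2 m (vcode y m)].
  have mD : measurable D by exact: (mE 0).
  have AE x : A (pastz x) /\ isst x 0 <-> blk L (zshiftk (- L%:Z) x) /\ C (th L (zmask star L (zshiftk (- L%:Z) x))).
    have -> : zmask star L (zshiftk (- L%:Z) x) = zmask star L (zshiftk (- L%:Z) (pastz x)).
      apply/funext => m; rewrite /zmask; case: ifP => // hm; rewrite /zshiftk /pastz ifT//; lia.
    split.
      move=> [[[st1 h] hC] st0]; split=> //; split=> //.
      - by rewrite isst_shiftk add0r; apply/isst_pastz => //; lia.
      - by rewrite isst_shiftk subrr.
      - by move=> m hm; rewrite isst_shiftk => /isst_pastz H; apply: (h (m - L%:Z)); [lia|apply: H; lia].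
    move=> [[_ st0 stL h] hC]; move: st0 stL; rewrite !isst_shiftk add0r subrr => st0 stL.
    split=> //; split=> //; split; first by apply/isst_pastz => //; lia.
    move=> m hm /isst_pastz H; apply: (h (m + L%:Z)); first lia.
    by rewrite isst_shiftk addrK; apply: H; lia.
  have FE : F L = zshiftk L%:Z @^-1` [set x : ZT | [/\ A (pastz x), isst x 0 & D (futz x)]].
    have zz x : zshiftk (- L%:Z) (zshiftk L%:Z x) = x by rewrite zshiftkD addNr zshiftk0.
    seteq=> x.
      move=> [b h]; have st0 : isst (zshiftk L%:Z x) 0 by rewrite isst_shiftk add0r; case: b.
      have [] := proj2 (AE (zshiftk L%:Z x)).
        rewrite zz; split=> //; apply/(CE _ b) => m hm; apply: h; lia.
      move=> Ap _; split=> // m hm; rewrite vcode_futz//; last lia.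
      by rewrite vcode_shiftk; apply: h; lia.
    move=> [/= Ap st0 Df]; have [] := proj1 (AE (zshiftk L%:Z x)) (conj Ap st0).
    rewrite zz => b hC; split=> // m hm; have [mL|mL] := leP m L%:Z.
      by move/(CE _ b): hC; apply; lia.
    have := Df (m - L%:Z); rewrite vcode_futz//; last lia.
    by rewrite vcode_shiftk /B2 subrK; apply; lia.
  have m3 : measurable [set x | [/\ A (pastz x), isst x 0 & D (futz x)]] by meas.
  rewrite FE (statk _ m3).
  have := start_renewal mA mD.
  have -> : pr [set x | isst x 0 /\ D (futz x)] = pst * \prod_(1 <= k < (N1 - L).+1) fine (nu01 (B2 k%:Z)).
    rewrite -ih//; last by lia.
    congr (pr _); seteq=> x [st0 h]; split=> // m hm.
      by have := h m hm; rewrite vcode_futz//; lia.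
    by rewrite vcode_futz//; [exact: h|lia].
  have -> : pr [set x | A (pastz x) /\ isst x 0] = pst * (fine (nu01 (Ilen L `&` B 1)) * \prod_(2 <= k < L.+1) fine (nu01 (B k%:Z))).
    rewrite -e1 -[in RHS](statk (- L%:Z)).
      by congr (pr _); seteq=> x /AE.
    apply: meas_and => //; apply: meas_preim => //.
    exact: (measurableT_comp (mth L) (meas_zmask star L)).
  have cE : c = \prod_(2 <= k < L.+1) fine (nu01 (B k%:Z)) * \prod_(1 <= k < (N1 - L).+1) fine (nu01 (B2 k%:Z)).
    rewrite /c (big_cat_nat (n := L.+1) (m := 2) (p := N1.+1))//=; try lia; congr (_ * _).
    rewrite -{1}[L.+1]add1n big_addn; rewrite (_ : (N1.+1 - L = (N1 - L).+1)%N); last lia.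
    by apply: eq_bigr => k _; rewrite /B2 PoszD.
  move=> e; apply: (mulIf (lt0r_neq0 p0)); rewrite e cE; ring.
rewrite (eq_eseriesr (fun L _ => key L)) nneseriesZl//.
have mIB L : measurable (Ilen L `&` B 1%R) by meas.
have tIB : trivIset setT (fun L => Ilen L `&` B 1%R).
  by move=> i j _ _ [u [[/= ui _] [uj _]]]; exact: Ilen_inj ui uj.
rewrite -(measure_semi_bigcup nu01 mIB tIB); last exact: bigcupT_measurable.
rewrite [X in ((pst * c)%:E * X)%E](_ : _ = nu01 (B 1%R)); last first.
  apply: ae_measure_eq => //.
    exact: bigcupT_measurable.
  have h01 : {ae nu01 (R := R), forall u, (`]0, 1[%classic : set RR) u}.
    by apply: ae_probability1; [exact: measurable_itv|exact: uniform01_open].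
  move: h01 => [Z [mZ Z0 sZ]]; exists Z; split=> // u nu; apply: sZ => h; apply: nu; move: h.
  rewrite /= in_itv/= => /andP[u0 u1].
  split=> [[L _ []]//|Bu].
  have [|L hL] := @Ilen_ex u.
  by rewrite ltW.
  by exists L.
rewrite -[nu01 _]fineK ?fin_num_measure// -EFinM /= -mulrA; congr (_ * _).
by rewrite mulrC [RHS]big_ltn.
Qed.

Lemma ae_code L (C : set (zseq RR)) : measurable C -> M L [set y | Ilen L (y 1) /\ ~ C y] = 0%E ->
  {ae mu, forall x, blk L x -> C (th L (zmask star L x))}.
Proof.
move=> mC C0; have [L0|L0] := posnP L; first by apply: aeW => x; rewrite L0 => -[].
have mt := measurableT_comp (mth L) (meas_zmask star L).
have mS := meas_and (mblk L) (meas_not (meas_preim mt mC)).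
exists [set x | blk L x /\ ~ C (th L (zmask star L x))]; split=> //.
  by apply: (etrans (prE mS)); rewrite (thE (measurableC mC) L0) C0 mulr0.
by move=> x /= h; apply: contrapT => n; apply: h => b; apply: contrapT => nC; apply: n.
Qed.

(** By [thE] the code of a block of length [L] follows a law carried by the vectors with first
    coordinate in [Ilen L]. The first symbol of a block thus tells its length. *)
Lemma vcode_len : {ae mu, forall x, forall s L, blk L (zshiftk s x) -> Ilen L (vcode x (s + 1))}.
Proof.
have h0 : {ae mu, forall x, forall L, blk L x -> Ilen L (th L (zmask star L x) 1)}.
  apply: ae_countable => L; apply: (ae_code (meas_preim (meas_at 1) (meas_Ilen L))).
  by rewrite (_ : [set y | _] = set0) ?measure0//; seteq=> y // [].
apply: filterS (ae_countable (fun s => ae_shiftk s h0)) => x h s L b.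
have hb : inblk x (s + 1) s L by split=> //; case: b => L0 _ _ _; lia.
by rewrite (vcodeE hb) addrAC subrr add0r; exact: h.
Qed.

(** From the law seen at a start to the stationary law: decompose by the last start up to time 0, at
    [-j]. That its block is longer than [j] is read off its first symbol, which must be at least
    [clen j.+1]. For [j > 0] this symbol is not among those under test, so the probability factors,
    and the weights of the starts sum to 1. *)
Lemma vcode_iid (a : int) N (B : int -> set RR) : (forall m, measurable (B m)) ->
  pr [set x | forall m, 1 <= m <= N%:Z -> B m (vcode x (a + m))] =
  \prod_(1 <= k < N.+1) fine (nu01 (B k%:Z)).
Proof.
move=> mB.
have mE b c N' (B' : int -> set RR) : (forall m, measurable (B' m)) ->
    measurable [set x | forall m, b <= m <= N' -> B' m (vcode x (c + m))].
  move=> mB'; apply: meas_all => m; apply: meas_imp => _.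
  exact: (meas_preim (meas_vcode _) (mB' m)).
have -> : pr [set x | forall m, 1 <= m <= N%:Z -> B m (vcode x (a + m))] =
    pr [set x | forall m, 1 <= m <= N%:Z -> B m (vcode x (0 + m))].
  rewrite -(statk a (mE 1 0 N%:Z B mB)); congr (pr _).
  by seteq=> x /= h m hm; have := h m hm; rewrite vcode_shiftk add0r addrC.
set c := \prod_(1 <= k < N.+1) _.
have c0 : 0 <= c by apply: prodr_ge0 => k _; rewrite fine_ge0.
pose lg j := [set x : ZT | longer j x].
have mlg j : measurable (lg j) by meas.
pose H j := [set x : ZT | lg j x /\ forall m, 1 <= m <= N%:Z -> B m (vcode x (j%:Z + m))].
have mH j : measurable (H j) by meas.
pose F j := zshiftk (- j%:Z) @^-1` H j.
pose F1 j := zshiftk (- j%:Z) @^-1` lg j.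
have mF j : measurable (F j) by apply: meas_preim => //; meas.
have mF1 j : measurable (F1 j) by apply: meas_preim => //; meas.
have tF1 : trivIset setT F1.
  move=> i j _ _ [x [[/= sti hi] [stj hj]]].
  have [lt|lt|//] := ltngtP i j.
    exfalso; apply: (hj (j%:Z - i%:Z)); first lia.
    by move: sti; rewrite !isst_shiftk add0r addrAC subrr add0r.
  exfalso; apply: (hi (i%:Z - j%:Z)); first lia.
  by move: stj; rewrite !isst_shiftk add0r addrAC subrr add0r.
have FF1 j : F j `<=` F1 j by move=> x [].
have exF1 : {ae mu, forall x, exists j, F1 j x}.
  apply: filterS io => x ios.
  have [s [L /inblkP[sts stL hs h]]] := inblk_ex 1 ios.
  exists (absz s); split; first by rewrite isst_shiftk add0r (_ : - _ = s)//; lia.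
  by move=> m hm; rewrite isst_shiftk; apply: h; lia.
have muH j : mu (F j) = (c%:E * mu (F1 j))%E.
  rewrite (statk _ (mH j)) (statk _ (mlg j)).
  rewrite (prE (mH j)) (prE (mlg j)) -EFinM; congr EFin.
  (* For [j = 0] the first symbol of the block is itself under test, but [longer 0] only asks for a
     start. *)
  have [jz|jz] := posnP j.
    rewrite (_ : H j = [set x : ZT | isst x 0 /\ forall m, 1 <= m <= N%:Z -> B m (vcode x m)]).
      rewrite vcode_future// jz (_ : lg 0%N = [set x : ZT | isst x 0]) 1?mulrC//.
      by seteq=> x; [case|move=> st0; split=> // m; lia].
    rewrite jz; seteq=> x.
      by move=> [[st0 _] h]; split=> // m hm; have := h m hm; rewrite add0r.
    by move=> [st0 h]; split; [split=> // m; lia|move=> m hm; rewrite add0r; exact: h].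
  pose B1 : set RR := [set u | clen j.+1 <= u].
  pose B' m := if m == 1 then B1 else if m <= j%:Z then setT else B (m - j%:Z).
  have mB1 : measurable B1.
    rewrite (_ : B1 = `[clen j.+1, +oo[%classic); first meas.
    by seteq=> u; rewrite /= in_itv/= andbT.
  have nuB1 : fine (nu01 B1) = 1 - clen j.+1.
    rewrite -[B1]setCK probability_setC; last exact: measurableC.
    rewrite (_ : ~` B1 = [set u | u < clen j.+1]) ?nu01_lt ?clen_ge0 ?clen_le1//.
    by seteq=> u /=; rewrite ltNge => /negP.
  have mB' m : measurable (B' m) by rewrite /B'; case: ifP => // _; case: ifP.
  have := vcode_future (j + N)%N mB'.
  have -> : \prod_(1 <= k < (j + N).+1) fine (nu01 (B' k%:Z)) = (1 - clen j.+1) * c.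
    rewrite big_ltn; last lia.
    rewrite {1}/B' eqxx nuB1; congr (_ * _).
    rewrite (big_cat_nat (n := j.+1))//=; try lia.
    rewrite big_nat_cond big1 ?mul1r.
      rewrite -[j.+1]add1n big_addn (_ : ((j + N).+1 - j = N.+1)%N); last lia.
      apply: eq_big_nat => k hk; rewrite /B' PoszD addrK.
      by case: eqP; [lia|case: ifP => //; lia].
    move=> k; rewrite andbT => hk; rewrite /B'; case: eqP; first lia.
    by case: ifP => hk2; [rewrite probability_setT|lia].
  rewrite mulrA -(pr_longer) mulrC => <-; congr fine.
  apply: ae_measure_eq => //.
    by apply: meas_and => //; have := mE 1 0 (j + N)%N%:Z B' mB'; under eq_set do under eq_forall do rewrite add0r.
  apply: filterS (aeI io vcode_len) => x [ios vl]; split.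
    move=> [[st0 hl] h]; split=> // m hm; rewrite /B'; case: eqP => [->|m1].
      have [L b] := blk_ex ios st0.
      have := vl 0 L; rewrite zshiftk0 add0r => /(_ b); rewrite /Ilen /= in_itv/= => /andP[le _].
      rewrite /B1 /=; apply: le_trans le; apply: nd.
      by have [L0 _ stL _] := b; rewrite ltnNge; apply/negP => Lj; case: (hl L%:Z) => //; lia.
    case: ifP => // mj; have := h (m - j%:Z); rewrite (_ : j%:Z + (m - j%:Z) = m); [apply; lia|lia].
  move=> [st0 h]; split; last first.
    move=> m hm; have := h (j%:Z + m); rewrite /B'; case: eqP; first lia.
    by move=> _; case: ifP; [lia|move=> _; rewrite (_ : j%:Z + m - j%:Z = m); [apply; lia|lia]].
  split=> // m hm stm; have [L b] := blk_ex ios st0.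
  have := vl 0 L; rewrite zshiftk0 add0r => /(_ b); rewrite /Ilen /= in_itv/= => /andP[_ lt].
  have := h 1; rewrite /B' eqxx => /(_ ltac:(lia)); rewrite /B1 /= leNgt => /negP; apply.
  apply: lt_le_trans lt _; apply: nd.
  have [//|Lj] := leqP L.+1 j.+1; case: b => _ _ _ hb; exfalso; apply: (hb m) => //; lia.
have muS : (\sum_(0 <= j <oo) mu (F1 j))%E = 1%E.
  rewrite -(@ae_sum_measure _ _ _ mu setT F1)//.
    exact: probability_setT.
  by apply: filterS exF1 => x [j Fj]; split=> // _; exists j.
rewrite (_ : mu _ = c%:E)// (@ae_sum_measure _ _ _ mu _ F)//.
- by rewrite (eq_eseriesr (fun j _ => muH j)) nneseriesZl// muS mule1.
- by have := mE 1 0 N%:Z B mB.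
- by move=> i j _ _ [x [Fi Fj]]; apply: tF1 => //; exists x; split; exact: FF1.
- apply: filterS exF1 => x [j Fj]; split.
    move=> h; exists j; split=> // m hm; rewrite vcode_shiftk; have := h m hm.
    by rewrite add0r addrAC subrr add0r.
  move=> [j' [_ h]] m hm; have := h m hm; rewrite vcode_shiftk.
  by rewrite add0r addrAC subrr add0r.
Qed.

(** * Decoding by synchronization *)

Variable th' : nat -> zseq RR -> ZT.
Hypothesis mth' : forall L, mfunT (th' L).
Hypothesis Mmask : forall L, M L [set y | zmask 0 L y = y] = 1%E.
Hypothesis thK : forall L, {ae mu, forall x, blk L x -> th' L (th L (zmask star L x)) = zmask star L x}.
Let mwin (lo hi : int) (B : int -> set RR) : (forall m, measurable (B m)) ->
  measurable [set x | forall m, lo <= m <= hi -> B m (vcode x m)].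
Proof. by meas. Qed.

Lemma vcode_window (K : nat) (B : int -> set RR) : (forall m, measurable (B m)) ->
  pr [set x | forall m, - K%:Z <= m <= K%:Z -> B m (vcode x m)] =
  \prod_(1 <= k < (K.*2.+1).+1) fine (nu01 (B (k%:Z - K.+1%:Z))).
Proof.
move=> mB; have := @vcode_iid (- K.+1%:Z) K.*2.+1 (fun m => B (m - K.+1%:Z)) (fun m => mB _).
move=> <-; congr (pr _); seteq=> x h m hm.
  by rewrite addrC; apply: h; lia.
have := h (m + K.+1%:Z); rewrite addrK (_ : - K.+1%:Z + (m + K.+1%:Z) = m); last lia.
by apply; lia.
Qed.

Lemma vcode_product (m : probability (zseq RR) R) :
  (forall A, measurable A -> m A = mu [set x | A (vcode x)]) -> is_product_measure nu01 m.
Proof.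
move=> mE J B uJ mB; pose K := (\max_(j <- J) absz j)%N.
have JK j : j \in J -> (absz j <= K)%N by move=> jJ; rewrite /K (big_rem _ jJ)/= leq_maxl.
pose B' j := if j \in J then B j else setT.
have mB' j : measurable (B' j) by rewrite /B'; case: ifP.
have mA : measurable [set x : zseq RR | forall i, i \in J -> B i (x i)] by meas.
rewrite mE// (_ : [set x | _] = [set x : ZT | forall m, - K%:Z <= m <= K%:Z -> B' m (vcode x m)]).
  rewrite prE; last exact: mwin.
  rewrite vcode_window//; congr EFin.
  rewrite (eq_bigr (fun k : nat => if (k%:Z - K.+1%:Z) \in J then fine (nu01 (B (k%:Z - K.+1%:Z))) else 1)); last first.
    by move=> k _; rewrite /B'; case: ifP => // _; rewrite probability_setT.
  rewrite -big_mkcond/=.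
  rewrite -(big_map (fun k : nat => k%:Z - K.+1%:Z) (mem J) (fun j => fine (nu01 (B j)))) -big_filter.
  apply: perm_big; apply: uniq_perm => //.
    apply: filter_uniq; rewrite map_inj_uniq ?iota_uniq//.
    by move=> i j; lia.
  move=> j; rewrite mem_filter; apply/andP/idP => [[]//|jJ]; split=> //.
  have jK := JK _ jJ; apply/mapP; exists (absz (j + K.+1%:Z)); last by lia.
  by rewrite mem_index_iota; lia.
seteq=> x h i.
  by move=> _; rewrite /B'; case: ifP => // /h.
by move=> iJ; have := h i; rewrite /B' iJ; apply; have := JK _ iJ; lia.
Qed.

Definition ztrunc (K : nat) (v : zseq RR) : zseq RR := fun m => if m <= - K%:Z then v m else 0.

Lemma meas_ztrunc K : mfunT (ztrunc K).
Proof. by apply: meas_zseq => m; rewrite /ztrunc; case: (_ <= _); meas. Qed.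

Let mvcode : mfunT (vcode : ZT -> zseq RR).
Proof. by meas. Qed.

(** The law of the truncated sequence conditioned on the window event is compared with the
    unconditioned law on cylinders, where both are products over disjoint sets of coordinates. *)
Lemma vcode_indep K (B : int -> set RR) A : (forall m, measurable (B m)) -> measurable A ->
  pr [set x | A (ztrunc K (vcode x)) /\ forall m, - K%:Z < m <= 0 -> B m (vcode x m)] =
  pr [set x | A (ztrunc K (vcode x))] * pr [set x | forall m, - K%:Z < m <= 0 -> B m (vcode x m)].
Proof.
move=> mB mA.
pose E := [set x : ZT | forall m, - K%:Z < m <= 0 -> B m (vcode x m)].
have mE : measurable E by meas.
have mtv := measurableT_comp (meas_ztrunc K) mvcode.
have mtA A' : measurable A' -> measurable [set x | A' (ztrunc K (vcode x))] by meas.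
have [E0|E0] := leP (mu E) 0%E.
  have e0 : mu E = 0%E by apply/eqP; rewrite eq_le E0 measure_ge0.
  rewrite -/E e0 mulr0 (_ : mu _ = 0%E)//; apply: subset_measure0 e0 => //.
    by meas.
  by move=> x [].
have [Q QE] := ex_conditional_law mE mtv E0.
have [Q' Q'E] := ex_pushforward mu mtv.
have e0 : 0 < pr E by rewrite -lte_fin -prE.
suff QQ' : Q A = Q' A.
  move: QQ'; rewrite QE// Q'E (_ : _ @^-1` A = [set x : ZT | A (ztrunc K (vcode x))])//.
  rewrite (_ : E `&` _ = [set x : ZT | A (ztrunc K (vcode x)) /\ E x]); last first.
    by set_eq.
  rewrite (prE (mtA _ mA)) (_ : mu [set x | _ /\ _] = (pr [set x | A (ztrunc K (vcode x)) /\ E x])%:E).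
    by rewrite -EFinM => -[<-]; rewrite mulfVK// lt0r_neq0.
  by rewrite -prE//; meas.
apply: (zseq_measure_unique (G := measurable)) => //.
- by rewrite sigma_algebra_id//; exact: sigma_algebra_measurable.
- by meas.
- by apply: (le_lt_trans (probability_le1 Q measurableT)); exact: ltry.
move=> N C mC; apply: (etrans (QE _ (meas_zcyl N mC))).
apply: esym; apply: (etrans (Q'E _)); apply: esym.
have mC' := meas_zcyl N mC.
(* Truncation puts 0 at the times after [-K], so a cylinder that excludes 0 there is never
   entered. *)
have [hC|hC] := pselect (forall m : int, (absz m <= N)%N -> - K%:Z < m -> C m 0); last first.
  rewrite (_ : _ @^-1` _ = set0) ?setI0 ?measure0 ?mul0e//.
  seteq=> // x h; apply: hC => m mN mK; have := h m mN.
  by rewrite /= /ztrunc leNgt mK.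
pose L := maxn N K.
pose C1 m := if (m <= - K%:Z) && (absz m <= N)%N then C m else setT.
pose C2 m := if - K%:Z < m <= 0 then B m else setT.
have mC1 m : measurable (C1 m) by rewrite /C1; case: ifP.
have mC2 m : measurable (C2 m) by rewrite /C2; case: ifP.
have S1 : (ztrunc K \o vcode) @^-1` zcyl N C = [set x : ZT | forall m, - L%:Z <= m <= L%:Z -> C1 m (vcode x m)].
  seteq=> x h m.
    by move=> _; rewrite /C1; case: ifP => // /andP[mK mN]; have := h m mN; rewrite /= /ztrunc mK.
  move=> mN; rewrite /= /ztrunc; case: leP => mK; last exact: hC.
  by have := h m; rewrite /C1 mK mN; apply; rewrite /L; lia.
have S2 : E = [set x : ZT | forall m, - L%:Z <= m <= L%:Z -> C2 m (vcode x m)].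
  seteq=> x h m.
    by move=> _; rewrite /C2; case: ifP => // /h.
  by move=> hm; have := h m; rewrite /C2 hm; apply; rewrite /L; lia.
have S3 : E `&` (ztrunc K \o vcode) @^-1` zcyl N C =
    [set x : ZT | forall m, - L%:Z <= m <= L%:Z -> (C1 m `&` C2 m) (vcode x m)].
  rewrite S1 S2; seteq=> x /=; first by move=> [h1 h2] m hm; split; [exact: h2|exact: h1].
  by move=> h; split=> m /h[].
rewrite S3 S1 (prE (mwin _ _ mC1)) (prE (mwin _ _ (fun m => measurableI _ _ (mC1 m) (mC2 m)))).
rewrite -EFinM; congr EFin; apply: (mulIf (lt0r_neq0 e0)); rewrite mulfVK ?lt0r_neq0//.
have mC12 m : measurable (C1 m `&` C2 m) by meas.
rewrite [in RHS]S2 (vcode_window L mC1) (vcode_window L mC2) (vcode_window L mC12) -big_split/=.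
apply: eq_bigr => k _; set j := _ - _; rewrite /C1 /C2.
have [j1|j1] := boolP (- K%:Z < j <= 0).
  rewrite [X in X && _](_ : _ = false); last by lia.
  by rewrite setTI probability_setT mul1r.
by rewrite setIT probability_setT mulr1.
Qed.

Definition syncset (b0 N0 j : nat) : set RR := if (j < b0)%N then setT
  else if (j <= N0)%N then Ilen j else [set u | u < clen (j.+1 - b0)].

Definition sync b0 N0 (v : zseq RR) (n : int) :=
  forall j : nat, syncset b0 N0 j (v (n - j%:Z + 1)).

Lemma meas_syncset b0 N0 j : measurable (syncset b0 N0 j).
Proof.
rewrite /syncset; case: ifP => // _; case: ifP => _; first meas.
rewrite (_ : [set u | _] = `]-oo, clen (j.+1 - b0)[%classic); first meas.
by set_eq.
Qed.

Definition decodable x := io_starts x /\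
  forall s L, blk L (zshiftk s x) -> Ilen L (vcode x (s + 1)).

(** The block owning [n - b0 + 1] started at [n - j] with [j >= b0]. It does not end at [n - b0] or
    earlier, so [j <= N0], and then it ends at [n]. *)
Lemma sync_isst b0 N0 x n : (0 < b0)%N -> decodable x -> sync b0 N0 (vcode x) n -> isst x n.
Proof.
move=> b00 [ios vl] sy.
have [s [L ib]] := inblk_ex (n - b0%:Z + 1) ios.
have [b hs] := ib; have /inblkP[_ stL _ _] := ib.
have IL := vl _ _ b.
have sn : exists2 j : nat, (b0 <= j)%N & n - j%:Z = s by exists (absz (n - s)); lia.
have [j bj js] := sn; have := sy j; rewrite js /syncset ltnNge bj /=.
case: ifP => jN.
  by move=> Ij; have e := Ilen_inj IL Ij; move: stL; rewrite e -js subrK.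
move: IL; rewrite /Ilen /= in_itv/= => /andP[le _] lt.
have [lL|Ll] := leqP (j.+1 - b0) L.
  by have := le_lt_trans (le_trans (nd lL) le) lt; rewrite ltxx.
by exfalso; lia.
Qed.

Lemma sync_shiftk b0 N0 k x n : sync b0 N0 (vcode (zshiftk k x)) n <-> sync b0 N0 (vcode x) (n + k).
Proof.
have e j : n - j%:Z + 1 + k = n + k - j%:Z + 1 by lia.
by split=> h j; have := h j; rewrite (vcode_shiftk) e.
Qed.

(** Finitely many intervals of positive length and infinitely many conditions with summable failure
    probabilities: for [K >= N0], those that concern the times in ]-K, 0] hold together with
    probability at least [c1 / 2]. The absence of synchronization up to [-K] is independent of these
    times and, by stationarity, almost surely the same event for all [K]. Together with the
    conditions on ]-K, 0] it requires a failure further back, which is as unlikely as desired; hence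
    it has probability zero. *)
Lemma sync_io b0 : (0 < b0)%N -> (forall L, (b0 <= L)%N -> 0 < qlen L) ->
  exists N0, {ae mu, forall x, forall n, exists2 m, m <= n & sync b0 N0 (vcode x) m}.
Proof.
move=> b00 q0.
pose a i := 1 - clen i.+1; pose S J := \sum_(0 <= i < J) a i.
have a0 i : 0 <= a i by rewrite subr_ge0 clen_le1.
have a01 i : 0 <= a i <= 1 by rewrite a0/= lerBlDr lerDl clen_ge0.
have Snd : {homo S : i j / (i <= j)%N >-> i <= j}.
  apply: homo_leq => //; first exact: le_trans.
  by move=> j; rewrite /S big_nat_recr//= lerDl.
have SC J : S J <= pst^-1 by rewrite /S big_mkord; exact: (clen_tail_sum).
have h20 : (0 : R) < 2^-1 by lra.
have [M1 hM1] := bounded_tail_small Snd SC h20.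
(* For [j] beyond this rank the failure probabilities [a (j - b0)] sum to at most 1/2. *)
pose N0 := (M1 + b0)%N; exists N0.
have mss := meas_syncset b0 N0.
have SD m n : (m <= n)%N -> \sum_(m <= i < n) a i = S n - S m.
  by move=> mn; rewrite /S [in RHS](big_cat_nat (n := m) (m := 0%N))//= addrAC subrr add0r.
have nuss j : (N0 < j)%N -> fine (nu01 (syncset b0 N0 j)) = 1 - a (j - b0)%N.
  move=> Nj; rewrite /syncset ifF; last by rewrite /N0 in Nj; lia.
  rewrite ifF; last by lia.
  rewrite nu01_lt ?clen_ge0 ?clen_le1// /a opprB addrC subrK.
  by congr (clen _); rewrite /N0 in Nj; lia.
pose FS (K : nat) := [set x : ZT | forall m : int, - K%:Z < m <= 0 -> syncset b0 N0 (absz (1 - m)) (vcode x m)].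
have mFS K : measurable (FS K) by meas.
have FSE K : pr (FS K) = \prod_(1 <= j < K.+1) fine (nu01 (syncset b0 N0 j)).
  rewrite big_nat_rev/=.
  have := @vcode_iid (- K%:Z) K (fun m => syncset b0 N0 (absz (K.+1%:Z - m))) (fun m => mss _).
  rewrite (_ : [set x : ZT | _] = FS K).
    move=> ->; apply: eq_big_nat => k hk; congr (fine (nu01 (syncset _ _ _))); lia.
  seteq=> x h m hm.
    have := h (m + K%:Z); rewrite (_ : - K%:Z + (m + K%:Z) = m); last lia.
    by rewrite (_ : K.+1%:Z - (m + K%:Z) = 1 - m); [apply; lia|lia].
  have := h (- K%:Z + m); rewrite (_ : 1 - (- K%:Z + m) = K.+1%:Z - m); last lia.
  by apply; lia.
pose c1 := \prod_(1 <= j < N0.+1) fine (nu01 (syncset b0 N0 j)).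
have c10 : 0 < c1.
  rewrite /c1 big_nat_cond; apply: prodr_gt0 => j /andP[/andP[_ jN] _].
  rewrite /syncset; case: ifP => jb; first by rewrite probability_setT.
  have jN' : (j <= N0)%N by lia.
  rewrite jN' (nu01_Ilen); apply: q0; lia.
have FS_ge K : (N0 <= K)%N -> c1 * 2^-1 <= pr (FS K).
  move=> NK; rewrite FSE (big_cat_nat (n := N0.+1))//= ler_pM2l//.
  rewrite (eq_big_nat _ _ (F2 := fun j => 1 - a (j - b0)%N)); last by move=> j hj; apply: nuss; lia.
  apply: le_trans (prod_ge_1sub _ _ (a := fun j => a (j - b0)%N) _) => //.
  rewrite -[N0.+1](@addKn b0) (_ : (b0 + N0.+1 - b0 = N0.+1 - b0 + b0)%N); last by rewrite /N0; lia.
  rewrite big_addn (eq_bigr a); last by move=> i _; rewrite addnK.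
  rewrite SD; last by rewrite /N0; lia.
  have h1 := hM1 (K.+1 - b0)%N.
  have h2 : S M1 <= S (N0.+1 - b0)%N by apply: Snd; rewrite /N0; lia.
  by lra.
pose TK (K i : nat) := [set x : ZT | ~ syncset b0 N0 (K.+1 + i) (vcode x (- (K + i)%:Z))].
have mTK K i : measurable (TK K i) by meas.
have TKE K i : (N0 <= K)%N -> mu (TK K i) = (a (K.+1 + i - b0)%N)%:E.
  move=> NK; rewrite prE//; congr EFin.
  have mC : measurable (~` syncset b0 N0 (K.+1 + i)) by meas.
  have := @vcode_iid (- (K + i)%:Z - 1) 1%N (fun=> ~` syncset b0 N0 (K.+1 + i)) (fun=> mC).
  rewrite big_nat1 probability_setC// fineB ?fin_num_measure// nuss; last lia.
  rewrite (_ : fine 1%E - (1 - a (K.+1 + i - b0)%N) = a (K.+1 + i - b0)%N); last by rewrite /=; ring.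
  move=> <-; congr (pr _); seteq=> x /=.
    move=> h m hm; have -> : - (K + i)%:Z - 1 + m = - (K + i)%:Z by lia.
    exact: h.
  by move=> /(_ 1 ltac:(lia)); rewrite subrK.
have TKle (e : R) : 0 < e -> exists2 K, (N0 <= K)%N & (mu (\bigcup_i TK K i) <= e%:E)%E.
  move=> e0; have [M2 hM2] := bounded_tail_small Snd SC e0.
  exists (M2 + N0)%N; first lia.
  apply: (le_trans (@measure_sigma_subadditive _ _ _ mu (\bigcup_i TK (M2 + N0)%N i) (TK (M2 + N0)%N) _ _ (@subset_refl _ _))) => //.
    exact: bigcupT_measurable.
  apply: lime_le; first exact: is_cvg_ereal_nneg_natsum.
  apply: nearW => n; rewrite (eq_bigr (fun i => (a ((M2 + N0).+1 + i - b0)%N)%:E)); last by move=> i _; apply: TKE; lia.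
  rewrite sumEFin lee_fin.
  have -> : \sum_(0 <= i < n) a ((M2 + N0).+1 + i - b0)%N = \sum_((M2 + N0).+1 - b0 <= i < (M2 + N0).+1 - b0 + n) a i.
    set c := ((M2 + N0).+1 - b0)%N; rewrite (addnC c n) -{1}[c]add0n big_addn addnK.
    by apply: eq_bigr => i _; congr a; rewrite /c /N0; lia.
  rewrite SD ?leq_addr//.
  have h1 := hM2 ((M2 + N0).+1 - b0 + n)%N.
  have h2 : S M2 <= S ((M2 + N0).+1 - b0)%N by apply: Snd; rewrite /N0; lia.
  by lra.
pose E (K : nat) := [set x : ZT | forall m, m <= - K%:Z -> ~ sync b0 N0 (vcode x) m].
pose A (K : nat) := [set v : zseq RR | forall m, m <= - K%:Z -> ~ sync b0 N0 v m].
have mA K : measurable (A K) by meas.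
(* Only the constraint of index [j = 0] may look past [-K], and it is void because [b0 > 0]. *)
have EA K : E K = [set x : ZT | A K (ztrunc K (vcode x))].
  seteq=> x h m mK sy; apply: (h m mK) => j; have := sy j.
    rewrite /ztrunc; case: leP => // hj _; rewrite /syncset ifT//; lia.
  by rewrite /ztrunc; case: leP => // hj _; rewrite /syncset ifT//; lia.
have mE K : measurable (E K) by meas.
have EK K : mu (E K) = mu (E 0%N).
  rewrite -(statk (- K%:Z) (mE 0%N)); congr (mu _).
  seteq=> x h m mK sy.
    have mK' : m + - K%:Z <= - K%:Z by lia.
    exact: (h _ mK' (proj1 (sync_shiftk b0 N0 (- K%:Z) x m) sy)).
  have mK' : m + K%:Z <= - 0%N%:Z by lia.
  apply: (h _ mK'); apply: (proj2 (sync_shiftk b0 N0 (- K%:Z) x (m + K%:Z))).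
  by rewrite addrK.
have pE (e : R) : 0 < e -> pr (E 0%N) * (c1 * 2^-1) <= e.
  move=> e0; have [K NK hK] := TKle e e0.
  apply: (@le_trans _ _ (pr (E 0%N) * pr (FS K))).
    by apply: ler_wpM2l; [rewrite fine_ge0|exact: FS_ge].
  rewrite -[in pr (E 0%N)](EK K).
  have := @vcode_indep K (fun m => syncset b0 N0 (absz (1 - m)%R)) _ (fun m => mss _) (mA K).
  rewrite -EA => <-; rewrite -lee_fin -prE; last first.
    by apply: meas_and; [rewrite -/(E K) -EA|exact: mFS].
  apply: le_trans hK.
  have mT : measurable (\bigcup_i TK K i) by exact: bigcupT_measurable.
  have mD : measurable (E K `\` E 0%N) by meas.
  have D0 : mu (E K `\` E 0%N) = 0%E.
    rewrite measureD//; last by rewrite -ge0_fin_numE// fin_num_measure.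
    rewrite (_ : E K `&` E 0%N = E 0%N); last by apply: setIidr => x h m mK; apply: h; lia.
    apply: (@etrans _ _ (mu (E 0%N) - mu (E 0%N))%E); first by congr (_ - _)%E; exact: EK.
    by rewrite subee// fin_num_measure.
  apply: (@le_trans _ _ (mu ((E K `\` E 0%N) `|` \bigcup_i TK K i))).
    apply: measure_le.
    - by apply: meas_and; [have := mE K; rewrite EA|exact: mFS].
    - by meas.
    - move=> x [EKx FSx]; have [Tx|nT] := pselect ((\bigcup_i TK K i) x); [by right|left].
      split; first by rewrite EA.
      move=> /(_ 0 (lexx _)); apply => j; rewrite add0r.
      have [j1|j1] := posnP j; first by rewrite /syncset ifT// j1.
      have [jK|jK] := leqP j K.
        by have := FSx (- j%:Z + 1); rewrite (_ : absz (1 - (- j%:Z + 1))%R = j); [apply; lia|lia].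
      apply: contrapT => ns; apply: nT; exists (j - K.+1)%N => //; rewrite /TK /= subnKC//.
      by rewrite (_ : - (K + (j - K.+1))%:Z = - j%:Z + 1)//; lia.
  apply: (le_trans (measureU2 _ mD mT)).
  by rewrite [X in (X + _)%E](_ : _ = 0%E) ?add0e//; exact: D0.
have E00 : pr (E 0%N) = 0.
  have : pr (E 0%N) * (c1 * 2^-1) <= 0 by apply/ler_addgt0Pr => e e0; rewrite add0r; exact: pE.
  rewrite pmulr_lle0 => [h|]; last by lra.
  by apply/eqP; rewrite eq_le h fine_ge0.
have s0 : {ae mu, forall x, exists2 m, m <= 0 & sync b0 N0 (vcode x) m}.
  exists (E 0%N); split=> //; first by rewrite prE// E00.
  by move=> x /= h m m0 sy; apply: h; exists m.
apply: ae_countable => n.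
apply: filterS (ae_shiftk n s0) => x [m m0 /sync_shiftk sy]; exists (m + n) => //; lia.
Qed.

(** Reading forwards: the symbol that follows a start gives the length of the block, hence the next
    start. *)
Fixpoint reach (v : zseq RR) (m : int) (k : nat) (n : int) : Prop :=
  if k is k'.+1 then exists p : int * nat,
    reach v m k' p.1 /\ (Ilen p.2 (v (p.1 + 1)) /\ n = p.1 + p.2%:Z)
  else n = m.

Definition dstart b0 N0 v n := exists p : int * nat, sync b0 N0 v p.1 /\ reach v p.1 p.2 n.

Definition dblk b0 N0 v n (s : int) (L : nat) :=
  dstart b0 N0 v s /\ (Ilen L (v (s + 1)) /\ s < n <= s + L%:Z).

(** An arbitrary sequence may show several blocks at [n]. Asking for a single one makes [decode] a
    function given piece by piece on countably many measurable sets. *)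
Definition dblk1 b0 N0 v n (p : int * nat) :=
  dblk b0 N0 v n p.1 p.2 /\ forall q : int * nat, dblk b0 N0 v n q.1 q.2 -> q = p.

Definition decode b0 N0 (v : zseq RR) : ZT := fun n =>
  match pselect (exists p, dblk1 b0 N0 v n p) with
  | left ex => th' (projT1 (cid ex)).2 (zmask 0 (projT1 (cid ex)).2 (zshiftk (projT1 (cid ex)).1 v))
      (n - (projT1 (cid ex)).1)
  | right _ => star
  end.

Lemma decodeE b0 N0 v n p : dblk1 b0 N0 v n p ->
  decode b0 N0 v n = th' p.2 (zmask 0 p.2 (zshiftk p.1 v)) (n - p.1).
Proof.
move=> h; rewrite /decode; case: pselect => [ex|[]]; last by exists p.
by case: cid => q /= [hq _]; rewrite (proj2 h q hq).
Qed.

Lemma meas_reach m k n : measurable [set v : zseq RR | reach v m k n].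
Proof.
elim: k n => [|k ih] n /=; first meas.
apply: meas_ex => p; apply: meas_and; first exact: ih.
apply: meas_and; last meas.
exact: (meas_preim (meas_at _) (meas_Ilen _)).
Qed.

Lemma meas_dblk b0 N0 n s L : measurable [set v : zseq RR | dblk b0 N0 v n s L].
Proof.
apply: meas_and.
  apply: meas_ex => p; apply: meas_and.
  by apply: meas_all => j; exact: (meas_preim (meas_at _) (meas_syncset b0 N0 j)).
  exact: meas_reach.
by meas.
Qed.

Lemma meas_decode b0 N0 : mfunT (decode b0 N0 : zseq RR -> ZT).
Proof.
apply: meas_zseq => n.
apply: (@meas_pieces _ _ (int * nat)%type _ _ (fun p => [set v : zseq RR | dblk1 b0 N0 v n p])
  (fun p v => th' p.2 (zmask 0 p.2 (zshiftk p.1 v)) (n - p.1)) star).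
- move=> p; apply: meas_and; first exact: meas_dblk.
  by apply: meas_all => q; apply: meas_impl; [exact: meas_dblk|exact: meas_Prop].
- move=> [s L] /=.
  have h := measurableT_comp (mth' L) (measurableT_comp (@meas_zmask _ RR (0 : R) L) (meas_zshiftk s)).
  exact: (measurableT_comp (meas_at (n - s)) h).
- by move=> p v; exact: decodeE.
- by move=> v h; rewrite /decode; case: pselect => // ex; exfalso; case: (ex) => p; exact: h.
Qed.

Lemma io_starts_shiftk k x : io_starts x -> io_starts (zshiftk k x).
Proof.
move=> h n; have [[m mn st] [m' mn' st']] := h (n + k).
split; [exists (m - k); first lia|exists (m' - k); first lia];
  by rewrite isst_shiftk subrK.
Qed.

Lemma decodable_step x s L : decodable x -> isst x s -> Ilen L (vcode x (s + 1)) -> blk L (zshiftk s x).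
Proof.
move=> [ios vl] sts IL.
have [|L' b] := blk_ex (io_starts_shiftk s ios); first by rewrite isst_shiftk add0r.
by rewrite (Ilen_inj IL (vl _ _ b)).
Qed.

Lemma reach_isst x m k n : decodable x -> isst x m -> reach (vcode x) m k n -> isst x n.
Proof.
move=> dx stm; elim: k n => [|k ih] n /=; first by move=> ->.
move=> [[s L] /= [/ih sts [IL ->]]].
by have [_ _ + _] := decodable_step dx sts IL; rewrite isst_shiftk addrC.
Qed.

(** Synchronized times are true starts and reading leads from start to start. Conversely, from a
    synchronized time [m <= n] the blocks up to [n] are read one after the other, by induction on
    the distance to [m]. *)
Lemma dstartP b0 N0 x n : (0 < b0)%N -> decodable x ->
  (forall n, exists2 m, m <= n & sync b0 N0 (vcode x) m) -> dstart b0 N0 (vcode x) n <-> isst x n.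
Proof.
move=> b00 dx sy; split.
  by move=> [[m k] /= [/(sync_isst b00 dx) stm]]; exact: reach_isst.
have [m mn sm] := sy n; have stm := sync_isst b00 dx sm.
suff H k n' : isst x n' -> m <= n' -> (absz (n' - m)%R <= k)%N -> exists k, reach (vcode x) m k n'.
  by move=> stn; have [k hk] := H _ n stn mn (leqnn _); exists (m, k).
elim: k n' => [|k ih] n' stn mn' nk; first by exists 0%N => /=; lia.
have [->|nm] := eqVneq n' m; first by exists 0%N.
have [s [L ib]] := inblk_ex n' (proj1 dx).
have [b _] := ib; have /inblkP[sts _ hs h] := ib.
have nE : n' = s + L%:Z.
  by apply/eqP; rewrite eq_le; apply/andP; split; [lia|rewrite leNgt; apply/negP => lt; apply: (h n') => //; lia].
have ms : m <= s by rewrite leNgt; apply/negP => lt; apply: (h m) => //; lia.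
have [|k' hk'] := ih s sts ms; first lia.
exists k'.+1, (s, L); split=> //=; split=> //; exact: (proj2 dx).
Qed.

Lemma decodeK b0 N0 x : (0 < b0)%N -> decodable x ->
  (forall n, exists2 m, m <= n & sync b0 N0 (vcode x) m) ->
  (forall s L, blk L (zshiftk s x) ->
     th' L (th L (zmask star L (zshiftk s x))) = zmask star L (zshiftk s x) /\
     zmask 0 L (th L (zmask star L (zshiftk s x))) = th L (zmask star L (zshiftk s x))) ->
  decode b0 N0 (vcode x) = x.
Proof.
move=> b00 dx sy hth; apply/funext => n.
have dP s' L' : dblk b0 N0 (vcode x) n s' L' <-> inblk x n s' L'.
  split; first by move=> [/(dstartP _ b00 dx sy) sts [IL hs]]; split=> //; exact: decodable_step.
  move=> ib; have [b hs] := ib; have /inblkP[sts _ _ _] := ib.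
  split; first by apply/(dstartP _ b00 dx sy).
  by split=> //; exact: (proj2 dx).
have [s [L ib]] := inblk_ex n (proj1 dx).
rewrite (@decodeE b0 N0 _ n (s, L)) /=; last first.
  split; first exact/dP.
  by move=> [s' L'] /= /dP ib'; have [-> ->] := inblk_inj ib ib'.
have [b hs] := ib; have [h1 h2] := hth _ _ b.
have -> : zmask 0 L (zshiftk s (vcode x)) = th L (zmask star L (zshiftk s x)).
  rewrite -h2; apply/funext => m; rewrite /zmask; case: ifP => // hm; rewrite {1}/zshiftk.
  have ib' : inblk x (m + s) s L by split=> //; lia.
  by rewrite (vcodeE ib') addrK.
rewrite h1 /zmask /zshiftk subrK ifT//; lia.
Qed.

Lemma bernoulli_of_codes : isomorphic_to_bernoulli_of_infinite_entropy mu (@zshift T).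
Proof.
have [b0 b00 q0] := qlen_eventually_gt0.
have [N0 sy] := sync_io b00 q0.
have [m mE] := ex_pushforward mu mvcode.
have thm L : {ae mu, forall x, blk L x -> zmask 0 L (th L (zmask star L x)) = th L (zmask star L x)}.
  have mC : measurable [set y : zseq RR | zmask 0 L y = y].
    by apply: meas_eq_zseq; [exact: meas_zmask|exact: measurable_id].
  have mI : measurable [set y : zseq RR | Ilen L (y 1)] by meas.
  apply: (ae_code mC).
  have C0 : M L (~` [set y | zmask 0 L y = y]) = 0%E by rewrite probability_setC// Mmask subee.
  apply: subset_measure0 C0; [exact: (meas_and mI (meas_not mC))|exact: measurableC|by move=> y []].
have hth := ae_countable (fun s => ae_shiftk s (ae_countable (fun L => aeI (thK L) (thm L)))).
exists _, RR, nu01, m; split.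
- exact: lebesgue_nu01.
- by apply: vcode_product => A mA; exact: mE.
- exact: entropy_nu01.
- exists vcode; split; last first.
    by apply: aeW => x; apply/funext => n; exact: (vcode_shiftk 1 x n).
  apply: (iso_mod0_code (psi := decode b0 N0)) => //.
  + exact: meas_decode.
  + apply: meas_eq_zseq; [exact: (measurableT_comp mvcode (meas_decode b0 N0))|exact: measurable_id].
  + apply: filterS (aeI (aeI io vcode_len) (aeI sy hth)) => x [dx [sx hx]].
    by apply: decodeK => // s L b; split; apply (hx s L).
Qed.
End codes.

(* A stationary sequence which renews itself at the visits of an atom of its
   marginal law, and whose other values are not atoms, is a Bernoulli shift. *)
Theorem bernoulli_of_renewal : isomorphic_to_bernoulli_of_infinite_entropy mu (@zshift T).
Proof.
have [th H1] := choice block_code_ex; have [th' H2] := choice H1; have [M H3] := choice H2.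
by apply: (@bernoulli_of_codes th M _ _ _ th') => L; have [? ? [? ?] ? ?] := H3 L.
Qed.
End renewal.

(** * Finite covers, rational balls and countable bases of Fell topologies *)

Lemma compact_finite_cover (X : topologicalType) (I : eqType) (D : set I) (b : I -> set X) (K : set X) :
  compact K -> (forall i, D i -> open (b i)) -> (forall x, K x -> exists i, D i /\ b i x) ->
  exists s : seq I, (forall i, i \in s -> D i) /\ K `<=` \bigcup_(i in [set` s]) b i.
Proof.
move=> cK ob cov.
(* The filter of finite lists ordered by inclusion. The near-covering form of compactness along it
   gives one list that works for all points of [K]. *)
pose F : set_system (seq I) := [set P | exists s0 : seq I, (forall i, i \in s0 -> D i) /\
  forall s : seq I, (forall i, i \in s -> D i) -> {subset s0 <= s} -> P s].
have FF : Filter F.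
  split; first by exists [::]; split.
  - move=> P Q [s1 [d1 h1]] [s2 [d2 h2]]; exists (s1 ++ s2); split.
      by move=> i; rewrite mem_cat => /orP[/d1|/d2].
    move=> s ds ss; split; [apply: h1 => // i|apply: h2 => // i] => hi;
      by apply: ss; rewrite mem_cat hi ?orbT.
  - by move=> P Q PQ [s0 [d0 h]]; exists s0; split=> // s ds /(h s ds)/PQ.
have := (compact_near_coveringP K).1 cK _ F
  (fun (s : seq I) x => (forall i, i \in s -> D i) -> exists2 i, i \in s & b i x) FF.
case.
  move=> x Kx; have [i [Di bx]] := cov x Kx.
  exists (b i, [set s : seq I | i \in s]); last first.
    by move=> [y s] /= [by_ si] _; exists i.
  split; first exact: open_nbhs_nbhs (conj (ob i Di) bx).
  exists [:: i]; split=> [j|s _]; first by rewrite inE => /eqP ->.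
  by apply; rewrite inE.
move=> s0 [d0 h]; exists s0; split=> // x Kx.
by have [i si bx] := h s0 d0 (fun _ => id) x Kx d0; exists i.
Qed.

Section rational_balls.
Context {R : realType} {n : nat}.
Local Notation E := 'rV[R]_n.
Implicit Types (x y : E) (A K G : set E).

Definition rpt (q : 'rV[rat]_n) : E := map_mx ratr q.
Definition qball (p : 'rV[rat]_n * rat) : set E := ball (rpt p.1) (ratr p.2).
Definition qcball (p : 'rV[rat]_n * rat) : set E := closed_ball (rpt p.1) (ratr p.2).

Lemma ltr_rV x (e : R) : 0 < e -> `|x| < e <-> forall i, `|x 0 i| < e.
Proof.
move=> e0; split=> [h i|h]; first exact: le_lt_trans (coord_le_norm x i) h.
rewrite [ltLHS]/Num.norm /= mx_normrE; apply/bigmax_ltP; split=> // -[i j] _ /=.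
by rewrite ord1.
Qed.

Lemma rpt_dense x (e : R) : 0 < e -> exists q, `|rpt q - x| < e.
Proof.
move=> e0.
have h i : exists q : rat, `|ratr q - x 0 i| < e.
  have lt : x 0 i - e < x 0 i + e by rewrite ltrD2l gtrN.
  have [q hq] := rat_in_itvoo lt; exists q.
  by move: hq; rewrite in_itv/= ltr_distl => /andP[-> ->].
have [f hf] := choice h; exists (\row_i f i); apply/(ltr_rV _ e0) => i.
by rewrite !mxE.
Qed.

Lemma closed_ballP (p x : E) (r : R) : 0 < r -> closed_ball p r x <-> `|p - x| <= r.
Proof. by move=> r0; rewrite closed_ballE. Qed.

Lemma compact_closed_ball (p : E) (r : R) : compact (closed_ball p r).
Proof.
have [r0|r0] := leP r 0.
  rewrite (_ : closed_ball p r = set0); first exact: compact0.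
  rewrite /closed_ball (_ : ball p r = set0) ?closure0//.
  seteq=> // y; rewrite -ball_normE /= => h.
  by have := le_lt_trans (normr_ge0 _) (lt_le_trans h r0); rewrite ltxx.
apply: bounded_closed_compact; last exact: closed_ball_closed.
exists (`|p| + r); split=> [|M hM y]; first exact: num_real.
move=> /(closed_ballP _ _ r0) xy; apply/ltW/(le_lt_trans _ hM).
by rewrite -[y](subKr p) (le_trans (ler_normB _ _))// lerD2l.
Qed.

Lemma compact_qcball p : compact (qcball p).
Proof. exact: compact_closed_ball. Qed.

Lemma open_qball p : open (qball p).
Proof. exact: ball_open. Qed.

Lemma sub_qcball p : qball p `<=` qcball p.
Proof. exact: subset_closure. Qed.

Lemma qball_base G x : open G -> G x -> exists p, [/\ 0 < p.2, qball p x & qcball p `<=` G].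
Proof.
move=> oG Gx; have /nbhs_ballP[e /= e0 he] := open_nbhs_nbhs (conj oG Gx).
have [r hr] := rat_in_itvoo (divr_gt0 e0 (ltr0n R 4)).
move: hr; rewrite in_itv/= => /andP[r0 r4].
have [q hq] := rpt_dense x r0; exists (q, r); split.
- by rewrite /= -(ltr0q R).
- by rewrite /qball/= -ball_normE.
- move=> y /(closed_ballP _ _ r0) hy; apply: he; rewrite -ball_normE /=.
  rewrite -[x](subrK (rpt q)) -addrA; apply: le_lt_trans (ler_normD _ _) _.
  rewrite distrC in hq; have : 0 < e := e0; move=> /= in hy hq r4 *; lra.
Qed.

Lemma qball_cover K G : compact K -> open G -> K `<=` G ->
  exists s : seq ('rV[rat]_n * rat), K `<=` (\bigcup_(p in [set` s]) qball p) /\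
    forall p, p \in s -> 0 < p.2 /\ qcball p `<=` G.
Proof.
move=> cK oG KG.
pose D := [set p : 'rV[rat]_n * rat | 0 < p.2 /\ qcball p `<=` G].
have [||s [sD Ks]] := @compact_finite_cover _ _ D qball K cK.
- by move=> p _; exact: open_qball.
- by move=> x /KG Gx; have [p [p0 px pG]] := qball_base oG Gx; exists p.
by exists s; split.
Qed.
End rational_balls.

Section pieces.
Context {X : topologicalType} {Y : Type} (I : countType) (f : Y -> set X) (b c : I -> set X).

(** Countably many finite combinations of hit and miss conditions, meant to replace the uncountable
    subbase of all open and all compact sets. *)
Definition piece (p : seq I * seq I) : set Y :=
  [set y | (forall i, i \in p.1 -> f y `&` b i !=set0) /\ (forall i, i \in p.2 -> f y `&` c i = set0)].

Lemma piece_cat p q : piece (p.1 ++ q.1, p.2 ++ q.2) = piece p `&` piece q.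
Proof.
seteq=> y.
  by move=> [h1 h2]; split; split=> i ip; [apply: h1|apply: h2|apply: h1|apply: h2]; rewrite mem_cat ip ?orbT.
move=> [[h1 h2] [h3 h4]]; split=> i; rewrite mem_cat => /orP[]; auto.
Qed.

Hypothesis ob : forall i, open (b i).
Hypothesis bc : forall i, b i `<=` c i.
Hypothesis base : forall G x, open G -> G x -> exists i, b i x /\ c i `<=` G.
Hypothesis cf : forall y, closed (f y).

Lemma piece_hit G y : open G -> f y `&` G !=set0 -> exists p, piece p y /\ piece p `<=` [set y | f y `&` G !=set0].
Proof.
move=> oG [x [fx Gx]]; have [i [bx cG]] := base oG Gx.
exists ([:: i], [::]); split.
  by split=> // j; rewrite inE => /eqP ->; exists x.
move=> z [h _]; have [|w [fw bw]] := h i; first by rewrite inE.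
by exists w; split=> //; exact/cG/bc.
Qed.

(** Finitely many [b i] cover [K] while the larger sets [c i] avoid the closed set [f y]; missing
    these [c i] is then enough to miss [K]. *)
Lemma piece_miss K y : compact K -> f y `&` K = set0 -> exists p, piece p y /\ piece p `<=` [set y | f y `&` K = set0].
Proof.
move=> cK fK; pose D := [set i | c i `<=` ~` f y].
have [||s [sD Ks]] := @compact_finite_cover _ _ D b K cK.
- by move=> i _; exact: ob.
- move=> x Kx; have nfx : (~` f y) x by move=> fx; have : (f y `&` K) x by []; rewrite fK.
  by have [i [bx cG]] := base (closed_openC (@cf y)) nfx; exists i.
exists ([::], s); split.
  by split=> // i /sD Di; seteq=> // x [fx /Di].
move=> z [_ h]; seteq=> // x [fx Kx].
have [i si bx] := Ks x Kx; have : (f z `&` c i) x by split=> //; exact: bc.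
by rewrite h.
Qed.

Lemma piece_base (F : set (set Y)) U y : finite_set F -> F `<=` hit_or_miss f ->
  (forall A, F A -> A y) -> (forall z, (forall A, F A -> A z) -> U z) ->
  exists p, piece p y /\ piece p `<=` U.
Proof.
move=> fF; have /finite_seqP[s sE] := fF; rewrite sE => {fF sE F}.
elim: s U => [|A s ih] U hF Fy FU.
  by exists ([::], [::]); split=> // z _; apply: FU.
have [p [py pA]] : exists p, piece p y /\ piece p `<=` A.
  have hA : hit_or_miss f A by apply: hF; rewrite /= inE eqxx.
  have Ay : A y by apply: Fy; rewrite /= inE eqxx.
  by case: hA Ay => [[G oG <-]|[K cK <-]] Ay; [exact: piece_hit|exact: piece_miss].
have [q [qy qU]] : exists q, piece q y /\ piece q `<=` [set z | forall A', A' \in s -> A' z].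
  apply: ih => //.
  - by move=> B Bs; apply: hF; rewrite /= inE; apply/orP; right.
  - by move=> B Bs; apply: Fy; rewrite /= inE; apply/orP; right.
exists (p.1 ++ q.1, p.2 ++ q.2); rewrite piece_cat; split=> // z [pz qz].
apply: FU => B; rewrite /= inE => /orP[/eqP ->|Bs]; first exact: pA.
exact: qU qz B Bs.
Qed.
End pieces.

Lemma subbase_pieces (X : topologicalType) (Y : Type) (I : countType) (f : Y -> set X) (b c : I -> set X)
    (U : set Y) : (forall i, open (b i)) -> (forall i, b i `<=` c i) ->
  (forall G x, open G -> G x -> exists i, b i x /\ c i `<=` G) -> (forall y, closed (f y)) ->
  (exists2 B, B `<=` finI_from (hit_or_miss f) id & \bigcup_(A in B) A = U) ->
  U = \bigcup_(p in [set p | piece f b c p `<=` U]) piece f b c p.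
Proof.
move=> ob bc base cf [B BF BU]; seteq=> [y|y [p pU] /pU//].
rewrite -BU => -[A BA Ay]; have [D' D'F AE] := BF A BA.
have [|||p [py pA]] := piece_base ob bc base cf (U := A) (y := y) (finite_fset D').
- by move=> C CD; apply/set_mem/D'F.
- by move=> C CD; rewrite -AE in Ay; exact: Ay.
- by move=> z hz; rewrite -AE => C /hz.
by exists p => // z /pA Az; exists A.
Qed.

(** * Random closed sets *)

Section random_closed_sets.
Context {R : realType} {n : nat} d {Om : measurableType d}.
Local Notation E := 'rV[R]_n.
Implicit Types (C D : Om -> set E).

(* A random closed set; the miss events of compact sets generate the Fell Borel sets. *)
Definition rcs C := (forall o, closed (C o)) /\
  forall K, compact K -> measurable [set o | C o `&` K = set0].

Lemma rcs_hit C (G : set E) : rcs C -> open G -> measurable [set o | C o `&` G !=set0].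
Proof.
move=> [_ mC] oG.
rewrite (_ : [set o | _] = [set o | exists p : 'rV[rat]_n * rat, (0 < p.2 /\ @qcball R n p `<=` G) /\ ~ (C o `&` qcball p = set0)]).
  apply: meas_ex => p; apply: meas_and; first exact: meas_Prop.
  by apply: meas_not; apply: mC; exact: compact_qcball.
seteq=> o /=.
  move=> [x [Cx Gx]]; have [p [p0 px pG]] := qball_base oG Gx; exists p; split=> //.
  by move=> e; have : (C o `&` qcball p) x; [split=> //; exact: sub_qcball|rewrite e].
move=> [p [[_ pG] /eqP/set0P[x [Cx px]]]]; exists x; split=> //; exact: pG.
Qed.

Lemma rcs_meet C K : rcs C -> compact K -> measurable [set o | C o `&` K !=set0].
Proof.
move=> [_ mC] cK; rewrite (_ : [set o | _] = [set o | ~ (C o `&` K = set0)]).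
  by apply: meas_not; exact: mC.
by seteq=> o /=; [move=> [x h] e; rewrite e in h|move=> /eqP/set0P].
Qed.

Lemma rcs_mem C x : rcs C -> measurable [set o | C o x].
Proof.
move=> mC; rewrite (_ : [set o | _] = [set o | C o `&` [set x] !=set0]).
  by apply: rcs_meet => //; exact: compact_set1.
by seteq=> o /=; [move=> Cx; exists x|move=> [y [Cy yx]]; rewrite -yx].
Qed.

Lemma rcs_cst (A : set E) : closed A -> rcs (fun=> A).
Proof. by move=> cA; split=> // K _; exact: meas_Prop. Qed.

(** Two closed sets that are disjoint on the compact [K] are told apart by a finite cover of [K]
    with rational balls, on each of which one of the two is missing. A miss event of the
    intersection is thereby a countable union of combinations of miss events of the two sets. *)
Lemma rcsI C D : rcs C -> rcs D -> rcs (fun o => C o `&` D o).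
Proof.
move=> [hC mC] [hD mD]; split=> [w|K cK]; first exact: closedI.
pose Q : Type := ('rV[rat]_n * rat)%type.
have cKq (p : Q) : compact (K `&` qcball p).
  by apply: (subclosed_compact _ cK); [apply: closedI;
    [apply: compact_closed => //; exact: norm_hausdorff|exact: closed_ball_closed]|move=> x []].
rewrite (_ : [set o | _] = [set o | exists s : seq Q, (K `<=` \bigcup_(p in [set` s]) @qball R n p) /\
   forall p : Q, p \in s -> C o `&` (K `&` qcball p) = set0 \/ D o `&` (K `&` qcball p) = set0]).
  apply: meas_ex => s; apply: meas_and; first exact: meas_Prop.
  apply: meas_all => p; apply: meas_imp => _.
  by apply: measurableU; [exact: mC|exact: mD].
seteq=> o /=.
  move=> e; pose P (p : Q) := C o `&` (K `&` qcball p) = set0 \/ D o `&` (K `&` qcball p) = set0.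
  have [||s [sP Ks]] := @compact_finite_cover _ _ P (@qball R n) K cK.
  - by move=> p _; exact: open_qball.
  - move=> x Kx; have [Cx|nC] := pselect (C o x).
      have nD : (~` D o) x by move=> Dx; have : (C o `&` D o `&` K) x by []; rewrite e.
      have [p [_ px pG]] := qball_base (closed_openC (@hD o)) nD; exists p; split=> //; right.
      by seteq=> // z [Dz [_ /pG]].
    have [p [_ px pG]] := qball_base (closed_openC (@hC o)) nC; exists p; split=> //; left.
    by seteq=> // z [Cz [_ /pG]].
  by exists s; split=> // p /sP.
move=> [s [Ks h]]; seteq=> // x [[Cx Dx] Kx].
have [p ps px] := Ks x Kx; have px' := sub_qcball px.
case: (h p ps) => e.
  by have : (C o `&` (K `&` qcball p)) x by []; rewrite e.
by have : (D o `&` (K `&` qcball p)) x by []; rewrite e.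
Qed.

(* A regular closed set is determined by its rational points. *)
Lemma rcs_regular C : (forall o, closed (C o)) -> (forall o, C o `<=` closure (C o)°) ->
  (forall q : 'rV[rat]_n, measurable [set o | C o (rpt q)]) -> rcs C.
Proof.
move=> cC rC mC; split=> // K cK.
pose Q : Type := ('rV[rat]_n * rat)%type.
pose P (p : Q) o := forall q : 'rV[rat]_n, @qball R n p (rpt q) -> ~ C o (rpt q).
have PE p o : P p o <-> C o `&` qball p = set0.
  split; last first.
    by move=> e q pq Cq; have : (C o `&` qball p) (rpt q) by []; rewrite e.
  move=> h; seteq=> // x [Cx px].
  have [y [Cy py]] := rC o x Cx (qball p) (open_nbhs_nbhs (conj (@open_qball R n p) px)).
  have /nbhs_ballP[e /= e0 he] : nbhs y ((C o)° `&` qball p).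
    by apply: open_nbhs_nbhs; split=> //; apply: openI; [exact: open_interior|exact: open_qball].
  have [q hq] := rpt_dense y e0.
  have [|Cq pq] := he (rpt q); first by rewrite -ball_normE/= distrC.
  by apply: (h q pq); exact: interior_subset.
rewrite (_ : [set o | _] = [set o | exists s : seq Q, (K `<=` \bigcup_(p in [set` s]) @qball R n p) /\
   forall p : Q, p \in s -> P p o]).
  apply: meas_ex => s; apply: meas_and; first exact: meas_Prop.
  apply: meas_all => p; apply: meas_imp => _.
  apply: meas_all => q; apply: meas_imp => _; exact: meas_not.
seteq=> o /=.
  move=> e.
  have KC : K `<=` ~` C o by move=> x Kx Cx; have : (C o `&` K) x by []; rewrite e.
  have [s [Ks hs]] := qball_cover cK (closed_openC (@cC o)) KC.
  exists s; split=> // p /hs[_ pC]; apply/PE; seteq=> // x [Cx px].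
  exact: (pC x (sub_qcball px)).
move=> [s [Ks h]]; seteq=> // x [Cx Kx].
have [p ps px] := Ks x Kx; have /PE e := h p ps.
by have : (C o `&` qball p) x by []; rewrite e.
Qed.
End random_closed_sets.

#[export] Hint Resolve rcs_hit rcs_mem rcs_meet open_qball compact_qcball compact_set1 open_interior rcsI : meas.

Lemma rcs_comp (R : realType) n d d' (Om : measurableType d) (Om' : measurableType d') (C : Om' -> set 'rV[R]_n)
  (f : Om -> Om') : mfunT f -> rcs C -> rcs (C \o f).
Proof. by move=> mf [cC mC]; split=> [w|K cK]; [exact: cC|exact: (meas_preim mf (mC K cK))]. Qed.

(** * Hyperplanes and their sides *)

Section hyperplane_measurable.
Context {R : realType} {l : nat}.
Local Notation E := 'rV[R]_l.+1.
Local Notation H := (hyperplane R l).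

Lemma dot_continuous (u : E) : continuous (dot u).
Proof.
apply: (@continuous_bigsum R E R) => i x.
apply: (@continuous_comp E R R (fun x : E => x 0 i) ( *%R (u 0 i))); [exact: coord_continuous|exact: mulrl_continuous].
Qed.

Lemma dotD (u x y : E) : dot u (x + y) = dot u x + dot u y.
Proof. by rewrite /dot -big_split/=; apply: eq_bigr => i _; rewrite mxE mulrDr. Qed.

Lemma dotZ (u x : E) (c : R) : dot u (c *: x) = c * dot u x.
Proof. by rewrite /dot mulr_sumr; apply: eq_bigr => i _; rewrite mxE mulrCA. Qed.

Lemma dot0 (u : E) : dot u 0 = 0.
Proof. by rewrite -(scale0r (0 : E)) dotZ mul0r. Qed.

Lemma dotZl (u x : E) (c : R) : dot (c *: u) x = c * dot u x.
Proof. by rewrite /dot mulr_sumr; apply: eq_bigr => i _; rewrite mxE mulrA. Qed.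

Lemma dotB (u x y : E) : dot u (x - y) = dot u x - dot u y.
Proof. by rewrite dotD -scaleN1r dotZ mulN1r. Qed.

Lemma dot_delta (u : E) i : dot u (delta_mx 0 i) = u 0 i.
Proof.
rewrite /dot (bigD1 i)//= mxE !eqxx mulr1 big1 ?addr0// => j ji.
by rewrite mxE (negbTE ji) andbF mulr0.
Qed.

Lemma hyperplane_closed (h : H) : closed (sval h).
Proof.
have [u [c [_ ->]]] := svalP h.
rewrite (_ : [set x | _] = dot u @^-1` [set c]); last by [].
by apply: closed_comp; [move=> x _; exact: dot_continuous|exact: closed_eq].
Qed.

Lemma hyperplane_open (U : set H) : open U ->
  U = \bigcup_(p in [set p | piece (fun h : H => sval h) (@qball R l.+1) (@qcball R l.+1) p `<=` U])
        piece (fun h : H => sval h) (@qball R l.+1) (@qcball R l.+1) p.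
Proof.
move=> oU; apply: subbase_pieces.
- exact: open_qball.
- exact: sub_qcball.
- by move=> G x oG Gx; have [p [_ px pG]] := qball_base oG Gx; exists p.
- exact: hyperplane_closed.
- exact: oU.
Qed.

Lemma meas_hyperplane_map d (Om : measurableType d) (f : Om -> H) :
  rcs (fun o => sval (f o)) -> mfunT f.
Proof.
move=> rf; apply: (measurability [set A : set H | open A]) => // _ [A oA <-].
rewrite setTI (hyperplane_open oA) preimage_bigcup.
rewrite (_ : \bigcup_(p in _) _ = \bigcup_p [set o | (piece (fun h : H => sval h) (@qball R l.+1) (@qcball R l.+1) p `<=` A) /\
   piece (fun o => sval (f o)) (@qball R l.+1) (@qcball R l.+1) p o]).
  apply: meas_bigcup => p; apply: meas_and; first meas.
  apply: meas_and; apply: meas_all => q; apply: meas_imp => _.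
    by apply: rcs_hit => //; exact: open_qball.
  by apply: rf.2; exact: compact_qcball.
by seteq=> o; [move=> [p pA po]; exists p|move=> [p _ [pA po]]; exists p].
Qed.

Lemma open_hyperplane_miss (K : set E) : compact K -> open [set h : H | sval h `&` K = set0].
Proof.
move=> cK; pose S := [set h : H | sval h `&` K = set0].
exists [set S]; last by rewrite bigcup_set1.
move=> _ ->; exists [fset S]%fset; last by rewrite set_fset1 bigcap_set1.
move=> B; rewrite inE => /eqP ->; apply/mem_set; right; by exists K.
Qed.

Lemma rcs_hyperplane : rcs (fun h : H => sval h).
Proof.
split; first exact: hyperplane_closed.
by move=> K cK; apply: sub_sigma_algebra; exact: open_hyperplane_miss.
Qed.

Definition line_seg (x : E) (i : 'I_l.+1) (a b : R) : set E := [set x + t *: delta_mx 0 i | t in `[a, b]%classic].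

Lemma compact_line_seg x i a b : compact (line_seg x i a b).
Proof.
apply: continuous_compact; last exact: segment_compact.
apply: continuous_subspaceT => t.
apply: (@cvgD _ E _ (nbhs t) _ (cst x) (fun t : R => t *: delta_mx 0 i)); first exact: cvg_cst.
exact: (@cvgZr_tmp _ E _ (nbhs t) _ id t (delta_mx 0 i) cvg_id).
Qed.

(* The hyperplanes with a normal vector of nonzero [i]-th coordinate, described by hitting conditions. *)
Definition transverse (i : 'I_l.+1) (h : H) :=
  (exists N : nat, sval h `&` line_seg 0 i (- N%:R) N%:R !=set0) /\ ~ (sval h 0 /\ sval h (delta_mx 0 i)).

Lemma real_lt_nat (x : R) : exists N : nat, `|x| <= N%:R.
Proof. by exists (Num.trunc `|x|).+1; apply: ltW; exact: truncnS_gt. Qed.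

Lemma transverseP i (h : H) u c : sval h = [set x | dot u x = c] -> transverse i h <-> u 0 i != 0.
Proof.
move=> hE; rewrite /transverse hE; split.
  move=> [[N [y [/= e [t _ te]]]] nh]; apply/negP => /eqP ui0; apply: nh.
  move: e; rewrite -te dotD dotZ dot_delta ui0 mulr0 addr0 => d0.
  by split=> //=; rewrite -d0 dot0.
move=> ui0; split; last first.
  move=> [/= d0 di]; move: ui0; by rewrite -dot_delta di -d0 dot0 eqxx.
have [N hN] := real_lt_nat (c / u 0 i); exists N.
exists (0 + (c / u 0 i) *: delta_mx 0 i); split; last first.
  by exists (c / u 0 i) => //=; rewrite in_itv/= -ler_norml.
by rewrite /= add0r dotZ dot_delta divfK.
Qed.

Lemma meas_transverse i : measurable [set h : H | transverse i h].
Proof.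
apply: meas_and; last first.
  by apply: meas_not; apply: meas_and; exact: (rcs_mem _ rcs_hyperplane).
apply: meas_ex => N; apply: rcs_meet rcs_hyperplane _.
exact: compact_line_seg.
Qed.

Lemma hyperplaneP (h : H) : exists u c, lexi_pos u /\ sval h = [set x | dot u x = c].
Proof.
have [u [c [u0 hE]]] := svalP h.
have ex : exists i, u 0 i != 0.
  apply: contrapT => nx; move/eqP: u0; apply; apply/rowP => i; rewrite mxE.
  by apply/eqP/negPn/negP => ui; apply: nx; exists i.
have [i ui mi] : exists2 i : 'I_l.+1, u 0 i != 0 & forall j : 'I_l.+1, (j < i)%N -> u 0 j = 0.
  have ex' : exists k : nat, [exists i : 'I_l.+1, (k == i :> nat) && (u 0 i != 0)].
    by case: ex => i ui; exists i; apply/existsP; exists i; rewrite eqxx.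
  have [k /existsP[i /andP[/eqP ki ui]] mk] := ex_minnP ex'.
  exists i => // j ji; apply/eqP/negPn/negP => uj.
  have : (k <= j)%N by apply: mk; apply/existsP; exists j; rewrite eqxx.
  by lia.
exists ((u 0 i)^-1 *: u), ((u 0 i)^-1 * c); split.
  exists i; split; first by rewrite mxE mulVf.
  by move=> j ji; rewrite mxE (mi j ji) mulr0.
rewrite hE; seteq=> x /=; rewrite dotZl; first by move=> ->.
by apply: mulfI; rewrite invr_eq0.
Qed.

(* The ray from [x] in the direction of decreasing i-th coordinate hits [h] iff
   [x] is on the nonnegative side of [h]. *)
Definition above (b : bool) (i : 'I_l.+1) (x : E) (h : H) :=
  exists N : nat, sval h `&` (if b then line_seg x i (- N%:R) 0 else line_seg x i 0 N%:R) !=set0.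

Lemma aboveP b i x (h : H) u c : sval h = [set x | dot u x = c] -> 0 < u 0 i ->
  above b i x h <-> if b then c <= dot u x else dot u x <= c.
Proof.
move=> hE ui; rewrite /above hE; split.
  move=> [N]; case: b => -[y [/= e [t]]]; rewrite /= in_itv/= => /andP[t1 t2] te;
    by move: e; rewrite -te dotD dotZ dot_delta => e; nra.
pose t := (c - dot u x) / u 0 i.
have tE : dot u (x + t *: delta_mx 0 i) = c by rewrite dotD dotZ dot_delta /t divfK ?gt_eqF// addrC subrK.
move=> hb; have [N hN] := real_lt_nat t; exists N; case: b hb => hb.
  exists (x + t *: delta_mx 0 i); split=> //; exists t => //; rewrite /= in_itv/=.
  move: hN; rewrite ler_norml => /andP[-> _] /=.
  by rewrite /t ler_pdivrMr// mul0r subr_le0.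
exists (x + t *: delta_mx 0 i); split=> //; exists t => //; rewrite /= in_itv/=.
move: hN; rewrite ler_norml => /andP[_ ->]; rewrite andbT.
by rewrite /t ler_pdivlMr// mul0r subr_ge0.
Qed.

Definition first_transverse (i : 'I_l.+1) (h : H) :=
  transverse i h /\ forall j : 'I_l.+1, (j < i)%N -> ~ transverse j h.

Lemma meas_first_transverse i : measurable [set h : H | first_transverse i h].
Proof.
apply: meas_and; first exact: meas_transverse.
apply: meas_all => j; apply: meas_imp => _.
by apply: meas_not; exact: meas_transverse.
Qed.

Lemma lexi_first_transverse (h : H) u c : lexi_pos u -> sval h = [set x | dot u x = c] ->
  exists i, first_transverse i h /\ 0 < u 0 i.
Proof.
move=> [i [ui mi]] hE; exists i; split=> //; split; first by apply/(transverseP _ hE); rewrite gt_eqF.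
by move=> j ji /(transverseP _ hE); rewrite mi// eqxx.
Qed.

Lemma first_transverse_inj i j (h : H) : first_transverse i h -> first_transverse j h -> i = j.
Proof.
move=> [hi mi] [hj mj]; have [lt|lt|/val_inj//] := ltngtP i j.
  by have := mj i lt.
by have := mi j lt.
Qed.

(** Whether a ray along an axis hits the hyperplane does not depend on the chosen equation, so all
    lexicographically positive normals define the same side. *)
Lemma sideP b (h : H) u c x : lexi_pos u -> sval h = [set y | dot u y = c] ->
  side b h x <-> if b then c <= dot u x else dot u x <= c.
Proof.
move=> lu hE; split; last by exists u, c.
move=> [u' [c' [lu' hE' hx]]].
have [i [fi ui]] := lexi_first_transverse lu hE.
have [i' [fi' ui']] := lexi_first_transverse lu' hE'.
have ii := first_transverse_inj fi fi'; rewrite -{i' fi'}ii in ui'.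
by apply/(aboveP b x hE ui)/(aboveP b x hE' ui').
Qed.

Lemma side_closed b (h : H) : closed (side b h).
Proof.
have [u [c [lu hE]]] := hyperplaneP h.
rewrite (_ : side b h = dot u @^-1` (if b then [set t | c <= t] else [set t | t <= c])); last first.
  by seteq=> x; rewrite /= (sideP b _ lu hE); case: b.
apply: closed_comp; first by move=> x _; exact: dot_continuous.
by case: b; [exact: closed_ge|exact: closed_le].
Qed.

Lemma side_cvx b (h : H) : cvx (side b h).
Proof.
have [u [c [lu hE]]] := hyperplaneP h.
move=> x y t /andP[t0 t1] /(sideP b _ lu hE) hx /(sideP b _ lu hE) hy.
by apply/(sideP b _ lu hE); rewrite dotD !dotZ; case: b hx hy => hx hy; nra.
Qed.

Lemma side_interior_ex b (h : H) : (side b h)° !=set0.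
Proof.
have [u [c [lu hE]]] := hyperplaneP h.
have [i [_ ui]] := lexi_first_transverse lu hE.
pose t := if b then (c + 1) / u 0 i else (c - 1) / u 0 i.
pose U := [set x | if b then c < dot u x else dot u x < c].
have oU : open U.
  rewrite (_ : U = dot u @^-1` (if b then [set t | c < t] else [set t | t < c])).
    apply: open_comp; first by move=> x _; exact: dot_continuous.
    by case: (b); [exact: open_gt|exact: open_lt].
  by seteq=> x; rewrite /U /=; case: (b).
exists (t *: delta_mx 0 i); apply: (filterS _ (open_nbhs_nbhs (conj oU _))).
  by move=> x Ux; apply/(sideP b _ lu hE); move: Ux; rewrite /U /=; case: (b) => /ltW.
by rewrite /U /= dotZ dot_delta /t; case: (b); rewrite divfK ?gt_eqF// ?ltrDl// gtrDl ltrN10.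
Qed.

Lemma rcs_side b : rcs (fun h : H => side b h).
Proof.
apply: rcs_regular.
- by move=> h; exact: side_closed.
- by move=> h; apply: cvx_closure_interior; [exact: side_cvx|exact: side_interior_ex].
- move=> q; rewrite (_ : [set h | _] = [set h : H | exists i, first_transverse i h /\ above b i (rpt q) h]).
    apply: meas_ex => i; apply: meas_and; first exact: meas_first_transverse.
    apply: meas_ex => N; apply: rcs_meet rcs_hyperplane _.
    by case: b; exact: compact_line_seg.
  seteq=> h /=.
    have [u [c [lu hE]]] := hyperplaneP h.
    have [i [fi ui]] := lexi_first_transverse lu hE.
    by move=> /(sideP b _ lu hE) hq; exists i; split=> //; apply/(aboveP b _ hE ui).
  have [u [c [lu hE]]] := hyperplaneP h.
  have [i [fi ui]] := lexi_first_transverse lu hE.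
  move=> [j [fj aj]]; rewrite -(first_transverse_inj fi fj) in aj.
  by apply/(sideP b _ lu hE)/(aboveP b _ hE ui).
Qed.

Lemma side_split (h : H) x : side true h x \/ side false h x.
Proof.
have [u [c [lu hE]]] := hyperplaneP h.
have [h1|h1] := leP c (dot u x); [left|right]; apply/(sideP _ _ lu hE) => //.
exact: ltW.
Qed.

Lemma side_both (h : H) x : side true h x -> side false h x -> sval h x.
Proof.
have [u [c [lu hE]]] := hyperplaneP h.
move=> /(sideP true _ lu hE) h1 /(sideP false _ lu hE) h2; rewrite hE /=.
by apply/eqP; rewrite eq_le h1 h2.
Qed.

Lemma sub_side b (h : H) : sval h `<=` side b h.
Proof.
have [u [c [lu hE]]] := hyperplaneP h.
by rewrite hE => x /= hx; apply/(sideP b _ lu hE); rewrite hx; case: b.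
Qed.

Lemma cvx_one_side (C : set E) (h : H) : cvx C -> sval h `&` C = set0 ->
  exists b, C `<=` side b h /\ C `&` side (~~ b) h = set0.
Proof.
move=> cC hC; have [u [c [lu hE]]] := hyperplaneP h.
have nC x : C x -> dot u x <> c.
  move=> Cx e; have hx : (sval h `&` C) x by split=> //; rewrite hE.
  by rewrite hC in hx.
suff [b hb] : exists b : bool, forall x, C x -> if b then c < dot u x else dot u x < c.
  exists b; split=> [x Cx|].
    by apply/(sideP b _ lu hE); have := hb x Cx; case: b {hb} => /ltW.
  seteq=> // x [Cx /(sideP (~~ b) _ lu hE)].
  by have := hb x Cx; case: b {hb} => /= h1 h2; have := lt_le_trans h1 h2; rewrite ltxx.
have [[y [Cy yc]]|h1] := pselect (exists y, C y /\ c < dot u y); last first.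
  exists false => x Cx; rewrite lt_neqAle; apply/andP; split; first by apply/eqP; exact: nC.
  by rewrite leNgt; apply/negP => lt; apply: h1; exists x.
exists true => x Cx; rewrite ltNge; apply/negP => le.
have {le} lt : dot u x < c by rewrite lt_neqAle le andbT; apply/eqP; exact: nC.
pose t := (c - dot u x) / (dot u y - dot u x).
have yx : 0 < dot u y - dot u x by lra.
apply: (@nC (t *: y + (1 - t) *: x)).
  apply: cC => //; apply/andP; split; first by rewrite divr_ge0// ?ltW// subr_gt0.
  by rewrite ler_pdivrMr// mul1r lerB// ltW.
rewrite dotD !dotZ.
have -> : t * dot u y + (1 - t) * dot u x = t * (dot u y - dot u x) + dot u x by ring.
by rewrite /t divfK ?gt_eqF// subrK.
Qed.
End hyperplane_measurable.

#[export] Hint Resolve rcs_hyperplane rcs_side : meas.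

Lemma open_all_seq (T : topologicalType) (m : nat) (P : nat -> set T) :
  (forall i, (i < m)%N -> open (P i)) -> open [set x | forall i, (i < m)%N -> P i x].
Proof.
elim: m => [_|m ih oP].
  by rewrite (_ : [set x | _] = setT); [exact: openT|seteq].
rewrite (_ : [set x | _] = [set x | forall i, (i < m)%N -> P i x] `&` P m).
  by apply: openI; [apply: ih => i im; apply: oP; exact: ltnW|exact: oP].
seteq=> x; first by move=> h; split=> [i im|]; apply: h => //; lia.
by move=> [h hm] i; rewrite ltnS leq_eqVlt => /orP[/eqP ->|/h].
Qed.

(** * Tests of cells by hit and miss data *)

Section tests.
Context {R : realType} {n : nat}.
Local Notation E := 'rV[R]_n.
Local Notation data := (seq (set E) * set E)%type.
Implicit Types (G : data) (t : seq data) (C V W : set E).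

Definition hm G C := (forall i, (i < size G.1)%N -> C `&` nth set0 G.1 i !=set0) /\ C `&` G.2 = set0.

(** With a nonempty list of open sets to be hit, the empty set realizes no data and so passes every
    test: a cell without trace in a window is never rejected. *)
Definition good_data G := [/\ (0 < size G.1)%N, forall i, (i < size G.1)%N -> open (nth set0 G.1 i) & compact G.2].

(** Stated negatively so that the event that all cells pass is the complement of hit events of the
    tessellation, viewed as a closed set of cells. Such events are closed under intersection, by
    concatenation of tests. *)
Definition passes t C := forall j, (j < size t)%N -> ~ hm (nth ([::], set0) t j) C.

Definition good t := forall j, (j < size t)%N -> good_data (nth ([::], set0) t j).

Definition local V t := forall j, (j < size t)%N ->
  (forall i, (i < size (nth ([::], set0) t j).1)%N -> nth set0 (nth ([::], set0) t j).1 i `<=` V) /\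
  (nth ([::], set0) t j).2 `<=` V.

Lemma passes_cat t t' C : passes (t ++ t') C <-> passes t C /\ passes t' C.
Proof.
split=> [h|[h h'] j].
  split=> j js; first by have := h j; rewrite nth_cat js size_cat; apply; lia.
  by have := h (size t + j)%N; rewrite nth_cat (ltnNge (size t + j) (size t)) leq_addr/= addKn size_cat ltn_add2l; apply.
by rewrite nth_cat size_cat; case: (ltnP j (size t)) => js; [move=> _; exact: h|move=> jt; apply: h'; lia].
Qed.

Lemma good_cat t t' : good t -> good t' -> good (t ++ t').
Proof.
move=> h h' j; rewrite nth_cat size_cat; case: (ltnP j (size t)) => js; [move=> _; exact: h|move=> jt; apply: h'; lia].
Qed.

Lemma passes0 t : good t -> passes t set0.
Proof.
move=> gt j js [h _]; have [s0 _ _] := gt j js.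
by have [x []] := h 0%N s0.
Qed.

Lemma passes_local V t C : local V t -> passes t (C `&` V) <-> passes t C.
Proof.
move=> lt; split=> h j js [h1 h2]; apply: (h j js); have [l1 l2] := lt j js; split.
- move=> i is_; have [x [Cx Ox]] := h1 i is_; exists x; split=> //; split=> //; exact: (l1 i).
- by seteq=> // x [[Cx _] Kx]; rewrite -h2.
- by move=> i is_; have [x [[Cx _] Ox]] := h1 i is_; exists x.
- by seteq=> // x [Cx Kx]; rewrite -h2; split=> //; split=> //; exact: l2.
Qed.

Lemma local_sub V V' t : V `<=` V' -> local V t -> local V' t.
Proof.
move=> VV lt j js; have [l1 l2] := lt j js; split=> [i is_|]; last exact: subset_trans l2 VV.
exact: subset_trans (l1 i is_) VV.
Qed.

Lemma meas_passes d (Om : measurableType d) (C : Om -> set E) t : rcs C -> good t ->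
  measurable [set o | passes t (C o)].
Proof.
move=> rC gt; apply: meas_all => j; apply: meas_imp => js.
have [_ oG cG] := gt j js; apply: meas_not; apply: meas_and; last exact: rC.2.
by meas.
Qed.

(** Adding the interior of [W] to the sets to be hit exempts the cells that do not reach the
    interior of [W]. *)
Definition trace_data W G : data := (W° :: map (fun O : set E => O `&` W°) G.1, G.2 `&` W).
Definition trace_test W t : seq data := map (trace_data W) t.

Definition dilate_data (c : R) G : data := (map (dilate c^-1) G.1, dilate c^-1 G.2).
Definition dilate_test (c : R) t : seq data := map (dilate_data c) t.

Lemma good_trace W t : compact W -> good t -> good (trace_test W t).
Proof.
move=> cW gt j; rewrite size_map => js; rewrite (nth_map ([::], set0))//.
have [s0 oG cG] := gt j js; split=> //=.
  case=> [_|i]; first exact: open_interior.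
  rewrite /= ltnS size_map => is_; rewrite (nth_map set0)//.
  by apply: openI; [exact: oG|exact: open_interior].
apply: (subclosed_compact _ cG) => [|x []//].
by apply: closedI; apply: compact_closed => //; exact: norm_hausdorff.
Qed.

Lemma local_trace W t : local W (trace_test W t).
Proof.
move=> j; rewrite size_map => js; rewrite (nth_map ([::], set0))//=; split.
  case=> [_|i]; first exact: interior_subset.
  rewrite /= ltnS size_map => is_; rewrite (nth_map set0)//.
  by move=> x [_ /interior_subset].
by move=> x [].
Qed.

Lemma mem_dilate (c : R) C x : c != 0 -> dilate c C x <-> C (c^-1 *: x).
Proof.
move=> c0; split=> [[y Cy <-]|Cx]; first by rewrite scalerA mulVf// scale1r.
by exists (c^-1 *: x) => //; rewrite scalerA divff// scale1r.
Qed.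

Lemma hm_dilate (c : R) G C : c != 0 -> hm (dilate_data c G) C <-> hm G (dilate c C).
Proof.
move=> c0; have ci0 : c^-1 != 0 by rewrite invr_eq0.
split=> -[h1 h2]; split.
- move=> i is_; have := h1 i; rewrite size_map => /(_ is_); rewrite (nth_map set0)//.
  by move=> [x [Cx [y Oy yx]]]; exists y; split=> //; apply/mem_dilate => //; rewrite yx.
- seteq=> // x [/(mem_dilate _ _ c0) Cx Kx].
  have : (C `&` (dilate_data c G).2) (c^-1 *: x) by split=> //; exists x.
  by rewrite h2.
- move=> i; rewrite size_map => is_; rewrite (nth_map set0)//.
  have [x [/(mem_dilate _ _ c0) Cx Ox]] := h1 i is_; exists (c^-1 *: x); split=> //.
  by exists x.
- seteq=> // x [Cx [y Ky yx]].
  have : (dilate c C `&` G.2) y by split=> //; apply/mem_dilate => //; rewrite yx.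
  by rewrite h2.
Qed.

Lemma passes_dilate (c : R) t C : c != 0 -> passes (dilate_test c t) C <-> passes t (dilate c C).
Proof.
move=> c0; split=> h j js.
  have := h j; rewrite size_map => /(_ js); rewrite (nth_map ([::], set0))// => nh hG.
  by apply: nh; apply/hm_dilate.
rewrite size_map in js; rewrite (nth_map ([::], set0))//.
by move/(hm_dilate _ _ c0); exact: h.
Qed.

Lemma open_dilate (c : R) C : c != 0 -> open C -> open (dilate c C).
Proof.
move=> c0 oC; rewrite (_ : dilate c C = (fun x => c^-1 *: x) @^-1` C).
  by apply: open_comp => // x _; exact: scale_continuous_rV.
by seteq=> x /(mem_dilate _ _ c0).
Qed.

Lemma compact_dilate (c : R) C : compact C -> compact (dilate c C).
Proof.
move=> cC; apply: continuous_compact => //; apply: continuous_subspaceT.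
exact: scale_continuous_rV.
Qed.

Lemma good_dilate (c : R) t : c != 0 -> good t -> good (dilate_test c t).
Proof.
move=> c0 gt j; rewrite size_map => js; rewrite (nth_map ([::], set0))//.
have [s0 oG cG] := gt j js; split; rewrite /= ?size_map//; last exact: compact_dilate.
move=> i is_; rewrite (nth_map set0)//; apply: open_dilate; last exact: oG.
by rewrite invr_eq0.
Qed.

Lemma local_dilate (c : R) V t : c != 0 -> local V t -> local (dilate c^-1 V) (dilate_test c t).
Proof.
move=> c0 lt j; rewrite size_map => js; rewrite (nth_map ([::], set0))//.
have [l1 l2] := lt j js; split=> /=.
  move=> i; rewrite size_map => is_; rewrite (nth_map set0)//.
  by move=> _ [x Ox <-]; exists x => //; exact: (l1 i).
by move=> _ [x Ox <-]; exists x => //; exact: l2.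
Qed.

(** By convexity, a cell that meets the interior of [W] has a trace with nonempty interior, and this
    trace lies in the closure of its interior. An open set hit by the trace is therefore also hit
    within the interior of [W]. *)
Lemma passes_trace W t C : polytope W -> polytope C -> good t ->
  passes (trace_test W t) C <-> ((C `&` W)° !=set0 -> passes t (C `&` W)).
Proof.
move=> pW pC gt.
have CW : C `&` W° !=set0 -> (C `&` W)° !=set0.
  move=> [x [Cx Wx]].
  have := cvx_closure_interior (polytope_cvx pC) pC.2 Cx.
  move=> /(_ W° (open_nbhs_nbhs (conj (@open_interior _ W) Wx))) [y [Cy Wy]].
  by exists y; apply: filterS2 Cy Wy => z Cz Wz; split=> //; exact: interior_subset.
have cl : (C `&` W)° !=set0 -> C `&` W `<=` closure (C `&` W)°.
  apply: cvx_closure_interior => x y u u01 [Cx Wx] [Cy Wy]; split; exact: polytope_cvx.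
have hE G : good_data G -> (C `&` W)° !=set0 ->
    hm (trace_data W G) C <-> hm G (C `&` W).
  move=> [s0 oG cG] ne; split=> -[h1 h2]; split.
  - move=> i is_; have := h1 i.+1; rewrite /= ltnS size_map => /(_ is_); rewrite (nth_map set0)//.
    by move=> [x [Cx [Ox /interior_subset Wx]]]; exists x.
  - by seteq=> // x [[Cx Wx] Kx]; rewrite -h2.
  - case=> [_|i] /=.
      have [x Cx] := ne; exists x; split; first by have [] := interior_subset Cx.
      by apply: filterS Cx => z [].
    rewrite ltnS size_map => is_; rewrite (nth_map set0)//.
    have [x [CWx Ox]] := h1 i is_.
    have [y [CWy Oy]] := cl ne x CWx _ (open_nbhs_nbhs (conj (oG i is_) Ox)).
    exists y; split; first by have [] := interior_subset CWy.
    by split=> //; apply: filterS CWy => z [].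
  - by seteq=> // x [Cx [Kx Wx]]; rewrite -h2.
split=> h.
  move=> ne j js hG; have := h j; rewrite size_map => /(_ js); rewrite (nth_map ([::], set0))//.
  by apply; apply/hE => //; exact: gt.
move=> j; rewrite size_map => js; rewrite (nth_map ([::], set0))// => hG.
have ne : (C `&` W)° !=set0 by apply: CW; exact: (hG.1 0%N isT).
by apply: (h ne j js); apply/hE => //; exact: gt.
Qed.
End tests.

(** * The sigma-field of tessellations is generated by tests *)

Section tess_measurable.
Context {R : realType} {n : nat} (D : @tessellable R n).
Local Notation E := 'rV[R]_n.
Local Notation X := (fell_in D).
Local Notation bpiece := (piece (fun F : X => sval F) (@qball R n) (@qcball R n)).

Lemma tess_cell (T : tess D) C : sval T C -> polytope C /\ C `<=` D.
Proof.
by have [_ _ pT _ UT] := svalP T => TC; split; [exact: pT|rewrite -UT => x Cx; exists C].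
Qed.

Lemma tess_fell (T : tess D) C : sval T C -> exists F : X, sval F = C.
Proof.
move=> /tess_cell[pC CD].
have h : [/\ closed C, C !=set0 & C `<=` D].
  split=> //; first exact: polytope_closed.
  by have [x Cx] := pC.2; exists x; exact: interior_subset.
by exists (exist _ C h).
Qed.

Lemma meas_tess_hit (G : set X) : open G ->
  measurable [set T : tess D | exists F : X, sval T (sval F) /\ G F].
Proof.
move=> oG.
pose U := [set Z : fell X | sval Z `&` G !=set0].
have oU : open U.
  exists [set U]; last by rewrite bigcup_set1.
  move=> _ ->; exists [fset U]%fset; last by rewrite set_fset1 bigcap_set1.
  by move=> B; rewrite inE => /eqP ->; apply/mem_set; left; exists G.
have mU : measurable (U : set (fell_borel X)) by exact: sub_sigma_algebra.
exists U => //; rewrite setTI; seteq=> T /=.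
  by move=> [F [TF GF]]; exists F.
by move=> [F [TF GF]]; exists F.
Qed.

Lemma open_hm (G : seq (set E) * set E) : good_data G -> open [set F : X | hm G (sval F)].
Proof.
move=> [_ oG cG].
apply: openI; last by apply: open_hit_or_miss; right; exists G.2.
apply: (@open_all_seq X (size G.1) (fun i => [set F : X | sval F `&` nth set0 G.1 i !=set0])).
by move=> i is_; apply: open_hit_or_miss; left; exists (nth set0 G.1 i) => //; exact: oG.
Qed.

Definition tests_ev (t : seq (seq (set E) * set E)) : set (tess D) :=
  [set T | forall C, sval T C -> passes t C].

Lemma meas_tests_ev t : good t -> measurable (tests_ev t).
Proof.
move=> gt.
rewrite (_ : tests_ev t = [set T : tess D | forall j, (j < size t)%N -> ~ exists F : X, sval T (sval F) /\
   [set F : X | hm (nth ([::], set0) t j) (sval F)] F]).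
  apply: meas_all => j; apply: meas_imp => js.
  by apply: meas_not; apply: meas_tess_hit; apply: open_hm; exact: gt.
seteq=> T h; first by move=> j js [F [TF hF]]; exact: (h _ TF j js).
by move=> C TC j js hC; apply: (h j js); have [F FC] := tess_fell TC; exists F; rewrite /= FC; split.
Qed.

Lemma fell_in_open (U : set X) : open U ->
  U = \bigcup_(p in [set p | bpiece p `<=` U]) bpiece p.
Proof.
move=> oU; apply: subbase_pieces.
- exact: open_qball.
- exact: sub_qcball.
- by move=> G x oG Gx; have [p [_ px pG]] := qball_base oG Gx; exists p.
- by move=> F; have [] := svalP F.
- exact: oU.
Qed.

(** The interior of [D], which every cell meets, keeps the list of open sets nonempty even when
    [p.1] is empty. *)
Definition piece_data (p : seq ('rV[rat]_n * rat) * seq ('rV[rat]_n * rat)) : seq (set E) * set E :=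
  ((D : set E)° :: map (@qball R n) p.1, [set x | exists2 i, i \in p.2 & qcball i x]).

Lemma good_piece_data p : good_data (piece_data p).
Proof.
split=> //=.
  case=> [_|i]; first exact: open_interior.
  rewrite /= ltnS size_map => is_; rewrite (nth_map (0, 0))//; exact: open_qball.
case: p => _ s /=; elim: s => [|i s ih].
  by rewrite (_ : [set x | _] = set0); [exact: compact0|seteq=> // x []].
rewrite (_ : [set x | _] = qcball i `|` [set x | exists2 i, i \in s & qcball i x]).
  by apply: compactU => //; exact: compact_qcball.
seteq=> x.
  by move=> [j]; rewrite inE => /orP[/eqP ->|js] jx; [left|right; exists j].
by move=> [ix|[j js jx]]; [exists i; rewrite ?inE ?eqxx|exists j; rewrite ?inE ?js ?orbT].
Qed.

Lemma hm_piece p (T : tess D) (F : X) : sval T (sval F) -> hm (piece_data p) (sval F) <-> bpiece p F.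
Proof.
move=> /tess_cell [pF FD]; split=> -[h1 h2]; split.
- move=> i ip; have := h1 (index i p.1).+1; rewrite /= ltnS size_map index_mem => /(_ ip).
  by rewrite (nth_map (0, 0)) ?index_mem// nth_index.
- by move=> i ip; seteq=> // x [Fx ix]; rewrite -h2; split=> //; exists i.
- case=> [_|i] /=.
    have [x Fx] := pF.2; exists x; split; first exact: interior_subset.
    by apply: filterS Fx.
  rewrite ltnS size_map => is_; rewrite (nth_map (0, 0))//; apply: h1; exact: mem_nth.
- by seteq=> // x [Fx [i ip ix]]; rewrite -(h2 i ip).
Qed.

Lemma open_bpiece p : open (bpiece p).
Proof.
have -> : bpiece p = [set F : X | forall i, (i < size p.1)%N -> [set F : X | sval F `&` qball (nth (0, 0) p.1 i) !=set0] F] `&`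
    [set F : X | forall i, (i < size p.2)%N -> [set F : X | sval F `&` qcball (nth (0, 0) p.2 i) = set0] F].
  seteq=> F [h1 h2]; split.
  - by move=> i is_; apply: h1; exact: mem_nth.
  - by move=> i is_; apply: h2; exact: mem_nth.
  - by move=> i ip; have := h1 (index i p.1); rewrite index_mem /= nth_index//; apply.
  - by move=> i ip; have := h2 (index i p.2); rewrite index_mem /= nth_index//; apply.
apply: openI; apply: open_all_seq => i is_; apply: open_hit_or_miss.
  by left; exists (qball (nth (0, 0) p.1 i)) => //; exact: open_qball.
by right; exists (qcball (nth (0, 0) p.2 i)) => //; exact: compact_qcball.
Qed.

Lemma fell_open (U : set (fell X)) : open U ->
  U = \bigcup_(p in [set p | piece (fun Z : fell X => sval Z) (fun q => bpiece q) (fun q => bpiece q) p `<=` U])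
        piece (fun Z : fell X => sval Z) (fun q => bpiece q) (fun q => bpiece q) p.
Proof.
move=> oU; apply: subbase_pieces.
- exact: open_bpiece.
- by move=> p F.
- by move=> G F oG; rewrite (fell_in_open oG) => -[p pG pF]; exists p; split=> //; rewrite -(fell_in_open oG).
- by move=> Z; exact: (svalP Z).
- exact: oU.
Qed.

Definition tests_class : set (set (tess D)) := [set tests_ev t | t in good].

Lemma tests_class_setI : setI_closed tests_class.
Proof.
move=> _ _ [t gt <-] [t' gt' <-]; exists (t ++ t'); first exact: good_cat.
seteq=> T.
  by move=> h; split=> C TC; have /passes_cat[] := h C TC.
by move=> [h h'] C TC; apply/passes_cat; split; [exact: h|exact: h'].
Qed.

(** Second countability at two levels: open sets of cells are countable unions of pieces, so open
    sets of closed sets of cells are countable unions of pieces of pieces. The hit events involved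
    are complements of test events. Laws of tessellations are then determined by the probabilities
    of tests. *)
Lemma meas_testsE : @measurable _ (tess D) = <<s tests_class >>.
Proof.
seteq; last first.
  apply: smallest_sub; first exact: sigma_algebra_measurable.
  by move=> _ [t gt <-]; exact: meas_tests_ev.
pose T' := g_sigma_algebraType tests_class.
have mhit p : @measurable _ T' [set T : tess D | exists F : X, sval T (sval F) /\ bpiece p F].
  have -> : [set T : tess D | exists F : X, sval T (sval F) /\ bpiece p F] = ~` tests_ev [:: piece_data p].
    seteq=> T.
      move=> [F [TF pF]] h; apply: (h _ TF 0%N isT); exact/(hm_piece p TF).
    move=> h; apply: contrapT => nF; apply: h => C TC [] // _ hC.
    have [F FC] := tess_fell TC; rewrite -FC in TC hC.
    by apply: nF; exists F; split=> //; exact/(hm_piece p TC).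
  apply: measurableC; apply: sub_sigma_algebra; exists [:: piece_data p] => //.
  by case=> // _; exact: good_piece_data.
have mf : mfunT (@fell_of R n D : T' -> fell_borel X).
  apply: (@measurability _ _ T' (fell_borel X) setT (@fell_of R n D) [set A : set (fell X) | open A]) => // _ [U oU <-].
  rewrite setTI (fell_open oU) preimage_bigcup.
  rewrite (_ : \bigcup_(p in _) _ = \bigcup_p [set T : T' | (piece (fun Z : fell X => sval Z) (fun q => bpiece q) (fun q => bpiece q) p `<=` U) /\
     piece (fun Z : fell X => sval Z) (fun q => bpiece q) (fun q => bpiece q) p (fell_of (T : tess D))]).
    apply: meas_bigcup => p; apply: meas_and; first meas.
    apply: meas_and; apply: meas_all => q; apply: meas_imp => _.
      have := mhit q; meas.
    rewrite (_ : [set x | _] = ~` [set T : T' | exists F : X, sval (T : tess D) (sval F) /\ bpiece q F]).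
      by meas.
    seteq=> T /=.
      by move=> e [F [TF pF]]; have : set0 F by rewrite -e.
    by move=> h; seteq=> // F [TF pF]; apply: h; exists F.
  by seteq=> o; [move=> [p pA po]; exists p|move=> [p _ [pA po]]; exists p].
move=> A [B mB <-]; have := mf measurableT B mB; rewrite setTI => h.
exact: h.
Qed.
End tess_measurable.

#[export] Hint Resolve meas_passes meas_tests_ev meas_transverse meas_first_transverse : meas.

(** * Translations and dilations of hyperplanes, and the driving measure *)

Section set_sections.
Context {R : realType} d1 d2 {T1 : measurableType d1} {T2 : measurableType d2}.
Implicit Types U : set (T1 * T2).

Lemma meas_section1 U x : measurable U -> measurable [set y | U (x, y)].
Proof. by meas. Qed.

Lemma xsection_set U x : xsection U x = [set y | U (x, y)].
Proof. by rewrite /xsection; seteq=> y; [move/set_mem|move/mem_set]. Qed.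

Lemma meas_measure_section (m2 : {sigma_finite_measure set T2 -> \bar R}) U : measurable U ->
  mfunT (fun x => m2 [set y | U (x, y)]).
Proof.
move=> mU; have := measurable_fun_xsection m2 mU.
by rewrite (_ : (_ \o _) = (fun x => m2 [set y | U (x, y)]))//; apply/funext => x /=; rewrite xsection_set.
Qed.

Lemma fubini_sets (m1 : {sigma_finite_measure set T1 -> \bar R}) (m2 : {sigma_finite_measure set T2 -> \bar R}) U :
  measurable U -> (\int[m1]_x m2 [set y | U (x, y)] = \int[m2]_y m1 [set x | U (x, y)])%E.
Proof.
move=> mU; transitivity (\int[m1]_x \int[m2]_y (\1_U (x, y))%:E)%E.
  apply: eq_integral => x _.
  rewrite (_ : (fun y => (\1_U (x, y))%:E) = (fun y => (\1_[set t | U (x, t)] y)%:E)).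
    by rewrite integral_indic ?setIT//; meas.
  apply/funext => y; rewrite !indicE (_ : ((x, y) \in U) = (y \in [set t | U (x, t)]))//.
rewrite (fubini_tonelli (m1 := m1) (m2 := m2) (fun p => (\1_U p)%:E)).
- apply: eq_integral => y _.
  rewrite (_ : (fun x => (\1_U (x, y))%:E) = (fun x => (\1_[set t | U (t, y)] x)%:E)).
    by rewrite integral_indic ?setIT//; meas.
  apply/funext => x; rewrite !indicE (_ : ((x, y) \in U) = (x \in [set t | U (t, y)]))//.
- by meas.
- by move=> p; rewrite lee_fin.
Qed.
End set_sections.

Section lebesgue_affine.
Context {R : realType}.
Local Notation RR := (measurableTypeR R).

Lemma lebesgue_affine (a b : R) (A : set R) : 0 < a -> measurable (A : set RR) ->
  lebesgue_measure ((fun t : R => a * t + b) @^-1` A) = ((a^-1)%:E * lebesgue_measure (A : set RR))%E.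
Proof.
move=> a0 mA; pose f : RR -> RR := fun t : R => a * t + b.
have mf : measurable_fun [set: RR] f by meas.
have [m mE] : exists m : {measure set RR -> \bar R}, forall B : set RR, m B = (a%:E * lebesgue_measure (f @^-1` B))%E.
  by unshelve eexists (mscale (NngNum (ltW a0)) (pushforward (lebesgue_measure : {measure set RR -> \bar R}) f)); [exact: mf|].
have h : forall B : set RR, measurable B -> lebesgue_measure B = m B.
  apply: lebesgue_measure_unique => _ [[x y] _ <-].
  rewrite mE.
  have -> : f @^-1` `]x, y]%classic = `](x - b) / a, (y - b) / a]%classic.
    seteq=> t; rewrite /= !in_itv/= ltr_pdivrMr// ler_pdivlMr// ltrBlDr lerBrDr [t * a]mulrC;
      by move=> ->.
  rewrite !lebesgue_measure_itv/= !lte_fin ltr_pM2r ?invr_gt0// ltrD2r.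
  case: ifP => _; last by rewrite mule0.
  by rewrite -!EFinB -EFinM; congr EFin; field; rewrite gt_eqF.
by rewrite (h A mA) mE muleA -EFinM mulVf ?gt_eqF// mul1e.
Qed.
End lebesgue_affine.

Section hyperplane_maps.
Context {R : realType} {l : nat}.
Local Notation E := 'rV[R]_l.+1.
Local Notation H := (hyperplane R l).
Local Notation RR := (measurableTypeR R).
Implicit Types (h : H) (v : E).

Lemma transl_ex v h : exists u c, u != 0 /\ [set x + v | x in sval h] = [set x | dot u x = c].
Proof.
have [u [c [u0 ->]]] := svalP h; exists u, (c + dot u v); split=> //.
seteq=> [_ [x /= <- <-]|x /= e]; first by rewrite dotD.
by exists (x - v); rewrite ?subrK//= dotB e addrK.
Qed.

Definition transl v h : H := exist _ _ (transl_ex v h).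

Lemma mem_transl v h x : sval (transl v h) x <-> sval h (x - v).
Proof. by split=> [[y hy <-]|hx]; [rewrite addrK|exists (x - v); rewrite ?subrK]. Qed.

Lemma dil_ex (a : R) h : a != 0 -> exists u c, u != 0 /\ dilate a (sval h) = [set x | dot u x = c].
Proof.
move=> a0; have [u [c [u0 hE]]] := svalP h; exists u, (a * c); split=> //.
rewrite hE; seteq=> [_ [x /= <- <-]|x /= e]; first by rewrite dotZ.
by apply/mem_dilate => //=; rewrite dotZ e mulKf.
Qed.

Definition dil (a : R) h : H := match pselect (a != 0) with
  | left a0 => exist _ _ (dil_ex h a0) | right _ => h end.

Lemma mem_dil (a : R) h x : a != 0 -> sval (dil a h) x <-> sval h (a^-1 *: x).
Proof. by move=> a0; rewrite /dil; case: pselect => // ?; exact: mem_dilate. Qed.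

Lemma hyperplane_eq h h' : (forall x, sval h x <-> sval h' x) -> h = h'.
Proof. by move=> e; apply: sval_injective; seteq=> x /e. Qed.

Lemma transl_normal v h u c : sval h = [set x | dot u x = c] ->
  sval (transl v h) = [set x | dot u x = c + dot u v].
Proof.
move=> hE; seteq=> x; first by move=> /mem_transl; rewrite hE /= dotB => <-; lra.
by move=> /= e; apply/mem_transl; rewrite hE /= dotB e addrK.
Qed.

Lemma dil_normal a h u c : a != 0 -> sval h = [set x | dot u x = c] ->
  sval (dil a h) = [set x | dot u x = a * c].
Proof.
move=> a0 hE; seteq=> x.
  by move=> /(mem_dil _ _ a0); rewrite hE /= dotZ => <-; rewrite mulVKf.
by move=> /= e; apply/mem_dil => //; rewrite hE /= dotZ e mulKf.
Qed.

Lemma first_transverseP i h u c : sval h = [set x | dot u x = c] ->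
  first_transverse i h <-> u 0 i != 0 /\ forall j : 'I_l.+1, (j < i)%N -> u 0 j = 0.
Proof.
move=> hE; split=> -[h1 h2]; split; first exact/(transverseP _ hE).
- by move=> j ji; apply/eqP/negPn/negP => /(transverseP j hE); exact: h2.
- exact/(transverseP _ hE).
- by move=> j ji /(transverseP _ hE); rewrite h2// eqxx.
Qed.

Lemma first_transverse_transl i v h : first_transverse i (transl v h) <-> first_transverse i h.
Proof.
have [u [c [_ hE]]] := hyperplaneP h.
by rewrite (first_transverseP i hE) (first_transverseP i (transl_normal v hE)).
Qed.

Local Notation "'e_ i" := (delta_mx 0 i : E).

Lemma intercept i h : first_transverse i h -> exists tau : R, forall t, sval h (t *: 'e_i) <-> t = tau.
Proof.
have [u [c [_ hE]]] := hyperplaneP h.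
move=> /(first_transverseP i hE)[ui _]; exists (c / u 0 i) => t; rewrite hE /= dotZ dot_delta.
by split=> [<-|->]; [rewrite mulfK|rewrite divfK].
Qed.

(** A dilate of [h] is parallel to [h], hence a translate along any axis that crosses it; the
    crossing point moves from [tau] to [a * tau]. *)
Lemma dil_transl i a h tau : a != 0 -> first_transverse i h -> sval h (tau *: 'e_i) ->
  dil a h = transl (((a - 1) * tau) *: 'e_i) h.
Proof.
move=> a0; have [u [c [_ hE]]] := hyperplaneP h.
move=> /(first_transverseP i hE)[ui _]; rewrite hE /= dotZ dot_delta => e.
apply: sval_injective; rewrite (dil_normal a0 hE) (transl_normal _ hE).
rewrite dotZ dot_delta; seteq=> x /= ->; rewrite -e; ring.
Qed.

Lemma translD v w h : transl v (transl w h) = transl (v + w) h.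
Proof.
apply: hyperplane_eq => x; rewrite (mem_transl v) (mem_transl w) (mem_transl (v + w)).
by rewrite opprD addrA.
Qed.

Lemma dil_translZ a v h : a != 0 -> dil a (transl v h) = transl (a *: v) (dil a h).
Proof.
move=> a0; apply: hyperplane_eq => x.
rewrite (mem_dil _ _ a0) (mem_transl v) (mem_transl (a *: v)) (mem_dil _ _ a0).
by rewrite scalerBr scalerA mulVf// scale1r.
Qed.

Lemma transl0 h : transl 0 h = h.
Proof. by apply: hyperplane_eq => x; rewrite (mem_transl 0) subr0. Qed.

Lemma meas_dil a : a != 0 -> mfunT (dil a).
Proof.
move=> a0; apply: meas_hyperplane_map; split; first by move=> h; exact: hyperplane_closed.
move=> K cK; have := rcs_hyperplane.2 _ (@compact_dilate R l.+1 a^-1 K cK).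
congr (measurable _); seteq=> h e; seteq=> // x [hx Kx].
  have : (sval h `&` dilate a^-1 K) (a^-1 *: x) by split; [exact/mem_dil|exists x].
  by rewrite e.
have ai0 : a^-1 != 0 by rewrite invr_eq0.
have : (sval (dil a h) `&` K) (a *: x).
  split; first by apply/mem_dil => //; rewrite scalerA mulVf// scale1r.
  by move/(mem_dilate _ _ ai0): Kx; rewrite invrK.
by rewrite e.
Qed.

(** To miss a compact set is an open condition on the translation parameter, so it holds on a
    rational interval around [t]. The translates of [K] by the opposite parameters fill one compact
    set, and the condition becomes that [h] misses it. *)
Lemma meas_transl i : mfunT (fun p : H * RR => transl ((p.2 : R) *: 'e_i) p.1).
Proof.
apply: meas_hyperplane_map; split; first by move=> p; exact: hyperplane_closed.
move=> K cK.
pose Kpq (p q : R) : set E := [set z.1 - z.2 *: 'e_i | z in K `*` `[p, q]%classic].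
have cKpq p q : compact (Kpq p q).
  apply: continuous_compact; last by apply: compact_setX => //; exact: segment_compact.
  apply: continuous_subspaceT => z.
  apply: (@cvgB _ E _ (nbhs z) _ (fun z : E * R => z.1) (fun z : E * R => z.2 *: 'e_i)).
    exact: cvg_fst.
  apply: (@cvgZr_tmp _ E _ (nbhs z) _ (fun z : E * R => z.2) z.2 ('e_i)); exact: cvg_snd.
rewrite (_ : [set o | _] = [set o : H * RR | exists pq : rat * rat,
    (`[ratr pq.1 : R, ratr pq.2]%classic (o.2 : R)) /\ sval o.1 `&` Kpq (ratr pq.1) (ratr pq.2) = set0]).
  apply: meas_ex => pq; apply: meas_and; first by meas.
  exact: (meas_preim measurable_fst (rcs_hyperplane.2 _ _)).
seteq=> -[h t] /=; last first.
  move=> [[p q] [/= tpq e]]; seteq=> // x [/mem_transl hx Kx].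
  have : (sval h `&` Kpq (ratr p) (ratr q)) (x - t *: 'e_i) by split=> //; exists (x, t).
  by rewrite e.
have [u [c [_ hE]]] := hyperplaneP h.
move=> e; pose D := [set dot u x - c | x in K].
have cD : closed D.
  apply: compact_closed; first exact: norm_hausdorff.
  apply: continuous_compact => //; apply: continuous_subspaceT => x.
  apply: (@cvgB _ R _ (nbhs x) _ (dot u) (cst c) (dot u x) c); first exact: dot_continuous.
  exact: cvg_cst.
have nD : (~` ((fun s : R => s * u 0 i) @^-1` D)) t.
  move=> [x Kx xt]; have : (sval (transl (t *: 'e_i) h) `&` K) x.
    by split=> //; apply/mem_transl; rewrite hE /= dotB dotZ dot_delta -xt; ring.
  by rewrite e.
have oD : open (~` ((fun s : R => s * u 0 i) @^-1` D)).
  apply: closed_openC; apply: closed_comp => // s _; exact: mulrr_continuous.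
have /nbhs_ballP[d0 /= d00 hd] := open_nbhs_nbhs (conj oD nD).
have lt1 : t - d0 < t by rewrite gtrDl oppr_lt0.
have lt2 : t < t + d0 by lra.
have [p hp] := rat_in_itvoo lt1; have [q hq] := rat_in_itvoo lt2.
move: hp hq; rewrite !in_itv/= => /andP[p1 p2] /andP[q1 q2].
exists (p, q); split; first by rewrite /= in_itv/= !ltW.
seteq=> // y [hy [[x s] [/= Kx]]]; rewrite in_itv/= => /andP[s1 s2] xs.
have : (~` ((fun s : R => s * u 0 i) @^-1` D)) s.
  by apply: hd; rewrite -ball_normE /= ltr_distl; apply/andP; split; lra.
apply; exists x => //; move: hy; rewrite hE -xs /= dotB dotZ dot_delta => <-; ring.
Qed.

(** A fundamental domain for the integer translations along the i-th axis, among the hyperplanes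
    whose first transverse axis is that one. *)
Definition unit_slab (i : 'I_l.+1) : set H :=
  [set h | first_transverse i h /\ exists2 t : R, 0 <= t < 1 & sval h (t *: 'e_i)].

Lemma meas_unit_slab i : measurable (unit_slab i).
Proof.
apply: meas_and; first meas.
rewrite (_ : [set h | _] = [set h : H | exists N : nat, sval h `&` line_seg 0 i 0 (1 - N.+1%:R^-1) !=set0]).
  apply: meas_ex => N; apply: rcs_meet rcs_hyperplane _; exact: compact_line_seg.
seteq=> h /=.
  move=> [t /andP[t0 t1] ht].
  have [N hN] := ltr_add_invr t1; exists N; exists (t *: 'e_i); split=> //.
  exists t; last by rewrite add0r.
  by rewrite /= in_itv/= t0/=; rewrite lerBrDr ltW.
move=> [N [y [hx [t]]]]; rewrite /= in_itv/= add0r => /andP[t0 t1] tx; exists t; last by rewrite tx.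
rewrite t0/= (le_lt_trans t1)// gtrDl oppr_lt0 invr_gt0 ltr0n//.
Qed.

Lemma meas_slab_fiber i (A : set H) : measurable A ->
  measurable [set p : H * RR | unit_slab i p.1 /\ A (transl ((- (p.2 : R)) *: 'e_i) p.1)].
Proof.
move=> mA; have h : mfunT (fun p : H * RR => (p.1, (- (p.2 : R) : RR))) by meas.
exact: meas_and (meas_preim measurable_fst (meas_unit_slab i)) (meas_preim (measurableT_comp (meas_transl i) h) mA).
Qed.

Variable L : {sigma_finite_measure set H -> \bar R}.
Hypothesis Ltr : translation_invariant L.

Lemma transl_invariant v (A : set H) : measurable A -> L [set h | A (transl v h)] = L A.
Proof.
move=> mA; rewrite -(Ltr (- v) mA); congr (L _); seteq=> h /=.
  move=> Ah; exists (transl v h) => //; have /(congr1 sval) := translD (- v) v h.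
  by rewrite addNr transl0 => <-.
move=> [k Ak hE]; suff -> : transl v h = k by [].
apply: hyperplane_eq => x; rewrite (mem_transl v) hE; split.
  by move=> [y ky /addIr <-] //; lia.
by move=> kx; exists x.
Qed.

Local Notation leb := (@lebesgue_measure R).

(* Integration over the hyperplanes meeting the i-th axis, first along the axis. *)
Lemma slab_disintegration i (A : set H) : measurable A ->
  L (A `&` [set h | first_transverse i h]) =
  (\int[L]_h leb [set t : R | unit_slab i h /\ A (transl ((- t) *: 'e_i) h)])%E.
Proof.
move=> mA; have mQ := meas_unit_slab i; have mF := @meas_first_transverse R l i.
have mt := meas_transl i.
pose S := [set p : H * RR | (A p.1 /\ first_transverse i p.1) /\ unit_slab i (transl ((p.2 : R) *: 'e_i) p.1)].
pose S' := [set p : H * RR | unit_slab i p.1 /\ A (transl ((- (p.2 : R)) *: 'e_i) p.1)].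
have mS : measurable S.
  exact: meas_and (meas_preim measurable_fst (measurableI _ _ mA mF)) (meas_preim mt mQ).
have mS' : measurable S' := meas_slab_fiber i mA.
transitivity (\int[L]_h leb [set t | S (h, t)])%E.
  transitivity (\int[L]_h (\1_(A `&` [set h | first_transverse i h]) h)%:E)%E.
    by rewrite integral_indic ?setIT//; meas.
  apply: eq_integral => h _; rewrite indicE.
  have [hA|hA] := pselect ((A `&` [set h | first_transverse i h]) h); last first.
    rewrite memNset//= (_ : [set t | _] = set0) ?measure0//.
    by seteq=> // t [].
  rewrite mem_set//=; have [tau tauP] := intercept hA.2.
  rewrite (_ : [set t | _] = `[- tau, 1 - tau[%classic).
    rewrite lebesgue_measure_itv/= lte_fin ltrD2r ltrN10 oppr_lt0 || rewrite lebesgue_measure_itv/= lte_fin.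
    have -> : - tau < 1 - tau by lra.
    by rewrite -EFinB opprK subrK.
  seteq=> t; rewrite /= in_itv/=.
    move=> [_ [_ [s s01 /mem_transl]]]; rewrite -scalerBl => /tauP e.
    by rewrite /= in e; move: s01; lra.
  move=> ht; split=> //; split; first by apply/first_transverse_transl; case: hA.
  exists (tau + t); first by lra.
  by apply/mem_transl; rewrite -scalerBl addrK; apply/tauP.
rewrite (fubini_sets L leb mS); apply: esym; rewrite (fubini_sets L leb mS'); apply: esym; apply: eq_integral => t _.
have mSt : measurable [set h | S' (h, t)] by exact: (meas_preim (measurable_pair2 t) mS').
rewrite -(transl_invariant (t *: 'e_i) mSt); congr (L _); seteq=> h; rewrite /S /S' /=.
  move=> [[Ah fh] Qh]; split=> //.
  by rewrite translD scaleNr addNr transl0.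
rewrite translD scaleNr addNr transl0 => -[[fh hh] Ah]; split=> //; split=> //.
by move/first_transverse_transl: fh.
Qed.

Lemma slab_null i (A : set H) : measurable A ->
  (forall h, first_transverse i h -> countable [set t : R | A (transl (t *: 'e_i) h)]) ->
  L (A `&` [set h | first_transverse i h]) = 0%E.
Proof.
move=> mA cA; rewrite (slab_disintegration i mA); apply: integral0_eq => h _.
have [Qh|Qh] := pselect (unit_slab i h); last first.
  by rewrite (_ : [set t | _] = set0) ?measure0//; set_eq.
apply: countable_lebesgue_measure0.
have c : countable [set - t | t in [set t : R | A (transl (t *: 'e_i) h)]].
  exact: (card_le_trans (card_image_le _ _) (cA h Qh.1)).
apply: sub_countable c; apply: subset_card_le => t [_ At]; exists (- t); rewrite ?opprK//.
Qed.

Lemma measure_first_transverse (A : set H) : measurable A ->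
  L A = (\sum_(i < l.+1) L (A `&` [set h | first_transverse i h]))%E.
Proof.
move=> mA.
pose F (k : nat) := A `&` [set h | exists2 i : 'I_l.+1, i = k :> nat & first_transverse i h].
have FE (i : 'I_l.+1) : F i = A `&` [set h | first_transverse i h].
  seteq=> h [Ah]; last by move=> fh; split=> //; exists i.
  by move=> [j /val_inj <-].
have mFk k : (k < l.+1)%N -> measurable (F k).
  move=> kl; rewrite (FE (Ordinal kl)); apply: measurableI => //.
  by meas.
rewrite (_ : (\sum_(i < l.+1) _)%E = (\sum_(i < l.+1) L (F i))%E); last first.
  by apply: eq_bigr => i _; rewrite FE.
rewrite -(measure_semi_additive_ord_I _ mFk) //.
- congr (L _); rewrite -bigcup_mkord; seteq=> h.
    move=> Ah; have [u [c [lu hE]]] := hyperplaneP h.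
    have [i [fi _]] := lexi_first_transverse lu hE.
    by exists i => //=; split=> //; exists i.
  by move=> [k _ []].
- move=> j k _ _ [h [[_ [i ij fi]] [_ [i' ik fi']]]].
  by rewrite -ij -ik (first_transverse_inj fi fi').
- rewrite -bigcup_mkord; apply: fin_bigcup_measurable => // k kl; exact: mFk.
Qed.

(** On the translates of one hyperplane along an axis, dilation by [a] acts on the parameter as an
    affine map of slope [a]. After disintegration the factor is the one of Lebesgue measure. *)
Lemma driving_scaling (a : R) (A : set H) : 0 < a -> measurable A ->
  L [set h | A (dil a h)] = ((a^-1)%:E * L A)%E.
Proof.
move=> a0 mA; have an0 : a != 0 by rewrite gt_eqF.
have mdA := meas_preim (meas_dil an0) mA.
rewrite (measure_first_transverse mA) (measure_first_transverse mdA).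
rewrite ge0_sume_distrr//; apply: eq_bigr => i _.
rewrite (slab_disintegration i mA) (slab_disintegration i mdA).
have mS' := meas_slab_fiber i mA.
rewrite -ge0_integralZl//; last 2 first.
- exact: (meas_measure_section lebesgue_measure mS').
- by rewrite lee_fin invr_ge0 ltW.
apply: eq_integral => h _.
have [Qh|Qh] := pselect (unit_slab i h); last first.
  have e0 (K : R -> Prop) : [set t | unit_slab i h /\ K t] = set0 by set_eq.
  by rewrite !e0 measure0 mule0.
have [tau tauP] := intercept Qh.1.
rewrite -(lebesgue_affine (- ((a - 1) * tau)) a0 (meas_section1 h mS')); congr (leb _).
apply: eq_set => t /=; congr (_ /\ A _).
rewrite dil_translZ// (dil_transl an0 Qh.1 (proj2 (tauP tau) erefl)) translD.
congr (transl _ h); rewrite scalerA -scalerDl; congr (_ *: _); ring.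
Qed.
End hyperplane_maps.

(** * Indicators and integrals of bounded functions *)

Definition ind {R : realType} (K : Prop) : R := (`[< K >])%:R.

Lemma ind_ge0 {R : realType} K : 0 <= ind K :> R.
Proof. by rewrite /ind ler0n. Qed.
Lemma ind_le1 {R : realType} K : ind K <= 1 :> R.
Proof. by rewrite /ind lern1 leq_b1. Qed.
Lemma ind1 {R : realType} K : K -> ind K = 1 :> R.
Proof. by move=> h; rewrite /ind asboolT. Qed.
Lemma ind0 {R : realType} K : ~ K -> ind K = 0 :> R.
Proof. by move=> h; rewrite /ind asboolF. Qed.
Lemma indE {R : realType} (T : Type) (A : set T) x : ind (A x) = \1_A x :> R.
Proof. by rewrite indicE /ind; congr (_%:R); apply/asboolP/idP => [/mem_set|/set_mem]. Qed.

Lemma ind_and {R : realType} K K' : ind (K /\ K') = ind K * ind K' :> R.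
Proof.
have [k|n] := pselect K; [rewrite (ind1 k) mul1r|rewrite (ind0 n) mul0r ind0//; tauto].
by congr ind; apply/propext; tauto.
Qed.

Lemma meas_ind {R : realType} d (S : measurableType d) (A : S -> Prop) :
  measurable [set x | A x] -> mfunT (fun x => ind (A x) : R).
Proof.
move=> mA; rewrite (_ : (fun x => _) = \1_[set x | A x]); first meas.
by apply/funext => x; rewrite -indE.
Qed.
#[export] Hint Resolve meas_ind : meas.

Lemma integral_exp_itv (R : realType) (lam a b : R) : a <= b ->
  (\int[lebesgue_measure]_(u in `[a, b]) (lam * expR (- lam * (u - a)))%:E = (1 - expR (- lam * (b - a)))%:E)%E.
Proof.
rewrite le_eqVlt => /orP[/eqP <-|ab].
  by rewrite set_itv1 integral_set1 subrr mulr0 expR0 subrr.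
pose G (u : R) := - expR (- lam * (u - a)).
have dG (x : R) : is_derive x (1 : R) G (lam * expR (- lam * (x - a))).
  by apply: is_derive_eq; rewrite /GRing.scale /=; ring.
have cG x : {for x, continuous G} by apply: differentiable_continuous; apply/derivable1_diffP; have [] := dG x.
rewrite (@continuous_FTC2 _ (fun u => lam * expR (- lam * (u - a))) G) //.
- by rewrite /G subrr mulr0 expR0 -EFinB; congr EFin; ring.
- apply: continuous_subspaceT => x; apply: cvgM; first exact: cvg_cst.
  apply: continuous_comp; last exact: continuous_expR.
  by apply: cvgM; [exact: cvg_cst|apply: cvgB; [exact: cvg_id|exact: cvg_cst]].
- by split; [move=> x _; have [] := dG x|apply: cvg_at_right_filter; exact: cG|apply: cvg_at_left_filter; exact: cG].
- by move=> x _; rewrite derive1E; have [_ ->] := dG x.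
Qed.

Section integral_tools.
Context {R : realType} d {S : measurableType d} (m : {measure set S -> \bar R}).

Lemma integral_ind (D : set S) (f : S -> R) :
  (\int[m]_(x in D) (f x)%:E = \int[m]_x (ind (D x) * f x)%:E)%E.
Proof.
rewrite integral_mkcond; apply: eq_integral => x _; rewrite patchE.
by case: ifPn => [/set_mem Dx|/negP nD]; [rewrite ind1 ?mul1r|rewrite ind0 ?mul0r// => Dx; apply: nD; exact/mem_set].
Qed.

Lemma integral_le_bound (D : set S) (f : S -> R) (c : R) : measurable D -> (m D < +oo)%E ->
  measurable_fun D f -> (forall x, D x -> 0 <= f x <= c) ->
  [/\ (\int[m]_(x in D) (f x)%:E \is a fin_num)%E,
   (0 <= \int[m]_(x in D) (f x)%:E)%E & (\int[m]_(x in D) (f x)%:E <= c%:E * m D)%E].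
Proof.
move=> mD fD mf f0.
have h0 : (0 <= \int[m]_(x in D) (f x)%:E)%E.
  by apply: integral_ge0 => x /f0/andP[? _]; rewrite lee_fin.
have h1 : (\int[m]_(x in D) (f x)%:E <= c%:E * m D)%E.
  rewrite -integral_cst//; apply: ge0_le_integral => //.
  - by move=> x /f0/andP[? _]; rewrite lee_fin.
  - by meas.
  - by move=> x /f0/andP[_ ?]; rewrite lee_fin.
split=> //; rewrite ge0_fin_numE//; apply: le_lt_trans h1 _.
by rewrite -[m D]fineK ?ge0_fin_numE// -EFinM ltry.
Qed.
End integral_tools.

Lemma meas_fine_integral (R : realType) d1 d2 (S1 : measurableType d1) (S2 : measurableType d2)
    (m : {sigma_finite_measure set S2 -> \bar R}) (f : S1 * S2 -> R) :
  mfunT f -> (forall p, 0 <= f p) ->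
  mfunT (fun x => fine (\int[m]_y (f (x, y))%:E)).
Proof.
move=> mf f0.
have h : mfunT (fubini_F m (EFin \o f)).
  apply: measurable_fun_fubini_tonelli_F; first meas.
  by move=> p; rewrite lee_fin.
by apply: (measurableT_comp (f := fine)) => //; meas.
Qed.

Lemma cvgn_bounds (R : realType) (u : nat -> R) (x a b : R) :
  (forall n, a <= u n <= b) -> u n @[n --> \oo] --> x -> a <= x <= b.
Proof.
move=> h cu; have cv : cvgn u by apply/cvg_ex; exists x.
rewrite -(cvg_lim _ cu)//; apply/andP; split; [apply: limr_ge => //|apply: limr_le => //]; apply: nearW => n;
  by case/andP: (h n).
Qed.

Lemma bounded_cvg_integral (R : realType) d (S : measurableType d) (m : {measure set S -> \bar R})
    (D : set S) (f_ : nat -> S -> R) (f : S -> R) (c : R) :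
  measurable D -> (m D < +oo)%E -> (forall n, measurable_fun D (f_ n)) ->
  (forall n x, D x -> 0 <= f_ n x <= c) ->
  (forall x, D x -> f_ n x @[n --> \oo] --> f x) ->
  fine (\int[m]_(x in D) (f_ n x)%:E)%E @[n --> \oo] --> fine (\int[m]_(x in D) (f x)%:E)%E.
Proof.
move=> mD fD mf f0 cf.
have mff : measurable_fun D f by exact: measurable_fun_cvg mf cf.
have f01 x : D x -> 0 <= f x <= c.
  by move=> Dx; apply: cvgn_bounds (cf x Dx) => n; exact: f0.
have [fi _ _] := integral_le_bound mD fD mff f01.
apply: fine_cvg; rewrite fineK//.
apply: (@dominated_cvg _ S R m D mD (fun n x => (f_ n x)%:E) (EFin \o f) (cst c%:E)).
- by meas.
- by move=> x Dx; apply: cvg_EFin; [exact: nearW|exact: cf].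
- by [].
- apply/integrableP; split; first meas.
  rewrite integral_cst//= -[m D]fineK ?ge0_fin_numE// -EFinM ltry//.
- by move=> n x Dx /=; have /andP[a b] := f0 n x Dx; rewrite lee_fin ger0_norm.
Qed.

Lemma fine_integral_le (R : realType) d (S : measurableType d) (m : {measure set S -> \bar R})
    (D : set S) (f g : S -> R) (c : R) :
  measurable D -> (m D < +oo)%E -> measurable_fun D f -> measurable_fun D g ->
  (forall x, D x -> 0 <= f x) -> (forall x, D x -> f x <= g x) -> (forall x, D x -> g x <= c) ->
  fine (\int[m]_(x in D) (f x)%:E)%E <= fine (\int[m]_(x in D) (g x)%:E)%E.
Proof.
move=> mD fD mf mg f0 fg gc.
have [fi _ _] := integral_le_bound (f := f) mD fD mf (fun x Dx => introT andP (conj (f0 x Dx) (le_trans (fg x Dx) (gc x Dx)))).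
have [gi _ _] := integral_le_bound (f := g) mD fD mg (fun x Dx => introT andP (conj (le_trans (f0 x Dx) (fg x Dx)) (gc x Dx))).
rewrite fine_le//; apply: ge0_le_integral => //.
- by meas.
- by meas.
Qed.

Lemma itv_fin (R : realType) (a b : R) : (@lebesgue_measure R `[a, b]%classic < +oo)%E.
Proof. by rewrite lebesgue_measure_itv/=; case: ifP => _ //; rewrite -EFinB ltry. Qed.

Section interval_integrals.
Context {R : realType}.
Local Notation RR := (measurableTypeR R).
Local Notation leb := (@lebesgue_measure R).
Implicit Types (f g : R -> R) (a b c : R).

Definition itvint a b f : R := fine (\int[leb]_(u in `[a, b]) (f u)%:E)%E.

Lemma itvint_ext a b f g : (forall u, a <= u -> u <= b -> f u = g u) -> itvint a b f = itvint a b g.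
Proof.
move=> fg; rewrite /itvint; congr fine; apply: eq_integral => u /set_mem.
by rewrite /= in_itv/= => /andP[au ub]; rewrite fg.
Qed.

Lemma itvint_eq a b f g : mfunT (f : RR -> R) -> mfunT (g : RR -> R) ->
  (forall u, a < u -> u <= b -> f u = g u) -> itvint a b f = itvint a b g.
Proof.
move=> mf mg fg; rewrite /itvint -integral_itv_obnd_cbnd; last first.
  by apply/measurable_EFinP/measurable_funTS; exact: mf.
rewrite -integral_itv_obnd_cbnd; last by apply/measurable_EFinP/measurable_funTS; exact: mg.
congr fine; apply: eq_integral => u /set_mem; rewrite /= in_itv/= => /andP[au ub].
by rewrite fg.
Qed.

Lemma itvint_fin a b f c : mfunT (f : RR -> R) ->
  (forall u, a <= u -> u <= b -> 0 <= f u <= c) -> (\int[leb]_(u in `[a, b]) (f u)%:E \is a fin_num)%E.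
Proof.
move=> mf f0.
by have [] := @integral_le_bound R _ RR leb `[a, b]%classic f c _ (itv_fin a b)
  (measurable_funTS mf) (fun u => fun h : `[a, b]%classic u => ltac:(by move: h; rewrite /= in_itv/= => /andP[? ?]; apply: f0)).
Qed.

Lemma itvint_cat a b c f k : a <= b -> b <= c -> mfunT (f : RR -> R) ->
  (forall u, a <= u -> u <= c -> 0 <= f u <= k) -> itvint a c f = itvint a b f + itvint b c f.
Proof.
move=> ab bc mf f0.
have f1 := itvint_fin (a := a) (b := b) mf (fun u h1 h2 => f0 u h1 (le_trans h2 bc)).
have f2 := itvint_fin (a := b) (b := c) mf (fun u h1 h2 => f0 u (le_trans ab h1) h2).
rewrite /itvint -fineD// (@itv_bndbnd_setU _ _ _ (BRight b)) ?bnd_simp//.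
rewrite ge0_integral_setU//=.
- by congr (fine (_ + _)%E); apply: integral_itv_obnd_cbnd; apply/measurable_EFinP/measurable_funTS; exact: mf.
- by apply/measurable_EFinP/measurable_funTS; exact: mf.
- move=> u; rewrite /= !in_itv/= => -[/andP[h1 h2]|/andP[h1 h2]]; rewrite lee_fin.
    by case/andP: (f0 u h1 (le_trans h2 bc)).
  by case/andP: (f0 u (le_trans ab (ltW h1)) h2).
- apply/disj_setPS => u [] /=; rewrite !in_itv/= => /andP[_ h1] /andP[h2 _].
  by move: (lt_le_trans h2 h1); rewrite ltxx.
Qed.

Lemma itvint_scale a b f k c : 0 <= k -> mfunT (f : RR -> R) ->
  (forall u, a <= u -> u <= b -> 0 <= f u <= c) ->
  itvint a b (fun u => k * f u) = k * itvint a b f.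
Proof.
move=> k0 mf f0; have fi := itvint_fin mf f0.
rewrite /itvint -[k in RHS]/(fine k%:E) -fineM// -ge0_integralZl_EFin//.
- by move=> u; rewrite /= in_itv/= lee_fin => /andP[h1 h2]; case/andP: (f0 u h1 h2).
- by apply/measurable_EFinP/measurable_funTS; exact: mf.
Qed.

Lemma itvint_near a b f v e : a <= b -> mfunT (f : RR -> R) ->
  (forall u, a <= u -> u <= b -> 0 <= f u) ->
  (forall u, a <= u -> u <= b -> `|f u - v| <= e) -> `|itvint a b f - (b - a) * v| <= e * (b - a).
Proof.
move=> ab mf f0 fv.
have itvE u : `[a, b]%classic u -> a <= u /\ u <= b by rewrite /= in_itv/= => /andP[].
have mD : measurable (`[a, b]%classic : set RR) by meas.
have mfD : measurable_fun (`[a, b]%classic : set RR) (f : RR -> R) by apply: measurable_funTS; exact: mf.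
have intc (c : R) : fine (\int[leb]_(u in `[a, b]) (c)%:E)%E = c * (b - a).
  rewrite integral_cst// /= lebesgue_measure_itv/= lte_fin.
  move: ab; rewrite le_eqVlt => /orP[/eqP <-|->]; first by rewrite ltxx mule0 subrr mulr0.
  by rewrite -EFinB -EFinM.
have h1 : itvint a b f <= (v + e) * (b - a).
  rewrite -intc; apply: (@fine_integral_le R _ RR leb _ _ _ (v + e)) => //; first exact: itv_fin.
  - by move=> u /itvE[? ?]; exact: f0.
  - by move=> u /itvE[h1 h2]; have := fv u h1 h2; rewrite ler_norml => /andP[_]; lra.
have h2 : (v - e) * (b - a) <= itvint a b f.
  have [ve|ve] := leP 0 (v - e).
    rewrite -intc; apply: (@fine_integral_le R _ RR leb _ _ _ (v + e)) => //; first exact: itv_fin.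
    - by move=> u /itvE[h3 h4]; have := fv u h3 h4; rewrite ler_norml => /andP[]; lra.
    - by move=> u /itvE[h3 h4]; have := fv u h3 h4; rewrite ler_norml => /andP[]; lra.
  apply: (@le_trans _ _ 0); first by apply: mulr_le0_ge0; [exact: ltW|rewrite subr_ge0].
  by rewrite fine_ge0// integral_ge0// => u /itvE[? ?]; rewrite lee_fin f0.
move: h1 h2; rewrite ler_norml !mulrDl mulNr ![_ * (b - a)]mulrC => h1 h2.
by apply/andP; split; lra.
Qed.
End interval_integrals.

Section bounded_integrals.
Context {R : realType} d {S : measurableType d} (m : {measure set S -> \bar R}) (D : set S).
Hypotheses (mD : measurable D) (fD : (m D < +oo)%E).

Lemma bounded_integrable (f : S -> R) c : measurable_fun D f ->
  (forall x, D x -> `|f x| <= c) -> m.-integrable D (EFin \o f).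
Proof.
move=> mf fc; apply: measurable_bounded_integrable => //.
by exists c; split=> [|M cM x Dx]; [exact: num_real|exact: le_trans (fc x Dx) (ltW cM)].
Qed.

Lemma Rintegral_near (f g : S -> R) e : 0 <= e ->
  m.-integrable D (EFin \o f) -> m.-integrable D (EFin \o g) ->
  {ae m, forall x, D x -> `|f x - g x| <= e} ->
  `|\int[m]_(x in D) f x - \int[m]_(x in D) g x| <= e * fine (m D).
Proof.
move=> e0 fi gi fg; rewrite -RintegralB//.
have fgi : m.-integrable D (EFin \o (fun x => f x - g x)).
  by rewrite (_ : EFin \o _ = (fun x => (EFin \o f) x - (EFin \o g) x)%E)//; exact: integrableB.
apply: le_trans (le_normr_Rintegral mD fgi) _; rewrite -(Rintegral_cst m mD e).
have mfg : measurable_fun D (fun x => f x - g x) by apply/measurable_EFinP; case/integrableP: fgi.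
have h : (\int[m]_(x in D) `|f x - g x|%:E <= \int[m]_(x in D) e%:E)%E.
  apply: ae_ge0_le_integral => //.
  by apply/measurable_EFinP; apply: measurableT_comp => //; meas.
have ei : (\int[m]_(x in D) e%:E)%E \is a fin_num by rewrite integral_cst// fin_numM// ge0_fin_numE.
rewrite /Rintegral fine_le// ge0_fin_numE ?integral_ge0//.
by rewrite (le_lt_trans h)// -ge0_fin_numE// integral_ge0.
Qed.
End bounded_integrals.

(** * Euler schemes for functions of a cell and a time *)

Lemma expRN_near (R : realType) (x : R) : 0 <= x -> `|expR (- x) - 1 + x| <= x ^+ 2.
Proof.
move=> x0; have h1 := expR_ge1Dx (- x); have h2 := expR_ge1Dx x.
have e0 := expR_gt0 (- x); have h3 : expR (- x) * expR x = 1 by rewrite expRN mulVf// gt_eqF// expR_gt0.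
rewrite ger0_norm; last by lra.
have h4 : expR (- x) * (1 + x) <= 1 by rewrite -[leRHS]h3 ler_pM2l.
have h5 : expR (- x) * (1 + x) <= (1 - x + x ^+ 2) * (1 + x).
  apply: le_trans h4 _; rewrite -subr_ge0 [X in 0 <= X](_ : _ = x ^+ 3); last by ring.
  exact: exprn_ge0.
rewrite ler_pM2r in h5; last by lra.
by lra.
Qed.

(* Stepping from [s1] to [s0] through [N] equal steps bounds the distance by
   [N * K * (delta / N) ^ 2 * exp (c * delta)]. *)
Lemma euler_unique (R : realType) (I : Type) (D : set I) (f g : I -> R -> R) (s0 s1 c K : R) :
  s0 <= s1 -> 0 <= c -> 0 <= K ->
  (forall i, D i -> f i s1 = g i s1) ->
  (forall s s' B, s0 <= s -> s <= s' -> s' <= s1 -> s' - s <= 1 -> 0 <= B ->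
     (forall i, D i -> `|f i s' - g i s'| <= B) ->
     forall i, D i -> `|f i s - g i s| <= (1 + c * (s' - s)) * B + K * (s' - s) ^+ 2) ->
  forall i, D i -> f i s0 = g i s0.
Proof.
move=> s01 c0 K0 fg1 st i Di.
pose del := s1 - s0; have d0 : 0 <= del by rewrite subr_ge0.
have bound N : del <= N.+1%:R -> `|f i s0 - g i s0| <= K * del ^+ 2 * expR (c * del) / N.+1%:R.
  move=> dN; pose h := del / N.+1%:R; have N0 : (0 < N.+1%:R :> R) by rewrite ltr0n.
  have h0 : 0 <= h by apply: divr_ge0 => //; exact: ltW.
  have h1 : h <= 1 by rewrite ler_pdivrMr// mul1r.
  have Nh : N.+1%:R * h = del by rewrite mulrC divfK// gt_eqF.
  have e1 : 1 <= expR (c * h) by rewrite -expR0 ler_expR mulr_ge0.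
  have claim k : (k <= N.+1)%N -> forall j, D j ->
      `|f j (s1 - k%:R * h) - g j (s1 - k%:R * h)| <= k%:R * (K * h ^+ 2) * expR (c * h) ^+ k.
    elim: k => [_ j Dj|k ih kN j Dj].
      by rewrite !mul0r subr0 fg1// subrr normr0.
    have kh : k.+1%:R * h <= del by rewrite -Nh ler_wpM2r// ler_nat.
    have kS : k.+1%:R * h = k%:R * h + h by rewrite -natr1 mulrDl mul1r.
    have B0 : 0 <= k%:R * (K * h ^+ 2) * expR (c * h) ^+ k by rewrite !mulr_ge0 ?exprn_ge0 ?expR_ge0.
    have kh0 : 0 <= k%:R * h by rewrite mulr_ge0.
    have hs : (s1 - k%:R * h) - (s1 - k.+1%:R * h) = h by rewrite kS; ring.
    have := st (s1 - k.+1%:R * h) (s1 - k%:R * h) _ _ _ _ _ B0 (ih (ltnW kN)) j Dj.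
    rewrite hs => /(_ ltac:(move: kh; rewrite /del; lra) ltac:(lra) ltac:(lra) h1) hh.
    apply: le_trans hh _.
    rewrite (_ : k.+1%:R * (K * h ^+ 2) * _ = k%:R * (K * h ^+ 2) * expR (c * h) ^+ k.+1 + K * h ^+ 2 * expR (c * h) ^+ k.+1); last first.
      by rewrite -natr1 !mulrDl mul1r.
    apply: lerD.
      rewrite [expR _ ^+ k.+1]exprS [leRHS]mulrCA; apply: ler_wpM2r => //; exact: expR_ge1Dx.
    by rewrite -[leLHS]mulr1 ler_wpM2l ?mulr_ge0 ?exprn_ge0// exprn_ege1.
  have := claim N.+1 (leqnn _) i Di; rewrite Nh /del subKr -expRM_natl => hh; apply: le_trans hh _.
  rewrite (_ : N.+1%:R * (c * h) = c * del); last by rewrite mulrCA Nh.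
  rewrite (_ : K * del ^+ 2 * _ / _ = N.+1%:R * (K * h ^+ 2) * expR (c * del)); first by rewrite /del.
  rewrite /h; field; exact: lt0r_neq0.
apply/eqP; rewrite -subr_eq0 -normr_le0 leNgt; apply/negP => e0.
set e := `|_| in e0 bound; set A := K * _ * _ in bound.
pose N := Num.trunc (Num.max del (A / e)).
have Nt : Num.max del (A / e) < N.+1%:R by exact: truncnS_gt.
have dm : del <= Num.max del (A / e) by rewrite le_max lexx.
have := bound N (ltW (le_lt_trans dm Nt)).
rewrite leNgt ltr_pdivrMr ?ltr0n// => /negP; apply.
rewrite mulrC -ltr_pdivrMr//; apply: le_lt_trans Nt; by rewrite le_max lexx orbT.
Qed.

Lemma normrM_le (R : realDomainType) (x y X Y : R) : `|x| <= X -> `|y| <= Y -> `|x * y| <= X * Y.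
Proof. by move=> hx hy; rewrite normrM ler_pM. Qed.

Lemma normrD_le (R : realDomainType) (x y X Y : R) : `|x| <= X -> `|y| <= Y -> `|x + y| <= X + Y.
Proof. by move=> hx hy; apply: le_trans (ler_normD _ _) _; exact: lerD. Qed.

Lemma normrB_le (R : realDomainType) (x y X Y : R) : `|x| <= X -> `|y| <= Y -> `|x - y| <= X + Y.
Proof. by move=> hx hy; apply: le_trans (ler_normB _ _) _; exact: lerD. Qed.

Lemma interior_ray (R : realType) (n : nat) (A : set 'rV[R]_n) p v : A° p -> exists t : R, 0 < t /\ A (t *: v + p).
Proof.
move=> Ap.
have gp : (t *: v + p) @[t --> (0 : R)] --> p.
  rewrite -[X in _ --> X]add0r -(scale0r v).
  apply: (@cvgD _ 'rV[R]_n _ (nbhs (0 : R)) _ (fun t : R => t *: v) (cst p)); last exact: cvg_cst.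
  exact: (@cvgZr_tmp _ 'rV[R]_n _ (nbhs (0 : R)) _ id 0 v cvg_id).
have h1 : \forall t \near (0 : R)^'+, A (t *: v + p) by apply: cvg_within; exact: gp.
have h2 : \forall t \near (0 : R)^'+, 0 < t by near=> t; near: t; exact: nbhs_right_gt.
by have [t [? ?]] := filter_ex (filterI h2 h1); exists t.
Unshelve. all: by end_near. Qed.

Lemma hyperplane_thin (R : realType) (l : nat) (A : set 'rV[R]_l.+1) (h : hyperplane R l) :
  A° !=set0 -> ~ (A `<=` sval h).
Proof.
move=> [p Ap] Ah; have [u [c [u0 hE]]] := svalP h.
have [i ui] : exists i, u 0 i != 0.
  apply: contrapT => hh; move/eqP: u0; apply; apply/rowP => i; rewrite mxE.
  by apply/eqP/negPn/negP => ui; apply: hh; exists i.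
have [t [t0 At]] := interior_ray 'e_i Ap.
have := Ah _ At; have := Ah _ (interior_subset Ap); rewrite hE /= => pc.
rewrite dotD dotZ pc => /eqP; rewrite -subr_eq0 addrK mulf_eq0 gt_eqF//= dot_delta => /eqP u00.
by rewrite u00 eqxx in ui.
Qed.

Lemma Rintegral_comb (R : realType) d (S : measurableType d) (m : {measure set S -> \bar R}) (D : set S)
    (f1 f2 f3 : S -> R) (x y z : R) : measurable D ->
  m.-integrable D (EFin \o f1) -> m.-integrable D (EFin \o f2) -> m.-integrable D (EFin \o f3) ->
  m.-integrable D (EFin \o (fun h => x * f1 h + y * f2 h - z * f3 h)) /\
  \int[m]_(h in D) (x * f1 h + y * f2 h - z * f3 h) =
    x * \int[m]_(h in D) f1 h + y * \int[m]_(h in D) f2 h - z * \int[m]_(h in D) f3 h.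
Proof.
move=> mD i1 i2 i3.
have s1 : m.-integrable D (EFin \o (fun h => x * f1 h)) by exact: (integrableZl mD x i1).
have s2 : m.-integrable D (EFin \o (fun h => y * f2 h)) by exact: (integrableZl mD y i2).
have s3 : m.-integrable D (EFin \o (fun h => z * f3 h)) by exact: (integrableZl mD z i3).
have s12 : m.-integrable D (EFin \o (fun h => x * f1 h + y * f2 h)) by exact: (integrableD mD s1 s2).
split; first by exact: (integrableB mD s12 s3).
by rewrite RintegralB// RintegralD// !RintegralZl.
Qed.

Section product_rule.
Context {R : realType}.
Variables (La Kb : R).
Hypotheses (La0 : 0 <= La) (Kb0 : 0 <= Kb).

Let R1 := La ^+ 2 * (9 + 4 * La).
(** Sum of the second-order errors: [R1] bounds the error on the product [a * b], [Kb] bounds the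
    exponential factor [ka], and the last term is the error of the step of [g]. *)
Definition product_const : R := Kb * (La ^+ 2 + La * (3 * La + R1 + La ^+ 2) + R1) + 4 * La ^+ 2.

Lemma product_const_ge0 : 0 <= product_const.
Proof.
have h2 := exprn_ge0 2 La0.
have r0 : 0 <= R1 by apply: mulr_ge0 => //; apply: addr_ge0 => //; exact: mulr_ge0.
have h3 : 0 <= La * (3 * La + R1 + La ^+ 2).
  by apply: mulr_ge0 => //; apply: addr_ge0 => //; apply: addr_ge0 => //; exact: mulr_ge0.
rewrite /product_const; apply: addr_ge0; last lra.
by apply: mulr_ge0 => //; lra.
Qed.

(** A discrete product rule, backwards in time. The three functions lose mass at the rate [lam], so
    the product [a * b] loses it at twice that rate; the factor [ka], which grows at the rate [mu],
    restores part of the loss. What differs from a single loss at the rate [lam] is the term in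
    [lam - mu] of the source. *)
Lemma product_euler (del lam mu ka ka' a a' b b' g g' al be ga B : R) :
  0 <= del <= 1 -> 0 <= lam <= La -> 0 <= mu <= La -> 0 <= B ->
  ka' = ka * expR (- (mu * del)) -> 0 <= ka <= Kb ->
  0 <= a' <= 1 -> 0 <= b' <= 1 -> 0 <= a <= 1 -> 0 <= b <= 1 ->
  0 <= al <= lam -> 0 <= be <= lam ->
  `|a - a' - del * (al - lam * a')| <= 4 * (La * del) ^+ 2 ->
  `|b - b' - del * (be - lam * b')| <= 4 * (La * del) ^+ 2 ->
  `|g - g' - del * (ga - lam * g')| <= 4 * (La * del) ^+ 2 ->
  `|g' - ka' * a' * b'| <= B ->
  `|ga - ka' * (b' * al + a' * be - (lam - mu) * a' * b')| <= lam * B ->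
  `|g - ka * a * b| <= (1 + 2 * La * del) * B + product_const * del ^+ 2.
Proof.
move=> /andP[d0 d1] /andP[l0 l1] /andP[m0 m1] B0 kaE /andP[k0 k1] /andP[a'0 a'1] /andP[b'0 b'1] /andP[a0 a1] /andP[b0 b1]
  /andP[al0 al1] /andP[be0 be1].
set x := al - lam * a'; set y := be - lam * b'; set z := ga - _.
set e1 := a - _ - _; set e2 := b - _ - _; set e3 := g - _ - _ => he1 he2 he3.
set eta := g' - _; set th := ga - _ => heta hth.
pose rho := expR (- (mu * del)) - 1 + mu * del.
have md0 : 0 <= mu * del by rewrite mulr_ge0.
have mdL : mu * del <= La * del by rewrite ler_wpM2r.
have hrho : `|rho| <= (La * del) ^+ 2.
  by apply: le_trans (expRN_near md0) _; rewrite lerXn2r ?nnegrE ?mulr_ge0.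
have k'0 : 0 <= ka' by rewrite kaE mulr_ge0 ?expR_ge0.
have k'k : ka' <= ka by rewrite kaE ler_piMr// expR_le1 oppr_le0.
have la' : 0 <= lam * a' <= lam by rewrite mulr_ge0//= ler_piMr.
have lb' : 0 <= lam * b' <= lam by rewrite mulr_ge0//= ler_piMr.
have hx : `|x| <= La by rewrite ler_norml /x; move: la' => /andP[? ?]; apply/andP; split; lra.
have hy : `|y| <= La by rewrite ler_norml /y; move: lb' => /andP[? ?]; apply/andP; split; lra.
have n1 (c : R) : 0 <= c -> c <= 1 -> `|c| <= 1 by move=> ? ?; rewrite ger0_norm.
have nd : `|del| <= del by rewrite ger0_norm.
pose r := a * b - a' * b' - del * (x * b' + a' * y).
have rE : r = del * del * (x * y) + (a' + del * x) * e2 + e1 * b.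
  by rewrite /r /e1 /e2 -/x -/y; ring.
have hr : `|r| <= R1 * del ^+ 2.
  rewrite rE; apply: le_trans (normrD_le (normrD_le (normrM_le (normrM_le nd nd) (normrM_le hx hy))
    (normrM_le (normrD_le (n1 _ a'0 a'1) (normrM_le nd hx)) he2)) (normrM_le he1 (n1 _ b0 b1))) _.
  have h : del * La * (4 * (La * del) ^+ 2) <= 1 * La * (4 * (La * del) ^+ 2).
    rewrite ler_wpM2r//; first by apply: mulr_ge0 => //; exact: exprn_ge0 (mulr_ge0 _ _).
    by rewrite ler_wpM2r.
  move: h; rewrite /R1 (_ : La ^+ 2 * (9 + 4 * La) * del ^+ 2 = 9 * (La * del) ^+ 2 + 1 * La * (4 * (La * del) ^+ 2)); last by ring.
  rewrite (_ : del * del * (La * La) = (La * del) ^+ 2); last by ring.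
  rewrite mulr1 [(1 + del * La) * _]mulrDl mul1r; move: ((La * del) ^+ 2) => q; lra.
have dab : `|a * b - a' * b'| <= del * (2 * La) + R1 * del ^+ 2.
  rewrite (_ : a * b - a' * b' = del * (x * b' + a' * y) + r); last by rewrite /r; ring.
  apply: normrD_le => //; apply: normrM_le => //.
  apply: le_trans (normrD_le (normrM_le hx (n1 _ b'0 b'1)) (normrM_le (n1 _ a'0 a'1) hy)) _.
  lra.
have nk : `|ka| <= Kb by rewrite ger0_norm.
have nk' : `|ka'| <= Kb by rewrite ger0_norm//; exact: le_trans k1.
have nab : `|a * b| <= 1 by rewrite -[leRHS]mulr1; apply: normrM_le; exact: n1.
have nab' : `|a' * b'| <= 1 by rewrite -[leRHS]mulr1; apply: normrM_le; exact: n1.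
have hkk : `|ka * (a * b) - ka' * (a' * b')| <= Kb * (del * (2 * La) + R1 * del ^+ 2) + Kb * (La * del + (La * del) ^+ 2).
  rewrite (_ : _ - _ = ka * (a * b - a' * b') + ka * ((mu * del - rho) * (a' * b'))); last by rewrite kaE /rho; ring.
  apply: normrD_le; apply: normrM_le => //.
  rewrite -[leRHS]mulr1; apply: normrM_le => //; apply: normrB_le => //.
  by rewrite ger0_norm.
have nmd : `|mu * del| <= La * del by rewrite ger0_norm.
have nld : `|1 - lam * del| <= 1 + La * del.
  apply: normrB_le; first by rewrite normr1.
  by rewrite ger0_norm ?mulr_ge0// ler_wpM2r.
have hth' : `|th| <= La * B by apply: le_trans hth _; rewrite ler_wpM2r.
rewrite (_ : g - ka * a * b = ka * (a * b) * rho - mu * del * (ka * (a * b) - ka' * (a' * b')) - ka' * r + eta * (1 - lam * del) + del * th + e3); last first.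
  by rewrite /r /th /e3 /eta /rho /x /y /z kaE; ring.
apply: le_trans (normrD_le (normrD_le (normrD_le (normrB_le (normrB_le (normrM_le (normrM_le nk nab) hrho) (normrM_le nmd hkk)) (normrM_le nk' hr)) (normrM_le heta nld)) (normrM_le nd hth')) he3) _.
have d3 : La * R1 * Kb * (del * del ^+ 2) <= La * R1 * Kb * (1 * del ^+ 2).
  have R10 : 0 <= R1.
    by apply: mulr_ge0; [exact: exprn_ge0|apply: addr_ge0 => //; exact: mulr_ge0].
  apply: ler_wpM2l; first by apply: mulr_ge0 => //; exact: mulr_ge0.
  by apply: ler_wpM2r => //; exact: exprn_ge0.
have d4 : La * La ^+ 2 * Kb * (del * del ^+ 2) <= La * La ^+ 2 * Kb * (1 * del ^+ 2).
  by rewrite ler_wpM2l ?mulr_ge0 ?exprn_ge0// ler_wpM2r// exprn_ge0.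
rewrite /product_const -subr_ge0.
rewrite [X in 0 <= X](_ : _ = (La * R1 * Kb * (1 * del ^+ 2) - La * R1 * Kb * (del * del ^+ 2)) +
   (La * La ^+ 2 * Kb * (1 * del ^+ 2) - La * La ^+ 2 * Kb * (del * del ^+ 2))); first by lra.
ring.
Qed.
End product_rule.

Lemma all_nth_cons (T : Type) (x0 : T) (K : T -> Prop) e s :
  (forall j, (j < size (e :: s))%N -> K (nth x0 (e :: s) j)) <-> K e /\ forall j, (j < size s)%N -> K (nth x0 s j).
Proof.
split=> [h|[h1 h2] [|j] hj]; [split; [exact: (h 0%N)|move=> j; exact: (h j.+1)]|exact: h1|exact: h2].
Qed.

Lemma all_nth_cat (T : Type) (x0 : T) (K : T -> Prop) (s s' : seq T) :
  (forall j, (j < size s)%N -> K (nth x0 s j)) -> (forall j, (j < size s')%N -> K (nth x0 s' j)) ->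
  forall j, (j < size (s ++ s'))%N -> K (nth x0 (s ++ s') j).
Proof.
move=> h h' j; rewrite size_cat nth_cat; case: ifP => js; first by move=> _; exact: h.
by move=> jt; apply: h'; lia.
Qed.

(** * Densities, product measures and conditional independence *)

Section density.
Local Open Scope ereal_scope.
Context d (X : measurableType d) (R : realType) (m : {measure set X -> \bar R}).
Variable w : X -> R.
Hypotheses (mw : mfunT w) (w0 : forall x, (0 <= w x)%R).

Let nu (A : set X) : \bar R := \int[m]_(x in A) (w x)%:E.
Let nu0 : nu set0 = 0. Proof. exact: integral_set0. Qed.
Let nu_ge0 A : 0 <= nu A. Proof. by apply: integral_ge0 => x _; rewrite lee_fin. Qed.
Let nu_additive : semi_sigma_additive nu.
Proof.
by apply: semi_sigma_additive_nng_induced => [|x]; [exact/measurable_EFinP|rewrite lee_fin].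
Qed.
HB.instance Definition _ := isMeasure.Build _ _ _ nu nu0 nu_ge0 nu_additive.

Definition density : {measure set X -> \bar R} := nu.

Lemma densityE A : density A = \int[m]_(x in A) (w x)%:E.
Proof. by []. Qed.

Import HBNNSimple.

Lemma integral_density (f : X -> R) : mfunT f -> (forall x, (0 <= f x)%R) ->
  \int[density]_x (f x)%:E = \int[m]_x (f x * w x)%:E.
Proof.
move=> mf f0.
have mEf : mfunT (EFin \o f) by meas.
pose f_ := nnsfun_approx measurableT mEf.
have cf x : (f_ n x)%:E @[n --> \oo] --> (f x)%:E.
  by apply: cvg_nnsfun_approx => // y _; rewrite lee_fin.
transitivity (limn (fun n => \int[density]_x (f_ n x)%:E)).
  rewrite -monotone_convergence//.
  - by apply: eq_integral => y _; apply/esym/cvg_lim => //; exact: cf.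
  - by meas.
  - by move=> n y _; rewrite lee_fin.
  - by move=> y _ i j ij; rewrite lee_fin; exact/lefP/nd_nnsfun_approx.
rewrite [X in limn X](_ : _ = (fun n => \int[m]_x (f_ n x * w x)%:E)).
  rewrite -monotone_convergence//; last 3 first.
  - by meas.
  - by move=> n x _; rewrite lee_fin mulr_ge0.
  - by move=> x _ i j ij; rewrite lee_fin ler_wpM2r//; exact/lefP/nd_nnsfun_approx.
  apply: eq_integral => x _; apply/cvg_lim => //.
  under eq_fun do rewrite EFinM.
  by rewrite EFinM; apply: cvgeZr => //; exact: cf.
apply/funext => n.
rewrite integralT_nnsfun sintegralE.
transitivity (\sum_(r \in range (f_ n)) \int[m]_x (r * \1_(f_ n @^-1` [set r]) x * w x)%:E).
  apply: eq_fsbigr => r /set_mem[x _ rE].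
  have r0 : (0 <= r)%R by rewrite -rE.
  under eq_integral do rewrite -mulrA EFinM.
  rewrite ge0_integralZl_EFin//; last 2 first.
  - by move=> y _; rewrite lee_fin mulr_ge0// indicE ler0n.
  - by meas.
  congr (_ * _); rewrite densityE integral_mkcond; apply: eq_integral => y _.
  by rewrite patchE indicE; case: ifP => _; rewrite ?mul1r ?mul0r.
rewrite -ge0_integral_fsum//.
- apply: eq_integral => x _; rewrite EFinM [in RHS]fimfunE -fsumEFin// ge0_mule_fsuml//.
  by move=> r; exact: nnfun_muleindic_ge0.
- by meas.
- by move=> r x _; rewrite lee_fin mulr_ge0// -[(_ * _)%R]/(_ _); exact: nnfun_muleindic_ge0.
Qed.
End density.

Lemma prod_measure_unique d1 d2 (T1 : measurableType d1) (T2 : measurableType d2) (R : realType)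
    (m1 m2 : {measure set (T1 * T2) -> \bar R}) : (m1 setT < +oo)%E ->
  (forall A B, measurable A -> measurable B -> m1 (A `*` B) = m2 (A `*` B)) ->
  forall Z, measurable Z -> m1 Z = m2 Z.
Proof.
move=> f1 h Z mZ.
pose G := [set C | exists2 A : set T1, measurable A & exists2 B : set T2, measurable B & A `*` B = C].
apply: (measure_unique G (fun=> setT)) => //.
- exact: measurable_prod_measurableType.
- move=> _ _ [A mA [B mB <-]] [A' mA' [B' mB' <-]]; exists (A `&` A'); first meas.
  by exists (B `&` B'); [exact: measurableI|rewrite setXI].
- by move=> _; exists setT => //; exists setT => //; rewrite setXTT.
- by rewrite bigcup_const//; exists 0%N.
- by move=> _ [A mA [B mB <-]]; exact: h.
Qed.

Section prod3.
Context d0 d1 d2 (T0 : measurableType d0) (T1 : measurableType d1) (T2 : measurableType d2) (R : realType).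

Lemma prod3_measure_unique (m1 m2 : {measure set (T0 * (T1 * T2)) -> \bar R}) : (m1 setT < +oo)%E ->
  (forall A D B, measurable A -> measurable D -> measurable B -> m1 (A `*` (D `*` B)) = m2 (A `*` (D `*` B))) ->
  forall Z, measurable Z -> m1 Z = m2 Z.
Proof.
move=> f1 h; apply: prod_measure_unique => // A Z mA mZ.
have mAT : measurable (A `*` [set: T1 * T2]) by meas.
have ms : mfunT (snd : T0 * (T1 * T2) -> T1 * T2) by meas.
have red (m : {measure set (T0 * (T1 * T2)) -> \bar R}) :
    {m' : {measure set (T1 * T2) -> \bar R} | forall Z, m' Z = m (A `*` Z)}.
  unshelve eexists (pushforward (mrestr m mAT) (snd : T0 * (T1 * T2) -> T1 * T2)); first exact: ms.
  move=> Z'; rewrite /pushforward/= /mrestr; congr (m _); seteq=> -[x y] /=.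
    by move=> [? [? _]].
  by move=> [? ?].
have [n1 n1E] := red m1; have [n2 n2E] := red m2.
rewrite -n1E -n2E; apply: prod_measure_unique => //.
  by rewrite n1E; apply: (@le_lt_trans _ _ (m1 setT)) => //; apply: measure_le.
by move=> D B mD mB; rewrite n1E n2E; exact: h.
Qed.
End prod3.

Section image_measures.
Context d d' (S : measurableType d) (S' : measurableType d') (R : realType) (f : S -> S').
Hypothesis mf : mfunT f.

Lemma ex_image_measure (m : {measure set S -> \bar R}) : exists N : {measure set S' -> \bar R},
  (forall A, N A = m (f @^-1` A)) /\
  forall g : S' -> \bar R, mfunT g -> (forall x, (0 <= g x)%E) ->
    (\int[N]_x g x = \int[m]_x g (f x))%E.
Proof.
unshelve eexists (pushforward m f); first exact: mf.
by split=> // g mg g0; rewrite ge0_integral_pushforward.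
Qed.

Lemma ex_image_probability (P : probability S R) : exists Q : probability S' R,
  (forall A, Q A = P (f @^-1` A)) /\
  forall g : S' -> \bar R, mfunT g -> (forall x, (0 <= g x)%E) ->
    (\int[Q]_x g x = \int[P]_x g (f x))%E.
Proof.
pose X : {mfun S >-> S'} := HB.pack f (@isMeasurableFun.Build _ _ _ _ f mf).
exists (distribution P (X : {RV P >-> S'})); split=> // g mg g0.
exact: (ge0_integral_distribution (X : {RV P >-> S'}) mg g0).
Qed.
End image_measures.

Section product_sigma_finite.
Context {R : realType} d1 d2 (T1 : measurableType d1) (T2 : measurableType d2).
Variables (m1 : {sigma_finite_measure set T1 -> \bar R}) (m2 : {sigma_finite_measure set T2 -> \bar R}).

Definition prod_measure := (m1 \x m2)%E.

HB.instance Definition _ := Measure.on prod_measure.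

Let prod_sigma_finite : sigma_finite setT prod_measure.
Proof.
have /sigma_finiteP[F [TF ndF Foo]] := sigma_finiteT m1.
have /sigma_finiteP[G [TG ndG Goo]] := sigma_finiteT m2.
exists (fun n => F n `*` G n).
  rewrite -setXTT TF TG predeqE => -[x y]; split; last by move=> [n _ []/= ? ?]; split; exists n.
  move=> [/= [n _ Fnx] [k _ Gky]]; exists (maxn n k) => //; split.
    by move: x Fnx; exact/subsetPset/ndF/leq_maxl.
  by move: y Gky; exact/subsetPset/ndG/leq_maxr.
move=> k; have [? ?] := Foo k; have [? ?] := Goo k.
split; first meas.
by rewrite /prod_measure product_measure1E// lte_mul_pinfty// ge0_fin_numE.
Qed.

HB.instance Definition _ := Measure_isSigmaFinite.Build _ _ _ prod_measure prod_sigma_finite.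
End product_sigma_finite.

Section weighted_disintegration.
Context {R : realType} d (Om : measurableType d) (P : probability Om R).
Context d0 d1 d2 (T0 : measurableType d0) (T1 : measurableType d1) (T2 : measurableType d2).
Variables (m1 : {sigma_finite_measure set T1 -> \bar R}) (m2 : {sigma_finite_measure set T2 -> \bar R}).
Variables (th : Om -> T0) (Y : Om -> T1 * T2) (X : Om -> R) (q : T0 * (T1 * T2) -> R).
Hypotheses (mth : mfunT th) (mY : mfunT Y)
  (mX : mfunT X) (X01 : forall o, 0 <= X o <= 1)
  (mq : mfunT q) (q0 : forall p, 0 <= q p).

Let int2 (f : T1 * T2 -> R) := (\int[prod_measure m1 m2]_p (f p)%:E)%E.

(** Both sides integrate [f] against a measure on the triple product, the first being finite with
    weight [X], the second having density [q]. Equality on rectangles makes the two measures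
    equal. *)
Lemma weighted_disintegration :
  (forall A D B, measurable A -> measurable D -> measurable B ->
     (\int[P]_o (ind (A (th o)) * ind (D (Y o).1 /\ B (Y o).2) * X o)%:E =
      \int[P]_o ((ind (A (th o)))%:E * \int[prod_measure m1 m2]_p (ind (D p.1 /\ B p.2) * q (th o, p))%:E))%E) ->
  forall f : T0 * (T1 * T2) -> R, mfunT f -> (forall p, 0 <= f p) ->
  (\int[P]_o (f (th o, Y o) * X o)%:E = \int[P]_o \int[prod_measure m1 m2]_p (f (th o, p) * q (th o, p))%:E)%E.
Proof.
move=> hyp f mf f0.
have X0 o : 0 <= X o by case/andP: (X01 o).
have mthY : mfunT (fun o => (th o, Y o)) by exact: measurable_fun_pair.
have [N1 [N1E intN1]] := ex_image_measure mthY (density P mX X0).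
have [P0 [P0E intP0]] := ex_image_probability mth P.
pose N2 := density [the measure (T0 * (T1 * T2))%type R of (P0 \x (prod_measure m1 m2))%E] mq q0.
have P12E (g : T0 * (T1 * T2) -> \bar R) : mfunT g -> (forall p, 0 <= g p)%E ->
    (\int[[the measure (T0 * (T1 * T2))%type R of (P0 \x (prod_measure m1 m2))%E]]_p g p =
     \int[P0]_x \int[prod_measure m1 m2]_y g (x, y))%E.
  by move=> mg g0; exact: (fubini_tonelli1 (m1 := P0) (m2 := prod_measure m1 m2) g mg g0).
have f2 (g : T0 * (T1 * T2) -> R) : mfunT g -> (forall p, 0 <= g p) ->
    (\int[[the measure (T0 * (T1 * T2))%type R of (P0 \x (prod_measure m1 m2))%E]]_p (g p)%:E = \int[P]_o int2 (fun p => g (th o, p)))%E.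
  move=> mg g0.
  have mg' : mfunT (EFin \o g) by meas.
  have g0' p : (0 <= (EFin \o g) p)%E by rewrite lee_fin.
  rewrite (P12E _ mg' g0') intP0; last 2 first.
  - exact: (measurable_fun_fubini_tonelli_F (m2 := prod_measure m1 m2) (EFin \o g) mg' g0').
  - by move=> x; apply: integral_ge0.
  exact: eq_integral.
have N1I Z : (N1 Z = \int[P]_o (ind (Z (th o, Y o)) * X o)%:E)%E by rewrite N1E; exact: integral_ind.
have N2I Z : (N2 Z = \int[[the measure (T0 * (T1 * T2))%type R of (P0 \x (prod_measure m1 m2))%E]]_p (ind (Z p) * q p)%:E)%E.
  exact: integral_ind.
have agree Z : measurable Z -> N1 Z = N2 Z.
  apply: prod3_measure_unique.
    rewrite N1E preimage_setT densityE.
    apply: (@le_lt_trans _ _ (\int[P]_o 1%:E)%E).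
      apply: ge0_le_integral => //; [by move=> o _; rewrite lee_fin|exact/measurable_EFinP|].
      by move=> o _; rewrite lee_fin; case/andP: (X01 o).
    by rewrite integral_cst// mul1e; apply: le_lt_trans (probability_le1 P measurableT) _; exact: ltry.
  move=> A D B mA mD mB; rewrite N1I N2I.
  transitivity (\int[P]_o (ind (A (th o)) * ind (D (Y o).1 /\ B (Y o).2) * X o)%:E)%E.
    by apply: eq_integral => o _; congr (_ * _)%:E; rewrite /= -ind_and.
  rewrite hyp//; have mi : mfunT (fun p => ind ((A `*` (D `*` B)) p) * q p).
    by apply: measurable_funM => //; apply: meas_ind; apply: measurableX => //; meas.
  rewrite (f2 _ mi); last by move=> p; rewrite mulr_ge0 ?ind_ge0.
  apply: eq_integral => o _; have [Ao|nAo] := pselect (A (th o)).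
    rewrite ind1// mul1e /int2; apply: eq_integral => -[x y] _.
    by congr (_ * _)%:E; congr ind; apply/propext; split=> [[]|[]].
  rewrite ind0// mul0e /int2 integral0_eq// => -[x y] _.
  by rewrite ind0 ?mul0r// => -[].
transitivity (\int[N1]_p (f p)%:E)%E.
  rewrite intN1; [|exact/measurable_EFinP|by move=> p; rewrite lee_fin].
  by apply/esym; apply: (integral_density P mX X0) => //; exact: (measurableT_comp (f := f)).
rewrite (eq_measure_integral N2); last by move=> Z mZ _; exact: agree.
apply: etrans (integral_density _ mq q0 mf f0) _; apply: f2.
- by meas.
- by move=> p; rewrite mulr_ge0.
Qed.
End weighted_disintegration.

Lemma meas_bigprod (R : realType) d (S : measurableType d) (I : Type) (r : seq I) (p : pred I) (h : I -> S -> R) :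
  (forall i, mfunT (h i)) -> mfunT (fun x => \prod_(i <- r | p i) h i x).
Proof.
move=> mh; elim: r => [|i r ih].
  by under eq_fun do rewrite big_nil; exact: measurable_cst.
under eq_fun do rewrite big_cons; case: (p i) => //; exact: measurable_funM.
Qed.

Section conditional_product.
Context {R : realType} d (Om : measurableType d) (P : probability Om R).
Context d0 d1 d2 (T0 : measurableType d0) (T1 : measurableType d1) (T2 : measurableType d2).
Variables (m1 : {sigma_finite_measure set T1 -> \bar R}) (m2 : {sigma_finite_measure set T2 -> \bar R}).
Variables (th : Om -> T0) (I : finType) (Y : I -> Om -> T1 * T2) (q : I -> T0 * (T1 * T2) -> R).
Hypotheses (mth : mfunT th) (mY : forall i, mfunT (Y i))
  (mq : forall i, mfunT (q i)) (q0 : forall i p, 0 <= q i p)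
  (q1 : forall i s, (\int[prod_measure m1 m2]_p (q i (s, p))%:E <= 1)%E).

Definition cond_exp i (f : T0 * (T1 * T2) -> R) s : R :=
  fine (\int[prod_measure m1 m2]_p (f (s, p) * q i (s, p))%:E)%E.

Let unit_fun (f : T0 * (T1 * T2) -> R) := mfunT f /\ forall p, 0 <= f p <= 1.

Let section_meas (f : T0 * (T1 * T2) -> R) s : mfunT f -> mfunT (fun p => f (s, p)).
Proof. by move=> mf; apply: (measurableT_comp (f := f)) => //; exact: measurable_pair1. Qed.

Lemma cond_expE i f s : unit_fun f ->
  (\int[prod_measure m1 m2]_p (f (s, p) * q i (s, p))%:E = (cond_exp i f s)%:E)%E /\ 0 <= cond_exp i f s <= 1.
Proof.
move=> [mf f01].
have h0 : (0 <= \int[prod_measure m1 m2]_p (f (s, p) * q i (s, p))%:E)%E.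
  by apply: integral_ge0 => p _; rewrite lee_fin mulr_ge0//; case/andP: (f01 (s, p)).
have h1 : (\int[prod_measure m1 m2]_p (f (s, p) * q i (s, p))%:E <= 1)%E.
  apply: le_trans (q1 i s); apply: ge0_le_integral => //.
  - by move=> p _; rewrite lee_fin mulr_ge0//; case/andP: (f01 (s, p)).
  - by apply/measurable_EFinP/measurable_funM; exact: section_meas.
  - by apply/measurable_EFinP; exact: section_meas.
  - by move=> p _; rewrite lee_fin ler_piMl//; case/andP: (f01 (s, p)).
have e : (\int[prod_measure m1 m2]_p (f (s, p) * q i (s, p))%:E = (cond_exp i f s)%:E)%E.
  by rewrite fineK// ge0_fin_numE// (le_lt_trans h1)// ltry.
by split=> //; move: h0 h1; rewrite e !lee_fin => -> ->.
Qed.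

Lemma meas_cond_exp i f : unit_fun f -> mfunT (cond_exp i f).
Proof.
move=> [mf f01]; apply: (@meas_fine_integral R _ _ _ _ (prod_measure m1 m2) (fun p => f p * q i p)).
  exact: measurable_funM.
by move=> p; rewrite mulr_ge0//; case/andP: (f01 p).
Qed.

Let rect (D : set T1) (B : set T2) (p : T0 * (T1 * T2)) : R := ind (D p.2.1 /\ B p.2.2).

Let unit_rect D B : measurable D -> measurable B -> unit_fun (rect D B).
Proof.
move=> mD mB; split=> [|p]; last by rewrite /rect ind_ge0 ind_le1.
have m21 : mfunT (fun p : T0 * (T1 * T2) => p.2.1) by apply: measurableT_comp.
have m22 : mfunT (fun p : T0 * (T1 * T2) => p.2.2) by apply: measurableT_comp.
apply: (meas_ind (A := fun p : T0 * (T1 * T2) => D p.2.1 /\ B p.2.2)); apply: meas_and.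
  exact: (meas_preim m21 mD).
exact: (meas_preim m22 mB).
Qed.

Let prod01 (r : seq I) (p : pred I) (g : I -> R) : (forall i, 0 <= g i <= 1) -> 0 <= \prod_(i <- r | p i) g i <= 1.
Proof.
move=> g01; apply: (big_ind (fun x => 0 <= x <= 1)) => //; first by rewrite ler01 lexx.
by move=> x y /andP[x0 x1] /andP[y0 y1]; rewrite mulr_ge0//= mulr_ile1.
Qed.

(** Rectangles are replaced by general functions one index at a time. For the index [i0] the other
    factors are frozen into a weight [X], represented conditionally by [Xh], and the replacement at
    [i0] is a disintegration with that weight. *)
Lemma conditional_product :
  (forall A (D : I -> set T1) (B : I -> set T2), measurable A -> (forall i, measurable (D i)) -> (forall i, measurable (B i)) ->
    (P (th @^-1` A `&` [set o | forall i, D i (Y i o).1 /\ B i (Y i o).2]) =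
     \int[P]_(o in th @^-1` A) (\prod_i cond_exp i (fun p => ind (D i p.2.1 /\ B i p.2.2)) (th o))%:E)%E) ->
  forall A (f : I -> T0 * (T1 * T2) -> R), measurable A -> (forall i, unit_fun (f i)) ->
  (\int[P]_o (ind (A (th o)) * \prod_i f i (th o, Y i o))%:E = \int[P]_o (ind (A (th o)) * \prod_i cond_exp i (f i) (th o))%:E)%E.
Proof.
move=> base.
(* [n] counts the indices, in the order of [enum_rank], that already carry arbitrary functions; the
   others carry rectangles. *)
suff H n : forall f : I -> T0 * (T1 * T2) -> R, (forall i, unit_fun (f i)) ->
    (forall i, (n <= enum_rank i)%N -> exists D B, [/\ measurable D, measurable B & f i = rect D B]) ->
    forall A, measurable A ->
    (\int[P]_o (ind (A (th o)) * \prod_i f i (th o, Y i o))%:E = \int[P]_o (ind (A (th o)) * \prod_i cond_exp i (f i) (th o))%:E)%E.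
  by move=> A f mA uf; apply: (H #|I|) => // i; rewrite leqNgt ltn_ord.
elim: n => [|n ih] f uf rf A mA.
  have rf' i : exists DB : set T1 * set T2, [/\ measurable DB.1, measurable DB.2 & f i = rect DB.1 DB.2].
    by have [D [B [? ? ?]]] := rf i (leq0n _); exists (D, B).
  have [DB hDB] := choice rf'.
  have fE i : f i = rect (DB i).1 (DB i).2 by have [] := hDB i.
  have b := base A (fun i => (DB i).1) (fun i => (DB i).2) mA (fun i => let: And3 h _ _ := hDB i in h) (fun i => let: And3 _ h _ := hDB i in h).
  rewrite (integral_ind P (th @^-1` A)) in b.
  rewrite (eq_integral (fun o => (ind (A (th o)) * \prod_i cond_exp i (fun p => ind ((DB i).1 p.2.1 /\ (DB i).2 p.2.2)) (th o))%:E)) in b; last by [].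
  under [RHS]eq_integral => o _ do under eq_bigr => i _ do rewrite fE.
  rewrite -b; set S := th @^-1` A `&` _.
  have mS : measurable S.
    apply: meas_and; first exact: (meas_preim mth mA).
    apply: meas_all => i; have [mD mB _] := hDB i; apply: meas_and.
      by apply: (meas_preim (f := fun o => (Y i o).1)) => //; exact: measurableT_comp.
    by apply: (meas_preim (f := fun o => (Y i o).2)) => //; exact: measurableT_comp.
  rewrite -[S in RHS]setIT -integral_indic//; apply: eq_integral => o _; congr EFin; rewrite -indE.
  have [[Ao So]|nS] := pselect (S o).
    rewrite [RHS]ind1; last by split.
    by rewrite ind1// mul1r big1// => i _; rewrite fE /rect ind1//; exact: So.
  rewrite [RHS]ind0//; have [Ao|nA] := pselect (A (th o)); last by rewrite ind0// mul0r.
  have [i ni] : exists i, ~ ((DB i).1 (Y i o).1 /\ (DB i).2 (Y i o).2).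
    by apply: contrapT => hh; apply: nS; split=> // i; apply: contrapT => ni; apply: hh; exists i.
  have z : f i (th o, Y i o) = 0 by rewrite fE /rect ind0.
  by rewrite (bigD1 i)//= z mul0r mulr0.
have [nI|In] := ltnP n #|I|; last first.
  by apply: ih => // i ni; have := leq_trans In ni; rewrite leqNgt ltn_ord.
pose i0 := enum_val (Ordinal nI).
pose Xh s := ind (A s) * \prod_(i | i != i0) cond_exp i (f i) s.
pose X o := ind (A (th o)) * \prod_(i | i != i0) f i (th o, Y i o).
have mfY i : mfunT (fun o => f i (th o, Y i o)).
  by apply: (measurableT_comp (f := f i)); [exact: (uf i).1|exact: measurable_fun_pair].
have mindA : mfunT (fun s => ind (A s) : R) by exact: meas_ind.
have X01 o : 0 <= X o <= 1.
  have /andP[x0 x1] : 0 <= \prod_(i | i != i0) f i (th o, Y i o) <= 1 by apply: prod01 => i; exact: (uf i).2.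
  by rewrite mulr_ge0 ?ind_ge0//= mulr_ile1 ?ind_ge0 ?ind_le1.
have Xh01 s : 0 <= Xh s <= 1.
  have /andP[x0 x1] : 0 <= \prod_(i | i != i0) cond_exp i (f i) s <= 1 by apply: prod01 => i; exact: (cond_expE _ _ (uf i)).2.
  by rewrite mulr_ge0 ?ind_ge0//= mulr_ile1 ?ind_ge0 ?ind_le1.
have mX : mfunT X.
  apply: measurable_funM; first exact: (measurableT_comp mindA mth).
  exact: meas_bigprod.
have mXh : mfunT Xh.
  by apply: measurable_funM => //; apply: meas_bigprod => i; exact: meas_cond_exp.
pose q' (p : T0 * (T1 * T2)) := Xh p.1 * q i0 p.
have mq' : mfunT q'.
  by apply: measurable_funM => //; exact: (measurableT_comp mXh).
have q'0 p : 0 <= q' p by rewrite mulr_ge0//; case/andP: (Xh01 p.1).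
have intq' g s : unit_fun g -> (\int[prod_measure m1 m2]_p (g (s, p) * q' (s, p))%:E = (Xh s * cond_exp i0 g s)%:E)%E.
  move=> ug; have [e _] := cond_expE i0 s ug; rewrite [RHS]EFinM -e -ge0_integralZl_EFin//; last 3 first.
  - by move=> p _; rewrite lee_fin mulr_ge0//; case/andP: (ug.2 (s, p)).
  - by apply/measurable_EFinP/measurable_funM; apply: section_meas => //; exact: ug.1.
  - by case/andP: (Xh01 s).
  by apply: eq_integral => p _; rewrite -EFinM; congr EFin; rewrite /q'/= mulrCA.
have ranki0 i : i != i0 -> (n <= enum_rank i)%N -> (n < enum_rank i)%N.
  move=> ii0; rewrite leq_eqVlt => /orP[/eqP ni|//]; case/eqP: ii0.
  by rewrite /i0; apply/enum_rank_inj; rewrite enum_valK; apply/val_inj.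
have := @weighted_disintegration R _ Om P _ _ _ T0 T1 T2 m1 m2 th (Y i0) X q' mth (mY i0) mX X01 mq' q'0 _ (f i0) (uf i0).1 (fun p => proj1 (andP ((uf i0).2 p))).
move=> /(_ _) hh.
transitivity (\int[P]_o (f i0 (th o, Y i0 o) * X o)%:E)%E.
  by apply: eq_integral => o _; congr EFin; rewrite /X (bigD1 i0)//= mulrCA.
rewrite hh; last first.
  move=> A' D B mA' mD mB.
  pose f' i := if i == i0 then rect D B else f i.
  have uf' i : unit_fun (f' i) by rewrite /f'; case: eqP => // _; exact: unit_rect.
  have := ih f' uf' _ (A `&` A') (measurableI _ _ mA mA').
  have f'n i : i != i0 -> f' i = f i by rewrite /f' => /negbTE ->.
  have -> : (\int[P]_o (ind ((A `&` A') (th o)) * \prod_i f' i (th o, Y i o))%:E =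
      \int[P]_o (ind (A' (th o)) * ind (D (Y i0 o).1 /\ B (Y i0 o).2) * X o)%:E)%E.
    apply: eq_integral => o _; congr EFin; rewrite (bigD1 i0)//= /X {1}/f' eqxx.
    rewrite (eq_bigr (fun i => f i (th o, Y i o))); last by move=> i /f'n ->.
    by rewrite /rect /= mulrA ind_and; ring.
  have -> : (\int[P]_o (ind ((A `&` A') (th o)) * \prod_i cond_exp i (f' i) (th o))%:E =
      \int[P]_o ((ind (A' (th o)))%:E * \int[prod_measure m1 m2]_p (ind (D p.1 /\ B p.2) * q' (th o, p))%:E))%E.
    apply: eq_integral => o _.
    rewrite (_ : (\int[prod_measure m1 m2]_p (ind (D p.1 /\ B p.2) * q' (th o, p))%:E)%E = (Xh (th o) * cond_exp i0 (rect D B) (th o))%:E); last first.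
      by rewrite -intq'//; exact: unit_rect.
    rewrite -EFinM; congr EFin; rewrite (bigD1 i0)//= /Xh {1}/f' eqxx.
    rewrite (eq_bigr (fun i => cond_exp i (f i) (th o))); last by move=> i /f'n ->.
    by rewrite ind_and; ring.
  apply=> i ni; rewrite /f'; case: eqP => [_|/eqP ii0]; first by exists D, B.
  exact/rf/ranki0.
apply: eq_integral => o _; rewrite intq'//; congr EFin.
by rewrite [in RHS](bigD1 i0)//= /Xh mulrCA mulrC.
Qed.
End conditional_product.

Lemma integral_shift (R : realType) (b : R) (f : R -> \bar R) :
  measurable_fun [set: measurableTypeR R] (f : measurableTypeR R -> \bar R) -> (forall x, (0 <= f x)%E) ->
  (\int[lebesgue_measure]_x f (x + b)%R = \int[lebesgue_measure]_x f x)%E.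
Proof.
move=> mf f0.
have ms : measurable_fun [set: measurableTypeR R] (fun x : measurableTypeR R => (x + b : measurableTypeR R)) by meas.
have [N [NE intN]] := ex_image_measure ms (@lebesgue_measure R).
rewrite -(intN f mf f0); apply: eq_measure_integral => A mA _; rewrite NE.
have h := @lebesgue_affine R 1 b A ltr01 mA; rewrite invr1 mul1e in h; apply: etrans _ h.
by congr (lebesgue_measure _); apply/funext => x; rewrite /preimage /= mul1r.
Qed.

Lemma exponential_pdf_ind (R : realType) (r x : R) : exponential_pdf r x = ind (0 <= x) * (r * expR (- r * x)).
Proof.
have [x0|x0] := leP 0 x; first by rewrite ind1// mul1r exponential_pdfE.
by rewrite ind0 ?mul0r// lt0_exponential_pdf.
Qed.

Lemma integral_rescale (R : realType) d (S : measurableType d) (m : {measure set S -> \bar R}) (g : S -> S) (r : R) :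
  0 < r -> mfunT g -> (forall A, measurable A -> m (g @^-1` A) = (r%:E * m A)%E) ->
  forall (D : set S) (f : S -> R), mfunT (fun x => ind (D x) * f x) -> (forall x, D x -> 0 <= f x) ->
  (\int[m]_(x in g @^-1` D) (f (g x))%:E = r%:E * \int[m]_(x in D) (f x)%:E)%E.
Proof.
move=> r0 mg hm D f mf f0; have [N [NE intN]] := ex_image_measure mg m.
rewrite (integral_ind m (g @^-1` D) (fun x => f (g x))) (integral_ind m D f); set F : S -> \bar R := fun x => (ind (D x) * f x)%:E.
have mF : mfunT F by apply/measurable_EFinP.
have F0 x : (0 <= F x)%E.
  rewrite lee_fin; have [h|h] := pselect (D x); first by rewrite mulr_ge0 ?ind_ge0 ?f0.
  by rewrite ind0// mul0r.
have -> : (\int[m]_x (ind ((g @^-1` D) x) * f (g x))%:E = \int[m]_x F (g x))%E by [].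
rewrite -(intN F mF F0).
transitivity (\int[mscale (NngNum (ltW r0)) m]_x F x)%E.
  by apply: eq_measure_integral => A mA _; rewrite NE hm.
by rewrite ge0_integral_mscale.
Qed.

(** * The renewal equation for the cells born from a given cell *)

Section cell_functionals.
Context {R : realType} {l : nat}.
Local Notation E := 'rV[R]_l.+1.
Local Notation H := (hyperplane R l).
Local Notation RR := (measurableTypeR R).
Local Notation leb := (@lebesgue_measure R).
Variable L : {sigma_finite_measure set H -> \bar R}.
Variable V : set E.
Hypothesis cV : compact V.
Hypothesis finV : (L (hitting V) < +oo)%E.
Variable T : R.

Section cells_functional.
Implicit Types (C : set E) (f : set E -> R -> R).

Definition is_cell C := closed C /\ C `<=` V.

Definition lam C : R := fine (L (hitting C)).

Lemma cell_compact C : is_cell C -> compact C.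
Proof. by move=> [cC CV]; exact: subclosed_compact cV CV. Qed.

Lemma meas_hitting C : is_cell C -> measurable (hitting C).
Proof. by move=> /cell_compact cC; exact: (rcs_meet rcs_hyperplane cC). Qed.
#[local] Hint Resolve meas_hitting : meas.

Lemma hitting_fin C : is_cell C -> (L (hitting C) < +oo)%E.
Proof.
move=> cC; apply: le_lt_trans finV; apply: measure_le; first exact: meas_hitting.
  by apply: (rcs_meet rcs_hyperplane cV).
by move=> h [x [hx Cx]]; exists x; split=> //; exact: cC.2.
Qed.
#[local] Hint Resolve hitting_fin : meas.

Lemma lamE C : is_cell C -> L (hitting C) = (lam C)%:E.
Proof. by move=> cC; rewrite fineK// ge0_fin_numE// hitting_fin. Qed.

Lemma lam_ge0 C : 0 <= lam C.
Proof. by rewrite fine_ge0. Qed.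

Lemma lam_le C D : is_cell C -> is_cell D -> C `<=` D -> lam C <= lam D.
Proof.
move=> cC cD CD; rewrite -lee_fin -!lamE//; apply: measure_le; [exact: meas_hitting..|].
by move=> h [x [hx Cx]]; exists x; split=> //; exact: CD.
Qed.

Lemma cell_side C b h : is_cell C -> is_cell (C `&` side b h).
Proof. by move=> [cC CV]; split; [apply: closedI => //; exact: side_closed|move=> x [/CV]]. Qed.

Lemma cellV : is_cell V.
Proof. by split=> //; apply: compact_closed => //; exact: norm_hausdorff. Qed.

Definition rcell d (Om : measurableType d) (C : Om -> set E) := rcs C /\ forall o, C o `<=` V.

Lemma rcell_cell d (Om : measurableType d) (C : Om -> set E) o : rcell C -> is_cell (C o).
Proof. by move=> [[cC _] CV]; split. Qed.

Lemma rcell_comp d d' (Om : measurableType d) (Om' : measurableType d') (C : Om' -> set E)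
  (f : Om -> Om') : mfunT f -> rcell C -> rcell (C \o f).
Proof. by move=> mf [rC CV]; split; [exact: rcs_comp|move=> o; exact: CV]. Qed.

Lemma rcell_side d (Om : measurableType d) (C : Om -> set E) b :
  rcell C -> rcell (fun p : Om * H => C p.1 `&` side b p.2).
Proof.
move=> [rC CV]; split; last by move=> p x [/CV].
apply: rcsI; first exact: (rcs_comp measurable_fst rC).
exact: (rcs_comp measurable_snd (rcs_side b)).
Qed.

Lemma meas_hits d (Om : measurableType d) (C : Om -> set E) : rcell C ->
  measurable [set p : Om * H | hitting (C p.1) p.2].
Proof.
move=> [rC CV].
have r : rcs (fun p : Om * H => sval p.2 `&` C p.1).
  by apply: rcsI; [exact: (rcs_comp measurable_snd rcs_hyperplane)|exact: (rcs_comp measurable_fst rC)].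
have := rcs_meet r cV; congr measurable; seteq=> p [x].
  by move=> [[hx Cx] _]; exists x.
by move=> [hx Cx]; exists x; split=> //; exact: CV Cx.
Qed.

Lemma meas_lam d (Om : measurableType d) (C : Om -> set E) : rcell C ->
  mfunT (fun o => lam (C o)).
Proof.
by move=> rC; apply: (measurableT_comp (f := fine)) (meas_measure_section L (meas_hits rC)); meas.
Qed.
#[local] Hint Resolve meas_lam : meas.

(* Bounded functionals of a cell and of a time which are measurable along random cells and times. *)
Definition admissible f := (forall C s, is_cell C -> 0 <= f C s <= 1) /\
  forall d (Om : measurableType d) (C : Om -> set E) (s : Om -> R), rcell C ->
    mfunT s -> mfunT (fun o => f (C o) (s o)).

(** The two halves evolve independently, hence the product. In [jump] the rate of division and the
    law of the dividing hyperplane are merged, their product being [L] restricted to [hitting C]. *)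
Definition split2 f C u (h : H) : R := f (C `&` side true h) u * f (C `&` side false h) u.

Definition jump f C u : R := fine (\int[L]_(h in hitting C) (split2 f C u h)%:E).

Lemma split2_01 f C u h : admissible f -> is_cell C -> 0 <= split2 f C u h <= 1.
Proof.
move=> [f01 _] cC; have /andP[a0 a1] := f01 _ u (cell_side true h cC).
have /andP[b0 b1] := f01 _ u (cell_side false h cC).
by rewrite mulr_ge0//= mulr_ile1.
Qed.

Lemma meas_split2 d (Om : measurableType d) (C : Om -> set E) (s : Om -> R) f :
  admissible f -> rcell C -> mfunT s ->
  mfunT (fun p => split2 f (C p.1) (s p.1) p.2).
Proof.
move=> [_ mf] rC ms; have ms1 := measurableT_comp ms (@measurable_fst _ _ Om H).
by apply: measurable_funM; apply: mf => //; exact: rcell_side.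
Qed.

Lemma rcell_cst C : is_cell C -> rcell (fun _ : unit => C).
Proof. by move=> [cC CV]; split=> //; exact: rcs_cst. Qed.

Lemma meas_split2_cst f C u : admissible f -> is_cell C -> mfunT (split2 f C u).
Proof.
move=> af cC; have h := meas_split2 af (rcell_cst cC) (@measurable_cst _ _ unit R setT u).
exact: (measurableT_comp h (measurable_pair1 tt)).
Qed.

Lemma jumpE f C u : admissible f -> is_cell C ->
  (\int[L]_(h in hitting C) (split2 f C u h)%:E = (jump f C u)%:E)%E.
Proof.
move=> af cC; rewrite fineK//.
have [] := @integral_le_bound R _ H L (hitting C) (split2 f C u) 1 (meas_hitting cC) (hitting_fin cC) => //.
  exact: measurable_funTS (meas_split2_cst u af cC).
by move=> h _; exact: split2_01.
Qed.

Lemma jump_bound f C u : admissible f -> is_cell C -> 0 <= jump f C u <= lam C.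
Proof.
move=> af cC.
have [] := @integral_le_bound R _ H L (hitting C) (split2 f C u) 1 (meas_hitting cC) (hitting_fin cC).
- exact: measurable_funTS (meas_split2_cst u af cC).
- by move=> h _; exact: split2_01.
move=> _ h0; rewrite [X in (_ <= X)%E](_ : _ = (lam C)%:E); last by rewrite mul1e; exact: lamE.
by move=> h1; move: h0 h1; rewrite jumpE// !lee_fin => -> ->.
Qed.

Lemma meas_jump d (Om : measurableType d) (C : Om -> set E) (s : Om -> R) f :
  admissible f -> rcell C -> mfunT s ->
  mfunT (fun o => jump f (C o) (s o)).
Proof.
move=> af rC ms.
rewrite (_ : (fun o => _) = (fun o => fine (\int[L]_h (ind (hitting (C o) h) * split2 f (C o) (s o) h)%:E)%E)).
  apply: (@meas_fine_integral R _ _ Om H L (fun p => ind (hitting (C p.1) p.2) * split2 f (C p.1) (s p.1) p.2)).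
    apply: measurable_funM; last exact: meas_split2.
    by apply: (meas_ind (A := fun p : Om * H => hitting (C p.1) p.2)); exact: meas_hits.
  by move=> p; rewrite mulr_ge0 ?ind_ge0//; case/andP: (split2_01 (s p.1) p.2 af (rcell_cell p.1 rC)).
by apply/funext => o; rewrite /jump integral_ind.
Qed.

(** The empty set must pass: it stands for a cell that leaves no trace in a smaller set. *)
Definition testp (psi : set E -> Prop) := psi set0 /\
  forall d (Om : measurableType d) (C : Om -> set E), rcs C -> measurable [set o | psi (C o)].

Definition obs_type := seq (R * (set E -> Prop)).
Implicit Types obs : obs_type.
Definition ob0 : R * (set E -> Prop) := (0, fun=> True).

Definition good_obs obs := forall j, (j < size obs)%N -> testp (nth ob0 obs j).2.

Definition pass obs C s u := forall j, (j < size obs)%N ->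
  s <= (nth ob0 obs j).1 < u -> (nth ob0 obs j).2 C.

Lemma meas_pass d (Om : measurableType d) (C : Om -> set E) (s u : Om -> R) obs :
  good_obs obs -> rcell C -> mfunT s -> mfunT u ->
  measurable [set o | pass obs (C o) (s o) (u o)].
Proof.
move=> go [rC CV] ms mu; apply: meas_all => j; apply: meas_imp => js.
apply: meas_impl; last exact: (go j js).2.
rewrite (_ : [set o | _] = [set o | s o <= (nth ob0 obs j).1 /\ (nth ob0 obs j).1 < u o]).
  by apply: meas_and; [exact: (meas_le (g := fun=> _))|exact: (meas_lt (f := fun=> _))].
by seteq=> o /=; [move/andP|move=> h; apply/andP].
Qed.
#[local] Hint Resolve meas_pass : meas.

(** Condition on the end of the life of the cell: either it survives until the horizon [T], or it is
    divided at a time [u] before. Tests are meant to be made before [T], hence the value 1 beyond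
    it. *)
Definition renew obs f C s : R :=
  if T <= s then 1 else
  ind (pass obs C s T) * expR (- lam C * (T - s)) +
  fine (\int[leb]_(u in `[s, T]) (ind (pass obs C s u) * expR (- lam C * (u - s)) * jump f C u)%:E).

Lemma meas_renew_int d (Om : measurableType d) (C : Om -> set E) (s : Om -> R) obs f :
  good_obs obs -> admissible f -> rcell C -> mfunT s ->
  mfunT (fun p : Om * RR => ind (pass obs (C p.1) (s p.1) (p.2 : R)) *
    expR (- lam (C p.1) * ((p.2 : R) - s p.1)) * jump f (C p.1) (p.2 : R)).
Proof.
move=> go af rC ms.
have rC1 := rcell_comp (@measurable_fst _ _ Om RR) rC.
have ms1 := measurableT_comp ms (@measurable_fst _ _ Om RR).
have m2 : mfunT (fun p : Om * RR => (p.2 : R)) by exact: measurable_snd.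
have mj := meas_jump af rC1 m2; have ml := meas_lam rC1.
apply: measurable_funM => //; apply: measurable_funM; last meas.
by apply: (meas_ind (A := fun p : Om * RR => pass obs (C p.1) (s p.1) (p.2 : R))); exact: meas_pass.
Qed.

Lemma meas_renew_cst C s obs f : good_obs obs -> admissible f -> is_cell C ->
  mfunT (fun u : RR => ind (pass obs C s (u : R)) * expR (- lam C * ((u : R) - s)) * jump f C (u : R)).
Proof.
move=> go af cC; have h := meas_renew_int go af (rcell_cst cC) (@measurable_cst _ _ unit R setT s).
exact: (measurableT_comp h (measurable_pair1 tt)).
Qed.

Lemma meas_decay f C s : admissible f -> is_cell C ->
  mfunT (fun u : RR => expR (- lam C * ((u : R) - s)) * jump f C (u : R)).
Proof.
move=> af cC; have := meas_renew_cst s (obs := nil) (fun _ h => ltac:(by [])) af cC.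
by congr measurable_fun; apply/funext => u; rewrite ind1 ?mul1r.
Qed.

Lemma renew_integral_bound C a b s obs f : good_obs obs -> admissible f -> is_cell C -> s <= a -> a <= b ->
  [/\ (\int[leb]_(u in `[a, b]) (ind (pass obs C s u) * expR (- lam C * (u - s)) * jump f C u)%:E \is a fin_num)%E,
   (0 <= \int[leb]_(u in `[a, b]) (ind (pass obs C s u) * expR (- lam C * (u - s)) * jump f C u)%:E)%E &
   (\int[leb]_(u in `[a, b]) (ind (pass obs C s u) * expR (- lam C * (u - s)) * jump f C u)%:E <= (expR (- lam C * (a - s)) - expR (- lam C * (b - s)))%:E)%E].
Proof.
move=> go af cC sa ab; set I := (\int[leb]_(u in `[a, b]) _)%E.
have I0 : (0 <= I)%E.
  apply: integral_ge0 => u _; rewrite lee_fin !mulr_ge0 ?ind_ge0 ?expR_ge0//.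
  by case/andP: (jump_bound u af cC).
have I1 : (I <= (expR (- lam C * (a - s)) - expR (- lam C * (b - s)))%:E)%E.
  have -> : expR (- lam C * (a - s)) - expR (- lam C * (b - s)) = expR (- lam C * (a - s)) * (1 - expR (- lam C * (b - a))).
    by rewrite [RHS]mulrBr mulr1 -expRD; congr (_ - expR _); ring.
  rewrite EFinM -integral_exp_itv// -ge0_integralZl_EFin ?expR_ge0//; last 2 first.
  - by move=> u _; rewrite lee_fin mulr_ge0 ?lam_ge0 ?expR_ge0.
  - by meas.
  apply: ge0_le_integral => //.
  - move=> u _; rewrite lee_fin !mulr_ge0 ?ind_ge0 ?expR_ge0//.
    by case/andP: (jump_bound u af cC).
  - by apply/measurable_EFinP/measurable_funTS; exact: meas_renew_cst.
  - by apply: emeasurable_funM; meas.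
  - move=> u _; rewrite lee_fin mulrCA -expRD -mulrDr [a - s + _]addrC -addrA [_ + (a - s)]addrA addNr add0r.
    have /andP[j0 j1] := jump_bound u af cC; rewrite [leRHS]mulrC -mulrA.
    rewrite -[leRHS]mul1r ler_pM ?ind_ge0 ?ind_le1 ?mulr_ge0 ?expR_ge0//.
    by apply: ler_pM => //; exact: expR_ge0.
by split=> //; rewrite ge0_fin_numE// (le_lt_trans I1)// ltry.
Qed.

Lemma admissible_renew obs f : good_obs obs -> admissible f -> admissible (renew obs f).
Proof.
move=> go af; split=> [C s cC|d Om C s rC ms].
  rewrite /renew; case: (leP T s) => Ts; first by rewrite ler01 lexx.
  have [fi i0 i1] := renew_integral_bound go af cC (lexx s) (ltW Ts).
  rewrite addr_ge0 ?mulr_ge0 ?ind_ge0 ?expR_ge0 ?fine_ge0//=.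
  move: i1; rewrite -[X in (X <= _)%E]fineK// lee_fin subrr mulr0 expR0 => i1.
  have := ler_wpM2r (expR_ge0 (- lam C * (T - s))) (@ind_le1 R (pass obs C s T)); rewrite mul1r.
  move: i1; set a := fine _; set b := _ * _; lra.
rewrite (_ : (fun o => _) = (fun o => ind (T <= s o) + (1 - ind (T <= s o)) * (ind (pass obs (C o) (s o) T) * expR (- lam (C o) * (T - s o)) +
   fine (\int[leb]_u (ind (s o <= (u : R) <= T) * (ind (pass obs (C o) (s o) u) * expR (- lam (C o) * (u - s o)) * jump f (C o) u))%:E)%E))); last first.
  apply/funext => o; rewrite /renew; case: leP => h.
    by rewrite ind1// subrr mul0r addr0.
  rewrite [ind false]ind0// subr0 mul1r add0r integral_ind; congr (_ + fine _); apply: eq_integral => u _.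
have mT : measurable [set o | T <= s o] by exact: (meas_le (f := fun=> T)).
have mi := @meas_ind R _ _ _ mT; have ml := meas_lam rC.
have mp := @meas_ind R _ _ _ (@meas_pass _ Om C s (fun=> T) obs go rC ms (measurable_cst _)).
apply: measurable_funD => //; apply: measurable_funM; first meas; apply: measurable_funD; first meas.
apply: (@meas_fine_integral R _ _ Om RR leb (fun p => ind (s p.1 <= (p.2 : R) <= T) * (ind (pass obs (C p.1) (s p.1) (p.2 : R)) *
    expR (- lam (C p.1) * ((p.2 : R) - s p.1)) * jump f (C p.1) (p.2 : R)))).
  apply: measurable_funM; last exact: meas_renew_int.
  apply: meas_ind.
  have m1 := measurableT_comp ms (@measurable_fst _ _ Om RR).
  have m2 : mfunT (fun p : Om * RR => (p.2 : R)) by exact: measurable_snd.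
  rewrite (_ : [set x | _] = [set x : Om * RR | s x.1 <= (x.2 : R) /\ (x.2 : R) <= T]).
    exact: meas_and (meas_le m1 m2) (meas_le (g := fun=> T) m2 (measurable_cst _)).
  by seteq=> o /=; [move/andP|move=> h; apply/andP].
move=> p; rewrite !mulr_ge0 ?ind_ge0 ?expR_ge0//.
by case/andP: (jump_bound (p.2 : R) af (rcell_cell p.1 rC)).
Qed.
End cells_functional.

Section pass_probability.
Implicit Types (C : set E) (f g : set E -> R -> R) (obs : obs_type).

Let mh C (cC : is_cell C) := meas_hitting cC.
Let fh C (cC : is_cell C) := hitting_fin cC.

Lemma jump_le f g C u : admissible f -> admissible g -> is_cell C ->
  (forall D, is_cell D -> f D u <= g D u) -> jump f C u <= jump g C u.
Proof.
move=> af ag cC fg; apply: (@fine_integral_le _ _ _ _ _ _ _ 1); [exact: mh|exact: fh|..].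
- exact: measurable_funTS (meas_split2_cst u af cC).
- exact: measurable_funTS (meas_split2_cst u ag cC).
- by move=> h _; case/andP: (split2_01 u h af cC).
- move=> h _; apply: ler_pM; [| |exact/fg/cell_side..].
    by case/andP: (af.1 _ u (cell_side true h cC)).
  by case/andP: (af.1 _ u (cell_side false h cC)).
- by move=> h _; case/andP: (split2_01 u h ag cC).
Qed.

Lemma renew_int01 C s obs f u : admissible f -> is_cell C -> s <= u ->
  0 <= ind (pass obs C s u) * expR (- lam C * (u - s)) * jump f C u <= lam C.
Proof.
move=> af cC su; have /andP[j0 j1] := jump_bound u af cC.
rewrite !mulr_ge0 ?ind_ge0 ?expR_ge0//= -[leRHS]mul1r ler_pM ?mulr_ge0 ?ind_ge0 ?expR_ge0//.
rewrite mulr_ile1 ?ind_ge0 ?expR_ge0 ?ind_le1// -expR0 ler_expR.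
by rewrite mulNr oppr_le0 mulr_ge0 ?lam_ge0 ?subr_ge0.
Qed.

Lemma renew_le obs f g C s : good_obs obs -> admissible f -> admissible g -> is_cell C ->
  (forall D u, is_cell D -> f D u <= g D u) -> renew obs f C s <= renew obs g C s.
Proof.
move=> go af ag cC fg; rewrite /renew; have [Ts|Ts] := leP T s; first exact: lexx.
rewrite lerD2l; apply: (@fine_integral_le R _ RR leb _ _ _ (lam C)) => //; first exact: itv_fin.
- apply: measurable_funTS; exact: (meas_renew_cst s go af cC).
- apply: measurable_funTS; exact: (meas_renew_cst s go ag cC).
- by move=> u; rewrite /= in_itv/= => /andP[su _]; case/andP: (renew_int01 obs af cC su).
- move=> u _; rewrite ler_wpM2l ?mulr_ge0 ?ind_ge0 ?expR_ge0//.
  by apply: jump_le => // D cD; exact: fg.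
- by move=> u; rewrite /= in_itv/= => /andP[su _]; case/andP: (renew_int01 obs ag cC su).
Qed.

(** Starting the iteration from 1 means forgetting the tests on all but the first [m] generations;
    the limit [pass_all] is therefore a decreasing one. *)
Definition pass_upto obs m : set E -> R -> R := iter m (renew obs) (fun _ _ => 1).

Definition pass_all obs C s : R := limn (fun m => pass_upto obs m C s).

Variable obs : obs_type.
Hypothesis go : good_obs obs.
Local Notation F := (pass_upto obs).
Local Notation G := (pass_all obs).

Lemma admissible_pass_upto m : admissible (F m).
Proof.
elim: m => [|m ih]; last exact: admissible_renew.
by split=> [C s _|d Om C s _ _]; [rewrite ler01 lexx|exact: measurable_cst].
Qed.

Lemma pass_upto_le C s m n : is_cell C -> (m <= n)%N -> F n C s <= F m C s.
Proof.
move=> cC /subnK <-; elim: (n - m)%N => // k ih; apply: le_trans ih; rewrite addSn.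
elim: (k + m)%N C s cC => [|j ih] C s cC.
  by case/andP: ((admissible_pass_upto 1).1 C s cC).
exact: (renew_le s go (admissible_pass_upto j.+1) (admissible_pass_upto j) cC ih).
Qed.

Lemma pass_upto_cvg C s : is_cell C -> F m C s @[m --> \oo] --> G C s.
Proof.
move=> cC; apply: nonincreasing_is_cvgn.
  by move=> m n mn; exact: pass_upto_le.
by exists 0 => _ [m _ <-]; case/andP: ((admissible_pass_upto m).1 C s cC).
Qed.

Lemma admissible_pass_all : admissible G.
Proof.
split=> [C s cC|d Om C s rC ms].
  by apply: (@cvgn_bounds R (fun m => F m C s)); [move=> m; exact: (admissible_pass_upto m).1|exact: pass_upto_cvg].
apply: (@measurable_fun_cvg _ Om R setT (fun m o => F m (C o) (s o))).
  by move=> m; exact: (admissible_pass_upto m).2.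
by move=> o _; apply: pass_upto_cvg; exact: rcell_cell.
Qed.

Lemma jump_cvg C u : is_cell C -> jump (F m) C u @[m --> \oo] --> jump G C u.
Proof.
move=> cC; apply: (@bounded_cvg_integral _ _ _ L _ (fun m => split2 (F m) C u) (split2 G C u) 1); [exact: mh|exact: fh|..].
- by move=> m; exact: measurable_funTS (meas_split2_cst u (admissible_pass_upto m) cC).
- by move=> m h _; exact: split2_01 (admissible_pass_upto m) cC.
- by move=> h _; apply: cvgM; apply: pass_upto_cvg; exact: cell_side.
Qed.

Lemma pass_allE C s : is_cell C -> G C s = renew obs G C s.
Proof.
move=> cC.
have h : F m.+1 C s @[m --> \oo] --> G C s by rewrite (cvg_shiftS (fun m => F m C s)); exact: pass_upto_cvg.
have h2 : F m.+1 C s @[m --> \oo] --> renew obs G C s.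
  rewrite /= /renew; case: (leP T s) => Ts; first exact: cvg_cst.
  apply: cvgD; first exact: cvg_cst.
  apply: (@bounded_cvg_integral _ _ RR leb _ (fun m u => ind (pass obs C s u) * expR (- lam C * (u - s)) * jump (F m) C u)
     (fun u => ind (pass obs C s u) * expR (- lam C * (u - s)) * jump G C u) (lam C)) => //; first exact: itv_fin.
  - by move=> m; apply: measurable_funTS; exact: (meas_renew_cst s go (admissible_pass_upto m) cC).
  - by move=> m u; rewrite /= in_itv/= => /andP[su _]; exact: renew_int01 (admissible_pass_upto m) cC su.
  - by move=> u _; apply: cvgM; [exact: cvg_cst|exact: jump_cvg].
exact: (cvg_unique _ h h2).
Qed.
End pass_probability.

Local Notation G := pass_all.

Section pass_probability_equations.
Implicit Types (C : set E) (f g : set E -> R -> R) (obs : obs_type).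

Lemma renewE obs f C s : s < T -> renew obs f C s =
  ind (pass obs C s T) * expR (- lam C * (T - s)) +
  itvint s T (fun u => ind (pass obs C s u) * expR (- lam C * (u - s)) * jump f C u).
Proof. by move=> sT; rewrite /renew leNgt sT. Qed.

Lemma renew1 obs f C s : T <= s -> renew obs f C s = 1.
Proof. by move=> sT; rewrite /renew sT. Qed.

Lemma pass_uptoS obs m C s : pass_upto obs m.+1 C s = renew obs (pass_upto obs m) C s.
Proof. exact: erefl. Qed.

Lemma eq_jump f g C u : (forall D, D `<=` C -> f D u = g D u) -> jump f C u = jump g C u.
Proof.
by move=> fg; rewrite /jump; congr fine; apply: eq_integral => k _; rewrite /split2 !fg// => x [].
Qed.

Lemma pass_all_eq obs obs' D s0 :
  (forall C s u, C `<=` D -> s0 <= s -> pass obs C s u <-> pass obs' C s u) ->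
  forall C s, C `<=` D -> s0 <= s -> G obs C s = G obs' C s.
Proof.
move=> h C s CD ss; rewrite /pass_all.
suff E m : pass_upto obs m C s = pass_upto obs' m C s by under eq_fun do rewrite E.
elim: m C s CD ss => [|m ih] C s CD ss; first exact: erefl.
rewrite !pass_uptoS; have [Ts|sT] := leP T s; first by rewrite !renew1.
have pE u : pass obs C s u = pass obs' C s u :> Prop by apply/propext; exact: h.
rewrite (renewE _ _ _ sT) (renewE _ _ _ sT) (pE T); apply: (congr1 (GRing.add _)); apply: itvint_ext => u su uT.
rewrite (pE u); apply: (congr1 (GRing.mul _)); apply: eq_jump => D' DC.
by apply: ih; [move=> x /DC/CD|exact: le_trans su].
Qed.

Lemma pass_allT obs C s : good_obs obs -> is_cell C -> T <= s -> G obs C s = 1.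
Proof. by move=> go cC Ts; rewrite (pass_allE go s cC) /renew Ts. Qed.

Lemma good_cons e obs : good_obs (e :: obs) <-> testp e.2 /\ good_obs obs.
Proof. exact: (all_nth_cons ob0 (fun e => testp e.2)). Qed.

Lemma pass_cons e obs C s u : pass (e :: obs) C s u <-> (s <= e.1 < u -> e.2 C) /\ pass obs C s u.
Proof. exact: (all_nth_cons ob0 (fun e => s <= e.1 < u -> e.2 C)). Qed.

(** The cell [C] born at the time of the first test undergoes it unless it is divided at that very
    instant, a null event. The verdict thus comes out as a factor. *)
Lemma pass_all_first e obs C : good_obs (e :: obs) -> is_cell C -> e.1 < T ->
  G (e :: obs) C e.1 = ind (e.2 C) * G obs C e.1.
Proof.
move=> go cC eT; have [te go'] := (good_cons _ _).1 go.
rewrite !(pass_allE _ e.1 cC)// !renewE// [RHS]mulrDr [in RHS]mulrA.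
have pE u : e.1 < u -> ind (pass (e :: obs) C e.1 u) = ind (e.2 C) * ind (pass obs C e.1 u) :> R.
  move=> eu; have [eC|neC] := pselect (e.2 C).
    rewrite [X in X * _]ind1// mul1r; congr ind; apply/propext; rewrite pass_cons; split=> [[]//|h]; split=> //.
  by rewrite [X in X * _]ind0// mul0r ind0// pass_cons lexx eu => -[/(_ isT)].
rewrite pE//; congr (_ + _); have af := admissible_pass_all go; have af' := admissible_pass_all go'.
rewrite -(@itvint_scale R _ _ _ _ (lam C)) ?ind_ge0//.
- apply: itvint_eq; first exact: (meas_renew_cst e.1 go af cC).
    exact: measurable_funM (measurable_cst _) (meas_renew_cst e.1 go' af' cC).
  move=> u eu uT; rewrite pE// !mulrA; apply: (congr1 (GRing.mul _)); apply: eq_jump => D _.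
  apply: (@pass_all_eq _ _ setT u) => // D' s v _ us; rewrite pass_cons.
  by split=> [[]//|h]; split=> // /andP[se _]; have := lt_le_trans eu (le_trans us se); rewrite ltxx.
- exact: (meas_renew_cst e.1 go' af' cC).
- by move=> u eu _; exact: (renew_int01 obs af' cC eu).
Qed.

(** With no test in between, the future after [s'] does not depend on the date of birth. By lack of
    memory the renewal equation at [s] contains the one at [s'], multiplied by the probability of
    surviving from [s] to [s']. *)
Lemma pass_all_step obs C s s' : good_obs obs -> is_cell C -> s <= s' -> s' <= T ->
  (forall D u v, s <= u -> u <= s' -> pass obs D u v <-> pass obs D s' v) ->
  G obs C s = expR (- lam C * (s' - s)) * G obs C s' +
     itvint s s' (fun u => expR (- lam C * (u - s)) * jump (G obs) C u).
Proof.
move=> go cC ss sT hp; have af := admissible_pass_all go.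
have [sT2|sT2] := leP T s.
  have sE : s = s' by apply/le_anti; rewrite ss (le_trans sT sT2).
  rewrite -sE subrr mulr0 expR0 mul1r /itvint set_itv1 integral_set1 addr0//.
rewrite (pass_allE go s cC) renewE//.
have mr := meas_decay s af cC.
rewrite (@itvint_cat R s s' T _ (lam C))//.
- rewrite addrCA addrC; congr (_ + _).
  + rewrite [X in _ = _ * X](pass_allE go s' cC); have [Ts|Ts] := leP T s'; first rewrite renew1//.
      have -> : s' = T by apply/le_anti; rewrite sT Ts.
      rewrite {1}/itvint set_itv1 integral_set1 addr0 mulr1 ind1 ?mul1r//.
      rewrite [pass obs C s T](propext (hp _ _ _ (lexx s) ss)) => //.
      by move=> j js /andP[h1 h2]; have := lt_le_trans (le_lt_trans h1 h2) Ts; rewrite ltxx.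
    rewrite renewE// [RHS]mulrDr; congr (_ + _).
      rewrite [pass obs C s T](propext (hp _ _ _ (lexx s) ss)) mulrCA -expRD -mulrDr.
      by apply: (congr1 (GRing.mul _)); congr (expR (_ * _)); ring.
    rewrite -(@itvint_scale R _ _ _ _ (lam C)) ?expR_ge0//.
    * apply: itvint_eq; first exact: (meas_renew_cst s go af cC).
        exact: measurable_funM (measurable_cst _) (meas_renew_cst s' go af cC).
      move=> u su uT; rewrite [pass obs C s u](propext (hp _ _ _ (lexx s) ss)) !mulrA; congr (_ * _).
      by rewrite mulrAC mulrC; congr (_ * _); rewrite -expRD -mulrDr; congr (expR (_ * _)); ring.
    * exact: (meas_renew_cst s' go af cC).
    * by move=> u eu _; exact: (renew_int01 obs af cC eu).
  + apply: itvint_eq => //; first exact: (meas_renew_cst s go af cC).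
    move=> u su us; rewrite ind1 ?mul1r// hp// => j js /andP[h1 h2].
    by have := lt_le_trans (le_lt_trans h1 h2) us; rewrite ltxx.
- exact: (meas_renew_cst s go af cC).
- by move=> u eu _; exact: (renew_int01 obs af cC eu).
Qed.
End pass_probability_equations.

(** * The backward equation, one Euler step at a time *)

Section euler_step.
Implicit Types (C : set E) (f g : set E -> R -> R) (obs : obs_type).

Lemma lam_leV C : is_cell C -> lam C <= lam V.
Proof. by move=> cC; apply: (lam_le cC (cellV)); exact: cC.2. Qed.

Lemma split2_integrable f C u : admissible f -> is_cell C ->
  L.-integrable (hitting C) (EFin \o split2 f C u).
Proof.
move=> af cC; apply: (@bounded_integrable _ _ _ _ _ _ _ (split2 f C u) 1).
- exact: meas_hitting cC.
- exact: hitting_fin cC.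
- by apply: measurable_funTS; exact: (meas_split2_cst u af cC).
- by move=> h _; have /andP[? ?] := split2_01 u h af cC; rewrite ger0_norm.
Qed.

Lemma jump_near f g C u v e : admissible f -> admissible g -> is_cell C -> 0 <= e ->
  (forall D, is_cell D -> `|f D u - g D v| <= e) -> `|jump f C u - jump g C v| <= 2 * e * lam C.
Proof.
move=> af ag cC e0 fg.
apply: (@Rintegral_near _ _ _ _ _ _ _ (split2 f C u) (split2 g C v)).
- exact: meas_hitting cC.
- exact: hitting_fin cC.
- by rewrite mulr_ge0.
- exact: split2_integrable.
- exact: split2_integrable.
- apply: aeW => h _; rewrite /split2.
  have c1 := cell_side true h cC; have c2 := cell_side false h cC.
  have /andP[a0 a1] := af.1 _ u c1; have /andP[b0 b1] := ag.1 _ v c2.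
  have := fg _ c1; have := fg _ c2; move: a0 a1 b0 b1.
  move: (f _ u) (f _ u) (g _ v) (g _ v) => x y z t x0 x1 t0 t1 h1 h2.
  rewrite [X in `|X|](_ : _ = y * (x - t) + (y - z) * t); last by ring.
  apply: le_trans (ler_normD _ _) _; rewrite !normrM [2 * e]mulr_natl mulr2n.
  by apply: lerD; [rewrite -[leRHS]mul1r|rewrite -[leRHS]mulr1]; apply: ler_pM => //; rewrite ger0_norm.
Qed.

(** Holds when no test is made in [s, s'[: a date of birth in that interval may be replaced by [s']
    without changing any verdict. *)
Definition quiet obs s s' := forall D u v, s <= u -> u <= s' -> pass obs D u v <-> pass obs D s' v.

Lemma quiet_sub obs s s' u : quiet obs s s' -> s <= u -> quiet obs u s'.
Proof. by move=> q su D v w uv; apply: q; exact: le_trans uv. Qed.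

Variable obs : obs_type.
Hypothesis go : good_obs obs.
Let ag := admissible_pass_all go.

Lemma pass_all_lip C u s' : is_cell C -> u <= s' -> s' <= T -> quiet obs u s' ->
  `|G obs C u - G obs C s'| <= lam V * (s' - u).
Proof.
move=> cC us sT q; rewrite (pass_all_step go cC us sT q).
have l0 := lam_ge0 C; have lV := lam_leV cC; have d0 : 0 <= s' - u by rewrite subr_ge0.
have mr := meas_decay u ag cC.
have i0 v : u <= v -> 0 <= expR (- lam C * (v - u)) * jump (G obs) C v <= lam C.
  move=> uv; have /andP[j0 j1] := jump_bound v ag cC.
  rewrite mulr_ge0 ?expR_ge0//= -[leRHS]mul1r ler_pM ?expR_ge0// expR_le1.
  by rewrite mulNr oppr_le0 mulr_ge0// subr_ge0.
have := @itvint_near R u s' _ (lam C / 2) (lam C / 2) us mr (fun v h _ => proj1 (andP (i0 v h))) _.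
set I := itvint _ _ _ => hI.
have {hI} : `|I - (s' - u) * (lam C / 2)| <= lam C / 2 * (s' - u).
  by apply: hI => v uv _; have /andP[] := i0 v uv; rewrite ler_norml => ? ?; apply/andP; split; lra.
have /andP[g0 g1] := ag.1 C s' cC; have := expR_ge1Dx (- lam C * (s' - u)).
have : expR (- lam C * (s' - u)) <= 1 by rewrite expR_le1 mulNr oppr_le0 mulr_ge0.
move: (expR _) => x x1 x0; rewrite !ler_norml => /andP[i1 i2].
have h3 : lam C * (s' - u) <= lam V * (s' - u) by exact: ler_wpM2r.
have h4 : 0 <= (1 - x) * G obs C s' <= lam C * (s' - u).
  apply/andP; split; first by apply: mulr_ge0 => //; lra.
  apply: (@le_trans _ _ (1 - x)); last by lra.
  by rewrite ler_piMr//; lra.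
by apply/andP; split; move: h4 => /andP[h4 h5]; lra.
Qed.

(** In the factor 4, two units come from the Lipschitz bound on [jump], one from the exponential
    under the integral, and one from the second-order term of the survival probability. *)
Lemma pass_all_euler C s s' : is_cell C -> s <= s' -> s' <= T -> quiet obs s s' ->
  `|G obs C s - G obs C s' - (s' - s) * (jump (G obs) C s' - lam C * G obs C s')| <= 4 * (lam V * (s' - s)) ^+ 2.
Proof.
move=> cC ss sT q; rewrite (pass_all_step go cC ss sT q).
have l0 := lam_ge0 C; have lV := lam_leV cC; have d0 : 0 <= s' - s by rewrite subr_ge0.
have mr := meas_decay s ag cC.
have j0 v := jump_bound v ag cC.
have hI : `|itvint s s' (fun v => expR (- lam C * (v - s)) * jump (G obs) C v) - (s' - s) * jump (G obs) C s'|
    <= 3 * lam V ^+ 2 * (s' - s) * (s' - s).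
  apply: itvint_near => // v sv vs.
    by rewrite mulr_ge0 ?expR_ge0//; case/andP: (j0 v).
  have jl : `|jump (G obs) C v - jump (G obs) C s'| <= 2 * (lam V * (s' - s)) * lam C.
    apply: jump_near => //; first by rewrite mulr_ge0// (le_trans l0 lV).
    move=> D cD; apply: le_trans (pass_all_lip cD vs sT (quiet_sub q sv)) _.
    by rewrite ler_wpM2l ?(le_trans l0 lV)// lerD2l lerN2.
  have e1 : expR (- lam C * (v - s)) <= 1 by rewrite expR_le1 mulNr oppr_le0 mulr_ge0// subr_ge0.
  have e0 : 1 - lam C * (s' - s) <= expR (- lam C * (v - s)).
    apply: le_trans (expR_ge1Dx _); rewrite mulNr lerD2l lerN2 ler_wpM2l// lerD2r//.
  have /andP[x0 x1] := j0 v; move: jl e1 e0 x0 x1.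
  move: (expR _) (jump _ _ v) (jump _ _ s') => e x y hxy e1 e0 x0 x1.
  have -> : e * x - y = (x - y) - (1 - e) * x by ring.
  apply: le_trans (ler_normB _ _) _.
  rewrite [X in _ + X <= _]ger0_norm; last by apply: mulr_ge0 => //; lra.
  have h1 : (1 - e) * x <= lam V * (s' - s) * lam V.
    apply: ler_pM => //; first by lra.
      by apply: (@le_trans _ _ (lam C * (s' - s))); [lra|exact: ler_wpM2r].
    exact: le_trans lV.
  have h2 : 2 * (lam V * (s' - s)) * lam C <= 2 * (lam V * (s' - s)) * lam V.
    by rewrite ler_wpM2l// !mulr_ge0// (le_trans l0 lV).
  by rewrite expr2; lra.
have /andP[g0 g1] := ag.1 C s' cC.
have hE : `|(expR (- lam C * (s' - s)) - 1 + lam C * (s' - s)) * G obs C s'| <= (lam V * (s' - s)) ^+ 2.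
  rewrite normrM -[leRHS]mulr1; apply: ler_pM => //; last by rewrite ger0_norm.
  rewrite mulNr; apply: le_trans (expRN_near (mulr_ge0 l0 d0)) _.
  by rewrite lerXn2r ?nnegrE ?mulr_ge0 ?(le_trans l0 lV)// ler_wpM2r.
move: hI hE; move: (itvint _ _ _) (expR _) => I e hI hE.
rewrite [X in `|X|](_ : _ = (e - 1 + lam C * (s' - s)) * G obs C s' + (I - (s' - s) * jump (G obs) C s')); last by ring.
apply: le_trans (ler_normD _ _) _; apply: le_trans (lerD hE hI) _.
by rewrite le_eqVlt; apply/orP; left; apply/eqP; ring.
Qed.
End euler_step.

(** * Consistency under restriction to a convex set *)

Section consistency.
Implicit Types (C D : set E) (f g : set E -> R -> R) (obs : obs_type).

Lemma lam0 : lam set0 = 0.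
Proof.
rewrite /lam (_ : hitting set0 = set0) ?measure0//.
by seteq=> // h [x []].
Qed.

Lemma jump0 f u : jump f set0 u = 0.
Proof.
rewrite /jump (_ : hitting set0 = set0) ?integral_set0//.
by seteq=> // h [x []].
Qed.

Lemma pass_all0 obs s : good_obs obs -> G obs set0 s = 1.
Proof.
move=> go; rewrite /pass_all.
suff E m u : pass_upto obs m set0 u = 1.
  by under eq_fun do rewrite E; exact: lim_cst.
elim: m u => [|m ih] u; first exact: erefl.
rewrite pass_uptoS; have [Ts|sT] := leP T u; first by rewrite renew1.
rewrite (renewE _ _ _ sT) lam0 oppr0 mul0r expR0 mulr1 ind1; last by move=> j js _; have [] := go j js.
rewrite (itvint_ext (g := fun=> 0)) ?/itvint ?integral0 ?addr0//.
by move=> v _ _; rewrite jump0 mulr0.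
Qed.

Lemma pass_all_le obs obs' C s : good_obs obs -> good_obs obs' -> is_cell C ->
  (forall D u v, pass obs D u v -> pass obs' D u v) -> G obs C s <= G obs' C s.
Proof.
move=> go go' cC h.
suff le m : pass_upto obs m C s <= pass_upto obs' m C s.
  apply: ler_lim; last exact: nearW.
    exact: (pass_upto_cvg go cC).
  exact: (pass_upto_cvg go' cC).
elim: m C s cC => [|m ih] C s cC; first exact: lexx.
rewrite !pass_uptoS; apply: (@le_trans _ _ (renew obs (pass_upto obs' m) C s)).
  by apply: (renew_le s go) => //; exact: admissible_pass_upto.
have [Ts|sT] := leP T s; first by rewrite !renew1.
have am := admissible_pass_upto go' m.
have indh u : ind (pass obs C s u) <= ind (pass obs' C s u) :> R.
  by have [p|p] := pselect (pass obs C s u); [rewrite !ind1//; exact: h|rewrite ind0// ind_ge0].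
rewrite (renewE _ _ _ sT) (renewE _ _ _ sT); apply: lerD.
  by rewrite ler_wpM2r ?expR_ge0.
apply: (@fine_integral_le R _ RR (@lebesgue_measure R) _ _ _ (lam C)) => //; first exact: itv_fin.
- by apply: measurable_funTS; exact: (meas_renew_cst s go am cC).
- by apply: measurable_funTS; exact: (meas_renew_cst s go' am cC).
- by move=> u; rewrite /= in_itv/= => /andP[su _]; case/andP: (renew_int01 obs am cC su).
- move=> u _; have /andP[j0 _] := jump_bound u am cC.
  by rewrite ler_wpM2r// ler_wpM2r ?expR_ge0.
- by move=> u; rewrite /= in_itv/= => /andP[su _]; case/andP: (renew_int01 obs' am cC su).
Qed.

Definition local_obs (B : set E) obs := forall j, (j < size obs)%N ->
  forall C, (nth ob0 obs j).2 (C `&` B) <-> (nth ob0 obs j).2 C.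

Fixpoint sorted_obs obs := if obs is e :: obs' then
  (forall j, (j < size obs')%N -> e.1 <= (nth ob0 obs' j).1) /\ sorted_obs obs' else True.

Definition before (t : R) obs := forall j, (j < size obs)%N -> (nth ob0 obs j).1 < t.

Lemma local_cons B e obs : local_obs B (e :: obs) <-> (forall C, e.2 (C `&` B) <-> e.2 C) /\ local_obs B obs.
Proof. exact: (all_nth_cons ob0 (fun e => forall C, e.2 (C `&` B) <-> e.2 C)). Qed.

Lemma before_cons t e obs : before t (e :: obs) <-> e.1 < t /\ before t obs.
Proof. exact: (all_nth_cons ob0 (fun e => e.1 < t)). Qed.

Lemma quiet_sorted e obs s : sorted_obs (e :: obs) -> quiet (e :: obs) s e.1.
Proof.
move=> [h _] D u v su ue; split=> p j js /andP[h1 h2]; apply: (p j js); rewrite h2 andbT.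
  exact: le_trans h1.
by case: j js {h1 h2 p} => [|j] js //=; exact: h.
Qed.

Lemma pass_all_tail e obs C s : e.1 < s -> G (e :: obs) C s = G obs C s.
Proof.
move=> es; apply: (@pass_all_eq _ _ setT s) => // D u v _ su; rewrite pass_cons.
by split=> [[]//|h]; split=> // /andP[ue _]; have := lt_le_trans es (le_trans su ue); rewrite ltxx.
Qed.

Lemma split2_miss f D h u : cvx D -> f set0 u = 1 -> sval h `&` D = set0 -> split2 f D u h = f D u.
Proof.
move=> cD f1 /(cvx_one_side cD)[b [Db Dnb]]; have DE : D `&` side b h = D by apply/setIidPl.
by rewrite /split2; case: b Db Dnb DE => /= Db Dnb -> ; rewrite Dnb f1 ?mulr1 ?mul1r.
Qed.

(* The last term comes from the hyperplanes hitting [C] but not [D]. *)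
Lemma split2_sub_int f C D u : admissible f -> is_cell C -> is_cell D -> D `<=` C -> cvx D ->
  f set0 u = 1 ->
  \int[L]_(h in hitting C) split2 f D u h = jump f D u + (lam C - lam D) * f D u.
Proof.
move=> af cC cD DC vD f1.
have mC := meas_hitting cC; have mD := meas_hitting cD.
have fC := hitting_fin cC.
have HDC : hitting D `<=` hitting C by move=> h [x [hx Dx]]; exists x; split=> //; exact: DC.
have s01 h := split2_01 u h af cD.
have ms := meas_split2_cst u af cD.
have mX : measurable (hitting C `\` hitting D) by exact: measurableD.
have fX : (L (hitting C `\` hitting D) < +oo)%E.
  by apply: le_lt_trans fC; apply: measure_le => // h [].
have -> : hitting C = hitting D `|` (hitting C `\` hitting D) by rewrite setDUK.
rewrite Rintegral_setU//; last 2 first.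
- rewrite setDUK//; apply: (@bounded_integrable _ _ _ _ _ _ _ (split2 f D u) 1) => //; first exact: measurable_funTS.
  by move=> h _; have /andP[? ?] := s01 h; rewrite ger0_norm.
- by apply/disj_setPS => h [? []].
congr (_ + _); rewrite (_ : \int[L]_(x in _ `\` _) _ = \int[L]_(x in hitting C `\` hitting D) (f D u)); last first.
  apply: eq_Rintegral => h /set_mem[_ nD]; apply: split2_miss => //; seteq=> // x [hx Dx].
  by apply: nD; exists x.
rewrite Rintegral_cst// mulrC; congr (_ * _).
rewrite measureD// (setIidr HDC).
rewrite fineB ?ge0_fin_numE//; exact: (hitting_fin cD).
Qed.

Variable obs : obs_type.

(** A hyperplane that hits [C] but misses its trace in [B] leaves the trace whole on one side. Hence
    the values at [C] and at its trace follow the same backward equation, the larger rate of [C]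
    being compensated by such hyperplanes. Each of the two schemes brings an error with factor 4,
    hence 8; in the rate 3, two units come from the two halves and one from [lam]. *)
Lemma consistent_step obs0 (B : set E) s0 s1 : good_obs obs0 -> closed B -> cvx B ->
  s0 <= s1 -> s1 <= T -> quiet obs0 s0 s1 ->
  (forall C, is_cell C -> cvx C -> G obs0 C s1 = G obs0 (C `&` B) s1) ->
  forall C, is_cell C -> cvx C -> G obs0 C s0 = G obs0 (C `&` B) s0.
Proof.
move=> go clB cB s01 s1T q h1 C cC vC.
have ag := admissible_pass_all go.
have lV0 := lam_ge0 V.
have cellI D : is_cell D -> is_cell (D `&` B).
  by move=> [cD DV]; split; [exact: closedI|move=> x [/DV]].
have cvxI D D' : cvx D -> cvx D' -> cvx (D `&` D').
  by move=> h h' x y t t01 [? ?] [? ?]; split; [exact: h|exact: h'].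
apply: (@euler_unique R (set E) (fun D => is_cell D /\ cvx D) (G obs0) (fun D s => G obs0 (D `&` B) s)
   s0 s1 (3 * lam V) (8 * lam V ^+ 2)) => //; try by rewrite mulr_ge0 ?exprn_ge0.
  by move=> D [cD vD]; exact: h1.
move=> s s' Bd s0s ss s's1 _ Bd0 hB D [cD vD].
have q' : quiet obs0 s s' by move=> D' u v su us; rewrite (q D' u) ?(le_trans s0s)// ?(le_trans us)// -(q D' s')// (le_trans s0s).
have sT : s' <= T by exact: le_trans s1T.
have e1 := pass_all_euler go cD ss sT q'.
have e2 := pass_all_euler go (cellI _ cD) ss sT q'.
have l0 := lam_ge0 D; have lV := lam_leV cD.
have jE := split2_sub_int ag cD (cellI _ cD) (@subIsetl _ D B) (cvxI _ _ vD cB) (pass_all0 s' go).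
have jn : `|jump (G obs0) D s' - \int[L]_(h in hitting D) split2 (G obs0) (D `&` B) s' h| <= 2 * Bd * lam D.
  apply: (@Rintegral_near _ _ _ _ _ _ _ (split2 (G obs0) D s') (split2 (G obs0) (D `&` B) s')).
  - exact: (meas_hitting cD).
  - exact: (hitting_fin cD).
  - by rewrite mulr_ge0.
  - exact: (split2_integrable).
  - apply: (@bounded_integrable _ _ _ _ _ _ _ (split2 (G obs0) (D `&` B) s') 1).
    + exact: (meas_hitting cD).
    + exact: (hitting_fin cD).
    + by apply: measurable_funTS; exact: (meas_split2_cst s' ag (cellI _ cD)).
    + by move=> h _; have /andP[? ?] := split2_01 s' h ag (cellI _ cD); rewrite ger0_norm.
  - apply: aeW => h _; rewrite /split2.
    have c1 := cell_side true h cD; have c2 := cell_side false h cD.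
    have /andP[a0 a1] := ag.1 _ s' c1; have /andP[b0 b1] := ag.1 _ s' (cellI _ c2).
    have := hB _ (conj c1 (cvxI _ _ vD (@side_cvx R l true h))).
    have := hB _ (conj c2 (cvxI _ _ vD (@side_cvx R l false h))); move: a0 a1 b0 b1.
    rewrite !(setIAC D B).
    move: (G obs0 (D `&` side true h) s') (G obs0 (D `&` side false h) s')
      (G obs0 (D `&` side true h `&` B) s') (G obs0 (D `&` side false h `&` B) s') => x y z t x0 x1 t0 t1 k1 k2.
    rewrite [X in `|X|](_ : _ = x * (y - t) + (x - z) * t); last by ring.
    apply: le_trans (ler_normD _ _) _; rewrite !normrM [2 * Bd]mulr_natl mulr2n.
    by apply: lerD; [rewrite -[leRHS]mul1r|rewrite -[leRHS]mulr1]; apply: ler_pM => //; rewrite ger0_norm.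
move: jn; rewrite jE; have := hB D (conj cD vD); move: e1 e2.
have d0 : 0 <= s' - s by rewrite subr_ge0.
have h4 : 2 * Bd * lam D * (s' - s) <= 2 * Bd * lam V * (s' - s) by rewrite ler_wpM2r// ler_wpM2l// mulr_ge0.
have h5 : Bd * (lam D * (s' - s)) <= Bd * (lam V * (s' - s)) by rewrite ler_wpM2l// ler_wpM2r.
have h6 : 0 <= lam D * (s' - s) by rewrite mulr_ge0.
move: (G obs0 D s) (G obs0 D s') (G obs0 (D `&` B) s) (G obs0 (D `&` B) s') (jump _ D _) (jump _ (D `&` B) _) (lam (D `&` B)) => x x' y y' j i k e1 e2 e3 e4.
rewrite [X in `|X|](_ : _ = (x - x' - (s' - s) * (j - lam D * x')) - (y - y' - (s' - s) * (i - k * y'))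
   + (x' - y') * (1 - lam D * (s' - s)) + (s' - s) * (j - (i + (lam D - k) * y'))); last by ring.
apply: le_trans (ler_normD _ _) _.
apply: (@le_trans _ _ ((4 * (lam V * (s' - s)) ^+ 2 + 4 * (lam V * (s' - s)) ^+ 2 + Bd * (1 + lam D * (s' - s))) + (s' - s) * (2 * Bd * lam D))); last first.
  rewrite (_ : 8 * lam V ^+ 2 * (s' - s) ^+ 2 = 8 * (lam V * (s' - s)) ^+ 2); last by ring.
  by move: h4 h5; lra.
apply: lerD; last by rewrite normrM ger0_norm// ler_wpM2l.
apply: le_trans (ler_normD _ _) _; apply: lerD; first by apply: le_trans (ler_normB _ _) _; exact: lerD.
rewrite normrM ler_pM//; apply: le_trans (ler_normB _ _) _; rewrite normr1 ger0_norm//.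
Qed.

(** Backwards through the sorted tests: the Euler comparison between test times, and at a test time
    the verdict factors out and is the same for the trace, the test being local. *)
Lemma consistent (B : set E) : good_obs obs -> sorted_obs obs -> before T obs -> local_obs B obs -> closed B -> cvx B ->
  forall C s, is_cell C -> cvx C -> G obs C s = G obs (C `&` B) s.
Proof.
move=> + + + + clB cB; elim: obs => [|e obs0 ih] go so bT lo C s cC vC.
  have cI : is_cell (C `&` B) by case: cC => cC CV; split; [exact: closedI|move=> x [/CV]].
  have [Ts|sT] := leP T s; first by rewrite !(pass_allT).
  apply: (@consistent_step nil B s T) => //; try exact: ltW; try by move=> D u v _ _; split=> _ j.
  move=> D cD vD; rewrite !(pass_allT)//.
  by case: cD => cD DV; split; [exact: closedI|move=> x [/DV]].
have [te go'] := (good_cons _ _).1 go; have [so1 so2] := so.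
have [eT bT'] := (before_cons _ _ _).1 bT; have [le lo'] := (local_cons _ _ _).1 lo.
have [se|es] := leP s e.1; last by rewrite !pass_all_tail//; exact: ih.
apply: (@consistent_step (e :: obs0) B s e.1) => //; try exact: ltW; try exact: quiet_sorted.
move=> D cD vD.
have cI : is_cell (D `&` B) by case: cD => cD DV; split; [exact: closedI|move=> x [/DV]].
by rewrite !(pass_all_first)// -ih// (propext (le D)).
Qed.
End consistency.

(** * Factorization of past and future given an undivided body *)

Section renewal.
Implicit Types (C D : set E) (f g : set E -> R -> R) (obs : obs_type).

Lemma quiet_sub2 obs s s1 s' : quiet obs s s' -> s <= s1 -> s1 <= s' -> quiet obs s s1.
Proof. by move=> q ss s1s D u v su us; rewrite (q D u)// ?(le_trans us)// -(q D s1). Qed.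

Lemma sorted_cat obs obs' : sorted_obs obs -> sorted_obs obs' ->
  (forall j k, (j < size obs)%N -> (k < size obs')%N -> (nth ob0 obs j).1 <= (nth ob0 obs' k).1) ->
  sorted_obs (obs ++ obs').
Proof.
elim: obs => [//|e obs ih] [h1 h2] h' hh; split; last by apply: ih => // j k js; exact: (hh j.+1).
move=> j; rewrite size_cat nth_cat; case: ifP => js; first by move=> _; exact: h1.
by move=> jt; apply: (hh 0%N) => //; lia.
Qed.

Lemma pass_nil C s u : pass (nil : obs_type) C s u.
Proof. by []. Qed.

Lemma pass_cat obs obs' C s u : pass (obs ++ obs') C s u <-> pass obs C s u /\ pass obs' C s u.
Proof.
elim: obs => [|e obs ih]; first by split=> [|[]//]; split=> //; exact: pass_nil.
rewrite cat_cons !pass_cons; split=> [[h /ih[]]//|[[h1 h2] h3]].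
by split=> //; apply/ih.
Qed.

Lemma pass_away (B : set E) obs C s u : good_obs obs -> local_obs B obs -> C `&` B = set0 -> pass obs C s u.
Proof. by move=> go lo CB j js _; apply/(lo j js); rewrite CB; exact: (go j js).1. Qed.

(** Consistency with the empty set compares every cell with the empty one. *)
Lemma pass_all_nil C s : is_cell C -> cvx C -> G nil C s = 1.
Proof.
move=> cC vC; rewrite (consistent (B := set0)) //; [by rewrite setI0 pass_all0|exact: closed0].
Qed.

(** Required of all cells of a tessellation, it says that the body [M] has not been divided. *)
Definition untouched (M C : set E) := C `&` M° !=set0 -> M `<=` C.

Variables (M : set E) (tau : R).
Hypotheses (cM : compact M) (vM : cvx M) (M0 : M° !=set0) (MV : M `<=` V) (tauT : tau < T).
Hypothesis touch : {ae L, forall h : H, hitting M h -> hitting M° h}.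

Lemma cellM : is_cell M.
Proof. by split=> //; apply: compact_closed => //; exact: norm_hausdorff. Qed.

Lemma testp_untouched : testp (untouched M).
Proof.
split=> [[x []//]|d Om C rC]; apply: meas_impl; first by apply: rcs_hit => //; exact: open_interior.
rewrite (_ : [set o | M `<=` C o] = [set o | forall q, M° (rpt q) -> C o (rpt q)]).
  by meas.
seteq=> o h; first by move=> q /interior_subset/h.
have clC := (closure_id (C o)).1 (rC.1 o).
have sub : M° `<=` C o.
  move=> y My; rewrite clC => U nU.
  have /nbhs_ballP[e/= e0 be] : nbhs y (M° `&` U).
    by apply: filterI => //; apply: open_nbhs_nbhs; split=> //; exact: open_interior.
  have [q hq] := rpt_dense y e0.
  have [Mq Uq] : (M° `&` U) (rpt q) by apply: be; rewrite -ball_normE/= distrC.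
  by exists (rpt q); split=> //; exact: h.
change (M `<=` C o); rewrite clC; apply: subset_trans (cvx_closure_interior vM M0) _.
exact: closure_subset.
Qed.

Local Notation obM := (tau, untouched M).

Lemma good_obM : good_obs [:: obM].
Proof. by case=> // _; exact: testp_untouched. Qed.

Lemma untouched_local B : M `<=` B -> forall C, untouched M (C `&` B) <-> untouched M C.
Proof.
move=> MB C; split=> h [x].
  move=> [Cx Mx] y /(h _)[]//; exists x; split=> //; split=> //.
  exact: MB (interior_subset Mx).
by move=> [[Cx Bx] Mx] y My; split; [apply: h => //; exists x|exact: MB].
Qed.

(** A point of the cell in the interior of [M] stays in one of the two halves, and that half still
    fails to contain [M]. A bad cell thus always has a bad descendant, and the test at [tau] fails:
    in the Euler scheme the solution agrees with zero. *)
Lemma touched_all C s : s <= tau -> is_cell C -> C `&` M° !=set0 -> ~ (M `<=` C) -> G [:: obM] C s = 0.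
Proof.
move=> st cC CM MC.
have go := good_obM; have ag := admissible_pass_all go.
have q : quiet [:: obM] s tau by apply: (@quiet_sorted obM nil s); split.
pose bad D := [/\ is_cell D, D `&` M° !=set0 & ~ (M `<=` D)].
apply: (@euler_unique R (set E) bad (G [:: obM]) (fun _ _ => 0) s tau (2 * lam V) (4 * lam V ^+ 2)) => //.
- by rewrite mulr_ge0// lam_ge0.
- by nra.
- move=> D [cD DM MD]; rewrite (pass_all_first go cD tauT) ind0 ?mul0r// => h.
  exact: MD (h DM).
move=> u u' B su uu ut _ B0 hB D [cD [x [Dx Mx]] MD]; rewrite subr0.
have q' : quiet [:: obM] u u' by apply: quiet_sub2 uu ut; exact: quiet_sub q su.
have e := pass_all_euler go cD uu (le_trans ut (ltW tauT)) q'.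
have lV := lam_leV cD; have l0 := lam_ge0 D; have d0 : 0 <= u' - u by lra.
have jB : `|jump (G [:: obM]) D u'| <= B * lam D.
  rewrite -[X in `|X|]subr0 -(_ : \int[L]_(h in hitting D) (0 : R) = 0); last by rewrite Rintegral_cst ?mul0r//; exact: (meas_hitting cD).
  apply: (@Rintegral_near _ _ _ _ _ _ _ (split2 (G [:: obM]) D u') (fun=> 0)) => //.
  - exact: (meas_hitting cD).
  - exact: (hitting_fin cD).
  - exact: (split2_integrable).
  - by apply: integrable0.
  - apply: aeW => h _; rewrite subr0 /split2.
    have c1 := cell_side true h cD; have c2 := cell_side false h cD.
    have /andP[a0 a1] := ag.1 _ u' c1; have /andP[b0 b1] := ag.1 _ u' c2.
    have bb b : side b h x -> bad (D `&` side b h).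
      move=> sx; split; first exact: cell_side.
        by exists x.
      by move=> /subset_trans - /(_ D) h'; apply: MD; apply: h' => y [].
    have [sx|sx] := side_split h x.
      have := hB _ (bb _ sx); rewrite subr0 normrM => hh; rewrite -[leRHS]mulr1; apply: ler_pM => //.
      by rewrite ger0_norm.
    have := hB _ (bb _ sx); rewrite subr0 normrM => hh; rewrite -[leRHS]mul1r; apply: ler_pM => //.
    by rewrite ger0_norm.
have := hB D _; rewrite subr0 => /(_ (And3 cD (ex_intro _ x (conj Dx Mx)) MD)) hD.
rewrite [X in `|X|](_ : _ = (G [:: obM] D u - G [:: obM] D u' - (u' - u) * (jump (G [:: obM]) D u' - lam D * G [:: obM] D u')) +
  (G [:: obM] D u' * (1 - lam D * (u' - u)) + (u' - u) * jump (G [:: obM]) D u')); last by ring.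
have nd : `|1 - lam D * (u' - u)| <= 1 + lam V * (u' - u).
  by apply: normrB_le; [rewrite normr1|rewrite ger0_norm ?mulr_ge0// ler_wpM2r].
have nu : `|u' - u| <= u' - u by rewrite ger0_norm.
apply: le_trans (normrD_le e (normrD_le (normrM_le hD nd) (normrM_le nu jB))) _.
have h5 : B * (lam D * (u' - u)) <= B * (lam V * (u' - u)) by rewrite ler_wpM2l// ler_wpM2r.
rewrite (_ : 4 * lam V ^+ 2 * (u' - u) ^+ 2 = 4 * (lam V * (u' - u)) ^+ 2); last by ring.
by move: h5; lra.
Qed.

Variables (LL RR : set E).
Hypotheses (cLL : closed LL) (vLL : cvx LL) (cRR : closed RR) (vRR : cvx RR) (MLL : M `<=` LL) (MRR : M `<=` RR).
Hypothesis separated : forall h : H, ~ hitting M h -> ~ hitting LL h \/ ~ hitting RR h.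
Variable obR : obs_type.
Hypotheses (goR : good_obs obR) (soR : sorted_obs obR) (bR : before T obR) (loR : local_obs RR obR)
  (Rtau : forall j, (j < size obR)%N -> tau < (nth ob0 obR j).1).

Definition left_obs obs := [/\ good_obs obs, sorted_obs obs, local_obs LL obs &
  forall j, (j < size obs)%N -> (nth ob0 obs j).1 <= tau].

(** Inverse of the probability that [M] remains undivided from [s] to [tau]. *)
Let kap s := expR (lam M * (tau - s)).
Let big := [set C | [/\ is_cell C, cvx C & M `<=` C]].

Let goMR : good_obs (obM :: obR). Proof. by apply/good_cons; split=> //; exact: testp_untouched. Qed.
Let soMR : sorted_obs (obM :: obR). Proof. by split=> // j js; exact/ltW/Rtau. Qed.
Let loMR : local_obs RR (obM :: obR). Proof. by apply/local_cons; split=> //; exact: untouched_local. Qed.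
Let bMR : before T (obM :: obR). Proof. by apply/before_cons. Qed.

Lemma left_good obs obs' : left_obs obs -> good_obs obs' -> good_obs (obs ++ obs').
Proof. by move=> [go _ _ _] go'; exact: (all_nth_cat (K := fun e => testp e.2)). Qed.

Lemma left_sorted obs obs' : left_obs obs -> sorted_obs (obM :: obs') -> sorted_obs (obs ++ obM :: obs').
Proof.
move=> [_ so _ lt] so'; apply: sorted_cat => // j [|k] js ks; first exact: lt.
by apply: le_trans (lt j js) _; case: so' => + _; apply.
Qed.

Lemma left_cons e obs : left_obs (e :: obs) -> [/\ left_obs obs, testp e.2, e.1 <= tau & forall C, e.2 (C `&` LL) <-> e.2 C].
Proof.
move=> [/good_cons[te go] [so1 so2] /local_cons[le lo] lt]; split=> //; last exact: (lt 0%N).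
by split=> // j js; exact: (lt j.+1).
Qed.

Let euler (f : set E -> R -> R) s0 s1 := forall C s s', is_cell C -> s0 <= s -> s <= s' -> s' <= s1 ->
  `|f C s - f C s' - (s' - s) * (jump f C s' - lam C * f C s')| <= 4 * (lam V * (s' - s)) ^+ 2.
Let dead (f : set E -> R -> R) s1 := forall C s, s <= s1 -> is_cell C -> C `&` M° !=set0 -> ~ (M `<=` C) -> f C s = 0.

(** Integrands are compared hyperplane by hyperplane. One that hits [M] almost surely hits its
    interior; a half then meets that interior without containing [M], and all three functions vanish
    there. One that misses [M] misses [LL] or [RR]. The half without [M] is then seen through the
    other window only, while on the half with [M] the factor of the missed window is unchanged. *)
Lemma renewal_step_abstract (a b g : set E -> R -> R) s0 s1 : admissible a -> admissible b -> admissible g ->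
  euler a s0 s1 -> euler b s0 s1 -> euler g s0 s1 ->
  (forall C s, is_cell C -> cvx C -> a C s = a (C `&` LL) s) ->
  (forall C s, is_cell C -> cvx C -> b C s = b (C `&` RR) s) ->
  (forall s, a set0 s = 1) -> (forall s, b set0 s = 1) ->
  dead a s1 -> dead b s1 -> dead g s1 ->
  (forall C s, C `&` LL = set0 -> g C s = b C s) -> (forall C s, C `&` RR = set0 -> g C s = a C s) ->
  s0 <= s1 -> s1 <= tau ->
  (forall C, big C -> g C s1 = kap s1 * a C s1 * b C s1) ->
  forall C, big C -> g C s0 = kap s0 * a C s0 * b C s0.
Proof.
move=> ada adb adg ea eb eg conA conB a0' b0' da db dg gb ga s01 s1t h1.
have S0 := lam_ge0 V.
have lM0 := lam_ge0 M; have lMV : lam M <= lam V := lam_leV cellM.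
pose Kb := kap s0; have Kb0 : 0 <= Kb by rewrite /Kb expR_ge0.
apply: (@euler_unique R (set E) big g (fun C s => kap s * a C s * b C s) s0 s1 (2 * lam V) (product_const (lam V) Kb)) => //.
- by lra.
- exact: product_const_ge0.
move=> s s' B s0s ss s's1 d1 B0 hB C [cC vC MC].
have st : s' <= tau by lra.
have lC0 := lam_ge0 C; have lCV : lam C <= lam V := lam_leV cC.
have mC := meas_hitting cC; have fC := hitting_fin cC.
have ia := split2_integrable s' ada cC; have ib := split2_integrable s' adb cC.
have ig := split2_integrable s' adg cC.
have k'0 : 0 <= kap s' by exact: expR_ge0.
apply: (@product_euler R (lam V) Kb S0 Kb0 (s' - s) (lam C) (lam M) (kap s) (kap s') (a C s) (a C s') (b C s) (b C s') (g C s) (g C s')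
  (jump a C s') (jump b C s') (jump g C s') B) => //.
- by lra.
- by rewrite lC0.
- by rewrite lM0.
- by rewrite /kap -expRD; congr expR; ring.
- rewrite expR_ge0 /Kb ler_expR/=; nra.
- exact: ada.1.
- exact: adb.1.
- exact: ada.1.
- exact: adb.1.
- exact: (jump_bound s' ada cC).
- exact: (jump_bound s' adb cC).
- exact: ea.
- exact: eb.
- exact: eg.
- exact: (hB C (And3 cC vC MC)).
have mM := meas_hitting cellM.
have /andP[a0 a1] := ada.1 C s' cC; have /andP[b0 b1] := adb.1 C s' cC.
pose nM (h : H) : R := 1 - ind (hitting M h).
have mnM : mfunT nM by apply: measurable_funB; meas.
have inM : L.-integrable (hitting C) (EFin \o nM).
  apply: (@bounded_integrable _ _ _ _ _ mC fC nM 1); first exact: measurable_funTS.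
  move=> h _; rewrite /nM ger0_norm ?subr_ge0 ?ind_le1//.
  by rewrite lerBlDr lerDl ind_ge0.
have intM : \int[L]_(h in hitting C) nM h = lam C - lam M.
  rewrite RintegralB//; last 2 first.
  - by apply: (@bounded_integrable _ _ _ _ _ mC fC (fun=> 1) 1) => // h _; rewrite normr1.
  - apply: (@bounded_integrable _ _ _ _ _ mC fC _ 1); first by apply: measurable_funTS; apply: meas_ind; meas.
    by move=> h _; rewrite ger0_norm ?ind_ge0 ?ind_le1.
  rewrite Rintegral_cst// mul1r; congr (_ - _).
  rewrite (_ : (fun h => _) = \1_(hitting M)); last by apply/funext => h; rewrite -indE.
  rewrite /Rintegral integral_indic//; congr (fine (L _)); apply/setIidPl => h [x [hx Mx]].
  by exists x; split=> //; exact: MC.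
have [ips intps] := Rintegral_comb (kap s' * b C s') (kap s' * a C s') (kap s' * (a C s' * b C s')) mC ia ib inM.
(* [lam C - lam M] is the mass of the hyperplanes that hit [C] and miss [M]; under the integral,
   that term removes what the first two terms count twice. *)
rewrite (_ : kap s' * _ = \int[L]_(h in hitting C) (kap s' * b C s' * split2 a C s' h + kap s' * a C s' * split2 b C s' h -
    kap s' * (a C s' * b C s') * nM h)); last first.
  have jE f : \int[L]_(h in hitting C) split2 f C s' h = jump f C s' by exact: erefl.
  rewrite intps intM (jE a) (jE b).
  move: (jump a C s') (jump b C s') (a C s') (b C s') (kap s') (lam C) (lam M) => x y z t k q r; ring.
rewrite [leRHS]mulrC; apply: Rintegral_near => //.
case: touch => N [mN N0 hN]; exists N; split=> // h; apply: contra_notP => nNh Ch.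
have {hN nNh} th : hitting M h -> hitting M° h by move=> Mh; apply: contrapT => nh; apply: nNh; apply: hN => /(_ Mh).
have cell b' := cell_side b' h cC.
have vs b' : cvx (C `&` side b' h).
  by move=> x y t t01 [? ?] [? ?]; split; [exact: vC|exact: side_cvx].
have [Mh|nMh] := pselect (hitting M h).
  have [x [hx Mx]] := th Mh.
  have hit b' : C `&` side b' h `&` M° !=set0.
    by exists x; split=> //; split; [exact: MC _ (interior_subset Mx)|exact: sub_side].
  have [b' nb] : exists b', ~ (M `<=` C `&` side b' h).
    apply: contrapT => hh; have allb b' : M `<=` side b' h.
      by move=> y My; have [//|] := pselect (M `<=` C `&` side b' h); [move=> /(_ y My)[]|move=> n; case: hh; exists b'].
    by apply: (@hyperplane_thin R l M h M0) => y My; apply: (@side_both R l); exact: allb.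
  have z f : dead f s1 -> split2 f C s' h = 0.
    move=> df; rewrite /split2.
    by case: b' nb => nb; [rewrite (df (C `&` side true h))// mul0r|rewrite (df (C `&` side false h))// mulr0].
  rewrite /nM (@ind1 R _ Mh) (z _ da) (z _ db) (z _ dg).
  by rewrite subrr !mulr0 addr0 !subr0 normr0.
rewrite /nM (@ind0 R _ nMh) subr0 mulr1.
have miss D : D `<=` C -> ~ hitting D h -> sval h `&` D = set0.
  by move=> DC nh; seteq=> // x [hx Dx]; apply: nh; exists x.
have cI D : closed D -> is_cell (C `&` D) by move=> cD; case: cC => clC CV; split; [exact: closedI|move=> x [/CV]].
have vI D : cvx D -> cvx (C `&` D) by move=> vD x y t t01 [? ?] [? ?]; split; [exact: vC|exact: vD].
have [nL|nR] := separated nMh.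
  have [b' [sb sn]] := cvx_one_side (vI _ vLL) (miss _ (@subIsetl _ C LL) (fun hh => nL (let: ex_intro x (conj hx (conj Cx Lx)) := hh in ex_intro _ x (conj hx Lx)))).
  have bigb : big (C `&` side b' h).
    split=> // y My; split; first exact: MC.
    by apply: sb; split; [exact: MC|exact: MLL].
  have ab : a (C `&` side b' h) s' = a C s'.
    rewrite conA// (conA C)//; congr (a _ _); seteq=> y [].
      by move=> [Cy _] Ly.
    by move=> Cy Ly; split=> //; split=> //; apply: sb.
  have anb : a (C `&` side (~~ b') h) s' = 1 by rewrite conA// -setIA [side _ _ `&` _]setIC setIA sn.
  have gnb : g (C `&` side (~~ b') h) s' = b (C `&` side (~~ b') h) s'.
    by apply: gb; rewrite -setIA [side _ _ `&` _]setIC setIA.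
  have e2 f : split2 f C s' h = f (C `&` side b' h) s' * f (C `&` side (~~ b') h) s'.
    by rewrite /split2; case: (b') => //=; rewrite mulrC.
  rewrite !e2 ab anb gnb.
  rewrite [X in `|X|](_ : _ = (g (C `&` side b' h) s' - kap s' * a C s' * b (C `&` side b' h) s') * b (C `&` side (~~ b') h) s'); last first.
    move: (g _ _) (b _ _) (b _ _) (a _ _) (b _ _) (kap s') => x1 x2 x3 x4 x5 x6; ring.
  have := hB _ bigb; rewrite ab => hh; rewrite -[leRHS]mulr1; apply: normrM_le => //.
  by have /andP[? ?] := adb.1 _ s' (cell (~~ b')); rewrite ger0_norm.
have [b' [sb sn]] := cvx_one_side (vI _ vRR) (miss _ (@subIsetl _ C RR) (fun hh => nR (let: ex_intro x (conj hx (conj Cx Lx)) := hh in ex_intro _ x (conj hx Lx)))).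
have bigb : big (C `&` side b' h).
  split=> // y My; split; first exact: MC.
  by apply: sb; split; [exact: MC|exact: MRR].
have ab : b (C `&` side b' h) s' = b C s'.
  rewrite conB// (conB C)//; congr (b _ _); seteq=> y [].
    by move=> [Cy _] Ly.
  by move=> Cy Ly; split=> //; split=> //; apply: sb.
have anb : b (C `&` side (~~ b') h) s' = 1 by rewrite conB// -setIA [side _ _ `&` _]setIC setIA sn.
have gnb : g (C `&` side (~~ b') h) s' = a (C `&` side (~~ b') h) s'.
  by apply: ga; rewrite -setIA [side _ _ `&` _]setIC setIA.
have e2 f : split2 f C s' h = f (C `&` side b' h) s' * f (C `&` side (~~ b') h) s'.
  by rewrite /split2; case: (b') => //=; rewrite mulrC.
rewrite !e2 ab anb gnb.
rewrite [X in `|X|](_ : _ = (g (C `&` side b' h) s' - kap s' * a (C `&` side b' h) s' * b C s') * a (C `&` side (~~ b') h) s'); last first.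
  move: (g _ _) (a _ _) (a _ _) (b _ _) (a _ _) (kap s') => x1 x2 x3 x4 x5 x6; ring.
have := hB _ bigb; rewrite ab => hh; rewrite -[leRHS]mulr1; apply: normrM_le => //.
by have /andP[? ?] := ada.1 _ s' (cell (~~ b')); rewrite ger0_norm.
Qed.
Lemma renewal_step obs s0 s1 : left_obs obs -> s0 <= s1 -> s1 <= tau ->
  quiet (obs ++ [:: obM]) s0 s1 -> quiet (obM :: obR) s0 s1 -> quiet (obs ++ obM :: obR) s0 s1 ->
  (forall C, big C -> G (obs ++ obM :: obR) C s1 = kap s1 * G (obs ++ [:: obM]) C s1 * G (obM :: obR) C s1) ->
  forall C, big C -> G (obs ++ obM :: obR) C s0 = kap s0 * G (obs ++ [:: obM]) C s0 * G (obM :: obR) C s0.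
Proof.
move=> lo s01 s1t qa qb qg.
set a := G (obs ++ [:: obM]); set b := G (obM :: obR); set g := G (obs ++ obM :: obR).
have goa : good_obs (obs ++ [:: obM]) := left_good lo good_obM.
have gog : good_obs (obs ++ obM :: obR) := left_good lo goMR.
have ada : admissible a := admissible_pass_all goa.
have adb : admissible b := admissible_pass_all goMR.
have adg : admissible g := admissible_pass_all gog.
have conA C s : is_cell C -> cvx C -> a C s = a (C `&` LL) s.
  apply: (consistent) => //.
  - by apply: left_sorted => //; split.
  - apply: (all_nth_cat (K := fun e => e.1 < T)); last by case.
    by move=> j js; apply: le_lt_trans tauT; case: lo => _ _ _; apply.
  - case: lo => _ _ lo _; apply: (all_nth_cat (K := fun e => forall C, e.2 (C `&` LL) <-> e.2 C)) => //.
    by case=> // _; exact: untouched_local.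
have conB C s : is_cell C -> cvx C -> b C s = b (C `&` RR) s by exact: (consistent).
have s1T : s1 <= T by exact: le_trans (ltW tauT).
have eul o : good_obs o -> quiet o s0 s1 -> euler (G o) s0 s1.
  move=> go q D s s' cD s0s ss s's1; apply: (pass_all_euler go cD ss (le_trans s's1 s1T)).
  by apply: quiet_sub2 ss s's1; exact: quiet_sub q s0s.
have dd o : good_obs o -> (forall D u v, pass o D u v -> pass [:: obM] D u v) -> dead (G o) s1.
  move=> go le D s ss cD h1' h2; have /andP[x0 _] := (admissible_pass_all go).1 D s cD.
  apply/le_anti; rewrite x0 andbT -(touched_all (le_trans ss s1t) cD h1' h2).
  exact: (pass_all_le s go good_obM cD le).
have passA D u v : pass (obs ++ [:: obM]) D u v -> pass [:: obM] D u v by move=> /pass_cat[].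
have passB D u v : pass (obM :: obR) D u v -> pass [:: obM] D u v.
  by rewrite !pass_cons => -[h1' _]; split=> //; exact: pass_nil.
have passG D u v : pass (obs ++ obM :: obR) D u v -> pass [:: obM] D u v by move=> /pass_cat[_]; exact: passB.
apply: (@renewal_step_abstract a b g s0 s1 ada adb adg (eul _ goa qa) (eul _ goMR qb) (eul _ gog qg) conA conB _ _
  (dd _ goa passA) (dd _ goMR passB) (dd _ gog passG) _ _ s01 s1t).
- by move=> s; exact: pass_all0.
- by move=> s; exact: pass_all0.
- move=> C s CLL; apply: (@pass_all_eq _ _ C s) => // D u v DC _.
  have DLL : D `&` LL = set0 by seteq=> // y [/DC Cy Ly]; rewrite -CLL.
  rewrite pass_cat; split=> [[]//|p]; split=> //.
  by case: lo => go _ lo _; exact: pass_away go lo DLL.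
- move=> C s CRR; apply: (@pass_all_eq _ _ C s) => // D u v DC _.
  have DRR : D `&` RR = set0 by seteq=> // y [/DC Cy Ly]; rewrite -CRR.
  rewrite !pass_cat !pass_cons; split=> [[p1 [p2 _]]|[p1 [p2 _]]]; (split=> //; split=> //; first [exact: pass_nil|exact: (pass_away goR loR DRR)]).
Qed.

Lemma left_nil : left_obs nil.
Proof. by split. Qed.

(** Each of the three lists contains the test that [M] is undivided at [tau]. At time [tau], with no
    earlier test left, this test is passed by a cell containing [M] and [kap] is 1. Earlier tests
    are then taken in one at a time, backwards. *)
Lemma pass_all_renewal obs C s : left_obs obs -> s <= tau -> big C ->
  G (obs ++ obM :: obR) C s = kap s * G (obs ++ [:: obM]) C s * G (obM :: obR) C s.
Proof.
elim: obs s C => [|e obs ih] s C lo st bC.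
  have sM : sorted_obs [:: obM] by [].
  have qM : quiet [:: obM] s tau := quiet_sorted (e := obM) sM.
  have qMR : quiet (obM :: obR) s tau := quiet_sorted (e := obM) soMR.
  apply: (@renewal_step nil s tau) => // D [cD vD MD].
  have uD : untouched M D by [].
  rewrite /kap subrr mulr0 expR0 mul1r !cat0s (pass_all_first good_obM cD tauT).
  by rewrite (pass_all_first goMR cD tauT) pass_all_nil// ind1// !mul1r.
have [lo' te et le] := left_cons lo.
have [se|es] := leP s e.1; last by rewrite !cat_cons !(@pass_all_tail e _ _ _ es); exact: ih.
have [go so _ lt] := lo.
have eT : e.1 < T by exact: le_lt_trans tauT.
have sM : sorted_obs [:: obM] by [].
have sl := left_sorted lo sM; have sg := left_sorted lo soMR.
have ga := left_good lo good_obM; have gg := left_good lo goMR.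
have qb : quiet (obM :: obR) s e.1.
  by apply: quiet_sub2 se et; exact: (quiet_sorted (e := obM) soMR).
apply: (@renewal_step (e :: obs) s e.1) => //.
- exact: (quiet_sorted (e := e) sl).
- exact: (quiet_sorted (e := e) sg).
move=> D bD; have [cD vD MD] := bD.
rewrite !cat_cons in ga gg *.
rewrite (pass_all_first ga cD eT) (pass_all_first gg cD eT) ih//.
move: (G _ _ _) (G _ _ _) (ind _) (kap _) => x y z t; ring.
Qed.
End renewal.

(** * The lifetime and the division of one cell *)

Section one_cell.
Variable C : set E.
Hypothesis cC : is_cell C.
Local Notation lamC := (lam C).

(** Joint density of the lifetime and the dividing hyperplane with respect to Lebesgue measure times
    [L]. It vanishes when [lam C] is 0, as do then the expressions in the definition of the
    process. *)
Definition life_pdf (p : RR * H) : R := exponential_pdf lamC p.1 * (ind (hitting C p.2) / lamC).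

Let lam0 : 0 <= lamC := lam_ge0 C.
Let mC := meas_hitting cC.
Let fC := hitting_fin cC.

Let pdf0 u : 0 <= exponential_pdf lamC u. Proof. exact: exponential_pdf_ge0. Qed.

Let mpdf : mfunT (fun u : RR => exponential_pdf lamC (u : R)).
Proof. exact: measurable_exponential_pdf. Qed.

Lemma life_pdf_ge0 p : 0 <= life_pdf p.
Proof. by rewrite mulr_ge0// divr_ge0// ind_ge0. Qed.

Lemma meas_life_pdf : mfunT life_pdf.
Proof.
apply: measurable_funM; first exact: (measurableT_comp mpdf).
exact: measurable_funM (measurableT_comp (meas_ind mC) measurable_snd) (measurable_cst _).
Qed.

Let fub (F : RR * H -> R) : mfunT F -> (forall p, 0 <= F p) ->
  (\int[prod_measure leb L]_p (F p)%:E = \int[leb]_u \int[L]_h (F (u, h))%:E)%E.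
Proof.
move=> mF F0; apply: (fubini_tonelli1 (m1 := leb) (m2 := L) (EFin \o F)); first exact/measurable_EFinP.
by move=> p; rewrite lee_fin.
Qed.

Lemma life_rect (D : set R) (B : set H) : measurable (D : set RR) -> measurable B ->
  (\int[prod_measure leb L]_p (ind (D p.1 /\ B p.2) * life_pdf p)%:E =
   (fine (exponential_prob lamC D) * normalized_on L C B)%:E)%E.
Proof.
move=> mD mB.
have mi : mfunT (fun p => ind (D p.1 /\ B p.2) : R) := meas_ind (measurableX mD mB).
rewrite fub; last 2 first.
- by apply: measurable_funM => //; exact: meas_life_pdf.
- by move=> p; rewrite mulr_ge0 ?ind_ge0 ?life_pdf_ge0.
have nB0 : 0 <= normalized_on L C B by rewrite divr_ge0 ?fine_ge0.
have inner (u : RR) : (\int[L]_h (ind (D u /\ B h) * life_pdf (u, h))%:E = (normalized_on L C B)%:E * (ind (D u) * exponential_pdf lamC u)%:E)%E.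
  transitivity (\int[L]_h ((ind (D u) * exponential_pdf lamC u / lamC)%:E * (\1_(B `&` hitting C) h)%:E))%E.
    apply: eq_integral => h _; rewrite -EFinM; congr EFin; rewrite -indE /life_pdf/=.
    by rewrite !ind_and; ring.
  have mBC : measurable (B `&` hitting C) by exact: measurableI.
  rewrite ge0_integralZl_EFin//; last 2 first.
  - exact/measurable_EFinP/measurable_indic.
  - by rewrite divr_ge0// mulr_ge0 ?ind_ge0.
  have -> : (\int[L]_h (\1_(B `&` hitting C) h)%:E = L (B `&` hitting C))%E by rewrite integral_indic// setIT.
  rewrite -[L (B `&` hitting C)]fineK; last first.
    rewrite ge0_fin_numE//; apply: le_lt_trans fC; apply: measure_le => //.
  by rewrite -!EFinM; congr EFin; rewrite /normalized_on /lamC; ring.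
under eq_integral do rewrite inner.
rewrite ge0_integralZl_EFin//; last 2 first.
- by move=> u _; rewrite lee_fin mulr_ge0 ?ind_ge0.
- by apply/measurable_EFinP/measurable_funM => //; exact: meas_ind.
rewrite -(integral_ind leb D (exponential_pdf lamC)) EFinM muleC fineK//.
have h0 : (0 <= exponential_prob lamC D)%E by apply: integral_ge0 => u _; rewrite lee_fin.
rewrite ge0_fin_numE//; move: lam0; rewrite le_eqVlt => /orP[/eqP lz|lp].
  rewrite /exponential_prob integral0_eq ?ltry// => u _.
  by rewrite exponential_pdf_ind -lz mul0r mulr0.
apply: (@le_lt_trans _ _ 1%E); last exact: ltry.
rewrite -(integral_exponential_pdf lp); apply: ge0_subset_integral => //.
  by apply/measurable_EFinP.
by move=> u _; rewrite lee_fin.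
Qed.

Hypothesis lamp : 0 < lamC.

Lemma life_mass : (\int[prod_measure leb L]_p (life_pdf p)%:E = 1)%E.
Proof.
have h := life_rect (@measurableT _ RR) (@measurableT _ H).
rewrite (eq_integral (fun p => (ind (setT p.1 /\ setT p.2) * life_pdf p)%:E)); last by move=> p _; rewrite ind1 ?mul1r.
rewrite h /exponential_prob integral_exponential_pdf// /= mul1r /normalized_on setTI divff//.
by rewrite gt_eqF.
Qed.

Variable obs : obs_type.
Hypotheses (go : good_obs obs) (bT : before T obs).

(** After a shift of the lifetime by the date of birth [b], the part of the integral over [b, T] is
    that of the renewal equation. Beyond [T] the function [f] is 1 and [jump] is [lam C], so the
    tail of the exponential law gives the survival term. *)
Lemma life_renew f (b : R) : admissible f -> (forall D u, is_cell D -> T <= u -> f D u = 1) ->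
  (\int[prod_measure leb L]_p (ind (pass obs C b (b + p.1)) * split2 f C (b + p.1) p.2 * life_pdf p)%:E =
   (renew obs f C b)%:E)%E.
Proof.
move=> af f1.
have rC : rcell (fun _ : RR => C) by split; [apply: rcs_cst; case: cC|move=> _; case: cC].
have mb : mfunT (fun u : RR => (b + (u : R))) by meas.
have mp (g : RR -> R) : mfunT g -> mfunT (fun u : RR => ind (pass obs C b (g u)) : R).
  by move=> mg; apply: meas_ind; apply: (@meas_pass _ RR (fun=> C) (fun=> b) g).
have mpdfb : mfunT (fun u : RR => exponential_pdf lamC ((u : R) - b)).
  by apply: (measurableT_comp mpdf); meas.
rewrite fub; last 2 first.
- apply: measurable_funM meas_life_pdf; apply: measurable_funM (meas_split2 af rC mb).
  exact: (measurableT_comp (mp _ mb)).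
- move=> p; rewrite mulr_ge0 ?life_pdf_ge0// mulr_ge0 ?ind_ge0//.
  by case/andP: (split2_01 (b + p.1) p.2 af cC).
pose K (u : R) := ind (pass obs C b u) * (exponential_pdf lamC (u - b) / lamC) * jump f C u.
have inner (u : RR) : (\int[L]_h (ind (pass obs C b (b + (u : R))) * split2 f C (b + (u : R)) h * life_pdf (u, h))%:E = (K ((u : R) + b))%:E)%E.
  transitivity (\int[L]_h ((ind (pass obs C b ((u : R) + b)) * (exponential_pdf lamC u / lamC))%:E * (ind (hitting C h) * split2 f C ((u : R) + b) h)%:E))%E.
    by apply: eq_integral => h _; rewrite -EFinM [b + _]addrC /life_pdf /=; congr EFin; ring.
  rewrite ge0_integralZl_EFin//; last 3 first.
  - by move=> h _; rewrite lee_fin mulr_ge0 ?ind_ge0//; case/andP: (split2_01 ((u : R) + b) h af cC).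
  - apply/measurable_EFinP/measurable_funM; first exact: meas_ind.
    exact: (meas_split2_cst _ af cC).
  - by rewrite mulr_ge0 ?ind_ge0// divr_ge0.
  by rewrite -integral_ind (jumpE _ af cC) -EFinM /K addrK.
under eq_integral do rewrite inner.
have mK : mfunT (fun u : RR => K (u : R)).
  apply: measurable_funM (meas_jump af rC (@measurable_id _ RR setT)).
  by apply: measurable_funM (mp _ (@measurable_id _ RR setT)) _; meas.
have K0 u : 0 <= K u.
  by rewrite !mulr_ge0 ?ind_ge0 ?invr_ge0//; case/andP: (jump_bound u af cC).
rewrite (integral_shift b (f := fun u => (K u)%:E)); last 2 first.
- by apply/measurable_EFinP.
- by move=> u; rewrite lee_fin.
have totb : (\int[leb]_u (exponential_pdf lamC (u - b))%:E = 1)%E.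
  rewrite (integral_shift (- b) (f := fun u => (exponential_pdf lamC u)%:E)) ?integral_exponential_pdf//.
  by apply/measurable_EFinP.
have jT u : T <= u -> jump f C u = lamC.
  move=> Tu; rewrite /jump (eq_integral (fun=> 1%:E)); last first.
    by move=> h _; rewrite /split2 !f1 ?mulr1//; exact: cell_side.
  by rewrite integral_cst// mul1e.
have passT u : T <= u -> pass obs C b u <-> pass obs C b T.
  move=> Tu; split=> h j js /andP[h1 h2]; apply: h => //; rewrite h1 ?bT//=.
  exact: lt_le_trans Tu.
have [Tb|bTl] := leP T b.
  rewrite renew1// -totb; apply: eq_integral => u _; congr EFin.
  have [ub|ub] := leP b u; last by rewrite /K lt0_exponential_pdf ?subr_lt0// !mul0r mulr0 mul0r.
  rewrite /K jT ?(le_trans Tb)// ind1 ?mul1r ?divfK ?gt_eqF// => j js /andP[h1 h2].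
  by have := lt_le_trans (bT js) (le_trans Tb h1); rewrite ltxx.
have splitD (g : R -> R) : mfunT (g : RR -> R) -> (forall u, 0 <= g u) ->
    (\int[leb]_u (g u)%:E = \int[leb]_(u in `[b, T]) (g u)%:E + \int[leb]_(u in ~` `[b, T]) (g u)%:E)%E.
  move=> mg g0; rewrite -(setvU `[b, T]%classic) setUC ge0_integral_setU//.
  - exact: measurableC.
  - by rewrite setUv; apply/measurable_EFinP.
  - by move=> u _; rewrite lee_fin.
  - exact/disj_setPCl.
rewrite splitD//.
have -> : (\int[leb]_(u in ~` `[b, T]) (K u)%:E = (ind (pass obs C b T) * expR (- lamC * (T - b)))%:E)%E.
  transitivity (\int[leb]_(u in ~` `[b, T]) ((ind (pass obs C b T))%:E * (exponential_pdf lamC (u - b))%:E))%E.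
    apply: eq_integral => u /set_mem; rewrite /= in_itv/= => /negP; rewrite negb_and -!ltNge => /orP[ub|Tu]; rewrite -EFinM; congr EFin.
      by rewrite /K lt0_exponential_pdf ?subr_lt0// !mul0r !mulr0 mul0r.
    by rewrite /K jT ?(ltW Tu)// [pass _ _ _ u](propext (passT _ (ltW Tu))) -mulrA divfK// gt_eqF.
  rewrite ge0_integralZl_EFin ?ind_ge0//; last 3 first.
  - exact: measurableC.
  - by move=> u _; rewrite lee_fin.
  - by apply/measurable_EFinP/measurable_funTS.
  rewrite EFinM; congr (_ * _)%E.
  have := splitD (fun u => exponential_pdf lamC (u - b)) mpdfb (fun u => pdf0 _); rewrite totb.
  rewrite (_ : (\int[leb]_(u in `[b, T]) (exponential_pdf lamC (u - b))%:E)%E =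
      (\int[leb]_(u in `[b, T]) (lamC * expR (- lamC * (u - b)))%:E)%E); last first.
    by apply: eq_integral => u /set_mem; rewrite /= in_itv/= => /andP[bu _]; rewrite exponential_pdfE// subr_ge0.
  rewrite integral_exp_itv ?(ltW bTl)// => e.
  have fin : (\int[leb]_(u in ~` `[b, T]) (exponential_pdf lamC (u - b))%:E)%E \is a fin_num.
    rewrite ge0_fin_numE; last by apply: integral_ge0 => u _; rewrite lee_fin.
    apply: (@le_lt_trans _ _ 1%E); last exact: ltry.
    by rewrite e leeDr// lee_fin subr_ge0 expR_le1 mulNr oppr_le0 mulr_ge0// subr_ge0 ltW.
  move: e; rewrite -(fineK fin) -EFinD => -[e]; congr EFin; lra.
have -> : (\int[leb]_(u in `[b, T]) (K u)%:E = (itvint b T (fun u => ind (pass obs C b u) * expR (- lamC * (u - b)) * jump f C u))%:E)%E.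
  rewrite fineK.
    apply: eq_integral => u /set_mem; rewrite /= in_itv/= => /andP[bu _]; congr EFin.
    by rewrite /K exponential_pdfE ?subr_ge0// [lamC * _]mulrC mulfK ?gt_eqF.
  apply: (@itvint_fin R b T _ lamC); first exact: (meas_renew_cst b go af cC).
  by move=> u bu _; exact: (renew_int01 obs af cC bu).
by rewrite renewE// -EFinD addrC.
Qed.
End one_cell.

Section renewal_corollaries.

(** Keeps only the event that the cell is not divided before the horizon. *)
Lemma pass_all_ge obs C s : good_obs obs -> is_cell C -> s < T ->
  ind (pass obs C s T) * expR (- lam C * (T - s)) <= pass_all obs C s.
Proof.
move=> go cC sT; rewrite (pass_allE go s cC) renewE// lerDl fine_ge0//.
apply: integral_ge0 => u; rewrite /= in_itv/= => /andP[su _]; rewrite lee_fin.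
by case/andP: (renew_int01 obs (admissible_pass_all go) cC su).
Qed.

Variables (M : set E) (tau : R).
Hypotheses (cM : compact M) (vM : cvx M) (M0 : M° !=set0) (MV : M `<=` V) (tauT : tau < T).
Hypothesis touch : {ae L, forall h, hitting M h -> hitting M° h}.
Local Notation obM := ((tau, untouched M) : R * (set E -> Prop)).

Lemma good_untouched : good_obs [:: obM].
Proof. by move=> [|//] _; exact: testp_untouched. Qed.

Lemma pass_all_untouched C s : is_cell C -> cvx C -> M `<=` C -> s <= tau ->
  G [:: obM] C s = expR (- lam M * (tau - s)).
Proof.
move=> cC vC MC st.
have g0 : 0 < G [:: obM] C s.
  apply: (lt_le_trans _ (pass_all_ge good_untouched cC (le_lt_trans st tauT))).
  rewrite ind1 ?mul1r ?expR_gt0// => -[|//] _ _ _; exact: MC.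
have clM := compact_closed (@norm_hausdorff _ _) cM.
have := @pass_all_renewal M tau cM vM M0 MV tauT touch M M clM vM clM vM
  (@subset_refl _ M) (@subset_refl _ M) (fun h nh => or_introl nh) [::] (fun j => ltac:(by [])) I (fun j => ltac:(by [])) (fun j => ltac:(by []))
  (fun j => ltac:(by [])) [::] C s (left_nil _ _) st (And3 cC vC MC).
rewrite cat0s; set g := G _ C s in g0 *; rewrite -/g => h.
have h1 : expR (lam M * (tau - s)) * g = 1.
  by apply: (mulIf (lt0r_neq0 g0)); rewrite mul1r -h.
by rewrite mulNr expRN; apply: (mulfI (lt0r_neq0 (expR_gt0 (lam M * (tau - s))))); rewrite h1 divff// lt0r_neq0// expR_gt0.
Qed.
End renewal_corollaries.
End cell_functionals.

#[export] Hint Resolve meas_hitting hitting_fin meas_pass meas_lam : meas.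

(** * The division tree and the probability of passing tests *)

Section division_tree.
Context {R : realType} {l : nat}.
Local Notation E := 'rV[R]_l.+1.
Local Notation H := (hyperplane R l).
Local Notation RR := (measurableTypeR R).
Local Notation leb := (@lebesgue_measure R).
Variable L : {sigma_finite_measure set H -> \bar R}.
Variable W : window R l.+1.
Local Notation V := (wset W).
Hypothesis finV : (L (hitting V) < +oo)%E.
Context d (Om : measurableType d) (P : probability Om R).
Variables (s : seq bool -> Om -> R) (k : seq bool -> Om -> H).
Hypothesis div : cell_division L W P s k.
Variable T : R.
Variable obs : @obs_type R l.
Hypotheses (go : good_obs obs) (bT : before T obs).
Local Notation lam := (lam L).

Let cV : compact V := polytope_compact (wset_polytope W).

Let C w o := cell W (k ^~ o) w.
Let b w o := birth (s ^~ o) w.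

Lemma cell_nil o : C [::] o = V.
Proof. by rewrite /C /cell; seteq=> x; [case|move=> Vx; split]. Qed.

Lemma cell_rcons w c o : C (rcons w c) o = C w o `&` side c (k w o).
Proof.
rewrite /C /cell; seteq=> x /=.
  move=> [Vx h]; split; last first.
    by have := h (size w); rewrite size_rcons nth_rcons ltnn eqxx -cats1 take_size_cat//; apply.
  split=> // i iw; have := h i; rewrite size_rcons nth_rcons iw -cats1 take_cat iw; apply.
  exact: ltnW.
move=> [[Vx h] hs]; split=> // i; rewrite size_rcons ltnS leq_eqVlt => /orP[/eqP ->|iw].
  by rewrite nth_rcons ltnn eqxx -cats1 take_size_cat.
by rewrite nth_rcons iw -cats1 take_cat iw; exact: h.
Qed.

Lemma birth_nil o : b [::] o = 0.
Proof. by rewrite /b /birth big_ord0. Qed.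

Lemma birth_rcons w c o : b (rcons w c) o = b w o + s w o.
Proof.
rewrite /b /birth size_rcons big_ord_recr /=; congr (_ + _).
  by apply: eq_bigr => i _; rewrite -cats1 take_cat ltn_ord.
by rewrite -cats1 take_size_cat.
Qed.

Definition gen_sets m : set (set Om) := [set A | exists v, (size v < m)%N /\
    ((exists2 D : set R, measurable D & A = s v @^-1` D) \/
     (exists2 B, measurable B & A = k v @^-1` B))].

(** The same set with the sigma-field of the generations before [m]; the cells of generation [m] and
    their dates of birth are measurable for it. *)
Definition past_space m := g_sigma_algebraType (gen_sets m).
HB.instance Definition _ m := Measurable.on (past_space m).

Let ms w : mfunT (s w). Proof. by case: div. Qed.
Let mk w : mfunT (k w). Proof. by case: div. Qed.

Lemma meas_past m : mfunT (id : Om -> past_space m).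
Proof.
apply: (@measurability _ _ Om (past_space m) setT id (gen_sets m) erefl) => _ [A [v [_ [[D mD ->]|[B mB ->]]]] <-].
  exact: measurableI (meas_preim (ms v) mD).
exact: measurableI (meas_preim (mk v) mB).
Qed.

Lemma past_sub m (A : set Om) : measurable (A : set (past_space m)) -> measurable A.
Proof. move=> mA; rewrite -(setTI A); exact: (@meas_past m measurableT A mA). Qed.

Lemma past_measurable m d' (S' : measurableType d') (g : past_space m -> S') :
  mfunT g -> mfunT (g : Om -> S').
Proof. by move=> mg _ A mA; rewrite setTI; apply: (@past_sub m); exact: (meas_preim mg mA). Qed.

Lemma past_s m w : (size w < m)%N -> mfunT (s w : past_space m -> R).
Proof.
by move=> wm _ D mD; rewrite setTI; apply: sub_sigma_algebra; exists w; split=> //; left; exists D.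
Qed.

Lemma past_k m w : (size w < m)%N -> mfunT (k w : past_space m -> H).
Proof.
by move=> wm _ D mD; rewrite setTI; apply: sub_sigma_algebra; exists w; split=> //; right; exists D.
Qed.

Lemma past_birth m w : (size w <= m)%N -> mfunT (b w : past_space m -> R).
Proof.
elim/last_ind: w => [|w c ih] wm.
  by rewrite (_ : b [::] = fun=> 0); [exact: measurable_cst|apply/funext => o; exact: birth_nil].
rewrite size_rcons in wm.
rewrite (_ : b (rcons w c) = fun o => b w o + s w o); last by apply/funext => o; exact: birth_rcons.
by apply: measurable_funD; [apply: ih; exact: ltnW|exact: past_s].
Qed.

Lemma past_cell m w : (size w <= m)%N -> rcell V (C w : past_space m -> set E).
Proof.
elim/last_ind: w => [|w c ih] wm.
  rewrite (_ : C [::] = fun=> V); last by apply/funext => o; exact: cell_nil.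
  by split; [exact: (@rcs_cst R _ _ (past_space m) V (polytope_closed (wset_polytope W)))|move=> o x].
rewrite size_rcons in wm.
rewrite (_ : C (rcons w c) = fun o => C w o `&` side c (k w o)); last by apply/funext => o; exact: cell_rcons.
have [rC CV] := ih (ltnW wm); split; last by move=> o x [/CV].
by apply: rcsI => //; apply: (rcs_comp (past_k wm) (rcs_side c)).
Qed.

Let cellC w o : is_cell V (C w o).
Proof. exact: (rcell_cell (Om := past_space (size w)) o (past_cell (leqnn _))). Qed.

Fixpoint words m : seq (seq bool) :=
  if m is m'.+1 then [seq rcons w c | w <- words m', c <- [:: true; false]] else [:: [::]].

Lemma mem_words m w : (w \in words m) = (size w == m).
Proof.
elim: m w => [|m ih] w; first by rewrite inE size_eq0.
apply/allpairsP/idP => [[[v c] /= [vm _ ->]]|].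
  by rewrite size_rcons eqSS -ih.
elim/last_ind: w => [//|w c _]; rewrite size_rcons eqSS => wm; exists (w, c); split=> //=.
  by rewrite ih.
by case: c.
Qed.

Lemma uniq_words m : uniq (words m).
Proof.
elim: m => [//|m ih]; apply: allpairs_uniq => // -[w c] [w' c'] _ _ /= /eqP.
by rewrite eqseq_rcons => /andP[/eqP -> /eqP ->].
Qed.

Lemma prod_words m (f : seq bool -> R) : \prod_(w : m.-tuple bool) f w = \prod_(w <- words m) f w.
Proof.
rewrite -(big_map (@tval m bool) xpredT f); apply: perm_big; apply: uniq_perm.
- by rewrite map_inj_uniq ?index_enum_uniq//; exact: val_inj.
- exact: uniq_words.
move=> w; rewrite mem_words; apply/mapP/eqP => [[t _ ->]|sw]; first by rewrite size_tuple.
by exists (tcast sw (in_tuple w)); rewrite ?mem_index_enum// val_tcast.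
Qed.

Lemma prod_wordsS m (f : seq bool -> R) :
  \prod_(w <- words m.+1) f w = \prod_(w <- words m) (f (rcons w true) * f (rcons w false)).
Proof.
change (words m.+1) with (flatten [seq [seq rcons w c | c <- [:: true; false]] | w <- words m]).
elim: (words m) => [|w r ih]; first by rewrite !big_nil.
by rewrite /= !big_cons ih mulrA.
Qed.

(** Taking full sets for all lifetimes and hyperplanes of a generation, the division rule gives
    total mass 1, whereas its integrand vanishes as soon as one cell of the generation has rate
    zero. *)
Lemma lam_pos w : {ae P, forall o, 0 < lam (C w o)}.
Proof.
have [_ _ h] := div.
have := h (size w) setT (fun=> setT) (fun=> setT) (measurableT : measurable (setT : set (past_space (size w)))) (fun=> measurableT) (fun=> measurableT).
rewrite setTI (_ : [set o | _] = setT); last set_eq.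
rewrite probability_setT => h1.
have mp : measurable [set o | 0 < lam (C w o)].
  have ml : mfunT (fun o => lam (C w o)).
    exact: (past_measurable (meas_lam L cV (past_cell (leqnn (size w))))).
  exact: (meas_lt (f := fun=> 0)).
apply: ae_probability1 => //; apply/le_anti; rewrite probability_le1//= h1.
apply: (@le_trans _ _ (\int[P]_o (\1_[set o | 0 < lam (C w o)] o)%:E)%E); last by rewrite integral_indic// setIT.
have fac (v : seq bool) o : fine (exponential_prob (fine (L (hitting (C v o)))) setT) * normalized_on L (C v o) setT = ind (0 < lam (C v o)).
  rewrite -/(lam (C v o)) /normalized_on setTI; have := lam_ge0 L (C v o); rewrite le_eqVlt => /orP[/eqP lz|lp].
    by rewrite -!/(lam (C v o)) -lz invr0 !mulr0 ind0// ltxx.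
  by rewrite ind1// -!/(lam (C v o)) divff ?gt_eqF// mulr1 /exponential_prob integral_exponential_pdf.
under eq_integral do under eq_bigr do rewrite fac.
have le o : \prod_(v : (size w).-tuple bool) ind (0 < lam (C v o)) <= \1_[set o | 0 < lam (C w o)] o :> R.
  rewrite -(indE [set o | 0 < lam (C w o)]) (bigD1 (in_tuple w))//= ler_piMr ?ind_ge0//.
  by rewrite prodr_ile1// => v _; rewrite ind_ge0 ind_le1.
apply: ge0_le_integral => //.
- by move=> o _; rewrite lee_fin prodr_ge0// => v _; exact: ind_ge0.
- apply/measurable_EFinP; apply: meas_bigprod => v; apply: meas_ind.
  have sv : (size v <= size w)%N by rewrite size_tuple.
  have ml := past_measurable (meas_lam L cV (past_cell sv)).
  exact: (meas_lt (f := fun=> 0)).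
- by meas.
- by move=> o _; rewrite lee_fin.
Qed.

Definition cell_ok w o := pass obs (C w o) (b w o) (b w o + s w o).

Definition ok_before m : set Om := [set o | forall w, (size w < m)%N -> cell_ok w o].

Lemma past_cell_ok m w : (size w < m)%N -> measurable (cell_ok w : set (past_space m)).
Proof.
move=> wm; have mb := past_birth (ltnW wm).
by apply: (@meas_pass _ _ V _ (past_space m) (C w) (b w) (fun o => b w o + s w o) obs go (past_cell (ltnW wm)) mb);
  apply: measurable_funD => //; exact: past_s.
Qed.

Lemma past_ok m : measurable (ok_before m : set (past_space m)).
Proof. by apply: meas_all => w; apply: meas_imp => wm; exact: past_cell_ok. Qed.

Lemma ok_beforeS m o : ind (ok_before m.+1 o) = ind (ok_before m o) * \prod_(w <- words m) ind (cell_ok w o) :> R.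
Proof.
have [h|nh] := pselect (ok_before m.+1 o).
  rewrite !ind1//; last by move=> w wm; apply: h; lia.
  rewrite big_seq big1 ?mulr1// => w; rewrite mem_words => /eqP wm; rewrite ind1//.
  by apply: h; rewrite wm.
rewrite [LHS]ind0//; have [h|h] := pselect (ok_before m o); last by rewrite ind0// mul0r.
have [w [wm nw]] : exists w, size w = m /\ ~ cell_ok w o.
  apply: contrapT => hh; apply: nh => w; rewrite ltnS leq_eqVlt => /orP[/eqP wm|wm]; last exact: h.
  by apply: contrapT => nw; apply: hh; exists w.
rewrite [X in _ * X](perm_big (w :: rem w (words m))); last by apply: perm_to_rem; rewrite mem_words wm.
have z : ind (cell_ok w o) = 0 :> R by rewrite ind0.
by rewrite big_cons /= z mul0r mulr0.
Qed.

(** Given the earlier generations the cells of generation [m] are independent, so the product over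
    daughters becomes a product over mothers of one-cell integrals, each of which is a value of
    [renew]. *)
Lemma peel_generation m f : admissible V f -> (forall D u, is_cell V D -> T <= u -> f D u = 1) ->
  (\int[P]_o (ind (ok_before m.+1 o) * \prod_(w <- words m.+1) f (C w o) (b w o))%:E =
   \int[P]_o (ind (ok_before m o) * \prod_(w <- words m) renew L T obs f (C w o) (b w o))%:E)%E.
Proof.
move=> af f1.
pose T0 := past_space m; pose th : Om -> T0 := id.
pose Y (w : m.-tuple bool) o : RR * H := (s w o, k w o).
have sz (w : m.-tuple bool) : (size w <= m)%N by rewrite size_tuple.
have rC (w : m.-tuple bool) : rcell V (C w : T0 -> set E) := past_cell (sz w).
have mbw (w : m.-tuple bool) : mfunT (b w : T0 -> R) := past_birth (sz w).
pose q (w : m.-tuple bool) (p : T0 * (RR * H)) : R := life_pdf L (C w p.1) p.2.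
have m21 : mfunT (fun p : T0 * (RR * H) => (p.2.1 : R)) by apply: measurableT_comp.
have m22 : mfunT (fun p : T0 * (RR * H) => p.2.2) by apply: measurableT_comp.
have mlam (w : m.-tuple bool) : mfunT (fun p : T0 * (RR * H) => lam (C w p.1)).
  by apply: (measurableT_comp (f := fun o : T0 => lam (C w o))) => //; exact: (meas_lam L cV (rC w)).
have mq w : mfunT (q w).
  rewrite (_ : q w = fun p => ind (0 <= p.2.1) * (lam (C w p.1) * expR (- lam (C w p.1) * p.2.1)) *
     (ind (hitting (C w p.1) p.2.2) * (lam (C w p.1)) `^ (-1))); last first.
    by apply/funext => p; rewrite /q /life_pdf exponential_pdf_ind powR_inv1// lam_ge0.
  have m0 := @meas_ind R _ _ _ (meas_le (f := fun=> 0) (measurable_cst _) m21).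
  apply: measurable_funM; first meas.
  apply: measurable_funM; last by apply: (measurableT_comp (f := fun x : R => x `^ (-1))) => //; meas.
  apply: (meas_ind (A := fun p : T0 * (RR * H) => hitting (C w p.1) p.2.2)).
  exact: (meas_preim (measurable_fun_pair measurable_fst m22) (meas_hits cV (rC w))).
have q0 w p : 0 <= q w p by exact: life_pdf_ge0.
have q1 w o : (\int[prod_measure leb L]_p (q w (o, p))%:E <= 1)%E.
  have := lam_ge0 L (C w o); rewrite le_eqVlt => /orP[/eqP lz|lp].
    by rewrite integral0_eq ?lee01// => p _; rewrite /q /life_pdf/= -lz invr0 !mulr0.
  by rewrite (life_mass cV finV (cellC w o) lp).
have mY w : mfunT (Y w) := measurable_fun_pair (ms w) (mk w).
pose F (w : m.-tuple bool) (p : T0 * (RR * H)) : R :=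
  ind (pass obs (C w p.1) (b w p.1) (b w p.1 + p.2.1)) * split2 f (C w p.1) (b w p.1 + p.2.1) p.2.2.
have rC1 (w : m.-tuple bool) : rcell V (fun p : T0 * (RR * H) => C w p.1).
  exact: (rcell_comp (f := fst) _ (rC w)).
have mb1 (w : m.-tuple bool) : mfunT (fun p : T0 * (RR * H) => b w p.1).
  by apply: (measurableT_comp (f := b w : T0 -> R)).
have mbs (w : m.-tuple bool) : mfunT (fun p : T0 * (RR * H) => b w p.1 + p.2.1) by meas.
have uF w : mfunT (F w) /\ forall p, 0 <= F w p <= 1.
  split; last first.
    move=> p; have /andP[x0 x1] := split2_01 (b w p.1 + p.2.1) p.2.2 af (cellC w p.1).
    by rewrite mulr_ge0 ?ind_ge0//= mulr_ile1 ?ind_ge0 ?ind_le1.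
  apply: measurable_funM; first by apply: meas_ind; exact: meas_pass.
  have rS c : rcell V (fun p : T0 * (RR * H) => C w p.1 `&` side c p.2.2).
    split; last by move=> p x [/(rC1 w).2].
    by apply: rcsI; [exact: (rC1 w).1|exact: (rcs_comp m22 (rcs_side c))].
  by apply: measurable_funM; apply: af.2.
have base A (D : m.-tuple bool -> set RR) (B : m.-tuple bool -> set H) : measurable (A : set T0) ->
    (forall i, measurable (D i)) -> (forall i, measurable (B i)) ->
    (P (th @^-1` A `&` [set o | forall i, D i (Y i o).1 /\ B i (Y i o).2]) =
     \int[P]_(o in th @^-1` A) (\prod_i cond_exp leb L q i (fun p => ind (D i p.2.1 /\ B i p.2.2)) (th o))%:E)%E.
  move=> mA mD mB; have [_ _ hd] := div; rewrite [LHS](hd m A D B mA mD mB).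
  apply: eq_integral => o _; congr EFin; apply: eq_bigr => w _.
  by rewrite /cond_exp (life_rect cV finV (cellC w o) (mD w) (mB w)).
have mth : mfunT th by exact: meas_past.
have mok := @meas_ind R _ _ _ (meas_preim mth (@past_ok m)).
have := conditional_product mth mY mq q0 q1 base (@past_ok m) uF.
have -> : (\int[P]_o (ind (ok_before m (th o)) * \prod_i F i (th o, Y i o))%:E =
    \int[P]_o (ind (ok_before m.+1 o) * \prod_(w <- words m.+1) f (C w o) (b w o))%:E)%E.
  apply: eq_integral => o _; congr EFin; rewrite ok_beforeS prod_wordsS -mulrA; congr (_ * _).
  rewrite -big_split/= -prod_words; apply: eq_bigr => w _.
  by rewrite /F /split2 /= !birth_rcons !cell_rcons.
move=> ->; apply: ae_eq_integral => //.
- apply/measurable_EFinP; apply: measurable_funM => //; apply: meas_bigprod => w.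
  by apply: (measurableT_comp (f := cond_exp leb L q w (F w))) => //; exact: meas_cond_exp.
- have ar := admissible_renew cV finV T go af.
  apply/measurable_EFinP; apply: measurable_funM => //; under eq_fun do rewrite -prod_words.
  by apply: meas_bigprod => w; apply: (@past_measurable m); exact: ar.2.
- have := ae_countable (fun w => lam_pos w); apply: filterS => o lp _; congr EFin; congr (_ * _).
  rewrite -prod_words; apply: eq_bigr => w _; rewrite /cond_exp /F /q /=.
  by rewrite (life_renew cV finV (cellC w o) (lp w) go bT (b w o) af f1).
Qed.

Hypothesis T0' : 0 < T.

Lemma pass_upto1 j D u : is_cell V D -> T <= u -> pass_upto L T obs j D u = 1.
Proof. by case: j => [//|j] _ Tu; rewrite pass_uptoS renew1. Qed.

Lemma pass_generations m j :
  (\int[P]_o (ind (ok_before m o) * \prod_(w <- words m) pass_upto L T obs j (C w o) (b w o))%:E =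
   (pass_upto L T obs (m + j) V 0)%:E)%E.
Proof.
elim: m j => [|m ih] j.
  rewrite (eq_integral (fun=> (pass_upto L T obs j V 0)%:E)); last first.
    by move=> o _; rewrite ind1// mul1r big_seq1 cell_nil birth_nil.
  by have -> : (\int[P]__ (pass_upto L T obs j V 0)%:E = (pass_upto L T obs j V 0)%:E * P setT)%E; [exact: integral_cst|rewrite probability_setT mule1].
rewrite peel_generation.
- by rewrite addSnnS -ih.
- exact: admissible_pass_upto.
- exact: pass_upto1.
Qed.

Lemma meas_ok m : measurable (ok_before m).
Proof. exact: (@past_sub m _ (@past_ok m)). Qed.

(** Peeling off one generation after the other leaves the iterate at the root, and the events for
    finitely many generations decrease to the full one. *)
Lemma probability_all_ok : P [set o | forall w, cell_ok w o] = (pass_all L T obs V 0)%:E.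
Proof.
have PE m : P (ok_before m) = (pass_upto L T obs m V 0)%:E.
  rewrite -[in RHS](addn0 m) -pass_generations.
    have -> : P (ok_before m) = (\int[P]_o (\1_(ok_before m) o)%:E)%E by rewrite integral_indic ?setIT//; exact: meas_ok.
  by apply: eq_integral => o _; rewrite -indE big1 ?mulr1.
have E : [set o | forall w, cell_ok w o] = \bigcap_m ok_before m.
  by seteq=> o h; [move=> m _ w _; exact: h|move=> w; exact: (h (size w).+1 I)].
have mE : measurable (\bigcap_m ok_before m) by apply: bigcapT_measurable => m; exact: meas_ok.
rewrite E; have h : P (ok_before m) @[m --> \oo] --> P (\bigcap_m ok_before m).
  apply: nonincreasing_cvg_mu => //.
  - by rewrite (le_lt_trans (probability_le1 _ _))// ?ltry//; exact: meas_ok.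
  - exact: meas_ok.
  - by move=> i j ij; apply/subsetPset => o hj w wi; apply: hj; exact: leq_trans ij.
have h2 : P (ok_before m) @[m --> \oo] --> (pass_all L T obs V 0)%:E.
  under eq_fun do rewrite PE.
  apply: cvg_EFin; first exact: nearW.
  exact: (pass_upto_cvg cV finV go (cellV cV)).
exact: (cvg_unique _ h h2).
Qed.

(** The cells present at a test time are those whose life contains it. Testing every cell during its
    life therefore amounts to testing the tessellations at the given times. *)
Lemma probability_pass (X : R -> Om -> tess (tessellable_window W)) :
  (forall j, (j < size obs)%N -> 0 <= (nth ob0 obs j).1) ->
  {ae P, forall o t, 0 <= t -> sval (X t o) = present_cells W (s ^~ o) (k ^~ o) t} ->
  measurable [set o | forall j, (j < size obs)%N -> forall D, sval (X (nth ob0 obs j).1 o) D -> (nth ob0 obs j).2 D] ->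
  P [set o | forall j, (j < size obs)%N -> forall D, sval (X (nth ob0 obs j).1 o) D -> (nth ob0 obs j).2 D] =
    (pass_all L T obs V 0)%:E.
Proof.
move=> t0 hX mA; rewrite -probability_all_ok; apply: ae_measure_eq => //.
  rewrite (_ : [set o | _] = \bigcap_m ok_before m); first by apply: bigcapT_measurable => m; exact: meas_ok.
  by seteq=> o h; [move=> m _ w _; exact: h|move=> w; exact: (h (size w).+1 I)].
move: hX; apply: filterS => o hX; split=> h.
  move=> w j js bj; apply: (h j js); rewrite hX ?t0//; exists w => //.
move=> j js D; rewrite hX ?t0// => -[w bj <-]; exact: h.
Qed.
End division_tree.

Lemma interior_cvx (R : realType) n (C : set 'rV[R]_n) : cvx C -> cvx C°.
Proof.
move=> vC x y t /andP[t0 t1] Cx Cy; move: t0; rewrite le_eqVlt => /orP[/eqP <-|t0].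
  by rewrite scale0r add0r subr0 scale1r.
have tn : t != 0 by rewrite gt_eqF.
pose k z := t^-1 *: z + (- (t^-1 * (1 - t))) *: y.
have kx : k (t *: x + (1 - t) *: y) = x by rewrite /k (scalerDr t^-1) !scalerA mulVf// scale1r scaleNr addrK.
have : nbhs (t *: x + (1 - t) *: y) (k @^-1` C).
  by apply: affine_continuous; rewrite -/(k _) kx.
apply: filterS => z Ckz.
have -> : z = t *: k z + (1 - t) *: y.
  by rewrite /k scalerDr !scalerA divff// scale1r mulrN mulrA divff// mul1r scaleNr subrK.
by apply: vC => //; [rewrite (ltW t0)|exact: interior_subset].
Qed.

(** * Hyperplanes that touch a convex body at its boundary only *)

Section boundary_null.
Context {R : realType} {l : nat}.
Local Notation E := 'rV[R]_l.+1.
Local Notation H := (hyperplane R l).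
Variable L : {sigma_finite_measure set H -> \bar R}.
Hypothesis inv : translation_invariant L.

Lemma meas_touching (C : set E) : compact C -> measurable [set h : H | hitting C h /\ ~ hitting C° h].
Proof.
by move=> cC; exact: meas_and (rcs_meet rcs_hyperplane cC) (meas_not (rcs_hit rcs_hyperplane (@open_interior _ _))).
Qed.

(** Such a hyperplane supports [C]: its linear form is extremal over [C] there. Along a transverse
    axis this leaves at most one translate for the minimum and one for the maximum, and the
    disintegration along axes concludes. *)
Lemma touching_null (C : set E) : compact C -> cvx C -> C° !=set0 ->
  L [set h | hitting C h /\ ~ hitting C° h] = 0%E.
Proof.
move=> cC vC C0.
set A := [set h : H | hitting C h /\ ~ hitting C° h].
have mA := meas_touching cC.
(* Were there values on both sides, there would also be some at interior points, and a convex
   combination of two of these would lie on [h]. *)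
have ext (h : H) u c : A h -> sval h = [set x | dot u x = c] ->
    (forall x, C x -> c <= dot u x) \/ (forall x, C x -> dot u x <= c).
  move=> [_ mC] hE; apply: contrapT => /not_orP[/existsNP[x1 /not_implyP[Cx1 /negP]] + /existsNP[x3 /not_implyP[Cx3 /negP]]].
  rewrite -!ltNge => l1 l3.
  have near x (P : set R) : C x -> open P -> P (dot u x) -> exists y, C° y /\ P (dot u y).
    move=> Cx oP Px; have := cvx_closure_interior vC C0 Cx.
    have nP : nbhs x (dot u @^-1` P) by apply: dot_continuous; exact: open_nbhs_nbhs.
    by move=> /(_ _ nP) [y [Cy Py]]; exists y.
  have [y1 [Cy1 /= h1]] := near x1 [set t | t < c] Cx1 (@open_lt R c) l1.
  have [y3 [Cy3 /= h3]] := near x3 [set t | c < t] Cx3 (@open_gt R c) l3.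
  pose t := (dot u y3 - c) / (dot u y3 - dot u y1).
  have d0 : 0 < dot u y3 - dot u y1 by rewrite subr_gt0 (lt_trans h1).
  have t01 : 0 <= t <= 1.
    by apply/andP; split; [apply: divr_ge0; apply: ltW => //; rewrite subr_gt0|rewrite /t ler_pdivrMr// mul1r lerD2l lerN2 ltW].
  apply: mC; exists (t *: y1 + (1 - t) *: y3); split.
    rewrite hE /= dotD !dotZ /t; field; exact: lt0r_neq0.
  exact: (interior_cvx vC).
rewrite measure_first_transverse//.
  rewrite big1// => i _; apply: (slab_null inv mA) => h ti.
  have [u [c [lu hE]]] := hyperplaneP h.
  have [ui _] := (first_transverseP i hE).1 ti.
  pose v t := c + t * u 0 i.
  have tE t : sval (transl (t *: 'e_i) h) = [set x | dot u x = v t].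
    by rewrite (transl_normal (t *: 'e_i) hE) dotZ dot_delta.
  have vinj s t : v s = v t -> s = t by move=> /addrI /(mulIf ui).
  have one (r : rel R) : antisymmetric r ->
      countable [set t | (forall x, C x -> r (v t) (dot u x)) /\ exists2 x, C x & dot u x = v t].
    move=> ra; set B := [set t | _]; have [[s [s1 [x Cx xs]]]|nB] := pselect (B !=set0).
      apply: (sub_countable _ (countable1 s)); apply: subset_card_le => t [t1 [y Cy yt]].
      by apply: vinj; apply: ra; move: (t1 x Cx) (s1 y Cy); rewrite xs yt => -> ->.
    by rewrite (_ : B = set0) ?countable0//; seteq=> s // Bs; apply: nB; exists s.
  have cU (A1 A2 : set R) : countable A1 -> countable A2 -> countable (A1 `|` A2).
    by move=> c1 c2; rewrite -bigcup2E; apply: bigcup_countable => // -[|[|n]].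
  apply: (sub_countable _ (cU _ _ (one _ le_anti) (one _ ge_anti))).
  apply: subset_card_le => t At; have [[x [hx Cx]] _] := At; have hx' : dot u x = v t by move: hx; rewrite tE.
  by have [h1|h1] := ext _ _ _ At (tE t); [left|right]; split=> //; exists x.
Qed.

Lemma touching_ae (C : set E) : compact C -> cvx C -> C° !=set0 ->
  {ae L, forall h, hitting C h -> hitting C° h}.
Proof.
move=> cC vC C0; exists [set h | hitting C h /\ ~ hitting C° h]; split.
- exact: meas_touching.
- exact: touching_null.
- by move=> h /= /not_implyP.
Qed.
End boundary_null.

(** * Scaling in space and time *)

Section scaling.
Context {R : realType} {l : nat}.
Local Notation E := 'rV[R]_l.+1.
Local Notation H := (hyperplane R l).
Local Notation RR := (measurableTypeR R).
Local Notation leb := (@lebesgue_measure R).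
Variable L : {sigma_finite_measure set H -> \bar R}.
Hypothesis inv : translation_invariant L.
Variables (V V' : set E) (a : R).
Hypotheses (a0 : 0 < a) (cV : compact V) (finV : (L (hitting V) < +oo)%E).
Hypotheses (cV' : compact V') (VV : dilate a V' = V).
Let an0 : a != 0. Proof. by rewrite gt_eqF. Qed.
Variable T : R.

Definition scale_obs (obs : @obs_type R l) : obs_type :=
  [seq (a * e.1, fun C => e.2 (dilate a C)) | e <- obs].

Lemma hitting_dil C (h : H) : hitting (dilate a C) (dil a h) <-> hitting C h.
Proof.
split=> [[x []]|[x [hx Cx]]].
  by rewrite mem_dil// => hx; rewrite mem_dilate// => Cx; exists (a^-1 *: x).
by exists (a *: x); split; [rewrite mem_dil// scalerA mulVf// scale1r|exists x].
Qed.

Lemma side_dil c (h : H) : dilate a (side c h) = side c (dil a h).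
Proof.
have [u [k [lu hE]]] := hyperplaneP h.
have hE' := dil_normal an0 hE.
seteq=> x; rewrite mem_dilate// => hx.
  apply/(sideP _ _ lu hE'); move/(sideP _ _ lu hE): hx; rewrite dotZ.
  by case: c; rewrite mulrC ?ler_pdivlMr// ?ler_pdivrMr// mulrC.
apply/(sideP _ _ lu hE); move/(sideP _ _ lu hE'): hx; rewrite dotZ.
by case: c; rewrite [a^-1 * _]mulrC ?ler_pdivlMr// ?ler_pdivrMr// mulrC.
Qed.

Lemma dilate_setI (C D : set E) : dilate a (C `&` D) = dilate a C `&` dilate a D.
Proof.
seteq=> x; first by rewrite mem_dilate// => -[? ?]; split; rewrite mem_dilate.
by move=> [] /mem_dilate-/(_ an0) Cx /mem_dilate-/(_ an0) Dx; rewrite mem_dilate.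
Qed.

Lemma cell_dilate C : is_cell V' C -> is_cell V (dilate a C).
Proof.
move=> cC; split.
  by apply: compact_closed; [exact: norm_hausdorff|apply: compact_dilate; exact: (cell_compact cV' cC)].
by rewrite -VV => _ [x /cC.2 Vx <-]; exists x.
Qed.

Lemma lam_dilate C : is_cell V' C -> lam L C = a^-1 * lam L (dilate a C).
Proof.
move=> cC; rewrite /lam.
have -> : hitting C = [set h | hitting (dilate a C) (dil a h)].
  by seteq=> h; rewrite /= hitting_dil.
have cD := cell_dilate cC.
rewrite (driving_scaling inv a0); last exact: (meas_hitting cV cD).
by rewrite fineM// ge0_fin_numE// (hitting_fin cV finV cD).
Qed.

Variable obs : @obs_type R l.
Hypothesis go : good_obs obs.
Variables f f' : set E -> R -> R.
Hypotheses (af : admissible V f) (ff : forall C s, is_cell V' C -> f' C (a * s) = f (dilate a C) s).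

Lemma pass_scale C s u : pass (scale_obs obs) C (a * s) (a * u) <-> pass obs (dilate a C) s u.
Proof.
split=> h j; first move=> js; last rewrite size_map => js.
  move=> b; have := h j; rewrite size_map (nth_map ob0)//= !ler_pM2l// !ltr_pM2l//; exact.
by rewrite (nth_map ob0)//= !ler_pM2l// !ltr_pM2l//; exact: h.
Qed.

Lemma jump_scale C s : is_cell V' C -> jump L f' C (a * s) = a^-1 * jump L f (dilate a C) s.
Proof.
move=> cC; have cD := cell_dilate cC; have mh := meas_hitting cV cD; rewrite /jump.
have -> : hitting C = dil a @^-1` hitting (dilate a C).
  by seteq=> h; rewrite /= /preimage /= hitting_dil.
have sE h : split2 f' C (a * s) h = split2 f (dilate a C) s (dil a h).
  by rewrite /split2 !ff ?dilate_setI ?side_dil//; exact: cell_side.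
under eq_integral do rewrite sE.
have ai0 : 0 < a^-1 by rewrite invr_gt0.
have mf := meas_split2_cst s af cD.
rewrite (integral_rescale ai0 (meas_dil an0) (fun A => driving_scaling inv a0 (A := A)) (measurable_funM (meas_ind mh) mf));
  last by move=> h _; case/andP: (split2_01 s h af cD).
have ms := measurable_funTS mf : measurable_fun (hitting (dilate a C)) (split2 f (dilate a C) s).
have [fi _ _] := integral_le_bound mh (hitting_fin cV finV cD) ms (fun h _ => split2_01 s h af cD).
by rewrite fineM.
Qed.

Lemma renew_scale C s : is_cell V' C ->
  renew L (a * T) (scale_obs obs) f' C (a * s) = renew L T obs f (dilate a C) s.
Proof.
move=> cC; have cD := cell_dilate cC; rewrite /renew (ler_pM2l a0); case: (leP T s) => [_|sT]; first reflexivity.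
have e (u : R) : expR (- lam L C * (a * u - a * s)) = expR (- lam L (dilate a C) * (u - s)).
  by congr expR; rewrite (lam_dilate cC); field.
have i (u : R) : ind (pass (scale_obs obs) C (a * s) (a * u)) = ind (pass obs (dilate a C) s u) :> R.
  by congr ind; apply/propext; exact: pass_scale.
rewrite e i; congr (_ + fine _).
pose phi (u : R) := ind (pass obs (dilate a C) s u) * expR (- lam L (dilate a C) * (u - s)) * jump L f (dilate a C) u.
pose g (u : RR) : RR := a^-1 * u.
have mphi : mfunT (phi : RR -> R) := meas_renew_cst L cV s go af cD.
have mg : measurable_fun [set: RR] g by apply: measurable_funM.
have gE : `[a * s, a * T]%classic = g @^-1` `[s, T]%classic.
  by seteq=> u; rewrite /preimage /g /= !in_itv/= ler_pdivlMl// ler_pdivrMl.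
have phi0 (u : RR) : `[s, T]%classic u -> 0 <= phi u.
  by rewrite /= in_itv/= => /andP[su _]; case/andP: (renew_int01 cV finV obs af cD su).
transitivity (\int[leb]_(u in g @^-1` `[s, T]%classic) (a^-1 * phi (g u))%:E)%E.
  rewrite gE; apply: eq_integral => u _; congr EFin.
  have uE : u = a * g u by rewrite /g mulrA divff// mul1r.
  rewrite {1 2 3}uE i e (jump_scale _ cC) /phi; ring.
have hm (A : set RR) : measurable A -> leb (g @^-1` A) = (a%:E * leb A)%E.
  move=> mA; have ai0 : 0 < a^-1 by rewrite invr_gt0.
  have := lebesgue_affine 0 ai0 mA; rewrite invrK => <-; congr (leb _).
  by apply/funext => u; rewrite /preimage /= addr0.
have ma : mfunT (fun u : RR => ind (`[s, T]%classic u) * (a^-1 * phi u)).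
  exact: measurable_funM (meas_ind (measurable_itv `[s, T])) (measurable_funM (measurable_cst _) mphi).
rewrite (integral_rescale a0 mg hm ma); last first.
  by move=> u /phi0 p0; apply: mulr_ge0 p0; rewrite invr_ge0; exact: ltW.
under eq_integral do rewrite EFinM.
rewrite ge0_integralZl_EFin//.
- by rewrite muleA -EFinM divff// mul1e.
- by apply/measurable_EFinP; exact: measurable_funTS.
- by rewrite invr_ge0 ltW.
Qed.
End scaling.

(** The dilate of [C] by [a] has [a] times the rate of [C], which a change of the time unit by the
    same factor compensates. The iterates of the two renewal equations agree one by one. *)
Lemma pass_all_scale (R : realType) l (L : {sigma_finite_measure set (hyperplane R l) -> \bar R})
    (V V' : set 'rV[R]_l.+1) (a T : R) (obs : @obs_type R l) C s :
  translation_invariant L -> 0 < a -> compact V -> (L (hitting V) < +oo)%E ->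
  compact V' -> dilate a V' = V -> good_obs obs -> is_cell V' C ->
  pass_all L (a * T) (scale_obs a obs) C (a * s) = pass_all L T obs (dilate a C) s.
Proof.
move=> inv a0 cV finV cV' VV go cC.
have h m : forall C s, is_cell V' C -> pass_upto L (a * T) (scale_obs a obs) m C (a * s) = pass_upto L T obs m (dilate a C) s.
  elim: m => [//|m ih] D u cD; rewrite !pass_uptoS.
  exact: (renew_scale inv a0 cV finV cV' VV T go (admissible_pass_upto cV finV T go m) ih u cD).
by rewrite /pass_all; under eq_fun do rewrite h//.
Qed.

(** * Measurability of being the convex hull of finitely many points *)

Lemma cvg_bigsum (R : realType) (V : normedModType R) (S I : Type) (F : set_system S) {FF : Filter F}
    (r : seq I) (f : S -> I -> V) (v : I -> V) :
  (forall i, f k i @[k --> F] --> v i) -> \sum_(i <- r) f k i @[k --> F] --> \sum_(i <- r) v i.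
Proof.
move=> h; elim: r => [|i r ih].
  by under eq_fun do rewrite big_nil; rewrite big_nil; exact: cvg_cst.
by under eq_fun do rewrite big_cons; rewrite big_cons; apply: cvgD; [exact: h|exact: ih].
Qed.

Lemma cvg_close (R : realType) (V : normedModType R) (S : Type) (F : set_system S) {FF : Filter F} (f g : S -> V) (v : V) :
  f k @[k --> F] --> v -> f k - g k @[k --> F] --> 0 -> g k @[k --> F] --> v.
Proof.
move=> fv fg; have -> : g = fun k => f k - (f k - g k) by apply/funext => k; rewrite subKr.
by rewrite -[v]subr0; apply: cvgB.
Qed.

Section ultrafilters.

Lemma ultra_fmap (S S' : Type) (U : set_system S) (f : S -> S') : UltraFilter U -> UltraFilter (f @ U).
Proof.
move=> ultU; have UP : ProperFilter U by exact: ultra_proper.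
apply: Build_UltraFilter => G PG sub; seteq=> A GA; last exact: sub.
have [//|UnA] := in_ultra_setVsetC (f @^-1` A) ultU.
have GnA : G (~` A) by apply: sub; exact: UnA.
by have [x [Ax nAx]] := filter_ex (filterI GA GnA).
Qed.
End ultrafilters.

Section approximating_polytopes.
Context {R : realType} {n : nat}.
Local Notation E := 'rV[R]_n.
Local Notation Q := ('rV[rat]_n * rat)%type.
Local Notation qb := (@qball R n).

Definition hull M (p : 'I_M -> E) := conv_hull [seq p i | i <- enum 'I_M].

Definition common_balls (bs : seq Q) (C D : set E) :=
  [/\ C `<=` \bigcup_(b in [set` bs]) qb b, D `<=` \bigcup_(b in [set` bs]) qb b &
      forall b, b \in bs -> C `&` qb b !=set0 /\ D `&` qb b !=set0].

Definition fine_balls (k : nat) (bs : seq Q) := forall b, b \in bs -> 0 < b.2 /\ b.2 * k.+1%:R < 1.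

(** [C] and some hull of [M] points are covered by the same finite list of small balls and both meet
    each of them, so they are close in Hausdorff distance. What is asked of [C] is a hit and miss
    condition. *)
Definition hull_near (M k : nat) (bs : seq Q) (C : set E) :=
  fine_balls k bs /\ exists p : 'I_M -> E, common_balls bs C (hull p).

Lemma common_balls_near k bs (C D : set E) x : fine_balls k bs -> common_balls bs C D -> C x ->
  exists y, D y /\ `|x - y| < 2 / k.+1%:R.
Proof.
move=> fb [hC _ h] Cx; have [b bs_b bx] := hC _ Cx; have [_ [y [Dy by_]]] := h b bs_b.
exists y; split=> //; have [_ bk] := fb b bs_b.
have {}bk : ratr b.2 < (k.+1%:R)^-1 :> R.
  rewrite -[ltRHS]mul1r ltr_pdivlMr ?ltr0n//.
  by have := bk; rewrite -(ltr_rat R) rmorphM/= rmorph1 ratr_nat.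
move: bx by_; rewrite /qball -ball_normE /= => bx by_.
have -> : x - y = (rpt b.1 - y) - (rpt b.1 - x) by rewrite [RHS]addrC opprB addrA subrK.
apply: (le_lt_trans (ler_normB _ _)).
have -> : 2 / k.+1%:R = (k.+1%:R)^-1 + (k.+1%:R)^-1 :> R by rewrite mulr_natl mulr2n.
by apply: ltrD; [exact: lt_trans by_ bk|exact: lt_trans bx bk].
Qed.

Lemma common_ballsC bs (C D : set E) : common_balls bs C D -> common_balls bs D C.
Proof. by case=> h1 h2 h3; split=> // b /h3[? ?]. Qed.

Lemma hull_near_exists (C : set E) k : compact C -> exists bs, fine_balls k bs /\ common_balls bs C C.
Proof.
move=> cC.
pose D : set Q := [set b | [/\ 0 < b.2, b.2 * k.+1%:R < 1 & C `&` qb b !=set0]].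
have cov x : C x -> exists b, D b /\ qb b x.
  move=> Cx; have k0 : 0 < (k.+1%:R : R)^-1 by rewrite invr_gt0 ltr0n.
  have [r [r0 rk]] : exists r : rat, 0 < r /\ r * k.+1%:R < 1.
    exists (k.+2%:R^-1); rewrite invr_gt0 ltr0n; split=> //.
    by rewrite mulrC ltr_pdivrMr ?ltr0n// mul1r ltr_nat.
  have rR : 0 < (ratr r : R) by rewrite ltr0q.
  have [q hq] := rpt_dense x rR.
  have bx : qb (q, r) x by rewrite /qball -ball_normE.
  by exists (q, r); split=> //; split=> //; exists x.
have [s [hs sC]] := compact_finite_cover cC (fun b _ => @open_qball R n b : open (qb b)) cov.
exists s; split; first by move=> b /hs[].
by split=> // b /hs[_ _ h]; split.
Qed.

(** For a fixed number [M] of points, the vertices of the approximating hulls converge along an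
    ultrafilter, and so do the weights that represent a given point of [C]; hence the limit vertices
    span [C]. Without a common [M] any compact convex set could be approximated. *)
Lemma hull_limit (M : nat) (C : set E) : compact C ->
  (forall k, exists bs, hull_near M k bs C) -> exists s, C = conv_hull s.
Proof.
move=> cC h.
have [bs hbs] := choice h; have fb k := (hbs k).1.
have [p hp] := choice (fun k => (hbs k).2).
have near1 k x := common_balls_near (x := x) (fb k) (hp k).
have near2 k y := common_balls_near (x := y) (fb k) (common_ballsC (hp k)).
(* Along an ultrafilter finer than the eventual one all the bounded sequences involved converge,
   with no extraction of subsequences. *)
have [U [ultU ooU]] := ultraFilterLemma (F := \oo) (eventually_filter : ProperFilter \oo).
have PU : ProperFilter U by exact: ultra_proper.
have small (u : nat -> E) : (forall k, `|u k| < 2 / k.+1%:R) -> u k @[k --> U] --> (0 : E).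
  move=> hu; apply: (cvg_trans (G := u k @[k --> \oo])); first by move=> A; exact: ooU.
  apply/cvgr0Pnorm_lt => e e0; near=> k; apply: (lt_trans (hu k)).
  rewrite ltr_pdivrMr ?ltr0n// mulrC -ltr_pdivrMr//.
  near: k; exists (Num.truncn (2 / e)).+1 => // j /= hj.
  by apply: lt_le_trans (truncnS_gt _) _; rewrite ler_nat; exact: (leq_trans hj).
have [N [_ hN]] : exists N : R, N \is Num.real /\ forall x, C x -> `|x| <= N.
  have [N [Nr hN]] := compact_bounded cC; exists (N + 1); split=> // x Cx; apply: hN Cx; by rewrite ltrDl.
have memp k j : hull (p k) (p k j).
  by apply: conv_hull_mem; apply/mapP; exists j => //; rewrite mem_enum.
have pb k j : closed_ball (0 : E) (N + 2) (p k j).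
  have [x [Cx hx]] := near2 k _ (memp k j).
  have hx2 : `|p k j - x| <= 2.
    by apply: (le_trans (ltW hx)); rewrite ler_pdivrMr ?ltr0n// ler_peMr// ler1n.
  have N0 : 0 <= N := le_trans (normr_ge0 _) (hN _ Cx).
  rewrite closed_ballP; last by lra.
  rewrite sub0r normrN -[p k j](subrK x); apply: (le_trans (ler_normD _ _)).
  by rewrite addrC; apply: lerD => //; exact: hN.
have lim j : exists q : E, p k j @[k --> U] --> q.
  have := @compact_closed_ball R n 0 (N + 2); rewrite compact_ultra => /(_ ((p ^~ j) @ U)) [||q [_ hq]].
  - exact: ultra_fmap.
  - by apply: (filterE (F := U)) => k; exact: pb.
  by exists q.
have [q hq] := choice lim.
exists [seq q i | i <- enum 'I_M]; seteq=> [x Cx|y /conv_hullP[w [w0 w1 ->]]].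
  have hw k : exists w : 'I_M -> R, [/\ forall i, 0 <= w i, \sum_i w i = 1 & `|x - \sum_i w i *: p k i| < 2 / k.+1%:R].
    by have [y [/conv_hullP[w [w0 w1 ->]] hy]] := near1 k x Cx; exists w.
  have [w hw2] := choice hw.
  have lv j : exists v : R, w k j @[k --> U] --> v /\ 0 <= v.
    have := @segment_compact R 0 1; rewrite compact_ultra => /(_ ((w ^~ j) @ U)) [||v [/= v01 hv]].
    - exact: ultra_fmap.
    - apply: (filterE (F := U)) => k; have [w0 w1 _] := hw2 k.
      by rewrite /= in_itv/= w0/= -w1 (bigD1 j)//= lerDl sumr_ge0.
    by exists v; move: v01; rewrite in_itv/= => /andP[].
  have [v hv] := choice lv.
  apply/conv_hullP; exists v; split=> [i| |]; first exact: (hv i).2.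
    have : \sum_i w k i @[k --> U] --> \sum_i v i by apply: cvg_bigsum => i; exact: (hv i).1.
    have -> : (fun k => \sum_i w k i) = fun=> 1 by apply/funext => k; have [] := hw2 k.
    by move=> h1; apply: (cvg_unique _ h1 (cvg_cst _)).
  have h1 : \sum_i w k i *: p k i @[k --> U] --> \sum_i v i *: q i.
    by apply: cvg_bigsum => i; apply: cvgZ; [exact: (hv i).1|exact: hq].
  have h0 : x - \sum_i w k i *: p k i @[k --> U] --> (0 : E) by apply: small => k; have [] := hw2 k.
  exact: (cvg_unique _ (cvg_close (cvg_cst x) h0) h1).
have h1 : \sum_i w i *: p k i @[k --> U] --> \sum_i w i *: q i.
  by apply: cvg_bigsum => i; apply: cvgZ; [exact: cvg_cst|exact: hq].
have hx k : exists x, C x /\ `|\sum_i w i *: p k i - x| < 2 / k.+1%:R.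
  by apply: near2; apply/conv_hullP; exists w.
have [x hx2] := choice hx.
have h2 := cvg_close h1 (small _ (fun k => (hx2 k).2)).
have nC : \forall k \near U, C (x k) by apply: (filterE (F := U)) => k; exact: (hx2 k).1.
exact: (@closed_cvg _ _ U PU x C (compact_closed (@norm_hausdorff _ _) cC) nC _ (h2 _)).
Unshelve. all: by end_near. Qed.

Lemma hull_nearP (C : set E) : compact C ->
  (exists s, C = conv_hull s) <-> exists M, forall k, exists bs, hull_near M k bs C.
Proof.
move=> cC; split=> [[s sE]|[M h]]; last exact: (hull_limit cC h).
exists (size s) => k; have [bs [fb hb]] := hull_near_exists k cC.
exists bs; split=> //; exists (fun i : 'I_(size s) => s`_i).
have -> // : hull (fun i : 'I_(size s) => s`_i) = C.
by rewrite /hull sE; congr conv_hull; rewrite -[RHS](mkseq_nth 0) /mkseq -val_enum_ord -map_comp.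
Qed.

Lemma meas_hull d (Om : measurableType d) (C : Om -> set E) (W : set E) :
  compact W -> rcs C -> (forall o, C o `<=` W) -> measurable [set o | exists s, C o = conv_hull s].
Proof.
move=> cW rC CW.
have cC o : compact (C o) by apply: (subclosed_compact _ cW) => //; exact: rC.1.
rewrite (_ : [set o | _] = [set o | exists M, forall k, exists bs, hull_near M k bs (C o)]); last first.
  by seteq=> o /= /(hull_nearP (cC o)).
apply: meas_ex => M; apply: meas_all => k.
apply: meas_ex => bs.
rewrite (_ : [set o | _] = [set o | (fine_balls k bs /\ exists p : 'I_M -> E, hull p `<=` \bigcup_(b in [set` bs]) qb b /\
     forall b, b \in bs -> hull p `&` qb b !=set0) /\
   (C o `&` (W `&` ~` \bigcup_(b in [set` bs]) qb b) = set0 /\ forall b, b \in bs -> C o `&` qb b !=set0)]).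
  apply: meas_and; first exact: meas_Prop.
  apply: meas_and.
    apply: rC.2; apply: compact_closedI => //; apply: open_closedC.
    by apply: bigcup_open => b _; exact: open_qball.
  apply: meas_all => b; apply: meas_imp => _.
  by apply: (rcs_hit rC); exact: open_qball.
seteq=> o /=.
  move=> [fb [p [h1 h2 h3]]]; split; last first.
    split; last by move=> b /h3[].
    by seteq=> // x [Cx [_ nx]]; apply: nx; exact: h1.
  by split=> //; exists p; split=> // b /h3[].
move=> [[fb [p [h2 h3]]] [h1 h4]]; split=> //; exists p; split=> //.
  move=> x Cx; apply: contrapT => nx.
  have : (C o `&` (W `&` ~` \bigcup_(b in [set` bs]) qb b)) x by split; [|split; [exact: (CW o)|]].
  by rewrite h1.
by move=> b bs_b; split; [exact: h4|exact: h3].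
Qed.
End approximating_polytopes.

(** * Binary codes of tessellations *)

Section encoding.
Context {R : realType} {n : nat}.
Local Notation E := 'rV[R]_n.
Local Notation Q := ('rV[rat]_n * rat)%type.
Local Notation qb := (@qball R n).
Variable W : window R n.
Local Notation TW := (tess (tessellable_window W)).
Let cW : compact (wset W) := polytope_compact (wset_polytope W).

(* A tessellation is encoded by the pairs of balls hit by a common cell. *)
Definition hit_pair (T : set (set E)) (p : Q * Q) := exists C, [/\ T C, C `&` qb p.1 !=set0 & C `&` qb p.2 !=set0].

Definition encode_tess (T : TW) : zseq bool := fun m =>
  if (choice.unpickle (absz m) : option (Q * Q)) is Some p then `[< hit_pair (sval T) p >] else false.

Definition entry (z : zseq bool) (p : Q * Q) : bool := z (Posz (choice.pickle p)).

Lemma entry_encode T p : entry (encode_tess T) p = `[< hit_pair (sval T) p >].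
Proof. by rewrite /entry /encode_tess /= choice.pickleK. Qed.

Lemma meas_hit_pair p : measurable [set T : TW | hit_pair (sval T) p].
Proof.
pose t : seq (seq (set E) * set E) := [:: ([:: qb p.1; qb p.2], set0)].
have gt : good t.
  move=> [|//] _ /=; split=> //; last exact: compact0.
  by move=> [|[|]]//= _; exact: open_qball.
have := meas_not (@meas_tests_ev R n (tessellable_window W) t gt); congr measurable.
seteq=> T.
  move=> /existsNP[C /not_implyP[TC /existsNP[[|j] /not_implyP[//= _ /contrapT [h _]]]]].
  by exists C; split=> //; [exact: (h 0%N)|exact: (h 1%N)].
move=> [C [TC h1 h2]] /(_ C TC 0%N isT); apply; split=> /=; last by rewrite setI0.
by move=> [|[|]].
Qed.

Lemma meas_encode_tess : mfunT encode_tess.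
Proof.
apply: (measurability (@zcylinder _ bool)) => // _ [_ [m [B [mB ->]]] <-]; rewrite setTI.
rewrite (_ : _ @^-1` _ = [set T | B (encode_tess T m)])//; rewrite /encode_tess.
case: choice.unpickle => [p|]; last meas.
rewrite (_ : [set T | _] = [set T : TW | (hit_pair (sval T) p /\ B true) \/ (~ hit_pair (sval T) p /\ B false)]).
  by have m1 := meas_hit_pair p; meas.
seteq=> T /=; have [h|h] := pselect (hit_pair (sval T) p).
- by rewrite asboolT// => ?; left.
- by rewrite asboolF// => ?; right.
- by rewrite asboolT// => -[[]|[]].
- by rewrite asboolF// => -[[]|[]].
Qed.

(** If the ball [b] lies inside a cell, this is that cell: its points are those all of whose
    rational neighbourhoods are recorded together with [b]. *)
Definition decoded_cell (b : Q) (z : zseq bool) : set E :=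
  [set x | wset W x /\ forall p : Q, 0 < p.2 -> qb p x -> entry z (p, b)].

Lemma decoded_cellE b z : decoded_cell b z =
  wset W `&` ~` \bigcup_(p in [set p : Q | 0 < p.2 /\ ~ entry z (p, b)]) qb p.
Proof.
seteq=> x [Wx h]; split=> //; first by move=> [p [p0 np] px]; apply: np; exact: h.
by move=> p p0 px; apply: contrapT => np; apply: h; exists p.
Qed.

Lemma meas_entry p : measurable [set z | entry z p].
Proof. by apply: sub_sigma_algebra; exists (Posz (choice.pickle p)), [set true]. Qed.

Lemma rcs_decoded_cell b : rcs (decoded_cell b).
Proof.
split=> [z|K cK].
  rewrite decoded_cellE; apply: closedI; first exact: (polytope_closed (wset_polytope W)).
  by apply: open_closedC; apply: bigcup_open => p _; exact: open_qball.
rewrite (_ : [set z | _] = [set z | exists s : seq Q, (wset W `&` K `<=` \bigcup_(p in [set` s]) qb p) /\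
    forall p, p \in s -> 0 < p.2 /\ ~ entry z (p, b)]).
  apply: meas_ex => s; apply: meas_and; first meas.
  apply: meas_all => p; apply: meas_imp => _.
  exact: meas_and (meas_Prop _) (meas_not (meas_entry _)).
have cWK : compact (wset W `&` K).
  by apply: compact_closedI => //; apply: compact_closed => //; exact: norm_hausdorff.
seteq=> z /=.
  rewrite decoded_cellE => e.
  have cov x : (wset W `&` K) x -> exists p, [set p : Q | 0 < p.2 /\ ~ entry z (p, b)] p /\ qb p x.
    move=> [Wx Kx]; apply: contrapT => nx.
    have : ((wset W `&` ~` (\bigcup_(p in [set p : Q | 0 < p.2 /\ ~ entry z (p, b)]) qb p)) `&` K) x.
      by split=> //; split=> // -[p hp px]; apply: nx; exists p.
    by rewrite e.
  have [s [hs sc]] := compact_finite_cover cWK (fun p _ => @open_qball R n p : open (qb p)) cov.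
  by exists s.
move=> [s [cov hs]]; seteq=> // x [[Wx h] Kx].
have [p ps px] := cov x (conj Wx Kx); have [p0 np] := hs p ps; apply: np; exact: h.
Qed.

#[local] Hint Resolve meas_entry : meas.

Lemma qball_center (p : Q) : 0 < p.2 -> qb p (rpt p.1).
Proof. by move=> p0; apply: ballxx; rewrite ltr0q. Qed.

Definition inside (p : Q) (C : set E) := 0 < p.2 /\ forall q, qb p (rpt q) -> C (rpt q).

Lemma insideP p C : closed C -> inside p C <-> 0 < p.2 /\ qb p `<=` C.
Proof.
move=> cC; split=> -[p0 h]; split=> //; last by move=> q /h.
move=> x px; rewrite closure_id in cC; rewrite cC => B nB.
have /nbhs_ballP[e /= e0 he] : nbhs x (B `&` qb p).
  by apply: filterI => //; apply: open_nbhs_nbhs; split=> //; exact: open_qball.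
have [q hq] := rpt_dense x e0.
have [|Bq pq] := he (rpt q); first by rewrite -ball_normE/= distrC.
by exists (rpt q); split=> //; exact: h.
Qed.

Lemma inside_interior (C : set E) : C° !=set0 -> exists p, [/\ 0 < p.2, qb p `<=` C & qb p (rpt p.1)].
Proof.
move=> [x Cx]; have [p [p0 px pC]] := qball_base (open_interior C) Cx.
exists p; split=> //; last exact: qball_center.
by move=> y /sub_qcball/pC/interior_subset.
Qed.

Local Notation dc s z j := (decoded_cell (nth 0 s j) z).

(** Countably many measurable conditions ensuring that the decoded sets form a tessellation recorded
    by [z]: polytopes, no common rational ball inside two of them, all rational points of [W]
    covered, and the right hit pairs. *)
Definition valid_code (s : seq Q) (z : zseq bool) :=
  (forall j, (j < size s)%N -> (exists r, dc s z j = conv_hull r) /\ exists p, inside p (dc s z j)) /\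
  (forall i j, (i < j < size s)%N -> forall p, ~ (inside p (dc s z i) /\ inside p (dc s z j))) /\
  (forall q, wset W (rpt q) -> exists j, (j < size s)%N /\ dc s z j (rpt q)) /\
  forall p, entry z p <-> exists j, [/\ (j < size s)%N, dc s z j `&` qb p.1 !=set0 & dc s z j `&` qb p.2 !=set0].

Lemma meas_valid s : measurable [set z | valid_code s z].
Proof.
have rC := rcs_decoded_cell; apply: meas_and.
  apply: meas_all => j; apply: meas_imp => _; apply: meas_and; last meas.
  by apply: (meas_hull cW (rC _)) => z x [].
apply: meas_and; first by do 2 apply: meas_all => ?; meas.
apply: meas_and; first meas.
by apply: meas_all => p; meas.
Qed.

Definition decoded_cells s z := [set dc s z j | j in [set j | (j < size s)%N]].

Lemma closed_decoded b z : closed (decoded_cell b z).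
Proof. exact: (rcs_decoded_cell b).1. Qed.

Lemma decoded_tessellation s z : valid_code s z -> tessellation (wset W) (decoded_cells s z).
Proof.
move=> [hP [hD [hU _]]].
have fin : finite_set (decoded_cells s z) by apply: finite_image; exact: finite_II.
split.
- exact: finite_set_countable.
- by move=> K _; apply: sub_finite_set fin => C [].
- move=> _ [j js <-]; have [[r rE] [p /(insideP _ (@closed_decoded _ _))[p0 pC]]] := hP j js.
  split; first by exists r.
  exists (rpt p.1); rewrite /interior; apply: filterS pC _; apply: open_nbhs_nbhs; split; first exact: open_qball.
  exact: qball_center.
- move=> _ _ [i si <-] [j js <-] ne; seteq=> // x [Cx Dx].
  have oI : open ((dc s z i)° `&` (dc s z j)°) by apply: openI; exact: open_interior.
  have [p [p0 px pI]] := qball_base oI (conj Cx Dx).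
  have pi : inside p (dc s z i) by split=> // q /sub_qcball/pI[/interior_subset].
  have pj : inside p (dc s z j) by split=> // q /sub_qcball/pI[_ /interior_subset].
  have [ij|ji|ij] := ltngtP i j; last by apply: ne; rewrite ij.
    by apply: (hD i j _ p); rewrite ?ij.
  by apply: (hD j i _ p); rewrite ?ji.
- seteq=> [x [_ [j _ <-]] []//|x Wx]; apply: contrapT => nx.
  have cU : closed (\bigcup_(C in decoded_cells s z) C).
    by apply: closed_bigcup => // _ [j _ <-]; exact: closed_decoded.
  have nU := open_nbhs_nbhs (conj (closed_openC cU) nx).
  have [y [Wy ny]] := cvx_closure_interior (polytope_cvx (wset_polytope W)) (wset_polytope W).2 Wx nU.
  have [p [p0 py pI]] := qball_base (openI (open_interior (wset W)) (closed_openC cU)) (conj Wy ny).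
  have pp : qb p (rpt p.1) by exact: qball_center.
  have [/interior_subset Wp nUp] := pI _ (sub_qcball pp).
  have [j [js Cj]] := hU _ Wp; apply: nUp; exists (dc s z j) => //; exists j => //.
Qed.

Lemma entry_valid s z p : valid_code s z -> entry z p <-> hit_pair (decoded_cells s z) p.
Proof.
move=> [_ [_ [_ h]]]; rewrite h; split=> [[j [js h1 h2]]|[_ [[j js <-] h1 h2]]]; last by exists j.
by exists (dc s z j); split=> //; exists j.
Qed.

Lemma ball_cell T C D i : tessellation (wset W) T -> T C -> T D -> qb i `<=` C -> D `&` qb i !=set0 -> D = C.
Proof.
move=> [_ _ pT dT _] TC TD iC [x [Dx ix]]; apply: contrapT => ne.
have [y [Dy iy]] := cvx_closure_interior (polytope_cvx (pT D TD)) (pT D TD).2 Dx (open_nbhs_nbhs (conj (@open_qball R n i) ix)).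
have : (D° `&` C°) y.
  by split=> //; apply: filterS iC _; exact: open_nbhs_nbhs (conj (@open_qball R n i) iy).
by rewrite dT.
Qed.

Lemma cell_recover T z C i : tessellation (wset W) T -> (forall p, entry z p <-> hit_pair T p) -> T C ->
  0 < i.2 -> qb i `<=` C -> decoded_cell i z = C.
Proof.
move=> tT hz TC i0 iC; have [_ _ pT _ UT] := tT.
have ii : qb i (rpt i.1) by exact: qball_center.
seteq=> x.
  move=> [Wx h]; apply: (polytope_closed (pT C TC)) => B nB.
  have [p [p0 px pB]] := qball_base (open_interior B) nB.
  have /hz[D [TD [y [Dy py]] hi]] := h p p0 px.
  rewrite (ball_cell tT TC TD iC hi) in Dy; exists y; split=> //; apply: interior_subset; apply: pB; exact: sub_qcball.
move=> Cx; split; first by rewrite -UT; exists C.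
by move=> p p0 px; apply/hz; exists C; split=> //; [exists x|exists (rpt i.1); split=> //; exact: iC].
Qed.

(** A small ball inside both a cell of [T] and a cell of [T'] decodes to each of them from the
    common record, so the two cells are equal. *)
Lemma hit_pair_sub T T' : tessellation (wset W) T -> tessellation (wset W) T' ->
  (forall p, hit_pair T p <-> hit_pair T' p) -> T `<=` T'.
Proof.
move=> tT tT' h C TC; have [_ _ pT _ UT] := tT; have [_ _ pT' _ UT'] := tT'.
pose z : zseq bool := fun m => if (choice.unpickle (absz m) : option (Q * Q)) is Some p then `[< hit_pair T p >] else false.
have hz p : entry z p <-> hit_pair T p by rewrite /entry /z /= choice.pickleK; split=> /asboolP.
have [i [i0 iC ii]] := inside_interior (pT C TC).2.
have [D T'D Di] : exists2 D, T' D & D (rpt i.1).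
  have : wset W (rpt i.1) by rewrite -UT; exists C => //; exact: iC.
  by rewrite -UT' => -[D T'D Dx]; exists D.
have [y [Dy iy]] := cvx_closure_interior (polytope_cvx (pT' D T'D)) (pT' D T'D).2 Di (open_nbhs_nbhs (conj (@open_qball R n i) ii)).
have [k [k0 ky kI]] := qball_base (openI (open_interior D) (@open_qball R n i)) (conj Dy iy).
have kD : qb k `<=` D by move=> x /sub_qcball/kI[/interior_subset].
have kC : qb k `<=` C by move=> x /sub_qcball/kI[_ /iC].
rewrite -(cell_recover tT hz TC k0 kC) (cell_recover tT' _ T'D k0 kD)//.
by move=> p; rewrite hz h.
Qed.

Lemma hit_pair_eq T T' : tessellation (wset W) T -> tessellation (wset W) T' ->
  (forall p, hit_pair T p <-> hit_pair T' p) -> T = T'.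
Proof.
move=> tT tT' h; seteq; first exact: (hit_pair_sub tT tT' h).
exact: (hit_pair_sub tT' tT (fun p => iff_sym (h p))).
Qed.

Lemma valid_unique s s' z : valid_code s z -> valid_code s' z -> decoded_cells s z = decoded_cells s' z.
Proof.
move=> vs vs'; apply: (hit_pair_eq (decoded_tessellation vs) (decoded_tessellation vs')) => p.
exact: (iff_trans (iff_sym (entry_valid p vs)) (entry_valid p vs')).
Qed.

Lemma valid_encode (T : TW) : exists s, valid_code s (encode_tess T).
Proof.
have tT : tessellation (wset W) (sval T) := svalP T; have [_ _ pT dT UT] := tT.
have hz p : entry (encode_tess T) p <-> hit_pair (sval T) p by rewrite entry_encode; split=> /asboolP.
have ex C : exists i : Q, sval T C -> 0 < i.2 /\ qb i `<=` C.
  have [TC|nT] := pselect (sval T C); last by exists 0.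
  by have [i [i0 iC _]] := inside_interior (pT C TC).2; exists i.
have [f hf] := choice ex.
have [s0 s0E] := (finite_seqP _).1 (tessellation_finite cW tT).
pose s1 := undup s0; pose s := map f s1; exists s.
have s1T C : C \in s1 <-> sval T C by rewrite mem_undup s0E.
have szs : size s = size s1 by rewrite size_map.
have rec j : (j < size s1)%N -> decoded_cell (nth 0 s j) (encode_tess T) = nth set0 s1 j /\ sval T (nth set0 s1 j).
  move=> js; have TC : sval T (nth set0 s1 j) by apply/s1T; exact: mem_nth.
  by have [f0 fC] := hf _ TC; rewrite (nth_map set0)//; split=> //; exact: (cell_recover tT hz TC f0 fC).
have idx C : sval T C -> exists j, (j < size s1)%N /\ nth set0 s1 j = C.
  by move=> /s1T Cs; exists (index C s1); rewrite index_mem nth_index.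
rewrite /valid_code szs; split; [|split; [|split]].
- move=> j js; have [-> TC] := rec j js; have [[r rE] ri] := pT _ TC; split; first by exists r.
  have [i [i0 iC _]] := inside_interior ri; exists i.
  by apply/(insideP _ (polytope_closed (pT _ TC))).
- move=> i j /andP[ij js] p; have [-> TC] := rec j js; have [-> TD] := rec i (ltn_trans ij js).
  move=> [/(insideP _ (polytope_closed (pT _ TD)))[p0 pD] /(insideP _ (polytope_closed (pT _ TC)))[_ pC]].
  have pp : qb p (rpt p.1) by exact: qball_center.
  have e : nth set0 s1 i = nth set0 s1 j by apply: (ball_cell tT TC TD pC); exists (rpt p.1); split=> //; exact: pD.
  have := nth_uniq set0 (ltn_trans ij js) js (undup_uniq s0 : uniq s1).
  by rewrite e eqxx => /esym/eqP ijE; lia.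
- move=> q; rewrite -UT => -[C TC Cq]; have [j [js jE]] := idx C TC; exists j; split=> //.
  by rewrite (rec j js).1 jE.
- move=> p; rewrite hz; split=> [[C [TC h1 h2]]|[j [js h1 h2]]].
    by have [j [js jE]] := idx C TC; exists j; rewrite (rec j js).1 jE.
  by exists (nth set0 s1 j); rewrite -(rec j js).1; split=> //; rewrite (rec j js).1; exact: (rec j js).2.
Qed.

Definition decode_tess (z : zseq bool) : TW :=
  match pselect (exists s, valid_code s z) with
  | left ex => tess_of (D := tessellable_window W) (decoded_tessellation (svalP (cid ex)))
  | right _ => point
  end.

Lemma decode_valid s z : valid_code s z -> sval (decode_tess z) = decoded_cells s z.
Proof.
move=> vs; rewrite /decode_tess; case: pselect => [ex|[]]; last by exists s.
exact: (valid_unique (svalP (cid ex)) vs).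
Qed.

Lemma encode_tessK T : decode_tess (encode_tess T) = T.
Proof.
apply: sval_injective; have [s vs] := valid_encode T; rewrite (decode_valid vs).
apply: (hit_pair_eq (decoded_tessellation vs) (svalP T)) => p; apply: (iff_trans (iff_sym (entry_valid p vs))).
by rewrite entry_encode; split=> /asboolP.
Qed.

Lemma meas_decode_tess : mfunT decode_tess.
Proof.
apply: (measurability (@tests_class R n (tessellable_window W))); first exact: meas_testsE.
move=> _ [_ [t gt <-] <-]; rewrite setTI.
rewrite (_ : _ @^-1` _ = [set z | exists s, valid_code s z /\ forall j, (j < size s)%N -> passes t (dc s z j)] `|`
  [set z | ~ (exists s, valid_code s z) /\ tests_ev t (point : TW)]).
  apply: measurableU.
    apply: meas_ex => s; apply: meas_and; first exact: meas_valid.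
    apply: meas_all => j; apply: meas_imp => _.
    exact: (meas_passes (rcs_decoded_cell _) gt).
  exact: meas_and (meas_not (meas_ex meas_valid)) (meas_Prop _).
seteq=> z.
  rewrite /preimage /= => h; have [[s vs]|nv] := pselect (exists s, valid_code s z).
    left; exists s; split=> // j js; apply: h; rewrite (decode_valid vs); by exists j.
  by right; split=> //; move: h; rewrite /decode_tess; case: pselect.
move=> [[s [vs h]]|[nv h]]; rewrite /preimage /=.
  by move=> C; rewrite (decode_valid vs) => -[j js <-]; exact: h.
by rewrite /decode_tess; case: pselect.
Qed.

Lemma meas_tess1 (T : TW) : measurable [set T].
Proof.
rewrite (_ : [set T] = [set T' : TW | forall p, hit_pair (sval T') p <-> hit_pair (sval T) p]).
  by apply: meas_all => p; have mh := meas_hit_pair p; meas.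
seteq=> [_ -> //|T' h /=]; apply: sval_injective.
exact: (hit_pair_eq (svalP T') (svalP T) h).
Qed.
End encoding.

Section sigma_finite_alias.
Context d (S : measurableType d) (R : realType) (m : {measure set S -> \bar R}).
Hypothesis h : sigma_finite [set: S] m.
(** Turns a proof of sigma-finiteness into the structure that Fubini's theorem asks for, without
    changing the measure. *)
Definition sfinite_alias (_ : sigma_finite [set: S] m) : set S -> \bar R := m.
HB.instance Definition _ := Measure.copy (sfinite_alias h) m.
HB.instance Definition _ := Measure_isSigmaFinite.Build d S R (sfinite_alias h) h.
Definition sfinite_copy : {sigma_finite_measure set S -> \bar R} := [the {sigma_finite_measure set S -> \bar R} of sfinite_alias h].
End sigma_finite_alias.

(** * Dilated windows and hyperplanes that miss them *)

Section windows_geometry.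
Context {R : realType} {n : nat}.
Local Notation E := 'rV[R]_n.
Implicit Types W : window R n.

Lemma dilate_polytope (c : R) (C : set E) : c != 0 -> polytope C -> polytope (dilate c C).
Proof.
move=> c0 [[s ->] [x Cx]]; split; first by exists (map (GRing.scale c) s); rewrite -conv_hull_lin.
exists (c *: x); rewrite /interior; apply: (@filterS _ _ _ (dilate c (conv_hull s)°)).
  by move=> _ [y /interior_subset Cy <-]; exists y.
by apply: open_nbhs_nbhs; split; [apply: open_dilate => //; exact: open_interior|exists x].
Qed.

Lemma dilate_comp (c c' : R) (C : set E) : dilate c (dilate c' C) = dilate (c * c') C.
Proof.
seteq=> [_ [_ [x Cx <-] <-]|_ [x Cx <-]]; first by exists x; rewrite ?scalerA.
by exists (c' *: x); [exists x|rewrite scalerA].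
Qed.

Lemma dilate1 (C : set E) : dilate 1 C = C.
Proof. by seteq=> [_ [x Cx <-]|x Cx]; [rewrite scale1r|exists x; rewrite ?scale1r]. Qed.

Lemma dilate_interior (c : R) (C : set E) : c != 0 -> dilate c C° `<=` (dilate c C)°.
Proof.
move=> c0 x Cx; rewrite /interior; apply: (@filterS _ _ _ (dilate c C°)).
  by move=> _ [y /interior_subset Cy <-]; exists y.
by apply: open_nbhs_nbhs; split=> //; apply: open_dilate => //; exact: open_interior.
Qed.

Definition dilated (c : R) W (c0 : c != 0) : window R n := Window (dilate_polytope c0 (wset_polytope W)).

Lemma ex_stretch W (lo hi : R) : 0 < lo -> lo <= hi -> exists V : window R n,
  (forall c, lo <= c <= hi -> dilate c W `<=` V) /\
  (forall K : set E, cvx K -> dilate lo W `<=` K -> dilate hi W `<=` K -> wset V `<=` K).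
Proof.
move=> lo0 lohi; have hi0 := lt_le_trans lo0 lohi.
have [[s sE] _] := wset_polytope W.
pose r := map (GRing.scale lo) s ++ map (GRing.scale hi) s.
have loS : dilate lo W `<=` conv_hull r.
  rewrite /dilate sE -[X in X `<=` _]/(GRing.scale lo @` _) conv_hull_lin.
  by apply: conv_hull_min => [|x xs]; [exact: conv_hull_cvx|apply: conv_hull_mem; rewrite mem_cat xs].
have hiS : dilate hi W `<=` conv_hull r.
  rewrite /dilate sE -[X in X `<=` _]/(GRing.scale hi @` _) conv_hull_lin.
  by apply: conv_hull_min => [|x xs]; [exact: conv_hull_cvx|apply: conv_hull_mem; rewrite mem_cat xs orbT].
have pr : polytope (conv_hull r).
  split; first by exists r.
  have [_ [x lx]] := dilate_polytope (lt0r_neq0 lo0) (wset_polytope W).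
  by exists x; exact: (filterS loS).
exists (Window pr); split=> [c /andP[lc ch] _ [w Ww <-]|K vK Klo Khi].
  move: lc; rewrite le_eqVlt => /orP[/eqP <-|lc]; first by apply: loS; exists w.
  have d0 : 0 < hi - lo by rewrite subr_gt0 (lt_le_trans lc).
  pose t := (hi - c) / (hi - lo).
  have -> : c *: w = t *: (lo *: w) + (1 - t) *: (hi *: w).
    rewrite !scalerA -scalerDl; congr (_ *: _); rewrite /t; field; exact: lt0r_neq0.
  apply: conv_hull_cvx.
  - apply/andP; split; first by rewrite divr_ge0 ?subr_ge0// ltW.
    by rewrite ler_pdivrMr// mul1r lerD2l lerN2 ltW.
  - by apply: loS; exists w.
  - by apply: hiS; exists w.
apply: conv_hull_min => // x; rewrite mem_cat => /orP[] /mapP[w ws ->].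
  by apply: Klo; exists w => //; rewrite sE; exact: conv_hull_mem.
by apply: Khi; exists w => //; rewrite sE; exact: conv_hull_mem.
Qed.
End windows_geometry.

Section separation.
Context {R : realType} {l : nat}.
Local Notation E := 'rV[R]_l.+1.
Local Notation H := (hyperplane R l).

Lemma cvx_below (u : E) (c : R) : cvx [set x | dot u x < c].
Proof.
move=> x y t /andP[t0 t1] /= xc yc; rewrite dotD !dotZ.
have [->|tn] := eqVneq t 0; first by rewrite mul0r add0r subr0 mul1r.
have tp : 0 < t by rewrite lt_neqAle eq_sym tn.
have h1 : t * dot u x < t * c by rewrite ltr_pM2l.
have h2 : (1 - t) * dot u y <= (1 - t) * c by rewrite ler_wpM2l ?subr_ge0// ltW.
have := ltr_leD h1 h2; by have -> : t * c + (1 - t) * c = c by ring.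
Qed.

Lemma one_sided (h : H) (C : set E) : cvx C -> C !=set0 -> ~ hitting C h ->
  exists u c, sval h = [set x | dot u x = c] /\ C `<=` [set x | dot u x < c].
Proof.
move=> vC [x0 Cx0] nh; have [u [c [_ hE]]] := hyperplaneP h.
have hE' : sval h = [set x | dot (- u) x = - c].
  rewrite hE; seteq=> x /=; rewrite -scaleN1r dotZl mulN1r; first by move=> ->.
  exact: oppr_inj.
have ne x : C x -> dot u x != c by move=> Cx; apply/eqP => e; apply: nh; exists x; rewrite hE.
have key x y : C x -> C y -> dot u x < c -> c < dot u y -> False.
  move=> Cx Cy xc yc; apply: nh.
  have d0 : 0 < dot u y - dot u x by rewrite subr_gt0 (lt_trans xc).
  pose t := (dot u y - c) / (dot u y - dot u x).
  exists (t *: x + (1 - t) *: y); split.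
    rewrite hE /= dotD !dotZ /t; field; exact: lt0r_neq0.
  apply: vC => //; apply/andP; split; first by apply: divr_ge0; apply: ltW => //; rewrite subr_gt0.
  by rewrite ler_pdivrMr// mul1r lerD2l lerN2 ltW.
have := ne x0 Cx0; rewrite neq_lt => /orP[l0|l0].
  exists u, c; split=> // y Cy /=; have := ne y Cy; rewrite neq_lt => /orP[//|yc].
  by case: (key x0 y).
exists (- u), (- c); split=> // y Cy /=; rewrite -scaleN1r dotZl mulN1r ltrN2.
by have := ne y Cy; rewrite neq_lt => /orP[yc|//]; case: (key y x0).
Qed.

(** Below a level [c <= 0] the linear form is negative, and enlarging the dilate lowers it further.
    Below a level [c > 0] shrinking the dilate moves positive values down and keeps the others
    nonpositive. *)
Lemma below_dilate (C : set E) (c0 c1 : R) u c : 0 < c0 -> 0 < c1 ->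
  dilate c0 C `<=` [set x | dot u x < c] -> (if c <= 0 then c0 <= c1 else c1 <= c0) ->
  dilate c1 C `<=` [set x | dot u x < c].
Proof.
move=> p0 p1 h ord _ [w Cw <-] /=.
have /= := h (c0 *: w) (ex_intro2 _ _ w Cw erefl); rewrite !dotZ => h0.
have r : c1 * dot u w = c1 / c0 * (c0 * dot u w) by rewrite mulrA divfK// gt_eqF.
move: ord; case: (leP c 0) => cl ord.
  have v0 : c0 * dot u w < 0 by exact: lt_le_trans h0 cl.
  apply: le_lt_trans h0; rewrite r -[leRHS]mul1r.
  by apply: ler_wnM2r; [exact: ltW|rewrite ler_pdivlMr// mul1r].
have [v0|v0] := leP 0 (c0 * dot u w); last first.
  by apply: lt_trans cl; rewrite r nmulr_llt0// divr_gt0.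
apply: le_lt_trans h0; rewrite r -[leRHS]mul1r ler_wpM2r//.
by rewrite ler_pdivrMr// mul1r.
Qed.

Lemma stretch_separated (W : window R l.+1) (lo c0 hi : R) (LL RR : set E) (h : H) :
  0 < lo -> lo <= c0 -> c0 <= hi ->
  (forall K : set E, cvx K -> dilate c0 W `<=` K -> dilate hi W `<=` K -> LL `<=` K) ->
  (forall K : set E, cvx K -> dilate lo W `<=` K -> dilate c0 W `<=` K -> RR `<=` K) ->
  ~ hitting (dilate c0 W) h -> ~ hitting LL h \/ ~ hitting RR h.
Proof.
move=> lo0 lc ch hL hR nh; have c00 := lt_le_trans lo0 lc; have hi0 := lt_le_trans c00 ch.
have pW := dilate_polytope (lt0r_neq0 c00) (wset_polytope W).
have [x /interior_subset Cx] := pW.2.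
have [u [c [hE hC]]] := one_sided (polytope_cvx pW) (ex_intro _ x Cx) nh.
have miss K : K `<=` [set x | dot u x < c] -> ~ hitting K h.
  by move=> hK [y []]; rewrite hE /= => ye /hK /=; rewrite ye ltxx.
have [cl|cl] := boolP (c <= 0); [left|right]; apply: miss.
  by apply: hL => //; [exact: cvx_below|apply: (below_dilate c00 hi0 hC); rewrite cl].
by apply: hR => //; [exact: cvx_below|apply: (below_dilate c00 lo0 hC); rewrite (negbTE cl)].
Qed.
End separation.

(** * Tests that a window can see *)

Section observed_tests.
Context {R : realType} {l : nat}.
Local Notation E := 'rV[R]_l.+1.
Local Notation TT := (tess (@whole_space R l.+1)).

(** Measurability is asked twice: along random closed sets, for the functional of cells, and as an
    event of tessellations, for the process. *)
Definition obs_test (psi : set E -> Prop) := testp psi /\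
  forall D : @tessellable R l.+1, measurable [set T : tess D | forall C, sval T C -> psi C].

(* Over a tessellation of the whole space, such a test can be read off its trace in [V]. *)
Definition seen (V : set E) (psi : set E -> Prop) :=
  (forall C, psi (C `&` V) <-> psi C) /\ forall C, polytope C -> (C `&` V)° = set0 -> psi C.

Lemma seen_sub (V U : set E) psi : V `<=` U -> seen V psi -> seen U psi.
Proof.
move=> VU [h h']; split=> [C|C pC CU]; first by rewrite -h -setIA (setIidr VU) h.
by apply: h' => //; rewrite -subset0 -CU; apply: interiorS; exact: setIS.
Qed.

Lemma wedge_seen (V : window R l.+1) psi (T : TT) : seen V psi ->
  (forall D, sval (wedge V T) D -> psi D) <-> (forall C, sval T C -> psi C).
Proof.
move=> [h1 h2]; split=> h.
  move=> C TC; have [n0|nn] := pselect ((C `&` V)° !=set0).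
    by apply/h1; apply: h; exists C.
  apply: h2; first exact: (tess_cell TC).1.
  by seteq=> x // Cx; apply: nn; exists x.
by move=> _ [C [TC _] <-]; apply/h1; exact: h.
Qed.

Lemma meets_interior (C M : set E) : polytope C -> C `&` M° !=set0 -> (C `&` M)° !=set0.
Proof.
move=> pC [x [Cx Mx]].
have [y [Cy My]] := cvx_closure_interior (polytope_cvx pC) pC.2 Cx (open_nbhs_nbhs (conj (open_interior M) Mx)).
by exists y; rewrite interiorI.
Qed.

(** A countable conjunction of hit-or-miss tests: no cell hits a rational ball contained in [M] and
    misses a rational point of the interior of [M]. Density of rational points and closedness of
    cells give the rest. *)
Lemma obs_untouched (M : window R l.+1) : obs_test (untouched M).
Proof.
have pM := wset_polytope M.
split=> [|D]; first exact: (testp_untouched (polytope_cvx pM) pM.2).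
pose t (p : 'rV[rat]_l.+1 * rat) q : seq (seq (set E) * set E) := [:: ([:: @qball R l.+1 p], [set rpt q])].
rewrite (_ : [set T | _] = [set T : tess D | forall p q, @qball R l.+1 p `<=` M -> (M° : set E) (rpt q) -> tests_ev (t p q) T]).
  apply: meas_all => p; apply: meas_all => q.
  apply: meas_imp => _; apply: meas_imp => _; apply: meas_tests_ev.
  by move=> [|//] _; split=> //; [move=> [|//] _; exact: open_qball|exact: compact_set1].
seteq=> T h.
  move=> p q pM' Mq C TC [|//] _ [/(_ 0%N isT) [x [Cx px]] e].
  have Cq : C (rpt q).
    apply: (h C TC); last exact: interior_subset.
    exists x; split=> //; rewrite /interior; apply: filterS pM' _.
    exact: open_nbhs_nbhs (conj (@open_qball R l.+1 p) px).
  by have : (C `&` [set rpt q]) (rpt q) by []; rewrite e.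
move=> C TC [x [Cx Mx]]; have [p [p0 px pI]] := qball_base (open_interior M) Mx.
have sM : @qball R l.+1 p `<=` M by move=> y /sub_qcball/pI/interior_subset.
have hq q : (M° : set E) (rpt q) -> C (rpt q).
  move=> Mq; apply: contrapT => nC; apply: (h p q sM Mq C TC 0%N isT); split=> /=.
    by move=> [|//] _; exists x.
  by seteq=> y // [Cy ye]; apply: nC; rewrite -ye.
have clC := (closure_id C).1 (polytope_closed (tess_cell TC).1).
have sub : M° `<=` C.
  move=> y My; rewrite clC => U nU.
  have /nbhs_ballP[e/= e0 be] : nbhs y ((M° : set E) `&` U).
    by apply: filterI => //; apply: open_nbhs_nbhs; split=> //; exact: open_interior.
  have [q hq'] := rpt_dense y e0.
  have [|Mq Uq] := be (rpt q); first by rewrite -ball_normE/= distrC.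
  by exists (rpt q); split=> //; exact: hq.
move=> y /(cvx_closure_interior (polytope_cvx pM) pM.2) My; rewrite clC => U nU.
by have [z [/sub Cz Uz]] := My U nU; exists z.
Qed.

Lemma seen_untouched (V M : set E) : M `<=` V -> seen V (untouched M).
Proof.
move=> MV; split=> [C|C pC e].
  split=> h [x [Cx Mx]].
    have Vx : V x by apply: MV; exact: interior_subset.
    by have := h (ex_intro _ x (conj (conj Cx Vx) Mx)) => MC y /MC[].
  by case: Cx => Cx _ y My; split; [apply: h My; exists x|exact: MV].
move=> CM; have [x xI] := meets_interior pC CM.
suff : (C `&` V)° x by rewrite e.
by apply: filterS xI => y [Cy /MV Vy].
Qed.

(* The test [t] on the cells of the trace in [W] of the tessellation dilated by [c]. *)
Definition traced (W : set E) (c : R) t (C : set E) : Prop := passes (trace_test W t) (dilate c C).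

Lemma obs_traced (W : window R l.+1) c t : c != 0 -> good t -> obs_test (traced W c t).
Proof.
move=> c0 gt; have gt' := good_dilate c0 (good_trace (polytope_compact (wset_polytope W)) gt).
rewrite (_ : traced W c t = passes (dilate_test c (trace_test W t))); last first.
  by apply/funext => C; apply/propext; apply: iff_sym; exact: passes_dilate.
split; first by split; [exact: passes0|move=> d Om C rC; exact: meas_passes].
by move=> D; exact: meas_tests_ev.
Qed.

Lemma seen_traced (W : window R l.+1) (V : set E) c t : c != 0 -> good t -> dilate c^-1 W `<=` V ->
  seen V (traced W c t).
Proof.
move=> c0 gt WV; have loc : local V (dilate_test c (trace_test W t)).
  by apply: local_sub WV _; apply: local_dilate => //; exact: local_trace.
split=> [C|C pC e].
  rewrite /traced -!(passes_dilate _ _ c0); exact: passes_local.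
apply/(passes_trace (wset_polytope W) (dilate_polytope c0 pC) gt) => -[x xI]; exfalso.
have cI : (dilate c^-1 (dilate c C `&` W))° (c^-1 *: x).
  by apply: dilate_interior; [rewrite invr_eq0|exists x].
suff : (C `&` V)° (c^-1 *: x) by rewrite e.
apply: filterS cI => _ [y [[z Cz <-] Wz] <-]; rewrite scalerA mulVf// scale1r; split=> //.
by apply: WV; exists (c *: z) => //; rewrite scalerA mulVf// scale1r.
Qed.

Lemma wedge_traced (W : window R l.+1) c t (T : TT) : c != 0 -> good t ->
  tests_ev t (wedge W (scale c T)) <-> (forall C, sval T C -> traced W c t C).
Proof.
move=> c0 gt; have pD C : sval T C -> polytope (dilate c C).
  by move=> TC; exact: dilate_polytope c0 (tess_cell TC).1.
split=> [h C TC|h D [C' [+ ne] <-]].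
  apply/(passes_trace (wset_polytope W) (pD C TC) gt) => ne; apply: h.
  by exists (dilate c C) => //; split=> //; rewrite scaleE//; exists C.
rewrite scaleE// => -[C TC CE]; rewrite -{C'}CE in ne *.
exact: ((passes_trace (wset_polytope W) (pD C TC) gt).1 (h C TC)).
Qed.

Variable L : {measure set (hyperplane R l) -> \bar R}.
Hypothesis L_driving : driving_measure L.
Context d (Om : measurableType d) (P : probability Om R).
Variable Y : R -> Om -> TT.
Hypothesis Y_stit : stit_process L P Y.

Definition observable (V : set E) T (e : R * (set E -> Prop)) := [/\ 0 < e.1 < T, obs_test e.2 & seen V e.2].

Definition seen_obs (V : set E) T (obs : @obs_type R l) := forall j, (j < size obs)%N ->
  observable V T (nth ob0 obs j).

Definition obs_ev (obs : @obs_type R l) : set Om :=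
  [set o | forall j, (j < size obs)%N -> forall C, sval (Y (nth ob0 obs j).1 o) C -> (nth ob0 obs j).2 C].

Lemma sfinite_driving : sigma_finite [set: hyperplane R l] L.
Proof. by case: L_driving. Qed.

(** The tests are read off the trace in [V], which has the law of a division tree; the sets [B t]
    collect the tests made at the same time. Any window that sees all the tests may serve, which
    lets several lists of tests be treated in one window. *)
Lemma stit_pass (V : window R l.+1) obs T : seen_obs V T obs ->
  P (obs_ev obs) = (pass_all (sfinite_copy sfinite_driving) T obs (wset V) 0)%:E.
Proof.
move=> sV; have [_ _ sW] := Y_stit.
have [d' [Om' [P' [X [[s [k [div mX XE]]] hP]]]]] := sW V.
pose B t := [set U : tess (tessellable_window V) | forall j, (j < size obs)%N -> (nth ob0 obs j).1 = t ->
  forall D, sval U D -> (nth ob0 obs j).2 D].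
have mB t : measurable (B t).
  apply: meas_all => j; apply: meas_imp => js; apply: meas_imp => _.
  by have [_ [_ m] _] := sV j js; exact: m.
have tpos t : t \in map fst obs -> 0 < t.
  by move=> /(nthP 0)[j]; rewrite size_map => js <-; rewrite (nth_map ob0)//; case: (sV j js) => /andP[].
have bE (U : R -> tess (tessellable_window V)) : (forall t, t \in map fst obs -> B t (U t)) <->
    forall j, (j < size obs)%N -> forall D, sval (U (nth ob0 obs j).1) D -> (nth ob0 obs j).2 D.
  split=> [h j js|h t _ j js <-]; last exact: h.
  by apply: h => //; rewrite -(nth_map ob0 0)// mem_nth ?size_map.
rewrite (_ : obs_ev obs = [set o | forall t, t \in map fst obs -> B t (wedge V (Y t o))]); last first.
  seteq=> o.
    by move=> h; apply/(bE (fun t => wedge V (Y t o))) => j js; have [_ _ sj] := sV j js; apply/(wedge_seen _ sj); exact: h.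
  by move=> /(bE (fun t => wedge V (Y t o))) h j js; have [_ _ sj] := sV j js; apply/(wedge_seen _ sj); exact: h.
rewrite (hP _ _ tpos mB).
rewrite (_ : [set o | _] = [set o | forall j, (j < size obs)%N -> forall D,
   sval (X (nth ob0 obs j).1 o) D -> (nth ob0 obs j).2 D]); last first.
  by seteq=> o; rewrite /= (bE (fun t => X t o)).
apply: (@probability_pass R l (sfinite_copy sfinite_driving) V _ d' Om' P' s k div T obs _ _ X).
- by have [_ _ _ fW _] := L_driving; exact: fW.
- by move=> j js; have [_ [? _] _] := sV j js.
- by move=> j js; have [/andP[]] := sV j js.
- by move=> j js; have [/andP[/ltW]] := sV j js.
- exact: XE.
apply: meas_all => j; apply: meas_imp => js.
have [/andP[/ltW p0 _] [_ m] _] := sV j js.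
exact: (meas_preim (mX _ p0) (m _)).
Qed.
End observed_tests.

(** * The sequence of rescaled tessellations *)

Section stit_sequence.
Context {R : realType} {l : nat}.
Local Notation E := 'rV[R]_l.+1.
Local Notation H := (hyperplane R l).
Local Notation test := (seq (seq (set E) * set E)).
Variable L : {measure set H -> \bar R}.
Hypothesis L_driving : driving_measure L.
Context d (Om : measurableType d) (P : probability Om R).
Variable Y : R -> Om -> tess (@whole_space R l.+1).
Hypothesis Y_stit : stit_process L P Y.
Variables (a : R) (a1 : 1 < a) (W : window R l.+1).
Local Notation TW := (tess (tessellable_window W)).
Local Notation ZW := (zseq TW).
Local Notation pr A := (fine (P A)).
Local Notation ev := (obs_ev Y).

Definition stit_seq (o : Om) : ZW := fun n => wedge W (scale (a ^ n) (Y (a ^ n) o)).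
Local Notation Z := stit_seq.

Let Lf := sfinite_copy (sfinite_driving L_driving).
Let inv : translation_invariant Lf. Proof. by case: L_driving. Qed.
Let finW (V : window R l.+1) : (Lf (hitting V) < +oo)%E. Proof. by case: L_driving => _ _ _ h _; exact: h. Qed.
Let mY t : 0 < t -> mfunT (Y t). Proof. by case: Y_stit => h _ _ /h. Qed.

Let a0 : 0 < a. Proof. exact: lt_trans a1. Qed.
Let an0 n : 0 < a ^ n. Proof. exact: exprz_gt0. Qed.
Let ane n : a ^ n != 0. Proof. by rewrite gt_eqF. Qed.
Let ale n m : (a ^ n <= a ^ m) = (n <= m). Proof. by rewrite ler_eXz2l. Qed.
Let alt n m : (a ^ n < a ^ m) = (n < m). Proof. by rewrite ltr_eXz2l. Qed.

Let prE A : measurable A -> P A = (pr A)%:E.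
Proof. by move=> mA; rewrite fineK// fin_num_measure. Qed.

(* The trace in [W] of [a ^ n Y] is a function of the trace of [Y] in [wdw n]. *)
Definition wdw (n : int) : window R l.+1 := dilated W (ane (- n)).

Definition obn n (t : test) : R * (set E -> Prop) := (a ^ n, traced W (a ^ n) t).
Definition obM (tau : R) n : R * (set E -> Prop) := (tau, untouched (wdw n)).

Lemma mem_obn n t o : good t -> tests_ev t (Z o n) <-> (forall C, sval (Y (a ^ n) o) C -> traced W (a ^ n) t C).
Proof. exact: wedge_traced. Qed.

Lemma meas_ev (V : set E) T obs : seen_obs V T obs -> measurable (ev obs).
Proof.
move=> sV; apply: meas_all => j; apply: meas_imp => js.
have [/andP[t0 _] [_ m] _] := sV j js; exact: (meas_preim (mY t0) (m _)).
Qed.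

Lemma meas_stit_seq : mfunT Z.
Proof.
apply: meas_zseq => n; apply: (measurability (@tests_class R l.+1 (tessellable_window W))).
  exact: meas_testsE.
move=> _ [_ [t gt <-] <-]; rewrite setTI.
have [_ m] := obs_traced W (ane n) gt; have := meas_preim (mY (an0 n)) (m _).
by congr measurable; seteq=> o; rewrite /preimage /= (mem_obn _ _ gt).
Qed.

Let mZ A : measurable A -> measurable [set o | A (Z o)].
Proof. by move=> mA; exact: (meas_preim meas_stit_seq mA). Qed.

Let star : TW := tess_of (D := tessellable_window W) (tessellation_set1 (wset_polytope W)).

Lemma starP n o : Z o n = star <-> forall C, sval (Y (a ^ n) o) C -> untouched (wdw n) C.
Proof.
have wE x : wset W (a ^ n *: x) -> wset (wdw n) x.
  by move=> h; exists (a ^ n *: x) => //; rewrite scalerA -invr_expz mulVf// scale1r.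
split=> [Zs C YC [x [Cx wx]]|h].
  have pC := dilate_polytope (ane n) (tess_cell YC).1.
  have ne : (dilate (a ^ n) C `&` W)° !=set0.
    apply: (meets_interior pC); exists (a ^ n *: x); split; first by exists x.
    have : (dilate (a ^ n) (wdw n))° (a ^ n *: x) by apply: dilate_interior => //; exists x.
    by rewrite /= dilate_comp -invr_expz divff// dilate1.
  have : sval (Z o n) (dilate (a ^ n) C `&` W).
    by exists (dilate (a ^ n) C) => //; split=> //; rewrite scaleE//; exists C.
  rewrite Zs /= => CW y [w Ww <-].
  have [] : (dilate (a ^ n) C `&` W) w by rewrite CW.
  by move=> [z Cz <-] _; rewrite scalerA -invr_expz mulVf// scale1r.
apply: sval_injective.
have sub D : sval (Z o n) D -> D = W.
  move=> [C' [+ ne] DE]; rewrite scaleE// => -[C YC CE]; rewrite -{}DE -{C'}CE in ne *.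
  seteq=> [x []//|w Ww]; split=> //.
  have [x [[z Cz zx] Wx]] : exists x, dilate (a ^ n) C x /\ (W : set E)° x.
    by have [x] := ne; rewrite interiorI => -[/interior_subset ? ?]; exists x.
  have zi : (wdw n : set E)° z.
    have := dilate_interior (ane (- n)) (C := W) (ex_intro2 _ _ x Wx erefl).
    by rewrite -zx scalerA (_ : a ^ (- n) * a ^ n = 1) ?scale1r// -invr_expz mulVf.
  have wC := h C YC (ex_intro _ z (conj Cz zi)).
  exists (a ^ (- n) *: w); first by apply: wC; exists w.
  by rewrite scalerA -invr_expz divff// scale1r.
seteq=> D; first exact: sub.
move=> ->; have [_ _ _ _ UT] := svalP (Z o n); have [x /interior_subset Wx] := (wset_polytope W).2.
have [D' ZD' _] : (\bigcup_(C in sval (Z o n)) C) x by rewrite UT.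
by rewrite -(sub D' ZD').
Qed.

Lemma observable_obn (V : window R l.+1) T n t : good t -> wset (wdw n) `<=` V -> a ^ n < T ->
  observable V T (obn n t).
Proof.
move=> gt wV nT; split=> //=; [by rewrite an0|exact: obs_traced|].
by apply: seen_traced => //; rewrite invr_expz.
Qed.

Lemma observable_obM (V : window R l.+1) T tau n : 0 < tau < T -> wset (wdw n) `<=` V ->
  observable V T (obM tau n).
Proof. by split=> //; [exact: (obs_untouched (wdw n))|exact: seen_untouched]. Qed.

Lemma seen_cons (V : set E) T e obs : observable V T e -> seen_obs V T obs -> seen_obs V T (e :: obs).
Proof. by move=> h hs [|j]//; exact: hs. Qed.

Lemma seen_cat (V : set E) T obs obs' : seen_obs V T obs -> seen_obs V T obs' -> seen_obs V T (obs ++ obs').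
Proof. exact: (@all_nth_cat _ ob0 (observable V T)). Qed.

Lemma seen_good (V : set E) T obs : seen_obs V T obs -> good_obs obs.
Proof. by move=> h j js; have [_ []] := h j js. Qed.

Lemma seen_mkseq (V : set E) T (f : nat -> R * (set E -> Prop)) N :
  (forall i, (i < N)%N -> observable V T (f i)) -> seen_obs V T (mkseq f N).
Proof. by move=> h j; rewrite size_mkseq => js; rewrite nth_mkseq//; exact: h. Qed.

Lemma sorted_mkseq (f : nat -> R * (set E -> Prop)) N :
  (forall i j, (i <= j)%N -> (f i).1 <= (f j).1) -> sorted_obs (mkseq f N).
Proof.
move=> h; suff: forall m, sorted_obs (map f (iota m N)) by apply.
elim: N => [//|N ih] m; split; last exact: ih.
move=> j; rewrite size_map size_iota => js; rewrite (nth_map 0%N) ?size_iota// nth_iota//; apply: h.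
by lia.
Qed.

Lemma ev_cat obs obs' : ev (obs ++ obs') = ev obs `&` ev obs'.
Proof.
seteq=> o; last by case; exact: (@all_nth_cat _ ob0 (fun e => forall C, sval (Y e.1 o) C -> e.2 C)).
move=> h; split=> j js; [have := h j|have := h (size obs + j)%N]; rewrite size_cat nth_cat.
  by rewrite js; apply; exact: ltn_addr.
by rewrite ltn_add2l ifN -?leqNgt ?leq_addr// addKn; exact.
Qed.

Lemma ev1 e : ev [:: e] = [set o | forall C, sval (Y e.1 o) C -> e.2 C].
Proof. by seteq=> o h; [exact: (h 0%N isT)|case]. Qed.

Lemma ev_mkseq (n : nat -> int) (t : nat -> test) N : (forall i, good (t i)) ->
  ev (mkseq (fun i => obn (n i) (t i)) N) = [set o | forall i, (i < N)%N -> tests_ev (t i) (Z o (n i))].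
Proof.
move=> gt; seteq=> o h i.
  by move=> iN; have := h i; rewrite size_mkseq nth_mkseq// => /(_ iN)/mem_obn; exact.
by rewrite size_mkseq => iN; rewrite nth_mkseq// => C YC; have /mem_obn := h i iN; apply.
Qed.

(** Indexed from the most remote time onwards, because the functional requires tests sorted by
    time. *)
Definition left_obn N (t : nat -> test) := mkseq (fun i => obn (- (N - i)%N%:Z) (t (N - i)%N)) N.+1.
Definition right_obn m N (t : nat -> test) := mkseq (fun i => obn (m + i)%N%:Z (t i)) N.+1.

Lemma ev_left N t : (forall i, good (t i)) ->
  ev (left_obn N t) = [set o | forall i, (i <= N)%N -> tests_ev (t i) (Z o (- i%:Z))].
Proof.
move=> gt; rewrite ev_mkseq//; seteq=> o h i iN; last exact/h/leq_subr.
by have := h (N - i)%N; rewrite ltnS leq_subr subKn//; exact.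
Qed.

Lemma touching_wdw n : {ae Lf, forall h : H, hitting (wdw n) h -> hitting ((wdw n : set E)°) h}.
Proof.
have pW := wset_polytope (wdw n).
exact: (touching_ae inv (polytope_compact pW) (polytope_cvx pW) pW.2).
Qed.

Let cW n : compact (wset (wdw n)). Proof. exact: polytope_compact (wset_polytope (wdw n)). Qed.

Lemma probability_untouched tau n : 0 < tau -> P (ev [:: obM tau n]) = (expR (- (lam Lf (wdw n) * tau)))%:E.
Proof.
move=> t0; have pW := wset_polytope (wdw n); have cV := polytope_compact pW.
have s : seen_obs (wdw n) (tau + 1) [:: obM tau n].
  by apply: seen_cons => //; apply: observable_obM => //; rewrite t0 ltrDl/=.
rewrite (stit_pass L_driving Y_stit s).
congr EFin; rewrite (pass_all_untouched cV (finW _) cV (polytope_cvx pW) pW.2)//.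
- by rewrite subr0 mulNr.
- by rewrite ltrDl.
- exact: touching_wdw.
- exact: cellV.
- exact: polytope_cvx.
- exact: ltW.
Qed.

Lemma lam_wdw (n : nat) : lam Lf (wdw n%:Z) = a ^- n * lam Lf W.
Proof.
have pW := wset_polytope W.
rewrite (lam_dilate inv (V' := wdw n%:Z) (an0 n%:Z) (polytope_compact pW) (finW _) (@cW _)) ?invr_expz.
- by rewrite /= dilate_comp -invr_expz divff// dilate1 exprnN.
- by rewrite /= dilate_comp -invr_expz divff// dilate1.
- exact: cellV.
Qed.

Lemma wdw_stretch (V : set E) (lo hi : R) n : (forall c, lo <= c <= hi -> dilate c W `<=` V) ->
  lo <= a ^ (- n) <= hi -> wset (wdw n) `<=` V.
Proof. by move=> h /h. Qed.

(** The body is [wdw k] at time 1. Tests up to time 1 are seen in the stretch of [W] from $a^{-k}$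
    to $a^N$, later ones in the stretch from $a^{-K}$ to $a^{-k}$, and both stretches contain the
    body. Later tests begin at the index [maxn k 1], so that their times exceed 1 and their windows
    are no larger than the body. *)
Lemma mid_renewal (k N N' : nat) (tL tR : nat -> test) : (forall i, good (tL i)) -> (forall i, good (tR i)) ->
  (P (ev (left_obn N tL ++ obM 1 k%:Z :: right_obn (maxn k 1) N' tR)) * P (ev [:: obM 1 k%:Z]) =
   P (ev (left_obn N tL ++ [:: obM 1 k%:Z])) * P (ev (obM 1 k%:Z :: right_obn (maxn k 1) N' tR)))%E.
Proof.
move=> gL gR; set m := maxn k 1; pose K := (m + N')%N; pose T := a ^ K.+1%:Z; pose c0 := a ^ (- k%:Z).
set M := obM 1 _; set oL := left_obn N tL; set oR := right_obn m N' tR.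
pose lo := a ^ (- K%:Z); pose hi := a ^ N%:Z.
have lc : lo <= c0 by rewrite ale; lia.
have ch : c0 <= hi by rewrite ale; lia.
have [V [hV minV]] := ex_stretch W (an0 _) (le_trans lc ch).
have [VL [hL minL]] := ex_stretch W (an0 _) ch.
have [VR [hR minR]] := ex_stretch W (an0 _) lc.
have pV := wset_polytope V; have pL := wset_polytope VL; have pR := wset_polytope VR.
have VLV : wset VL `<=` V.
  by apply: minL; [exact: polytope_cvx|apply: hV; rewrite lc|apply: hV; rewrite lexx (le_trans lc)].
have VRV : wset VR `<=` V.
  by apply: minR; [exact: polytope_cvx|apply: hV; rewrite lexx (le_trans lc)|apply: hV; rewrite lc].
have ML : wset (wdw k%:Z) `<=` VL by apply: hL; rewrite lexx.
have MR : wset (wdw k%:Z) `<=` VR by apply: hR; rewrite lexx andbT.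
have MV := subset_trans ML VLV.
have aT n : n <= K%:Z -> a ^ n < T by move=> nK; rewrite alt; lia.
have T1 : 1 < T := aT 0 isT.
have sL : seen_obs VL T oL.
  apply: seen_mkseq => i iN; apply: observable_obn => //; last by apply: aT; lia.
  by apply: (wdw_stretch hL); rewrite !ale; lia.
have sR : seen_obs VR T oR.
  apply: seen_mkseq => i iN; apply: observable_obn => //; last by apply: aT; lia.
  by apply: (wdw_stretch hR); rewrite !ale; lia.
have wide U obs : wset U `<=` V -> seen_obs U T obs -> seen_obs V T obs.
  by move=> UV h j js; have [? ? /(seen_sub UV)] := h j js.
have sM : seen_obs V T [:: M] by apply: seen_cons => //; apply: observable_obM => //; rewrite ltr01.
have sMR : seen_obs V T (M :: oR) by exact: (seen_cat sM (wide _ _ VRV sR)).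
have sLV := wide _ _ VLV sL.
have key := stit_pass L_driving Y_stit.
rewrite (key _ _ _ (seen_cat sLV sMR)) (key _ _ _ sM) (key _ _ _ (seen_cat sLV sM)) (key _ _ _ sMR).
have pM := wset_polytope (wdw k%:Z); have cV := polytope_compact pV.
have loc (U : window R l.+1) obs : seen_obs U T obs -> local_obs U obs by move=> h j js; have [_ _ []] := h j js.
have bef obs : seen_obs VR T obs -> before T obs by move=> h j js; have [/andP[]] := h j js.
have left : left_obs 1 VL oL.
  split; [exact: seen_good sL| |exact: loc|].
  - by apply: sorted_mkseq => i j ij /=; rewrite ale; lia.
  - by move=> j; rewrite size_mkseq => js; rewrite nth_mkseq//= (ale _ 0); lia.
have := pass_all_renewal cV (finW V) (@cW k%:Z) (polytope_cvx pM) pM.2 MV T1 (touching_wdw _)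
  (polytope_closed pL) (polytope_cvx pL) (polytope_closed pR) (polytope_cvx pR) ML MR _ (seen_good sR) _ (bef _ sR)
  (loc _ _ sR) _ left ler01 (And3 (cellV cV) (polytope_cvx pV) MV).
rewrite -/M => ->.
- rewrite -!EFinM; congr EFin.
  rewrite (pass_all_untouched cV (finW V) (@cW k%:Z) (polytope_cvx pM) pM.2 MV T1 (touching_wdw _))//.
  + by rewrite mulrC !mulrA mulNr -mulrA mulrA -expRD addNr expR0 mul1r.
  + exact: cellV.
  + exact: polytope_cvx.
- move=> h; exact: (stretch_separated (an0 _) lc ch minL minR).
- by apply: sorted_mkseq => i j ij /=; rewrite ale; lia.
- by move=> j; rewrite size_mkseq => js; rewrite nth_mkseq//= (alt 0); lia.
Qed.

Let Mk (k : nat) := ev [:: obM 1 k%:Z].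
Let mM k : measurable (Mk k).
Proof.
by apply: (@meas_ev (wdw k%:Z) 2); apply: seen_cons => //; apply: observable_obM => //; rewrite ltr01 ltr1n.
Qed.

(** Folding along the absolute value keeps two-sided sequences while only one half of the times is
    seen. A cylinder then imposes on each time the tests of two opposite indices, which [sym]
    concatenates. *)
Definition past_half (x : ZW) : ZW := fun m => x (- (absz m)%:Z).
Definition future_half k (x : ZW) : ZW := fun m => x (maxn k 1 + absz m)%N%:Z.

Let meas_past_half : mfunT past_half.
Proof. by apply: meas_zseq => m; exact: meas_at. Qed.

Let meas_future_half k : mfunT (future_half k).
Proof. by apply: meas_zseq => m; exact: meas_at. Qed.

Let Pa (A : set ZW) := [set o | A (past_half (Z o))].
Let Fu k (A : set ZW) := [set o | A (future_half k (Z o))].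
Let mPa A : measurable A -> measurable (Pa A).
Proof. by move=> mA; apply: (mZ (A := past_half @^-1` A)); exact: (meas_preim meas_past_half). Qed.
Let mFu k A : measurable A -> measurable (Fu k A).
Proof. by move=> mA; apply: (mZ (A := future_half k @^-1` A)); exact: (meas_preim (@meas_future_half k)). Qed.

Lemma path_law_unique (f1 f2 : Om -> ZW) (E1 E2 : set Om) (c1 c2 : R) :
  mfunT f1 -> mfunT f2 -> measurable E1 -> measurable E2 -> 0 <= c1 -> 0 <= c2 ->
  (forall N B, (forall m, tests_class (B m)) ->
     (c1%:E * P (f1 @^-1` zcyl N B `&` E1) = c2%:E * P (f2 @^-1` zcyl N B `&` E2))%E) ->
  forall A, measurable A -> (c1%:E * P (f1 @^-1` A `&` E1) = c2%:E * P (f2 @^-1` A `&` E2))%E.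
Proof.
move=> mf1 mf2 mE1 mE2 c10 c20 h A mA.
have [N1 [h1 _]] := ex_image_measure mf1 [the {measure set Om -> \bar R} of mrestr P mE1].
have [N2 [h2 _]] := ex_image_measure mf2 [the {measure set Om -> \bar R} of mrestr P mE2].
have e1 B : mscale (NngNum c10) N1 B = (c1%:E * P (f1 @^-1` B `&` E1))%E by rewrite /mscale h1.
have e2 B : mscale (NngNum c20) N2 B = (c2%:E * P (f2 @^-1` B `&` E2))%E by rewrite /mscale h2.
rewrite -e1 -e2; apply: (@zseq_measure_unique R _ TW (@tests_class R l.+1 (tessellable_window W))) => //.
- exact: meas_testsE.
- exact: tests_class_setI.
- by exists [::] => //; seteq.
- by rewrite [ltLHS]e1 preimage_setT setTI prE// -EFinM ltry.
- by move=> N B hB; rewrite [LHS]e1 [RHS]e2; exact: h.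
Qed.

Lemma cylinder_tests (B : int -> set TW) : (forall m, tests_class (B m)) ->
  exists t : int -> test, forall m, good (t m) /\ tests_ev (t m) = B m.
Proof.
move=> hB; have h m : exists t, good t /\ tests_ev t = B m by have [t gt tE] := hB m; exists t.
by have [t ht] := choice h; exists t.
Qed.

Let sym (t : int -> test) (i : nat) : test := t i%:Z ++ t (- i%:Z).

Let zcyl_half N (B : int -> set TW) (t : int -> test) (x : nat -> TW) : (forall m, tests_ev (t m) = B m) ->
  zcyl N B (fun m => x (absz m)) = (forall i, (i <= N)%N -> tests_ev (sym t i) (x i)).
Proof.
move=> tE; apply/propext; split=> h.
  move=> i iN C xC; have := h i%:Z iN; have := h (- i%:Z); rewrite abszN => /(_ iN).
  by rewrite -!tE => h1 h2; apply/passes_cat; split; [exact: h2|exact: h1].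
move=> m mN; rewrite -tE => C xC; have /passes_cat[h1 h2] := h _ mN C xC.
by have [->|->] : m = (absz m)%:Z \/ m = - (absz m)%:Z by lia.
Qed.

Let good_sym t : (forall m, good (t m)) -> forall i, good (sym t i).
Proof. by move=> gt i; exact: good_cat. Qed.

(* Given that [wdw k] is undivided at time 1, the times up to 1 and the times after [a ^ k] are independent. *)
Lemma mixing k A B : measurable A -> measurable B ->
  (P (Mk k) * P (Fu k B `&` (Mk k `&` Pa A)) = P (Mk k `&` Pa A) * P (Fu k B `&` Mk k))%E.
Proof.
move=> mA mB; rewrite (prE (mM k)) (prE (measurableI _ _ (mM k) (mPa mA))).
apply: (@path_law_unique (future_half k \o Z) (future_half k \o Z)) => //; try exact: measurableI (mPa mA);
  try exact: fine_ge0; try exact: (measurableT_comp (@meas_future_half k) meas_stit_seq).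
move=> N B' hB; have [tR tRE] := cylinder_tests hB.
have gR := good_sym (fun m => (tRE m).1); set F := _ @^-1` _.
have FE : F = ev (right_obn (maxn k 1) N (sym tR)).
  by rewrite ev_mkseq//; apply: eq_set => o; exact: (zcyl_half _ (fun i => Z o _) (fun j => (tRE j).2)).
have mF : measurable F.
  by apply: mFu; apply: meas_zcyl => j; case: (tRE j) => gt <-; exact: meas_tests_ev.
(* Uniqueness of laws is used twice: here the past becomes an arbitrary event for a fixed cylinder
   of the future, and outside the future becomes arbitrary in turn. *)
have key A' : measurable A' -> (P (Mk k) * P (Pa A' `&` (Mk k `&` F)) = P (F `&` Mk k) * P (Pa A' `&` Mk k))%E.
  move=> mA'; rewrite (prE (mM k)) (prE (measurableI _ _ mF (mM k))).
  apply: (@path_law_unique (past_half \o Z) (past_half \o Z)) => //; try exact: measurableI;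
    try exact: fine_ge0; try exact: (measurableT_comp meas_past_half meas_stit_seq).
  move=> N' B'' hB'; have [tL tLE] := cylinder_tests hB'.
  have gL := good_sym (fun m => (tLE m).1).
  rewrite -(prE (mM k)) -(prE (measurableI _ _ mF (mM k))) FE (_ : _ @^-1` _ = ev (left_obn N' (sym tL))).
    have := mid_renewal k N' N gL gR; rewrite -(cat1s _ (right_obn _ _ _)) !ev_cat => e.
    by rewrite muleC e muleC setIC.
  by rewrite ev_left//; apply: eq_set => o; exact: (zcyl_half _ (fun i => Z o _) (fun j => (tLE j).2)).
rewrite -(prE (mM k)) -(prE (measurableI _ _ (mM k) (mPa mA))) setIA setIC (setIC _ (Mk k)) key//.
by rewrite muleC (setIC (Pa A)) (setIC F).
Qed.

(** Raising the index by one multiplies the test times by [a] and shrinks the observed windows by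
    [a], which is exactly the scaling that the functional allows. *)
Lemma stit_stationary A : measurable A -> P [set o | A (zshift (Z o))] = P [set o | A (Z o)].
Proof.
move=> mA; have := path_law_unique (measurableT_comp (@meas_zshift _ TW) meas_stit_seq) meas_stit_seq measurableT measurableT ler01 ler01 _ mA.
rewrite !mul1e !setIT; apply => N B /cylinder_tests[t tE]; rewrite !mul1e !setIT.
have gt m : good (t m) by case: (tE m).
have lohi : a ^ (- N.+1%:Z) <= a ^ N%:Z by rewrite ale; lia.
have [V' [hV' _]] := ex_stretch W (an0 _) lohi.
pose V := dilated V' (lt0r_neq0 a0).
pose obs (e : int) := mkseq (fun i => obn (i%:Z - N%:Z + e) (t (i%:Z - N%:Z))) (N + N).+1.
have evE e : [set o | zcyl N B (fun m => Z o (m + e))] = ev (obs e).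
  rewrite (ev_mkseq (fun i => i%:Z - N%:Z + e))//; seteq=> o h.
    by move=> i iN; rewrite (tE _).2; apply: h; lia.
  move=> m mN; rewrite -(tE _).2; have := h (absz (m + N%:Z)).
  have [js ->] : (absz (m + N%:Z)%R < (N + N).+1)%N /\ (absz (m + N%:Z))%:Z - N%:Z = m by lia.
  exact.
have sc : obs 1 = scale_obs a (obs 0).
  rewrite /obs /mkseq /scale_obs -map_comp; apply: eq_map => i /=.
  rewrite /obn addr0 expfzDr ?gt_eqF// expr1z mulrC; congr pair; apply/funext => C.
  by rewrite /traced dilate_comp mulrC.
pose T := a ^ N.+1%:Z; have aD n : a * a ^ n = a ^ (1 + n) by rewrite expfzDr ?gt_eqF.
have inV' n : - N%:Z <= n -> n <= N.+1%:Z -> wset (wdw n) `<=` V'.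
  by move=> h1 h2; apply: (wdw_stretch hV'); rewrite !ale; lia.
have s1 : seen_obs V' (a * T) (obs 1).
  by apply: seen_mkseq => i iN; apply: observable_obn; rewrite ?aD ?alt//; [apply: inV'|]; lia.
have s0 : seen_obs V T (obs 0).
  apply: seen_mkseq => i iN; apply: observable_obn; rewrite ?alt//; [set n := _ + 0|lia].
  have -> : wset (wdw n) = dilate a (wdw (n + 1)).
    by rewrite /= dilate_comp aD; congr dilate; congr exprz; ring.
  by move=> _ [x xw <-]; exists x => //; apply: inV' xw; rewrite /n; lia.
rewrite (_ : _ @^-1` _ = ev (obs 1)); last by rewrite -evE.
rewrite (_ : Z @^-1` _ = ev (obs 0)); last first.
  by rewrite -evE; seteq=> o h m mN; have := h m mN; rewrite addr0.
rewrite (stit_pass L_driving Y_stit s1) (stit_pass L_driving Y_stit s0) sc; congr EFin.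
rewrite -[X in pass_all _ _ _ _ X = _](mulr0 a).
have c' := polytope_compact (wset_polytope V'); have c := polytope_compact (wset_polytope V).
rewrite (pass_all_scale _ _ inv a0 c (finW V) c') //; first exact: seen_good s0.
exact: cellV.
Qed.

(** The rate of [wdw k] is $a^{-k}$ times that of [W], hence tends to 0. *)
Lemma untouched_near1 (e : R) : 0 < e -> exists2 k, (0 < k)%N & (P (~` Mk k) < e%:E)%E.
Proof.
move=> e0; have ai : `|a^-1| < 1 by rewrite ger0_norm ?invr_ge0 ?(ltW a0)// invf_lt1.
have /cvgrPdist_lt/(_ e e0)[k /= _ hk] := cvg_geometric (lam Lf W) ai.
exists k.+1 => //; have := hk k.+1 (leqnSn k); rewrite /geometric sub0r normrN.
rewrite probability_setC// probability_untouched// -EFinB lte_fin mulr1 lam_wdw -exprVn mulrC.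
apply: le_lt_trans; apply: (le_trans _ (ler_norm _)).
by rewrite lerBlDr addrC -lerBlDr; exact: expR_ge1Dx.
Qed.

Variable mu : probability (ZW) R.
Hypothesis mu_law : forall A, measurable A -> mu A = P [set o | A (Z o)].

Lemma mu_stationary A : measurable A -> mu (@zshift TW @^-1` A) = mu A.
Proof.
move=> mA; rewrite !mu_law//; first exact: stit_stationary.
exact: (meas_preim (@meas_zshift _ TW) mA).
Qed.

(* A past entirely in [D] forces the present in [D]; but it becomes independent of
   the present at the cost of a negligible event. *)
Lemma past_in_null (D : set TW) : measurable D -> (mu [set x | D (x 0%R)] < 1)%E ->
  mu [set x | forall m : int, m <= 0 -> D (x m)] = 0%E.
Proof.
move=> mD D1; pose A := [set x : ZW | forall m : int, m <= 0 -> D (x m)]; pose A' := [set x : ZW | forall m : int, D (x m)].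
pose N (n : int) : set ZW := [set x | ~ D (x n)].
have mDn n : measurable [set x : ZW | D (x n)] by exact: (meas_preim (@meas_at _ TW n) mD).
have mN n : measurable (N n) by exact: meas_not.
have mA : measurable A by apply: meas_all => m; apply: meas_imp.
have mA' : measurable A' by exact: meas_all.
have AE : [set o | A (Z o)] = Pa A'.
  by seteq=> o h m; [apply: h; lia|move=> m0; have := h m; rewrite /past_half (_ : - _ = m)//; lia].
have st k B : measurable B -> mu (zshiftk k @^-1` B) = mu B by exact: (stationary_shiftk mu_stationary).
have stN k : mu (N k) = mu (N 0).
  by rewrite -(st k (N 0))//; congr (mu _); apply: eq_set => x; rewrite /zshiftk /N/= add0r.
(* [A] and its shifts are almost surely equal, so [A] excludes [N k]. Given [Mk k] the two events
   are independent, hence one of them is null on [Mk k] and has probability below [e]; by [eN] it is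
   [A]. *)
have small (e : R) : 0 < e -> (e%:E <= mu (N 0%R))%E -> (mu A <= e%:E)%E.
  move=> e0 eN; have [k k0 ke] := untouched_near1 e0.
  have FN : Fu k (N 0) = [set o | N k%:Z (Z o)] by apply: eq_set => o; rewrite /N/= /future_half (_ : (maxn k 1 + _)%N = k)//; lia.
  have mF := @mFu k _ (mN 0); have mP := mPa mA'.
  have null : P (Fu k (N 0) `&` Pa A') = 0%E.
    rewrite -AE FN (_ : _ `&` _ = [set o | (N k%:Z `&` A) (Z o)])// -mu_law; last exact: measurableI.
    have mS := meas_preim (meas_zshiftk k%:Z) mA.
    apply: (subset_measure0 (B := A `\` zshiftk k%:Z @^-1` A)); [exact: measurableI|exact: measurableD| |].
      by move=> x [nD Ax]; split=> // /(_ 0 (lexx 0)); rewrite /zshiftk add0r.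
    rewrite measureD//; last by rewrite ltey_eq fin_num_measure.
    rewrite setIidr; first by rewrite [X in (_ - X)%E]st// subee// fin_num_measure.
    by move=> x h m m0; have := h (m - k%:Z); rewrite /zshiftk subrK; apply; lia.
  have cov E0 : measurable E0 -> P (E0 `&` Mk k) = 0%E -> (P E0 < e%:E)%E.
    move=> mE0 E00; rewrite (measureDI P mE0 (mM k)) [X in (_ + X)%E]E00 adde0.
    apply: le_lt_trans ke; apply: measure_le; [exact: measurableD|exact: measurableC|by move=> o []].
  have := mixing k mA' (mN 0); rewrite (_ : P (_ `&` (_ `&` _)) = 0%E) ?mule0; last first.
    by apply: (subset_measure0 _ _ _ null) => [| |o [h [_ h']]]//; do !apply: measurableI.
  move=> /esym/eqP; rewrite mule_eq0 setIC => /orP[/eqP h|/eqP/(cov _ mF)].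
    by rewrite mu_law// AE; exact/ltW/cov.
  by rewrite FN -mu_law// stN ltNge eN.
have N0 : (0 < mu (N 0%R))%E by rewrite (_ : N 0 = ~` [set x : ZW | D (x 0)])// probability_setC// sube_gt0.
apply/eqP; rewrite -measure_le0 -/A; apply/lee_addgt0Pr => e e0; rewrite add0e.
have [eN|Ne] := leP e%:E (mu (N 0)); first exact: small.
have NE : (fine (mu (N 0)))%:E = mu (N 0) by rewrite fineK// fin_num_measure.
by rewrite -NE in N0 Ne small *; apply: le_trans (small _ N0 (lexx _)) (ltW Ne).
Qed.

Let mstar : measurable [set star] := meas_tess1 star.
Let ms n : measurable [set x : ZW | x n = star].
Proof. exact: (meas_preim (@meas_at _ TW n) mstar). Qed.

Let star_ev n : [set o | Z o n = star] = ev [:: obM (a ^ n) n].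
Proof. by rewrite ev1; seteq=> o /starP. Qed.

(** For [k = 0] the body is [W] itself, and that it is undivided at time 1 means a visit to [star]
    at index 0: mixing becomes renewal. *)
Lemma mu_renewal A B : measurable A -> measurable B ->
  (mu [set x | [/\ A (pastz star x), x 0%R = star & B (futz star x)]] * mu [set x | x 0%R = star] =
   mu [set x | A (pastz star x) /\ x 0%R = star] * mu [set x | x 0%R = star /\ B (futz star x)])%E.
Proof.
move=> mA mB.
(* [future_half 0] begins with the value at index 1; [hf] puts it back in its place. *)
pose hf (y : ZW) : ZW := fun m => if 1 <= m then y (m - 1) else star.
have mhf : mfunT hf.
  by apply: meas_zseq => m; rewrite /hf; case: (1 <= m); [exact: meas_at|exact: measurable_cst].
have pE x : pastz star x = pastz star (past_half x).
  by apply/funext => m; rewrite /pastz /past_half; case: ifP => // m0; congr x; lia.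
have fE x : futz star x = hf (future_half 0 x).
  by apply/funext => m; rewrite /futz /hf /future_half; case: ifP => // m1; congr x; lia.
have mPS := meas_and (meas_preim (meas_pastz star) mA) (ms 0).
have mSF := meas_and (ms 0) (meas_preim (meas_futz star) mB).
rewrite (_ : [set x : ZW | [/\ A (pastz star x), x 0%R = star & B (futz star x)]] =
  [set x | A (pastz star x) /\ (x 0%R = star /\ B (futz star x))]); last first.
  by seteq=> x; [case|case=> ? []].
rewrite !mu_law//; last by have := meas_and (meas_preim (meas_pastz star) mA) mSF.
have M0 : [set o | Z o 0 = star] = Mk 0 by rewrite star_ev.
have := mixing 0 (meas_preim (meas_pastz star) mA) (meas_preim mhf mB).
rewrite -M0 muleC => e; apply: etrans (etrans e _); congr (P _ * P _)%E;
  by seteq=> o; rewrite /Fu /Pa /preimage /= -?pE -?fE; tauto.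
Qed.

(** The existence of the process forces it: the root of a division tree has a positive rate almost
    surely, and the root is [W]. *)
Lemma driving_gt0 : 0 < lam Lf W.
Proof.
have [_ _ sW] := Y_stit; have [d' [Om' [P' [X [[s [k [div _ _]]] _]]]]] := sW W.
have ae0 := lam_pos (L := Lf) div [::].
have [om] : exists o : Om', 0 < lam Lf (cell W (k ^~ o) [::]).
  apply: contrapT => nK.
  have : P'.-negligible setT by apply: negligibleS ae0 => o _ h; apply: nK; exists o.
  by move=> /(negligible_null measurableT); rewrite probability_setT => /eqP; rewrite onee_eq0.
by rewrite cell_nil.
Qed.

Lemma mu_starE n : mu [set x | x n = star] = (expR (- lam Lf W))%:E.
Proof.
have -> : [set x : ZW | x n = star] = zshiftk n @^-1` [set x : ZW | x 0 = star].
  by seteq=> x; rewrite /preimage /= /zshiftk add0r.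
rewrite (stationary_shiftk mu_stationary)// mu_law// star_ev probability_untouched// mulr1.
by have := lam_wdw 0; rewrite expr0 invr1 mul1r => e; congr (expR (- _))%:E.
Qed.

(** Neither the visits nor the non-visits are almost sure, so both recur arbitrarily far in the
    past. After a visit, the time just before the first non-visit is a start. *)
Lemma mu_isst : {ae mu, forall x : ZW, exists n, isst star x n}.
Proof.
have often (D : set TW) : measurable D -> (mu [set x | D (x 0%R)] < 1)%E ->
    {ae mu, forall x : ZW, forall j : int, exists2 m, m <= j & ~ D (x m)}.
  move=> mD D1; have mA : measurable [set x : ZW | forall m : int, m <= 0 -> D (x m)].
    by apply: meas_all => m; apply: meas_imp => _; exact: (meas_preim (@meas_at _ TW m) mD).
  apply: ae_countable => j.
  apply: (negligibleS _ (null_negligible (meas_preim (@meas_zshiftk _ TW j) mA) _)); last first.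
    by rewrite (stationary_shiftk mu_stationary)//; exact: past_in_null.
  move=> x nx m m0; apply: contrapT => nD; apply: nx; exists (m + j) => //; lia.
have s01 : (mu [set x | x 0%R = star] < 1)%E by rewrite mu_starE lte_fin -expR0 ltr_expR oppr_lt0 driving_gt0.
have n01 : (mu [set x | ~ (x 0%R = star)] < 1)%E.
  rewrite (_ : [set x : ZW | _] = ~` [set x : ZW | x 0%R = star])// probability_setC// mu_starE.
  by rewrite -EFinB lte_fin ltrBlDr ltrDl expR_gt0.
have h := aeI (often _ (meas_not mstar) n01) (often _ mstar s01).
apply: filterS h => x [h1 h2].
have [m _ nm] := h2 0; have [j jm /contrapT js] := h1 m.
have ex : exists i : nat, x (j + i.+1%:Z) != star.
  have mj : m != j by apply/eqP => e; apply: nm; rewrite e.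
  by exists (absz (m - j - 1)%R); rewrite (_ : j + _ = m); [apply/eqP|lia].
have [i /eqP ni min] := ex_minnP ex; exists (j + i%:Z); split; last by rewrite -addrA -PoszD addn1.
case: i ni min => [|i] _ min; first by rewrite addr0.
by apply/eqP; apply: contraT => /min; rewrite ltnn.
Qed.

(** A window containing both $W$ and $a^{-1}W$ remains undivided until the horizon with positive
    probability. *)
Lemma mu_star2 : (0 < mu [set x | x 0%R = star /\ x 1%R = star])%E.
Proof.
rewrite mu_law; last exact: meas_and.
have e : [set o | Z o 0 = star /\ Z o 1 = star] = ev [:: obM (a ^ 0) 0; obM (a ^ 1) 1].
  by rewrite -cat1s ev_cat -!star_ev.
rewrite [X in P X]e.
have lohi : a ^ (-1) <= a ^ 0 by rewrite ale.
have [V [hV _]] := ex_stretch W (an0 _) lohi.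
have s : seen_obs V (a ^ 2) [:: obM (a ^ 0) 0; obM (a ^ 1) 1].
  by do !apply: seen_cons => //; apply: observable_obM; rewrite ?an0 ?alt//; apply: (wdw_stretch hV); rewrite !ale.
rewrite (stit_pass L_driving Y_stit s) lte_fin.
have c := polytope_compact (wset_polytope V).
apply: (lt_le_trans _ (pass_all_ge c (finW V) (seen_good s) (cellV c) (an0 2))).
rewrite ind1 ?mul1r ?expR_gt0//.
have sub n : 0 <= n <= 1 -> wset (wdw n) `<=` V.
  by move=> n01; apply: (wdw_stretch hV); rewrite !ale; lia.
by move=> [|[|]]//= _ _ _; exact: sub.
Qed.

(** The division rule for generation 0, whose only cell is [W]. *)
Lemma first_hyperplane d' (Om' : measurableType d') (P' : probability Om' R) s k (B : set H) :
  cell_division L W P' s k -> measurable B -> L (B `&` hitting W) = 0%E -> P' [set o | B (k [::] o)] = 0%E.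
Proof.
move=> [_ _ div] mB B0.
have := div 0%N setT (fun=> setT) (fun=> B); rewrite setTI.
rewrite (_ : [set o | _] = [set o | B (k [::] o)]); last first.
  by seteq=> o; [move=> /(_ [tuple])[]|move=> h w; rewrite (tuple0 w)].
move=> ->//; last exact: (@measurableT _ (g_sigma_algebraType _)).
apply: integral0_eq => o _; congr EFin; apply/eqP; rewrite prodf_seq_eq0; apply/hasP; exists [tuple].
  by rewrite mem_index_enum.
rewrite /= /normalized_on (_ : cell W (k^~ o) [tuple] = W) ?B0 ?mul0r ?mulr0//.
exact: cell_nil.
Qed.

Lemma side_interior c (h : H) y : sval h y -> ~ (side c h)° y.
Proof.
move=> hy; have [u [e [lu hE]]] := hyperplaneP h; have [i [ui _]] := lu.
move=> /(interior_ray ((if c then - 1 else 1) *: 'e_i))[t [t0]].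
move/(sideP c _ lu hE); rewrite dotD !dotZ dot_delta.
by move: hy; rewrite hE /= => ->; case: c; nra.
Qed.

(* The first dividing hyperplane misses the interiors of the cells of [t], hence touches one of them. *)
Lemma mu_nonatomic (t : TW) : t <> star -> mu.-negligible [set x : ZW | x 0 = t].
Proof.
move=> ts; have mt := meas_preim (@meas_at _ TW 0) (meas_tess1 t).
apply: null_negligible => //; rewrite mu_law//.
have [_ _ sW] := Y_stit; have [d' [Om' [P' [X [[s [k [div mX XE]]] hP]]]]] := sW W.
have one (Q : R -> Prop) : (forall r, r \in [:: 1] -> Q r) = Q 1.
  by apply/propext; split=> [|q r]; [apply; exact: mem_head|rewrite inE => /eqP->].
have Z0 o : Z o 0 = wedge W (Y 1 o).
  rewrite /Z /= expr0z; congr wedge; apply: sval_injective; rewrite scaleE ?oner_eq0//.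
  by seteq=> [_ [C YC <-]|C YC]; [rewrite dilate1|exists C; rewrite ?dilate1].
have := hP [:: 1] (fun=> [set t]); rewrite (_ : [set o | _] = [set o | Z o 0 = t]); last first.
  by apply: eq_set => o; rewrite (one (fun r => [set t] (wedge W (Y r o)))) Z0.
move=> ->; first last.
- by move=> _; exact: meas_tess1.
- by rewrite (one (fun r => 0 < r)).
rewrite (_ : [set o | _] = X 1 @^-1` [set t]); last first.
  by apply: eq_set => o; rewrite (one (fun r => [set t] (X r o))).
have tT : tessellation (wset W) (sval t) := svalP t; have [_ _ pT dT UT] := tT.
pose touch C := [set h : H | hitting C h /\ ~ hitting C° h].
pose B := \bigcup_(C in sval t) touch C `|` ~` hitting W.
have finT := tessellation_finite (polytope_compact (wset_polytope W)) tT.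
have mW : measurable (hitting W : set H) := rcs_meet (@rcs_hyperplane R l) (polytope_compact (wset_polytope W)).
have mB : measurable B.
  apply: measurableU (measurableC mW); apply: fin_bigcup_measurable => // C /pT/polytope_compact.
  exact: meas_touching.
have B0 : L (B `&` hitting W) = 0%E.
  apply/(negligibleP _ (measurableI _ _ mB mW)).
  have [r rE] := (finite_seqP _).1 finT.
  apply: (negligibleS _ (@negligible_countable _ _ _ 'I_(size r) L (fun i => touch (nth set0 r i)) _)).
    move=> h [[[C tC hC]|//] _]; have Cr : C \in r by move: tC; rewrite rE.
    have ir : (index C r < size r)%N by rewrite index_mem.
    by exists (Ordinal ir) => //=; rewrite nth_index.
  move=> i; have tC : sval t (nth set0 r i) by rewrite rE; exact: mem_nth.
  have pC := pT _ tC; have := touching_ae inv (polytope_compact pC) (polytope_cvx pC) pC.2.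
  by apply: negligibleS => h [h1 h2] h3; apply: h2; exact: h3.
have mX1 : mfunT (X 1) by exact: mX.
have mk : mfunT (k [::]) by case: div.
have mE2 := meas_preim mk mB.
apply: (negligible_null (meas_preim mX1 (meas_tess1 t))).
apply: (negligibleS _ (negligibleU XE (null_negligible mE2 (first_hyperplane div mB B0)))) => o Xt.
have [XP|nXP] := pselect (forall t, 0 <= t -> sval (X t o) = present_cells W (s ^~ o) (k ^~ o) t); last by left.
right; have [[x [hx Wx]]|nh] := pselect (hitting W (k [::] o)); last by right.
left; have [C tC Cx] : (\bigcup_(C in sval t) C) x by rewrite UT.
exists C => //; split; first by exists x.
(* As a cell of the tree, [C] is either the root, which makes [t] equal to [star], or contained in a
   closed side of the first hyperplane, which then cannot meet its interior. *)
move=> [y [hy Cy]]; have := tC; rewrite -[in X in X -> _]Xt XP// => -[[|c w] _ CE].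
  apply: ts; apply: sval_injective; seteq=> D; last by move=> ->; rewrite -CE in tC; rewrite (cell_nil W k o) in tC.
  move=> tD; apply: contrapT => DW; have [z Dz] := (pT D tD).2.
  have : (D° `&` C°) z.
    by split=> //; apply: filterS Dz => z' Dz'; rewrite -CE cell_nil -UT; exists D.
  by rewrite dT// => DC; apply: DW; rewrite DC -CE cell_nil.
by apply: (@side_interior c (k [::] o) y hy); apply: filterS Cy => z; rewrite -CE => -[_ /(_ 0%N isT)].
Qed.
End stit_sequence.

Theorem corollary1p4 (R : realType) (l : nat)
  (L : {measure set (hyperplane R l) -> \bar R})
  (L_driving : driving_measure L)
  (d : measure_display) (Om : measurableType d) (P : probability Om R)
  (Y : R -> Om -> tess (@whole_space R l.+1))
  (Y_stit : stit_process L P Y)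
  (a : R) (a_gt1 : 1 < a) (W : window R l.+1)
  (mu : probability (zseq (tess (tessellable_window W))) R)
  (mu_law : forall A, measurable A ->
     mu A = P [set o | A (fun n : int => wedge W (scale (a ^ n) (Y (a ^ n) o)))]) :
  isomorphic_to_bernoulli_of_infinite_entropy mu
    (@zshift (tess (tessellable_window W))).
Proof.
apply: (bernoulli_of_renewal (@meas_tess1 _ _ _) _ _ _ (@meas_encode_tess R l.+1 W)
  (@meas_decode_tess R l.+1 W) (@encode_tessK _ _ _)) => //.
- exact: (mu_stationary L_driving Y_stit a_gt1 mu_law).
- exact: (mu_isst L_driving Y_stit a_gt1 mu_law).
- exact: (mu_renewal L_driving Y_stit a_gt1 mu_law).
- by move=> t; apply: (mu_nonatomic L_driving Y_stit mu_law).
- exact: (mu_star2 L_driving Y_stit a_gt1 mu_law).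
Qed.
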